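(* Let $d\ge 1$ and let $\lambda$ and $\rho=(\rho_1,\dots,\rho_{\ell(\rho)})=\langle 1^{\beta_1}\,2^{\beta_2}\cdots\rangle$ be partitions such that $|\lambda|+|\rho|=d$. Put $g_{\max}=\frac{(d-1)(d-2)}{2}$. Then the number $N_{d,g_{\max}}(\lambda,\rho)$ of irreducible plane complex algebraic curves of degree $d$ (and genus $g_{\max}$) passing through a generic configuration of $\frac{d(d+1)}{2}+\ell(\rho)$ points and having tangencies to a given line described by $\lambda$ and $\rho$ (that is, $\lambda$ describes tangencies at given points whereas $\rho$ describes tangencies at unspecified points) is equal to $$N_{d,g_{\max}}(\lambda,\rho)=\rho_1\,\rho_2\cdots\rho_{\ell(\rho)}\cdot\frac{(\ell(\rho))!}{\beta_1!\,\beta_2!\cdots}.$$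
   Context: A partition $\lambda=(\lambda_1\ge\lambda_2\ge\cdots)$ has size $|\lambda|=\sum_i\lambda_i$; $\ell(\lambda)$ is its number of nonzero parts; $\lambda=\langle 1^{\alpha_1}2^{\alpha_2}\cdots\rangle$ means that $\lambda$ has $\alpha_i$ parts equal to $i$. For partitions $\lambda,\rho$ with $|\lambda|+|\rho|=d$, the relative Gromov-Witten invariant $N_{d,g}(\lambda,\rho)$ is the number of irreducible complex plane algebraic curves of degree $d$ and (geometric) genus $g$ that pass through a generic configuration of $2d-1+g+\ell(\rho)$ points in the plane and satisfy the following tangency conditions with respect to a fixed line $L$ and a given generic collection of $\ell(\lambda)$ points $p_1,\dots,p_{\ell(\lambda)}$ on $L$: the curve meets $L$ at exactly $\ell(\lambda)+\ell(\rho)$ points; it passes through each $p_i$ with tangency to $L$ of degree $\lambda_i$; and its degrees of tangency to $L$ at the other $\ell(\rho)$ (unspecified) points of intersection form the partition $\rho$. Here tangency of degree $k$ at a point means that a single smooth branch of the curve passes through that point and has intersection multiplicity $k$ with $L$ there (so degree $1$ means transversal intersection). *)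

(* Defs.v *)
From HB Require Import structures.
From mathcomp Require Import all_boot all_order all_algebra.
From mathcomp Require Import mpoly.

Set Implicit Arguments.
Unset Strict Implicit.
Unset Printing Implicit Defensive.

Import Order.TTheory GRing.Theory Num.Theory.
Local Open Scope ring_scope.

Definition is_partition (s : seq nat) : bool :=
  sorted geq s && all (ltn 0) s.

Definition proportional (C : fieldType) (V : lmodType C) (u v : V) : Prop :=
  exists2 c : C, c != 0 & v = c *: u.

(* Points of the projective plane are nonzero row vectors and plane curves are
   homogeneous forms in three variables, both up to [proportional]. *)

Definition mpoly_dvd (C : fieldType) n (F G : {mpoly C[n]}) : Prop :=
  exists H, G = H * F.

Definition mpoly_irreducible (C : fieldType) n (F : {mpoly C[n]}) : Prop :=
  (1 < msize F)%N /\
  forall G H : {mpoly C[n]}, F = G * H -> (msize G <= 1)%N \/ (msize H <= 1)%N.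

Definition on_line (C : fieldType) (l x : 'rV[C]_3) : Prop :=
  \sum_j l 0 j * x 0 j = 0.

(* The function field of the curve F = 0, determined up to isomorphism.  The
   triple [ff_gen] gives homogeneous coordinates of the generic point: a form
   vanishes there iff it is a multiple of F, and every rational function is a
   quotient of two forms of the same degree. *)
Record function_field (C : fieldType) (F : {mpoly C[3]}) := FunctionField {
  ff_field :> fieldType;
  ff_const : {rmorphism C -> ff_field};
  ff_gen : 'I_3 -> ff_field;
  ff_genP : forall e (G : {mpoly C[3]}), G \is e.-homog ->
    (mmap ff_const ff_gen G = 0 <-> mpoly_dvd F G);
  ff_fracP : forall x : ff_field, exists e (G H : {mpoly C[3]}),
    [/\ G \is e.-homog, H \is e.-homog, mmap ff_const ff_gen H != 0 &
        x = mmap ff_const ff_gen G / mmap ff_const ff_gen H]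
}.

(* A place of K over C is a normalized discrete valuation trivial on C.  The
   value of [place_val] at 0 carries no information.  The places of the function
   field of a curve are the points of its normalization, that is, the branches
   of the curve. *)
Record place (C K : fieldType) (iota : {rmorphism C -> K}) := Place {
  place_val :> K -> int;
  place_valM : forall x y, x != 0 -> y != 0 ->
    place_val (x * y) = place_val x + place_val y;
  place_valD : forall x y, x != 0 -> y != 0 -> x + y != 0 ->
    Num.min (place_val x) (place_val y) <= place_val (x + y);
  place_val_const : forall c, c != 0 -> place_val (iota c) = 0;
  place_val_unif : exists2 t, t != 0 & place_val t = 1
}.

Definition val_ge (C K : fieldType) (iota : {rmorphism C -> K})
    (v : place iota) (x : K) (n : int) : Prop :=
  x = 0 \/ n <= v x.

Definition is_derivation (C K : fieldType) (iota : {rmorphism C -> K})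
    (M : lmodType K) (D : K -> M) : Prop :=
  [/\ forall x y, D (x + y) = D x + D y,
      forall x y, D (x * y) = x *: D y + y *: D x &
      forall c, D (iota c) = 0].

(* The module of Kaehler differentials of K over C. *)
Record kaehler (C K : fieldType) (iota : {rmorphism C -> K}) := Kaehler {
  kaehler_mod :> lmodType K;
  kaehler_d : K -> kaehler_mod;
  kaehler_dP : is_derivation iota kaehler_d;
  kaehler_univ : forall (M : lmodType K) (D : K -> M), is_derivation iota D ->
    exists phi : {linear kaehler_mod -> M},
      (forall x, D x = phi (kaehler_d x)) /\
      (forall psi : {linear kaehler_mod -> M},
         (forall x, D x = psi (kaehler_d x)) -> psi =1 phi)
}.

Definition regular_differential (C K : fieldType) (iota : {rmorphism C -> K})
    (W : kaehler iota) (w : W) : Prop :=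
  forall v : place iota, exists t u : K,
    [/\ t != 0, v t = 1, val_ge v u 0 & w = u *: kaehler_d W t].

(* The dimension over C of the space of everywhere regular differentials on the
   normalization. *)
Definition geometric_genus (C : fieldType) (F : {mpoly C[3]})
    (K : function_field F) (g : nat) : Prop :=
  exists (W : kaehler (ff_const K)) (w : 'I_g -> W),
    [/\ forall i, regular_differential (w i),
        forall c : 'I_g -> C,
          \sum_i ff_const K (c i) *: w i = 0 -> forall i, c i = 0 &
        forall u : W, regular_differential u ->
          exists c : 'I_g -> C, u = \sum_i ff_const K (c i) *: w i].

(* The function x_j / x_i - p_j / p_i: an affine coordinate, centred at p, of
   the chart x_i <> 0. *)
Definition affine_coord (C : fieldType) (F : {mpoly C[3]})
    (K : function_field F) (p : 'rV[C]_3) (i j : 'I_3) : K :=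
  ff_gen K j / ff_gen K i - ff_const K (p 0 j / p 0 i).

(* In the next three definitions the choice of the chart i is immaterial. *)

Definition branch_at (C : fieldType) (F : {mpoly C[3]}) (K : function_field F)
    (v : place (ff_const K)) (p : 'rV[C]_3) : Prop :=
  exists i, [/\ p 0 i != 0, ff_gen K i != 0 &
    forall j, val_ge v (affine_coord K p i j) 1].

Definition branch_smooth (C : fieldType) (F : {mpoly C[3]})
    (K : function_field F) (v : place (ff_const K)) (p : 'rV[C]_3) : Prop :=
  exists i j, [/\ p 0 i != 0, ff_gen K i != 0,
    affine_coord K p i j != 0 & v (affine_coord K p i j) = 1].

Definition branch_intersection (C : fieldType) (F : {mpoly C[3]})
    (K : function_field F) (v : place (ff_const K))
    (l p : 'rV[C]_3) (k : nat) : Prop :=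
  exists i, let f := (\sum_j ff_const K (l 0 j) * ff_gen K j) / ff_gen K i in
    [/\ p 0 i != 0, ff_gen K i != 0, f != 0 & v f = k%:Z].

Definition tangency (C : fieldType) (F : {mpoly C[3]}) (K : function_field F)
    (l p : 'rV[C]_3) (k : nat) : Prop :=
  exists v : place (ff_const K),
    [/\ branch_at v p,
        (forall w : place (ff_const K), branch_at w p ->
           forall x, x != 0 -> w x = v x),
        branch_smooth v p & branch_intersection v l p k].

(* The curve F = 0 is irreducible of degree d and geometric genus g, passes
   through the rows of X, and is tangent to the line l to degrees [lam] at the
   rows of P and to degrees [rho] at further points, the rows of Q. *)
Definition admissible_curve (C : fieldType) (d g n : nat) (lam rho : seq nat)
    (l : 'rV[C]_3) (P : 'M[C]_(size lam, 3)) (X : 'M[C]_(n, 3))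
    (F : {mpoly C[3]}) : Prop :=
  [/\ F \is d.-homog, mpoly_irreducible F,
      forall k, F.@[X k] = 0 &
      exists K : function_field F,
        geometric_genus K g /\
        exists Q : 'M[C]_(size rho, 3),
          [/\ forall i j,
                proportional (row i (col_mx P Q)) (row j (col_mx P Q)) -> i = j,
              (forall i, row i Q != 0),
              (forall x : 'rV[C]_3, x != 0 ->
                 (on_line l x /\ F.@[x 0] = 0 <->
                  exists i, proportional (row i (col_mx P Q)) x)),
              (forall i, tangency K l (row i P) (nth 0%N lam i)) &
              (forall i, tangency K l (row i Q) (nth 0%N rho i))]].

Definition curve_count (C : fieldType) (S : {mpoly C[3]} -> Prop) (N : nat) :
    Prop :=
  exists s : 'I_N -> {mpoly C[3]},
    [/\ forall i, S (s i),
        forall i j, proportional (s i) (s j) -> i = j &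
        forall F, S F -> exists i, proportional (s i) F].

(* Homogeneous coordinates of points P on the line l and points X in the plane. *)
Definition configuration (C : fieldType) (m n : nat) (l : 'rV[C]_3)
    (P : 'M[C]_(m, 3)) (X : 'M[C]_(n, 3)) : Prop :=
  [/\ forall i, row i P != 0, forall i, on_line l (row i P) &
      forall k, row k X != 0].

(* A property of configurations holds generically if it holds on a nonempty
   Zariski-open set of configurations.  The polynomial need not be
   multihomogeneous, since nonempty open sets of coordinate vectors have
   nonempty open images among configurations of projective points. *)
Definition generically (C : fieldType) (m n : nat) (l : 'rV[C]_3)
    (T : 'M[C]_(m, 3) -> 'M[C]_(n, 3) -> Prop) : Prop :=
  exists Phi : {mpoly C[(m + n) * 3]},
    let nonvanishing (P : 'M[C]_(m, 3)) (X : 'M[C]_(n, 3)) :=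
      Phi.@[mxvec (col_mx P X) 0] != 0 in
    (exists P X, configuration l P X /\ nonvanishing P X) /\
    (forall P X, configuration l P X -> nonvanishing P X -> T P X).

Definition gw_points (d g : nat) (rho : seq nat) : nat :=
  ((2 * d).-1 + g + size rho)%N.

(* The relative invariant N_{d,g}(lam, rho) over the field C equals N. *)
Definition relative_GW (C : fieldType) (d g : nat) (lam rho : seq nat)
    (N : nat) : Prop :=
  forall l : 'rV[C]_3, l != 0 ->
    generically l
      (fun (P : 'M[C]_(size lam, 3)) (X : 'M[C]_(gw_points d g rho, 3)) =>
         curve_count (admissible_curve d g rho l P X) N).

(* Main.v *)
Require Import Defs.
From mathcomp Require Import all_boot all_order all_algebra.
From mathcomp Require Import reals complex.
From HB Require Import structures.
From mathcomp Require Import fingroup perm action qfpoly.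
From mathcomp Require Import mpoly ring zify.
From Stdlib Require Import ClassicalEpsilon.
Set Implicit Arguments.
Unset Strict Implicit.
Unset Printing Implicit Defensive.
Import Order.TTheory GRing.Theory Num.Theory.


Section Polynomials.
Local Open Scope ring_scope.
Variable C : numClosedFieldType.

Lemma poly_neq0_avoid (p : {poly C}) (s : seq C) :
  p != 0 -> exists2 t, p.[t] != 0 & t \notin s.
Proof.
move=> p0; pose q := p * \prod_(a <- s) ('X - a%:P).
have q0 : q != 0.
  by rewrite mulf_neq0 // prodf_seq_neq0; apply/allP => a _; rewrite polyXsubC_eq0.
have [t qt] : exists t, q.[t] != 0.
  pose rs := [seq i%:R : C | i <- iota 0 (size q)].
  have urs : uniq rs.
    rewrite map_inj_uniq ?iota_uniq // => i j /eqP.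
    by rewrite eqr_nat => /eqP.
  have : ~~ all (root q) rs.
    apply/negP => ars; have := max_poly_roots q0 ars urs.
    by rewrite size_map size_iota ltnn.
  by case/allPn => t _ rt; exists t.
exists t; move: qt; rewrite hornerM mulf_eq0 negb_or => /andP[] //.
move=> _; apply: contraNN => ts; rewrite horner_prod (big_rem t) //=.
by rewrite hornerXsubC subrr mul0r.
Qed.

Lemma base_digits_inj n b (f g : 'I_n -> nat) :
  (forall i, f i < b)%N -> (forall i, g i < b)%N ->
  (\sum_i f i * b ^ i = \sum_i g i * b ^ i)%N -> f =1 g.
Proof.
elim: n f g => [|n IH] f g fb gb; first by move=> _ [].
rewrite !big_ord_recl /= !expn0 !muln1.
have e h : (\sum_(i < n) h (lift ord0 i) * b ^ bump 0 i =
   b * \sum_(i < n) h (lift ord0 i) * b ^ i)%N.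
  by rewrite big_distrr; apply: eq_bigr => i _; rewrite /bump add1n expnS mulnCA.
rewrite !e => E.
have b0 : (0 < b)%N by rewrite (leq_ltn_trans _ (fb ord0)).
have E0 : f ord0 = g ord0.
  have := congr1 (modn^~ b) E.
  by rewrite ![(_ + b * _)%N]addnC ![(b * _)%N]mulnC !modnMDl !modn_small.
move: E; rewrite E0 => /addnI /eqP; rewrite eqn_pmul2l // => /eqP E1 i.
case: (unliftP ord0 i) => [j|] -> //.
by apply: (IH _ _ _ _ E1 j) => ?.
Qed.

(** Kronecker substitution: with a large base, distinct monomials are sent to
    distinct powers of one variable, so a polynomial vanishing at all points
    has the zero univariate image and is zero. *)
Lemma mpoly_eq0_eval n (p : {mpoly C[n]}) : (forall v, p.@[v] = 0) -> p = 0.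
Proof.
move=> pv; pose b := msize p; pose w (m : 'X_{1..n}) := (\sum_i m i * b ^ i)%N.
have mlt m i : m \in msupp p -> (m i < b)%N.
  move=> /msize_mdeg_lt; apply: leq_ltn_trans; rewrite mdegE (bigD1 i) //=.
  exact: leq_addr.
pose P : {poly C} := \sum_(m <- msupp p) p@_m *: 'X^(w m).
have P0 : P = 0.
  apply/eqP/contraT => /(@poly_neq0_avoid _ [::])[t Pt _].
  have := pv (fun i => t ^+ (b ^ i)); rewrite mevalE => e.
  case/negP: Pt; rewrite horner_sum -[X in _ == X]e; apply/eqP/eq_bigr => m _.
  rewrite hornerZ hornerXn; congr (_ * _); rewrite /w -prodrXr.
  by apply: eq_bigr => i _; rewrite -exprM mulnC.
apply/mpolyP => m; rewrite mcoeff0; apply/eqP/contraT; rewrite -mcoeff_msupp.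
move=> mp; have := congr1 (fun q : {poly C} => q`_(w m)) P0.
rewrite coef0 coef_sum (big_rem m) //= coefZ coefXn eqxx mulr1 big_seq big1 ?addr0.
  by move/eqP; rewrite mcoeff_eq0 mp.
move=> m'; rewrite mem_rem_uniq ?msupp_uniq // inE => /andP[nm m'p].
rewrite coefZ coefXn; case: eqP => [e|]; last by rewrite mulr0.
case/eqP: nm; apply/mnmP => i.
by apply: (@base_digits_inj _ b m' m) => //= *; exact: mlt.
Qed.

Lemma mpoly_neq0_point n (p : {mpoly C[n]}) : p != 0 -> exists v, p.@[v] != 0.
Proof.
move=> p0; apply: NNPP => H; case/eqP: p0; apply: mpoly_eq0_eval => v.
by apply/eqP/negPn/negP => h; apply: H; exists v.
Qed.

(** First order Taylor expansion with polynomial remainder coefficients. *)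
Lemma mpoly_taylor n (p : {mpoly C[n]}) (a : 'I_n -> C) :
  exists g : 'I_n -> {mpoly C[n]},
    p = (p.@[a])%:MP + \sum_j ('X_j - (a j)%:MP) * g j /\
    forall j, (g j).@[a] = (p^`M(j)).@[a].
Proof.
pose T p := exists g : 'I_n -> {mpoly C[n]},
    p = (p.@[a])%:MP + \sum_j ('X_j - (a j)%:MP) * g j.
have TX i : T 'X_i.
  exists (fun j => (i == j)%:R); rewrite mevalXU (bigD1 i) //= eqxx mulr1.
  rewrite big1 ?addr0 1?addrC ?subrK // => j; rewrite eq_sym => /negbTE ->.
  by rewrite mulr0.
have TC c : T c%:MP.
  by exists (fun=> 0); rewrite mevalC big1 ?addr0 // => j _; rewrite mulr0.
have TD q1 q2 : T q1 -> T q2 -> T (q1 + q2).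
  move=> [g1 e1] [g2 e2]; exists (fun j => g1 j + g2 j).
  rewrite mevalD mpolyCD.
  rewrite (eq_bigr (fun j => ('X_j - (a j)%:MP) * g1 j + ('X_j - (a j)%:MP) * g2 j)).
    by rewrite big_split /= addrACA -e1 -e2.
  by move=> j _; rewrite mulrDr.
have TM q1 q2 : T q1 -> T q2 -> T (q1 * q2).
  move=> [g1 e1] [g2 e2]; exists (fun j => g1 j * q2 + (q1.@[a])%:MP * g2 j).
  rewrite mevalM mpolyCM.
  rewrite (eq_bigr (fun j => ('X_j - (a j)%:MP) * g1 j * q2
     + (q1.@[a])%:MP * (('X_j - (a j)%:MP) * g2 j))).
    rewrite big_split /= -mulr_suml -mulr_sumr.
    have -> : \sum_j ('X_j - (a j)%:MP) * g1 j = q1 - (q1.@[a])%:MP.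
      by apply/eqP; rewrite eq_sym subr_eq addrC -e1.
    have -> : \sum_j ('X_j - (a j)%:MP) * g2 j = q2 - (q2.@[a])%:MP.
      by apply/eqP; rewrite eq_sym subr_eq addrC -e2.
    ring.
  by move=> j _; rewrite mulrDr mulrA mulrCA.
have Tp : T p.
  rewrite [p]mpolyE; elim: (msupp p) => [|m s IH].
    by rewrite big_nil -mpolyC0; apply: TC.
  rewrite big_cons; apply: (TD) => //; rewrite -mul_mpolyC; apply: (TM) => //.
  rewrite mpolyXE_id; apply: (big_ind T); [exact: (TC 1)|exact: TM|].
  move=> i _; elim: (m i) => [|k IHk]; first exact: (TC 1).
  by rewrite exprS; apply: TM.
case: Tp => g e; exists g; split=> // j.
rewrite [in RHS]e mderivD mderivC add0r (raddf_sum (mderiv j)) (raddf_sum (meval a)) (bigD1 j) //= big1.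
  rewrite addr0 mderivM mderivB mderivC mderivX mnm1E eqxx subr0 scale1r.
  have -> : (U_(j) - U_(j))%MM = 0%MM :> 'X_{1..n}.
    by apply/mnmP => i; rewrite mnmBE subnn mnm0E.
  rewrite mpolyX0 mul1r mevalD mevalM mevalB mevalXU mevalC subrr mul0r.
  by rewrite addr0.
move=> k kj; rewrite mderivM mderivB mderivC mderivX mnm1E (negbTE kj) scale0r.
by rewrite subr0 mul0r add0r mevalM mevalB mevalXU mevalC subrr mul0r.
Qed.

Lemma mpoly_euler n d (F : {mpoly C[n]}) :
  F \is d.-homog -> \sum_j 'X_j * F^`M(j) = d%:R *: F.
Proof.
move=> /dhomogP hF; rewrite [in RHS](mpolyE F) scaler_sumr.
rewrite (eq_bigr (fun j => \sum_(m <- msupp F) F@_m *: ((m j)%:R *: 'X_[m]))).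
  rewrite exchange_big /= [LHS]big_seq [RHS]big_seq; apply: eq_bigr => m mF.
  rewrite -scaler_sumr -scaler_suml -natr_sum -mdegE (hF _ mF).
  by rewrite scalerA mulrC -scalerA.
move=> j _; rewrite [X in X^`M(j)](mpolyE F) raddf_sum /= mulr_sumr.
apply: eq_bigr => m _; rewrite mderivZ mderivX -!scalerAr.
congr (_ *: _); case: (posnP (m j)) => [->|mj]; first by rewrite !scale0r.
rewrite -mpolyXD addmC submK //; apply/mnm_lepP => i; rewrite mnm1E.
by case: eqP => [<-|].
Qed.

Lemma dhomog_eval n d (F : {mpoly C[n]}) c v :
  F \is d.-homog -> F.@[fun i => c * v i] = c ^+ d * F.@[v].
Proof.
move=> /dhomogP hF; rewrite !mevalE mulr_sumr big_seq [RHS]big_seq.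
apply: eq_bigr => m mF; rewrite mulrCA; congr (_ * _).
rewrite -(hF _ mF) /= mdegE -prodrXr -big_split; apply: eq_bigr => i _.
by rewrite exprMn.
Qed.

Lemma dhomog_deriv n d (F : {mpoly C[n]}) j :
  F \is d.+1.-homog -> F^`M(j) \is d.-homog.
Proof.
move=> /dhomogP hF; apply/dhomogP => m; rewrite mcoeff_msupp mcoeff_mderiv.
move=> h; have : (m + U_(j))%MM \in msupp F.
  by rewrite mcoeff_msupp; apply: contraNN h => /eqP ->; rewrite mul0rn.
by move/hF; rewrite /= mdegD mdeg1 addn1 => -[].
Qed.

(** In a product the extreme homogeneous components do not cancel, so a
    homogeneous product has homogeneous factors.  Scaling all the variables by
    a new one makes this a statement on univariate polynomials: two factors
    whose product is a monomial in the scaling variable are monomials. *)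
Lemma dhomog_factor n d (F G : {mpoly C[n]}) :
  F * G \is d.-homog -> F * G != 0 ->
  exists e f, [/\ (e + f)%N = d, F \is e.-homog & G \is f.-homog].
Proof.
move=> hFG FG0; have [F0 G0] : F != 0 /\ G != 0.
  by move: FG0; rewrite mulf_eq0 negb_or => /andP.
pose sc (p : {mpoly C[n]}) : {poly {mpoly C[n]}} :=
  mmap (polyC \o @mpolyC n C) (fun i => ('X_i)%:P * 'X) p.
have scE p k : (sc p)`_k = pihomog mdeg k p.
  rewrite /sc /mmap coef_sum pihomogE [RHS]big_mkcond /=; apply: eq_bigr => m _.
  have -> : mmap1 (fun i => ('X_i)%:P * 'X) m
       = ('X_[m])%:P * 'X^(mdeg m) :> {poly {mpoly C[n]}}.
    rewrite /mmap1 (eq_bigr (fun i => ('X_i ^+ m i)%:P * 'X^(m i))).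
      by rewrite big_split /= -rmorph_prod /= -mpolyXE_id mdegE prodrXr.
    by move=> i _; rewrite exprMn rmorphXn.
  rewrite mulrA -polyCM coefCM coefXn eq_sym; case: eqP => _.
    by rewrite mulr1 mul_mpolyC.
  by rewrite mulr0.
have scM p q : sc (p * q) = sc p * sc q.
  exact: rmorphM.
have sc0 p : p != 0 -> sc p != 0.
  apply: contra_neq => e; apply/mpolyP => m; rewrite mcoeff0.
  have := congr1 (fun q : {poly {mpoly C[n]}} => (q`_(mdeg m))@_m) e.
  rewrite scE coef0 mcoeff0 => h; apply/eqP; move/eqP: h; apply: contraTT => pm.
  rewrite pihomogE raddf_sum /= big_mkcond (big_rem m) ?mcoeff_msupp //= eqxx.
  rewrite mcoeffZ mcoeffX eqxx mulr1 big_seq big1 ?addr0 // => m'.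
  rewrite mem_rem_uniq ?msupp_uniq // inE => /andP[nm _].
  by case: eqP => // _; rewrite mcoeffZ mcoeffX (negbTE nm) mulr0.
have scFG : sc (F * G) = (F * G) *: 'X^d.
  apply/polyP => k; rewrite scE coefZ coefXn; case: eqP => [->|/eqP kd].
    by rewrite mulr1 pihomog_dE.
  by rewrite mulr0 (pihomog_ne0 _ hFG) // eq_sym.
have mono (p : {mpoly C[n]}) (P Q : {poly {mpoly C[n]}}) e f :
   P`_e != 0 -> Q`_f != 0 -> (forall i, (i < e)%N -> P`_i = 0) ->
   (forall i, (i < f)%N -> Q`_i = 0) -> P * Q = p *: 'X^d -> (e + f = d)%N.
  move=> Pe Qf P0 Q0 E; have := congr1 (fun R : {poly _} => R`_(e + f)) E.
  rewrite coefM (bigD1 (inord e)) //= inordK ?ltnS ?leq_addr // addKn big1.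
    rewrite addr0 coefZ coefXn; case: eqP => // _; rewrite mulr0 => /eqP.
    by rewrite mulf_eq0 (negbTE Pe) (negbTE Qf).
  move=> i; rewrite -val_eqE /= inordK ?ltnS ?leq_addr // neq_ltn => /orP[lt|lt].
    by rewrite P0 ?mul0r.
  rewrite Q0 ?mulr0 //; clear -lt; have := ltn_ord i; lia.
have low (P : {poly {mpoly C[n]}}) : P != 0 ->
   exists2 e, P`_e != 0 & forall i, (i < e)%N -> P`_i = 0.
  move=> P0; have ex : exists i, P`_i != 0.
    by exists (size P).-1; rewrite -lead_coefE lead_coef_eq0.
  exists (ex_minn ex); first by case: ex_minnP.
  move=> i; case: ex_minnP => m _ mn lt; apply/eqP/contraT => /mn.
  by rewrite leqNgt lt.
have [e Fe Fl] := low _ (sc0 _ F0); have [f Gf Gl] := low _ (sc0 _ G0).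
have ef : (e + f = d)%N by apply: mono Fe Gf Fl Gl _; rewrite -scM scFG.
have top : (size (sc F) + size (sc G) = d.+2)%N.
  have := congr1 (fun R : {poly _} => size R) scFG; rewrite scM.
  rewrite size_mul ?sc0 // size_scale // size_polyXn => h.
  by case: (_ + _)%N h => [|s] //= ->.
have sF : (e < size (sc F))%N by rewrite ltnNge; apply: contraNN Fe => /leq_sizeP ->.
have sG : (f < size (sc G))%N by rewrite ltnNge; apply: contraNN Gf => /leq_sizeP ->.
have hom p k : (forall i, (i < k)%N -> (sc p)`_i = 0) -> size (sc p) = k.+1 ->
    p \is k.-homog.
  move=> lo hi; apply/dhomogP => m mp; apply/eqP/contraT => /= nk.
  have : (sc p)`_(mdeg m) = 0.
    by move: nk; rewrite neq_ltn => /orP[/lo //|lt]; apply: nth_default; rewrite hi.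
  rewrite scE => /(congr1 (mcoeff m)); rewrite mcoeff0 pihomogE raddf_sum /=.
  rewrite big_mkcond (big_rem m) //= eqxx mcoeffZ mcoeffX eqxx mulr1 big_seq big1.
    by rewrite addr0 => /eqP; rewrite mcoeff_eq0 mp.
  move=> m'; rewrite mem_rem_uniq ?msupp_uniq // inE => /andP[nm _].
  by case: eqP => // _; rewrite mcoeffZ mcoeffX (negbTE nm) mulr0.
have [eF eG] : size (sc F) = e.+1 /\ size (sc G) = f.+1.
  have arith a b : (e < a -> f < b -> a + b = d.+2 -> a = e.+1 /\ b = f.+1)%N.
    by clear -ef; lia.
  exact: arith.
by exists e, f; split=> //; apply: hom.
Qed.

End Polynomials.


Section PolynomialFamilies.
Local Open Scope ring_scope.
Variable C : numClosedFieldType.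
Variables (T : Type) (N : nat) (co : T -> 'I_N -> C).

(** Functions of a parameter that are polynomial in its coordinates, and
    families of polynomials whose coefficients are such functions.  They are
    handled through their closure properties, so that the polynomials need
    never be written down. *)
Definition polyfun (f : T -> C) := exists P : {mpoly C[N]}, forall c, f c = P.@[co c].

Definition polyfam r (g : T -> {mpoly C[r]}) :=
  exists P : {mpoly {mpoly C[N]}[r]}, forall c, g c = map_mpoly (meval (co c)) P.

Lemma polyfun_ext f g : f =1 g -> polyfun f -> polyfun g.
Proof. by move=> e [P h]; exists P => c; rewrite -e. Qed.

Lemma polyfun_const a : polyfun (fun=> a).
Proof. by exists a%:MP => c; rewrite mevalC. Qed.

Lemma polyfun_coord i : polyfun (fun c => co c i).
Proof. by exists 'X_i => c; rewrite mevalXU. Qed.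

Lemma polyfunD f g : polyfun f -> polyfun g -> polyfun (fun c => f c + g c).
Proof. by move=> [P p] [Q q]; exists (P + Q) => c; rewrite mevalD p q. Qed.

Lemma polyfunN f : polyfun f -> polyfun (fun c => - f c).
Proof. by move=> [P p]; exists (- P) => c; rewrite mevalN p. Qed.

Lemma polyfunB f g : polyfun f -> polyfun g -> polyfun (fun c => f c - g c).
Proof. by move=> hf hg; apply: polyfunD => //; apply: polyfunN. Qed.

Lemma polyfunM f g : polyfun f -> polyfun g -> polyfun (fun c => f c * g c).
Proof. by move=> [P p] [Q q]; exists (P * Q) => c; rewrite mevalM p q. Qed.

Lemma polyfunX f k : polyfun f -> polyfun (fun c => f c ^+ k).
Proof. by move=> [P p]; exists (P ^+ k) => c; rewrite rmorphXn /= p. Qed.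

Lemma polyfun_sum (I : Type) (s : seq I) f :
  (forall i, polyfun (f i)) -> polyfun (fun c => \sum_(i <- s) f i c).
Proof.
move=> h; elim: s => [|i s IH].
  by apply: (polyfun_ext _ (polyfun_const 0)) => c; rewrite big_nil.
by apply: (polyfun_ext _ (polyfunD (h i) IH)) => c; rewrite big_cons.
Qed.

Lemma polyfun_prod (I : Type) (s : seq I) f :
  (forall i, polyfun (f i)) -> polyfun (fun c => \prod_(i <- s) f i c).
Proof.
move=> h; elim: s => [|i s IH].
  by apply: (polyfun_ext _ (polyfun_const 1)) => c; rewrite big_nil.
by apply: (polyfun_ext _ (polyfunM (h i) IH)) => c; rewrite big_cons.
Qed.

Lemma polyfun_det k (A : T -> 'M[C]_k) :
  (forall i j, polyfun (fun c => A c i j)) -> polyfun (fun c => \det (A c)).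
Proof.
move=> h; apply: polyfun_sum => s; apply: polyfunM; first exact: polyfun_const.
exact: polyfun_prod.
Qed.

Lemma polyfun_adj k (A : T -> 'M[C]_k) i j :
  (forall i j, polyfun (fun c => A c i j)) -> polyfun (fun c => (\adj (A c)) i j).
Proof.
move=> h; apply: (@polyfun_ext (fun c => cofactor (A c) j i)).
  by move=> c; rewrite mxE.
apply: polyfunM; first exact: polyfun_const.
by apply: polyfun_det => a b; apply: polyfun_ext (h _ _) => c; rewrite !mxE.
Qed.

Section Fixed.
Variable r : nat.
Implicit Types f g : T -> {mpoly C[r]}.

Lemma polyfam_ext f g : f =1 g -> polyfam f -> polyfam g.
Proof. by move=> e [P h]; exists P => c; rewrite -e. Qed.

Lemma polyfam_lift (a : T -> C) : polyfun a -> polyfam (fun c => (a c)%:MP_[r]).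
Proof. by move=> [P p]; exists P%:MP => c; rewrite map_mpolyC p. Qed.

Lemma polyfamD f g : polyfam f -> polyfam g -> polyfam (fun c => f c + g c).
Proof. by move=> [P p] [Q q]; exists (P + Q) => c; rewrite rmorphD p q. Qed.

Lemma polyfamN f : polyfam f -> polyfam (fun c => - f c).
Proof. by move=> [P p]; exists (- P) => c; rewrite rmorphN p. Qed.

Lemma polyfamB f g : polyfam f -> polyfam g -> polyfam (fun c => f c - g c).
Proof. by move=> hf hg; apply: polyfamD => //; apply: polyfamN. Qed.

Lemma polyfamM f g : polyfam f -> polyfam g -> polyfam (fun c => f c * g c).
Proof. by move=> [P p] [Q q]; exists (P * Q) => c; rewrite rmorphM p q. Qed.

Lemma polyfamX f k : polyfam f -> polyfam (fun c => f c ^+ k).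
Proof. by move=> [P p]; exists (P ^+ k) => c; rewrite rmorphXn p. Qed.

Lemma polyfam_sum (I : Type) (s : seq I) (f : I -> T -> {mpoly C[r]}) :
  (forall i, polyfam (f i)) -> polyfam (fun c => \sum_(i <- s) f i c).
Proof.
move=> h; elim: s => [|i s IH].
  by exists 0 => c; rewrite big_nil rmorph0.
by apply: (polyfam_ext _ (polyfamD (h i) IH)) => c; rewrite big_cons.
Qed.

Lemma polyfam_prod (I : Type) (s : seq I) (f : I -> T -> {mpoly C[r]}) :
  (forall i, polyfam (f i)) -> polyfam (fun c => \prod_(i <- s) f i c).
Proof.
move=> h; elim: s => [|i s IH].
  by exists 1 => c; rewrite big_nil rmorph1.
by apply: (polyfam_ext _ (polyfamM (h i) IH)) => c; rewrite big_cons.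
Qed.

Lemma polyfam_const (p : {mpoly C[r]}) : polyfam (fun=> p).
Proof.
rewrite [p]mpolyE; apply: polyfam_sum => m.
apply: (@polyfam_ext (fun=> (p@_m)%:MP * 'X_[m])).
  by move=> c; rewrite mul_mpolyC.
apply: polyfamM; first by apply: polyfam_lift; apply: polyfun_const.
by exists 'X_[m] => c; rewrite map_mpolyX.
Qed.

Lemma polyfam_det k (A : T -> 'M[{mpoly C[r]}]_k) :
  (forall i j, polyfam (fun c => A c i j)) -> polyfam (fun c => \det (A c)).
Proof.
move=> h; apply: polyfam_sum => s; apply: polyfamM; first exact: polyfam_const.
exact: polyfam_prod.
Qed.

Lemma polyfam_deriv f i : polyfam f -> polyfam (fun c => (f c)^`M(i)).
Proof.
move=> [P p]; exists (P^`M(i)) => c; rewrite p; apply/mpolyP => m.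
by rewrite mcoeff_mderiv !mcoeff_map_mpoly mcoeff_mderiv raddfMn.
Qed.

Lemma polyfam_coef f m : polyfam f -> polyfun (fun c => (f c)@_m).
Proof. by move=> [P p]; exists P@_m => c; rewrite p mcoeff_map_mpoly. Qed.

Lemma polyfam_bounded f : polyfam f ->
  exists K, forall c m, (f c)@_m != 0 -> (mdeg m < K)%N.
Proof.
move=> [P p]; exists (msize P) => c m; rewrite p mcoeff_map_mpoly => h.
apply: msize_mdeg_lt; rewrite mcoeff_msupp; apply: contraNN h => /eqP ->.
by rewrite raddf0.
Qed.

Lemma polyfam_eval f q : polyfam f -> polyfun (fun c => (f c).@[q]).
Proof.
move=> [P p]; exists (P.@[fun i => (q i)%:MP]) => c; rewrite p.
rewrite [P in map_mpoly _ P]mpolyE [P.@[_]]mevalE.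
rewrite (raddf_sum (map_mpoly (meval (co c)))) (raddf_sum (meval q)).
rewrite (raddf_sum (meval (co c))) /=.
apply: eq_bigr => m _; rewrite map_mpolyZ map_mpolyX mevalZ mevalX mevalM.
congr (_ * _); rewrite rmorph_prod; apply: eq_bigr => i _.
by rewrite rmorphXn /= mevalC.
Qed.

End Fixed.
End PolynomialFamilies.

Section MonomialSupport.
Local Open Scope ring_scope.
Variable R : nzRingType.
Variables (n : nat) (ms : seq 'X_{1..n}).
Hypothesis ums : uniq ms.

Definition supported (p : {mpoly R[n]}) := forall m, p@_m != 0 -> m \in ms.

Lemma supportedE p : supported p ->
  p = \sum_(k < size ms) p@_(nth 0%MM ms k) *: 'X_[nth 0%MM ms k].
Proof.
move=> hp; apply/mpolyP => m; rewrite raddf_sum /=.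
under eq_bigr do rewrite mcoeffZ mcoeffX.
have [mm|mm] := boolP (m \in ms).
  have lt : (index m ms < size ms)%N by rewrite index_mem.
  rewrite (bigD1 (Ordinal lt)) //= nth_index // eqxx mulr1 big1 ?addr0 //.
  move=> k; rewrite -val_eqE /= => nk; case: eqP => [e|]; last by rewrite mulr0.
  by case/eqP: nk; rewrite -e index_uniq.
rewrite big1 => [|k _]; first by apply/eqP/contraT => /hp; rewrite (negbTE mm).
case: eqP => [e|_]; last by rewrite mulr0.
by move: mm; rewrite -e mem_nth.
Qed.

End MonomialSupport.

Section MonomialSpans.
Local Open Scope ring_scope.
Variable C : numClosedFieldType.
Variables (n : nat) (ms : seq 'X_{1..n}).
Hypothesis ums : uniq ms.
Variable I : finType.

Local Notation supported := (@supported C n ms).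

Definition spanning (w : I -> {mpoly C[n]}) :=
  forall p, supported p -> exists a : I -> C, p = \sum_i a i *: w i.

Definition coefmx (w : I -> {mpoly C[n]}) :=
  \matrix_(i < #|I|, k < size ms) (w (enum_val i))@_(nth 0%MM ms k).

Lemma sum_enum_val (R : nmodType) (F : I -> R) :
  \sum_i F i = \sum_(k < #|I|) F (enum_val k).
Proof. by rewrite -big_enum_val. Qed.

Lemma spanning_row_full w : (forall i, supported (w i)) ->
  spanning w <-> row_full (coefmx w).
Proof.
move=> hw; split=> [sp|/row_fullP[B BM] p hp].
  have /fin_all_exists[a ha] (k : 'I_(size ms)) :
     exists a : I -> C, 'X_[nth 0%MM ms k] = \sum_i a i *: w i.
    apply: sp => m; rewrite mcoeffX; case: (_ =P m) => [<- _|_]; first exact: mem_nth.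
    by rewrite eqxx.
  apply/row_fullP; exists (\matrix_(k, i) a k (enum_val i)).
  apply/matrixP => k k'; rewrite !mxE.
  have /(congr1 (mcoeff (nth 0%MM ms k'))) := ha k.
  rewrite mcoeffX nth_uniq // => e; rewrite -[RHS]/((k == k' :> nat)%:R) e.
  rewrite raddf_sum /= sum_enum_val; apply: eq_bigr => i _.
  by rewrite !mxE mcoeffZ.
exists (fun i => \sum_(k < size ms) p@_(nth 0%MM ms k) * B k (enum_rank i)).
apply/mpolyP => m; rewrite raddf_sum /=.
have [mm|mm] := boolP (m \in ms); last first.
  rewrite big1 => [|i _]; first by apply/eqP/contraT => /hp; rewrite (negbTE mm).
  rewrite mcoeffZ; have -> : (w i)@_m = 0; last by rewrite mulr0.
  by apply/eqP/contraT => /hw; rewrite (negbTE mm).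
have lt : (index m ms < size ms)%N by rewrite index_mem.
pose k0 := Ordinal lt; have ek0 : nth 0%MM ms k0 = m by rewrite nth_index.
rewrite sum_enum_val -ek0.
transitivity (\sum_(k < size ms) p@_(nth 0%MM ms k) * (B *m coefmx w) k k0).
  rewrite BM (bigD1 k0) //= mxE eqxx mulr1 big1 ?addr0 // => k nk.
  by rewrite mxE (negbTE nk) mulr0.
transitivity (\sum_(k < size ms) \sum_i p@_(nth 0%MM ms k) * (B k i * coefmx w i k0)).
  by apply: eq_bigr => k _; rewrite mxE mulr_sumr.
rewrite exchange_big; apply: eq_bigr => i _; rewrite mcoeffZ mulr_suml.
by apply: eq_bigr => k _; rewrite !mxE enum_valK mulrA.
Qed.

(** A spanning family with as many members as there are monomials is
    independent. *)
Lemma spanning_indep w a : (forall i, supported (w i)) -> spanning w ->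
  #|I| = size ms -> \sum_i a i *: w i = 0 -> forall i, a i = 0.
Proof.
move=> hw sp eI e i; have /(spanning_row_full hw) rf := sp.
have /row_free_inj inj : row_free (coefmx w).
  by rewrite /row_free; move: rf; rewrite /row_full => /eqP ->; rewrite eI.
pose u := \row_k a (enum_val k) : 'rV[C]_#|I|.
have u0 : u = 0.
  apply: inj; rewrite mul0mx; apply/rowP => k; rewrite !mxE.
  have /(congr1 (mcoeff (nth 0%MM ms k))) := e.
  rewrite raddf_sum /= mcoeff0 sum_enum_val => e0; rewrite -[RHS]e0; apply: eq_bigr => j _.
  by rewrite !mxE mcoeffZ.
by have := congr1 (fun v : 'rV_#|I| => v 0 (enum_rank i)) u0; rewrite !mxE enum_rankK.
Qed.

End MonomialSpans.

Section Openness.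
Local Open Scope ring_scope.
Variable C : numClosedFieldType.
Variables (T : Type) (N : nat) (co : T -> 'I_N -> C).

Lemma row_full_open a b (M : T -> 'M[C]_(a, b)) c0 :
  (forall i j, polyfun co (fun c => M c i j)) -> row_full (M c0) ->
  exists psi, [/\ polyfun co psi, psi c0 != 0 &
    forall c, psi c != 0 -> row_full (M c)].
Proof.
move=> hM rf; pose f := fullrankfun rf.
exists (fun c => \det (rowsub f (M c))); split.
- by apply: polyfun_det => i j; apply: polyfun_ext (hM (f i) j) => c; rewrite mxE.
- by rewrite -unitfE -unitmxE fullrowsub_unit.
move=> c; rewrite -unitfE -unitmxE => u; rewrite -sub1mx.
apply: submx_trans (rowsub_sub f (M c)); rewrite sub1mx.
by rewrite row_full_unit.
Qed.

(** Spanning is detected by a nonzero minor, hence is an open condition. *)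
Lemma spanning_open n (ms : seq 'X_{1..n}) (I : finType)
    (w : I -> T -> {mpoly C[n]}) c0 :
  uniq ms -> (forall i, polyfam co (w i)) ->
  (forall i c, supported ms (w i c)) -> spanning ms (w^~ c0) ->
  exists psi, [/\ polyfun co psi, psi c0 != 0 &
    forall c, psi c != 0 -> spanning ms (w^~ c)].
Proof.
move=> ums hw sw sp.
have [||psi [h1 h2 h3]] := @row_full_open _ _ (fun c => coefmx ms (w^~ c)) c0.
- move=> i j; apply: polyfun_ext (polyfam_coef (nth 0%MM ms j) (hw (enum_val i))).
  by move=> c; rewrite mxE.
- exact: (proj1 (spanning_row_full ums (fun i => sw i c0)) sp).
by exists psi; split=> // c /h3; exact: (proj2 (spanning_row_full ums (fun i => sw i c))).
Qed.

End Openness.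


Section Ideals.
Local Open Scope ring_scope.
Variables (C : numClosedFieldType) (r : nat).
Implicit Types (P : {mpoly C[r]} -> Prop) (p q : {mpoly C[r]}).

Record is_ideal P : Prop := IsIdeal {
  ideal0 : P 0;
  idealD : forall p q, P p -> P q -> P (p + q);
  idealM : forall p q, P p -> P (q * p)
}.

Definition adjoin P h p := exists a b, P a /\ p = a + h * b.

Lemma adjoin_ideal P h : is_ideal P -> is_ideal (adjoin P h).
Proof.
move=> [P0 PD PM]; split; first by exists 0, 0; split=> //; rewrite mulr0 addr0.
- move=> _ _ [a [b [Pa ->]]] [a' [b' [Pa' ->]]]; exists (a + a'), (b + b').
  by split; [exact: PD|ring].
- move=> _ c [a [b [Pa ->]]]; exists (c * a), (c * b).
  by split; [exact: PM|ring].
Qed.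

Lemma adjoin_sub P h p : P p -> adjoin P h p.
Proof. by exists p, 0; split=> //; rewrite mulr0 addr0. Qed.

Lemma adjoin_gen P h : is_ideal P -> adjoin P h h.
Proof. by move=> hP; exists 0, 1; split; [exact: ideal0|ring]. Qed.

Definition upoly (j : 'I_r) (u : {poly C}) : {mpoly C[r]} :=
  (map_poly (@mpolyC r C) u).['X_j].

Lemma upoly_eval j u (q : 'I_r -> C) : (upoly j u).@[q] = u.[q j].
Proof.
rewrite /upoly horner_coef size_map_inj_poly ?rmorph0 //; last first.
  by move=> x y /eqP; rewrite mpolyC_eq => /eqP.
rewrite raddf_sum horner_coef /=; apply: eq_bigr => i _.
by rewrite coef_map mevalM mevalC rmorphXn /= mevalXU.
Qed.

Lemma prime_avoid P j u : is_ideal P -> u != 0 -> P (upoly j u) -> ~ P 1 ->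
  exists a : C, ~ adjoin P ('X_j - a%:MP) 1.
Proof.
move=> hP u0 Pu P1; apply: NNPP => H; apply: P1.
have A (a : C) : adjoin P ('X_j - a%:MP) 1.
  by apply: NNPP => h; apply: H; exists a.
have B (s : seq C) : adjoin P (\prod_(a <- s) ('X_j - a%:MP)) 1.
  elim: s => [|a s [x [y [Px e]]]].
    by exists 0, 1; split; [exact: ideal0|rewrite big_nil; ring].
  case: (A a) => x' [y' [Px' e']]; rewrite big_cons.
  set w := \prod_(_ <- _) _ in e *; set v := 'X_j - _ in e' *.
  exists (x + (w * y) * x'), (y * y'); split.
    by apply: idealD => //; apply: idealM.
  have -> : x + w * y * x' + v * w * (y * y') = x + w * y * (x' + v * y') by ring.
  by rewrite -e' mulr1.
have [s us] := closed_field_poly_normal u.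
case: (B s) => a [b [Pa e]]; rewrite e; apply: idealD => //.
rewrite mulrC; have -> : \prod_(z <- s) ('X_j - z%:MP) = (lead_coef u)^-1%:MP * upoly j u.
  rewrite /upoly {2}us map_polyZ hornerZ rmorph_prod horner_prod mulrA -mpolyCM.
  rewrite mulVf ?lead_coef_eq0 // mpolyC1 mul1r; apply: eq_bigr => z _.
  by rewrite rmorphB /= map_polyX map_polyC hornerXsubC.
by apply: idealM => //; apply: idealM.
Qed.

(** Weak Nullstellensatz for ideals of finite codimension: the variables are
    specialized one at a time to roots of the univariate polynomials that the
    ideal contains, keeping the ideal proper. *)
Lemma nullstellensatz P : is_ideal P ->
  (forall j, exists2 u, u != 0 & P (upoly j u)) ->
  (forall q : 'I_r -> C, exists2 g, P g & g.@[q] != 0) -> P 1.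
Proof.
move=> hP hu hq; apply: NNPP => P1.
have [q [Q [hQ PQ Q1 Qq]]] : exists q : 'I_r -> C, exists Q,
   [/\ is_ideal Q, forall p, P p -> Q p, ~ Q 1 &
       forall j, j \in enum 'I_r -> Q ('X_j - (q j)%:MP)].
  elim: (enum 'I_r) => [|j s [q [Q [hQ PQ Q1 Qq]]]].
    by exists (fun=> 0), P; split.
  have [u u0 Pu] := hu j.
  have [a Ha] := prime_avoid hQ u0 (PQ _ Pu) Q1.
  exists (fun i => if i == j then a else q i), (adjoin Q ('X_j - a%:MP)); split=> //.
  - exact: adjoin_ideal.
  - by move=> p /PQ; apply: adjoin_sub.
  - move=> i; rewrite inE; case: eqP => [->|_] /= h; first exact: adjoin_gen.
    by apply: adjoin_sub; apply: Qq.
have [g Pg gq] := hq q; apply: Q1.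
have [h [e _]] := mpoly_taylor g q.
have S : Q (\sum_j ('X_j - (q j)%:MP) * h j).
  apply: (big_ind Q); [exact: ideal0|exact: idealD|] => j _.
  by rewrite mulrC; apply: idealM => //; apply: Qq; rewrite mem_enum.
have : Q ((g.@[q])^-1%:MP * (g + (-1) * \sum_j ('X_j - (q j)%:MP) * h j)).
  by apply: idealM => //; apply: idealD => //; [exact: PQ|exact: idealM].
have -> : g + (-1) * \sum_j ('X_j - (q j)%:MP) * h j = (g.@[q])%:MP.
  by rewrite mulN1r {1}e addrK.
by rewrite -mpolyCM mulVf.
Qed.

End Ideals.

Section Boxes.
Local Open Scope ring_scope.
Variables (C : numClosedFieldType) (r : nat).
Implicit Types (p q : {mpoly C[r]}) (N M : 'I_r -> nat).

Definition boxed N p := forall m, p@_m != 0 -> forall j, (m j <= N j)%N.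

Definition boxms N : seq 'X_{1..r} :=
  [seq [multinom nat_of_ord (f j) | j < r] | f : {dffun forall j, 'I_(N j).+1}].

Lemma mem_boxms N m : (m \in boxms N) = [forall j, m j <= N j]%N.
Proof.
apply/imageP/forallP => [[f _ ->] j|h]; first by rewrite mnmE -ltnS.
exists [ffun j => inord (m j)] => //; apply/mnmP => j.
by rewrite mnmE ffunE inordK // ltnS.
Qed.

Lemma uniq_boxms N : uniq (boxms N).
Proof.
rewrite map_inj_uniq ?enum_uniq // => f g /mnmP e; apply/ffunP => j.
by apply/val_inj; have := e j; rewrite !mnmE.
Qed.

Lemma size_boxms N : size (boxms N) = (\prod_j (N j).+1)%N.
Proof.
rewrite size_map -cardE card_dep_ffun /image_mem foldrE big_map big_enum /=.
by apply: eq_bigr => j _; rewrite card_ord.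
Qed.

Lemma boxedP N p : boxed N p <-> supported (boxms N) p.
Proof.
split=> h m /h; first by move=> hm; rewrite mem_boxms; apply/forallP.
by rewrite mem_boxms => /forallP.
Qed.

Lemma boxed0 N : boxed N 0.
Proof. by move=> m; rewrite mcoeff0 eqxx. Qed.

Lemma boxedD N p q : boxed N p -> boxed N q -> boxed N (p + q).
Proof.
move=> hp hq m; rewrite mcoeffD => h; have [e|] := eqVneq p@_m 0; last exact: hp.
by move: h; rewrite e add0r; apply: hq.
Qed.

Lemma boxedZ N a p : boxed N p -> boxed N (a *: p).
Proof.
by move=> hp m; rewrite mcoeffZ mulf_eq0 negb_or => /andP[_]; apply: hp.
Qed.

Lemma boxed_sum N (I : Type) (s : seq I) (Q : pred I) f :
  (forall i, Q i -> boxed N (f i)) -> boxed N (\sum_(i <- s | Q i) f i).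
Proof.
by move=> h; apply: (big_ind (boxed N)) => //; [exact: boxed0|exact: boxedD].
Qed.

Lemma boxedX N (m : 'X_{1..r}) : (forall j, m j <= N j)%N -> boxed N 'X_[m].
Proof.
move=> h m'; rewrite mcoeffX; case: (m =P m') => [<-|_] //.
by rewrite eqxx.
Qed.

Lemma boxedC N c : boxed N c%:MP.
Proof.
move=> m; rewrite mcoeffC mulf_eq0 negb_or => /andP[_] h j.
by case: (m =P 0%MM) h => [->|]; rewrite ?mnm0E ?eqxx.
Qed.

Lemma boxed1 N : boxed N 1.
Proof. by rewrite -mpolyC1; apply: boxedC. Qed.

Lemma boxedW N M p : (forall j, N j <= M j)%N -> boxed N p -> boxed M p.
Proof. by move=> NM h m pm j; apply: leq_trans (NM j); apply: h. Qed.

Lemma boxed_ind N (Q : {mpoly C[r]} -> Prop) : Q 0 ->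
  (forall p q, Q p -> Q q -> Q (p + q)) -> (forall a p, Q p -> Q (a *: p)) ->
  (forall m : 'X_{1..r}, (forall j, m j <= N j)%N -> Q 'X_[m]) ->
  forall p, boxed N p -> Q p.
Proof.
move=> Q0 QD QZ QX p hp; rewrite [p]mpolyE big_seq.
apply: (big_ind Q) => // m; rewrite mcoeff_msupp => /hp h.
by apply: QZ; apply: QX.
Qed.

Lemma boxedM N M p q : boxed N p -> boxed M q -> boxed (fun j => N j + M j)%N (p * q).
Proof.
move=> hp hq; pose B := boxed (fun j => N j + M j)%N.
move: p hp; apply: (@boxed_ind N (fun p => B (p * q))) => [|p1 p2|a p1|m hm].
- by rewrite mul0r; apply: boxed0.
- by rewrite mulrDl; apply: boxedD.
- by rewrite -scalerAl; apply: boxedZ.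
move: q hq; apply: (@boxed_ind M (fun q => B ('X_[m] * q))) => [|p1 p2|a p1|m' hm'].
- by rewrite mulr0; apply: boxed0.
- by rewrite mulrDr; apply: boxedD.
- by rewrite -scalerAr; apply: boxedZ.
by rewrite -mpolyXD; apply: boxedX => j; rewrite mnmDE leq_add.
Qed.

Lemma boxed_bound p : exists K, boxed (fun=> K) p.
Proof.
exists (msize p) => m; rewrite -mcoeff_msupp => /msize_mdeg_lt /ltnW h j.
by apply: leq_trans h; rewrite mdegE (bigD1 j) //= leq_addr.
Qed.

End Boxes.


Section FormMonomials.
Local Open Scope ring_scope.
Variable R : nzRingType.

Definition formms n d : seq 'X_{1..n} :=
  [seq s2m t | t : d.-tuple 'I_n <- enum (basis n d)].

Lemma mem_formms n d m : (m \in formms n d) = (mdeg m == d).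
Proof. by rewrite basis_cover. Qed.

Lemma uniq_formms n d : uniq (formms n d).
Proof. exact: uniq_basis. Qed.

Lemma size_formms n d : size (formms n.+1 d) = 'C(d + n, d).
Proof. exact: size_basis. Qed.

Lemma dhomog_supported n d (p : {mpoly R[n]}) :
  p \is d.-homog <-> supported (formms n d) p.
Proof.
split=> [/dhomogP h m|h]; first by rewrite -mcoeff_msupp mem_formms => /h ->.
by apply/dhomogP => m; rewrite mcoeff_msupp => /h; rewrite mem_formms => /eqP.
Qed.

End FormMonomials.

Section CompleteIntersection.
Local Open Scope ring_scope.
Variables (C : numClosedFieldType) (r : nat) (rho : 'I_r -> nat).
Hypothesis rho_gt0 : forall j, (0 < rho j)%N.
Implicit Types (p g : {mpoly C[r]}).

Definition level (e : nat) (j : 'I_r) : nat := ((j.+1 + e) * rho j).-1.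

Lemma levelS e j : (level e j).+1 = ((j.+1 + e) * rho j)%N.
Proof. by rewrite prednK // muln_gt0 rho_gt0. Qed.

Lemma levelD e f j : level (e + f) j = (level e j + f * rho j)%N.
Proof.
by apply: succn_inj; rewrite levelS -addSn levelS addnA mulnDl.
Qed.

Lemma level_ge e j : (e <= level e j)%N.
Proof. by rewrite -ltnS levelS; have := rho_gt0 j; nia. Qed.

Lemma levelW e f j : (e <= f)%N -> (level e j <= level f j)%N.
Proof. by move=> /subnKC <-; rewrite levelD leq_addr. Qed.

Lemma boxed_level p : exists e, boxed (level e) p.
Proof.
have [K h] := boxed_bound p; exists K; apply: boxedW h => j.
exact: level_ge.
Qed.

Variable E : 'I_r -> {mpoly C[r]}.
Hypothesis E_boxed : forall k, boxed rho (E k).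

Definition combination (N M : 'I_r -> nat) p :=
  exists (g0 : {mpoly C[r]}) (g : 'I_r -> {mpoly C[r]}),
  [/\ boxed N g0, forall k : 'I_r, boxed M (g k) & p = g0 + \sum_k E k * g k].

Definition regular_system := forall p,
  boxed (level 1) p -> combination (level 0) (level 0) p.

Definition idl p := exists g : 'I_r -> {mpoly C[r]}, p = \sum_k E k * g k.

Definition solution (q : 'I_r -> C) := forall k, (E k).@[q] = 0.

Lemma idl_ideal : is_ideal idl.
Proof.
split.
- by exists (fun=> 0); rewrite big1 // => k _; rewrite mulr0.
- move=> _ _ [g ->] [h ->]; exists (fun k => g k + h k).
  by rewrite -big_split; apply: eq_bigr => k _; rewrite mulrDr.
- move=> _ q [g ->]; exists (fun k => q * g k).
  by rewrite mulr_sumr; apply: eq_bigr => k _; rewrite mulrCA.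
Qed.

Lemma idl_gen k : idl (E k).
Proof.
exists (fun i => (i == k)%:R); rewrite (bigD1 k) //= eqxx mulr1 big1 ?addr0 //.
by move=> i /negbTE ->; rewrite mulr0.
Qed.

Lemma idl_eval p q : idl p -> solution q -> p.@[q] = 0.
Proof.
move=> [g ->] sq; rewrite raddf_sum big1 // => k _ /=.
by rewrite mevalM sq mul0r.
Qed.

Lemma combinationD N M p q : combination N M p -> combination N M q ->
  combination N M (p + q).
Proof.
move=> [g0 [g [h0 h ->]]] [f0 [f [k0 k ->]]].
exists (g0 + f0), (fun i => g i + f i); split=> [|i|]; try exact: boxedD.
rewrite addrACA -big_split; congr (_ + _); apply: eq_bigr => i _.
by rewrite mulrDr.
Qed.

Lemma combinationZ N M a p : combination N M p -> combination N M (a *: p).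
Proof.
move=> [g0 [g [h0 h ->]]]; exists (a *: g0), (fun i => a *: g i).
split=> [|i|]; try exact: boxedZ.
rewrite scalerDr scaler_sumr; congr (_ + _); apply: eq_bigr => i _.
by rewrite scalerAr.
Qed.

Lemma combination0 N M : combination N M 0.
Proof.
exists 0, (fun=> 0); split=> [|i|]; try exact: boxed0.
by rewrite big1 ?addr0 // => i _; rewrite mulr0.
Qed.

Hypothesis hE : regular_system.

Lemma regular_level e p : boxed (level e.+1) p -> combination (level 0) (level e) p.
Proof.
elim: e p => [|e IH]; first exact: hE.
apply: boxed_ind => [|p q|a p|m hm].
- exact: combination0.
- exact: combinationD.
- exact: combinationZ.
pose m1 := [multinom minn (m j) (level 1 j) | j < r].
pose m2 := (m - m1)%MM.
have em : m = (m1 + m2)%MM.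
  rewrite addmC submK //; apply/mnm_lepP => j; rewrite mnmE; exact: geq_minl.
have h2 : boxed (fun j => (e.+1 * rho j)%N) ('X_[m2] : {mpoly C[r]}).
  apply: boxedX => j; rewrite mnmBE mnmE; have := hm j.
  by rewrite -[e.+2]add1n levelD; clear; lia.
have [|g0 [g [b0 bg e1]]] := hE (p := 'X_[m1]).
  by apply: boxedX => j; rewrite mnmE geq_minr.
rewrite em mpolyXD e1 mulrDl mulr_suml.
apply: combinationD.
  have [] := IH (g0 * 'X_[m2]).
    by apply: boxedW (boxedM b0 h2) => j; rewrite -levelD add0n.
  move=> f0 [f [k0 k ->]]; exists f0, f; split=> // i.
  by apply: boxedW (k i) => j; apply: levelW.
exists 0, (fun i => g i * 'X_[m2]); split=> [|i|]; first exact: boxed0.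
  by apply: boxedW (boxedM (bg i) h2) => j; rewrite -levelD add0n.
by rewrite add0r; apply: eq_bigr => i _; rewrite mulrA.
Qed.

Lemma reduce p : exists2 b, boxed (level 0) b & exists2 i, idl i & p = b + i.
Proof.
have [e he] := boxed_level p.
have [|b [g [hb _ ->]]] := @regular_level e p.
  by apply: boxedW he => j; apply: levelW.
by exists b => //; exists (\sum_k E k * g k) => //; exists g.
Qed.

(** The polynomials are a free module over the subring generated by the
    equations: with one more variable for the unit, expressions of degree e in
    the equations with coefficients in the lowest box span the e-th box, and
    their number is the number of monomials of that box. *)
Local Notation Y := {mpoly {mpoly C[r]}[r.+1]}.

Definition eqns (i : 'I_r.+1) : {mpoly C[r]} :=
  if unlift ord0 i is Some k then E k else 1.

Definition subst (Th : Y) : {mpoly C[r]} := mmap idfun eqns Th.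

Definition small (Th : Y) := forall m, boxed (level 0) Th@_m.

Lemma eqns0 : eqns ord0 = 1.
Proof. by rewrite /eqns unlift_none. Qed.

Lemma eqnsS k : eqns (lift ord0 k) = E k.
Proof. by rewrite /eqns liftK. Qed.

Lemma substD (a b : Y) : subst (a + b) = subst a + subst b.
Proof. exact: mmapD. Qed.

Lemma subst_sum (I : Type) (s : seq I) (f : I -> Y) :
  subst (\sum_(i <- s) f i) = \sum_(i <- s) subst (f i).
Proof. exact: raddf_sum. Qed.

Lemma substM (a b : Y) : subst (a * b) = subst a * subst b.
Proof. exact: (rmorphM (mmap idfun eqns)). Qed.

Lemma substX i : subst 'X_i = eqns i.
Proof. by rewrite /subst mmapX mmap1U. Qed.

Lemma smallXM i Th : small Th -> small ('X_i * Th).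
Proof.
move=> h m; rewrite mulrC; have [mi|mi] := posnP (m i).
  have -> : (Th * 'X_i)@_m = 0; last exact: boxed0.
  apply/eqP; rewrite mcoeff_eq0 (perm_mem (msuppMX Th U_(i))).
  by apply/mapP => -[m' _ em]; move: mi; rewrite em mnmDE mnm1E eqxx.
have -> : m = (U_(i) + (m - U_(i)))%MM by rewrite addmC submK // lep1mP -lt0n.
by rewrite mcoeffMX.
Qed.

Lemma small_sum (I : Type) (s : seq I) (f : I -> Y) :
  (forall i, small (f i)) -> small (\sum_(i <- s) f i).
Proof. by move=> h m; rewrite raddf_sum /=; apply: boxed_sum => i _; apply: h. Qed.

Lemma smallD (a b : Y) : small a -> small b -> small (a + b).
Proof. by move=> ha hb m; rewrite mcoeffD; apply: boxedD. Qed.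

Lemma level_expressions e p : boxed (level e) p ->
  exists Th : Y, [/\ Th \is e.-homog, small Th & subst Th = p].
Proof.
elim: e p => [|e IH] p hp.
  exists p%:MP; split.
  - apply/dhomogP => m; rewrite mcoeff_msupp mcoeffC.
    by case: (m =P 0%MM) => [->|_]; rewrite ?mulr0 ?eqxx //= mdeg0.
  - move=> m; rewrite mcoeffC; case: (m == 0%MM); rewrite ?mulr1 ?mulr0 //.
    exact: boxed0.
  - exact: mmapC.
have [g0 [g [h0 h ->]]] := regular_level hp.
have [|T0 [t0 s0 e0]] := IH g0.
  by apply: boxedW h0 => j; apply: levelW.
have /fin_all_exists[T hT] k := IH (g k) (h k).
exists ('X_ord0 * T0 + \sum_k 'X_(lift ord0 k) * T k); split.
- rewrite -[e.+1]add1n.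
  apply: rpredD; first by apply: dhomogM => //; rewrite dhomogX /= mdeg1.
  apply: rpred_sum => k _; have [tk _ _] := hT k.
  by apply: dhomogM => //; rewrite dhomogX /= mdeg1.
- apply: smallD; first exact: smallXM.
  by apply: small_sum => k; apply: smallXM; have [] := hT k.
rewrite substD subst_sum substM substX eqns0 mul1r e0; congr (_ + _).
by apply: eq_bigr => k _; rewrite substM substX eqnsS; have [_ _ ->] := hT k.
Qed.

Lemma prod_level e :
  (\prod_(j < r) (level e j).+1 = 'C(e + r, e) * \prod_(j < r) (level 0 j).+1)%N.
Proof.
under eq_bigr do rewrite levelS; under [in RHS]eq_bigr do rewrite levelS addn0.
rewrite !big_split /= mulnA; congr (_ * _)%N.
have fac f : (\prod_(j < r) (j.+1 + f) * f`! = (f + r)`!)%N.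
  elim: r => [|s IH]; first by rewrite big_ord0 mul1n addn0.
  by rewrite big_ord_recr /= mulnAC IH addnS factS mulnC addSn addnC.
apply/eqP; rewrite -(eqn_pmul2r (fact_gt0 e)) fac.
have := fac 0%N; rewrite fact0 muln1 add0n => h.
under [in X in _ == X]eq_bigr do rewrite -[_.+1]addn0.
by rewrite h -(bin_fact (leq_addr r e)) addKn; apply/eqP; ring.
Qed.

Lemma level_independent e (Th : Y) :
  Th \is e.-homog -> small Th -> subst Th = 0 -> Th = 0.
Proof.
move=> hT sT T0.
pose A := 'I_(size (formms r.+1 e)); pose B := 'I_(size (@boxms r (level 0))).
pose ma (a : A) := nth 0%MM (formms r.+1 e) a.
pose mb (b : B) := nth 0%MM (boxms (level 0)) b.
pose w (i : A * B) := 'X_[mb i.2] * mmap1 eqns (ma i.1).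
pose sub m : {mpoly C[r]} := subst 'X_[m].
have subE m : sub m = mmap1 eqns m by rewrite /sub /subst mmapX.
have expand (Q : Y) : Q \is e.-homog -> small Q ->
    subst Q = \sum_i (Q@_(ma i.1))@_(mb i.2) *: w i.
  move=> /dhomog_supported hQ sQ.
  have hQ' : Q = \sum_(a : A) Q@_(ma a) *: 'X_[ma a].
    exact: (supportedE (uniq_formms _ _)).
  rewrite {1}hQ' subst_sum.
  rewrite -(pair_bigA _ (fun a b => (Q@_(ma a))@_(mb b) *: w (a, b))) /=.
  apply: eq_bigr => a _; rewrite /subst mmapZ mmapX /=.
  have /boxedP/(supportedE (uniq_boxms _)) e1 := sQ (ma a).
  rewrite {1}e1 mulr_suml; apply: eq_bigr => b _.
  by rewrite -scalerAl.
have Eb i : boxed rho (eqns i).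
  by rewrite /eqns; case: unlift => [k|]; [exact: E_boxed|exact: boxed1].
have boxedE i k : boxed (fun j => k * rho j)%N (eqns i ^+ k).
  elim: k => [|k IH]; first exact: boxed1.
  by rewrite exprS; apply: boxedW (boxedM (Eb i) IH) => j; rewrite mulSn.
have wb i : boxed (level e) (w i).
  case: i => a b; rewrite /w /=.
  have : mb b \in boxms (level 0) by apply: mem_nth.
  rewrite mem_boxms => /forallP /(@boxedX C) hb.
  have : ma a \in formms r.+1 e by apply: mem_nth.
  rewrite mem_formms => /eqP ea.
  have hp (s : seq 'I_r.+1) : boxed (fun j => (\sum_(i <- s) ma a i) * rho j)%N
      (\prod_(i <- s) eqns i ^+ ma a i).
    elim: s => [|i s IH]; first by rewrite [X in boxed _ X]big_nil; apply: boxed1.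
    rewrite [X in boxed _ X]big_cons; apply: boxedW (boxedM (boxedE i _) IH) => j.
    by rewrite big_cons mulnDl.
  apply: boxedW (boxedM hb (hp (index_enum _))) => j.
  by rewrite -mdegE ea -levelD add0n.
have cardE : #|{: A * B}| = size (boxms (level e)).
  by rewrite card_prod !card_ord size_formms !size_boxms (prod_level e).
have spw : spanning (boxms (level e)) w.
  move=> p hp; have [Q [hQ sQ <-]] := level_expressions (proj2 (boxedP _ _) hp).
  by exists (fun i => (Q@_(ma i.1))@_(mb i.2)); apply: expand.
have := expand Th hT sT; rewrite T0 => /esym zero.
have coef0 a b : (Th@_(ma a))@_(mb b) = 0.
  apply: (spanning_indep (uniq_boxms _) _ spw cardE zero (a, b)) => i.
  exact/boxedP.
apply/mpolyP => m; rewrite mcoeff0; have [mf|mf] := boolP (m \in formms r.+1 e).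
  have lt : (index m (formms r.+1 e) < size (formms r.+1 e))%N by rewrite index_mem.
  have -> : m = ma (Ordinal lt) by rewrite /ma nth_index.
  apply/mpolyP => m'; rewrite mcoeff0.
  have [mb'|mb'] := boolP (m' \in boxms (level 0)).
    have lt' : (index m' (boxms (level 0)) < size (boxms (level 0)))%N.
      by rewrite index_mem.
    by have := coef0 (Ordinal lt) (Ordinal lt'); rewrite /mb nth_index.
  have /boxedP/(_ m') := sT (ma (Ordinal lt)).
  by case: eqP => // _ /(_ isT); rewrite (negbTE mb').
by apply: (dhomog_nemf_coeff hT); rewrite -mem_formms.
Qed.

(** No nonzero polynomial of the lowest box lies in the ideal: the quotient by
    the ideal has dimension exactly the number of monomials of that box. *)
Lemma level0_idl b : boxed (level 0) b -> idl b -> b = 0.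
Proof.
move=> hb [g eb].
have [e he] : exists e, forall k, boxed (level e) (g k).
  have /fin_all_exists[f hf] k := boxed_level (g k).
  exists (\sum_k f k)%N => k; apply: boxedW (hf k) => j; apply: levelW.
  by rewrite (bigD1 k) //= leq_addr.
have /fin_all_exists[T hT] k := level_expressions (he k).
pose Th : Y := 'X_[U_(ord0) *+ e.+1] * b%:MP - \sum_k 'X_(lift ord0 k) * T k.
have Th0 : Th = 0.
  apply: (@level_independent e.+1).
  - apply: rpredB.
      rewrite -[e.+1]addn0; apply: dhomogM.
        by rewrite dhomogX /= mdegMn mdeg1 mul1n addn0.
      apply/dhomogP => m; rewrite mcoeff_msupp mcoeffC.
      by case: (m =P 0%MM) => [->|_]; rewrite ?mulr0 ?eqxx //= mdeg0.
    apply: rpred_sum => k _; have [tk _ _] := hT k.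
    suff h : 'X_(lift ord0 k) * T k \is (1 + e).-homog by exact: h.
    by apply: dhomogM => //; rewrite dhomogX /= mdeg1.
  - move=> m; rewrite mcoeffB; apply: boxedD.
      rewrite mulrC mcoeffCM mcoeffX; case: (_ == m); rewrite ?mulr1 ?mulr0 //.
      exact: boxed0.
    rewrite -scaleN1r; apply: boxedZ.
    by apply: (@small_sum _ _ (fun k => 'X_(lift ord0 k) * T k)) => k; apply: smallXM; have [] := hT k.
  rewrite /Th /subst mmapB -/(subst _) -/(subst _) substM subst_sum.
  rewrite {1}/subst mmapX {1}/subst mmapC /=.
  have -> : mmap1 eqns (U_(ord0) *+ e.+1) = 1.
    rewrite /mmap1 big1 // => i _; rewrite mulmnE mnm1E.
    by case: eqP => [<-|_]; rewrite ?eqns0 ?expr1n ?mul0n.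
  rewrite mul1r {1}eb; apply/eqP; rewrite subr_eq0; apply/eqP/eq_bigr => k _.
  by rewrite substM substX eqnsS; have [_ _ ->] := hT k.
have := congr1 (mcoeff (U_(ord0) *+ e.+1)%MM) Th0.
rewrite mcoeff0 mcoeffB mulrC mcoeffCM mcoeffX eqxx mulr1 raddf_sum /=.
rewrite big1 ?subr0 // => k _; rewrite mulrC; apply/eqP.
rewrite mcoeff_eq0 (perm_mem (msuppMX _ _)); apply/mapP => -[m' _ em].
have := congr1 (fun m : 'X_{1..r.+1} => m (lift ord0 k)) em.
by rewrite mnmDE mulmnE !mnm1E eqxx.
Qed.

End CompleteIntersection.


Section CountingSolutions.
Local Open Scope ring_scope.
Variables (C : numClosedFieldType) (r : nat) (rho : 'I_r -> nat).
Hypothesis rho_gt0 : forall j, (0 < rho j)%N.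
Variable E : 'I_r -> {mpoly C[r]}.
Hypothesis E_boxed : forall k, boxed rho (E k).
Hypothesis hE : regular_system rho E.

Local Notation level := (level rho).
Local Notation idl := (idl E).
Local Notation solution := (solution E).

Lemma boxed_expand N (p : {mpoly C[r]}) : boxed N p ->
  p = \sum_(k < size (@boxms r N)) p@_(nth 0%MM (boxms N) k) *: 'X_[nth 0%MM (boxms N) k].
Proof. by move=> /boxedP; apply: supportedE; apply: uniq_boxms. Qed.

Lemma solution_dec q : solution q \/ exists k, (E k).@[q] != 0.
Proof.
case: (boolP [forall k, (E k).@[q] == 0]) => [/forallP h|]; first by left=> k; apply/eqP.
by rewrite negb_forall => /existsP h; right.
Qed.

(** Powers of a variable are dependent modulo the ideal. *)
Lemma upoly_idl j : exists2 u, u != 0 & idl (upoly j u).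
Proof.
pose ms := @boxms r (level 0); pose M := size ms.
have /fin_all_exists[b hb] (i : 'I_M.+1) :
    exists b, boxed (level 0) b /\ exists2 a, idl a & 'X_j ^+ i = b + a :> {mpoly C[r]}.
  by have [b hb ha] := reduce rho_gt0 hE ('X_j ^+ i); exists b.
pose A := \matrix_(i < M.+1, k < M) (b i)@_(nth 0%MM ms k).
have kA : kermx A != 0.
  rewrite kermx_eq0 /row_free neq_ltn; apply/orP; left.
  by apply: leq_ltn_trans (rank_leq_col _) _.
pose v := nz_row (kermx A).
have v0 : v != 0 by rewrite nz_row_eq0.
have vA : v *m A = 0 by apply/eqP; rewrite -sub_kermx nz_row_sub.
exists (rVpoly v); first by apply: contra_neq v0 => e; rewrite -[v]rVpolyK e linear0.
have -> : upoly j (rVpoly v) = \sum_(i < M.+1) v 0 i *: 'X_j ^+ i :> {mpoly C[r]}.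
  rewrite /upoly /rVpoly poly_def raddf_sum /= horner_sum; apply: eq_bigr => i _.
  rewrite map_polyZ map_polyXn hornerZ hornerXn mul_mpolyC.
  by case: insubP => [i' _ e|]; [congr (v 0 _ *: _); exact: val_inj|rewrite ltn_ord].
have -> : \sum_(i < M.+1) v 0 i *: 'X_j ^+ i = \sum_(i < M.+1) v 0 i *: b i
    + \sum_(i < M.+1) v 0 i *: ('X_j ^+ i - b i).
  by rewrite -big_split; apply: eq_bigr => i _; rewrite /= -scalerDr addrC subrK.
have -> : \sum_(i < M.+1) v 0 i *: b i = 0.
  transitivity (\sum_(i < M.+1) v 0 i *:
      \sum_(k < M) (b i)@_(nth 0%MM ms k) *: 'X_[nth 0%MM ms k] : {mpoly C[r]}).
    by apply: eq_bigr => i _; rewrite -boxed_expand //; have [] := hb i.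
  under eq_bigr do rewrite scaler_sumr.
  rewrite exchange_big big1 // => k _ /=.
  under eq_bigr do rewrite scalerA.
  rewrite -scaler_suml; have := congr1 (fun x : 'rV_M => x 0 k) vA.
  by rewrite !mxE; under eq_bigr do rewrite mxE; move=> ->; rewrite scale0r.
have [i0 iD iM] := idl_ideal E.
rewrite add0r; apply: (big_ind idl) => // i _.
by rewrite -mul_mpolyC; apply: iM; have [_ [a ia ->]] := hb i; rewrite addrC addKr.
Qed.

Lemma unit_modulo d : (forall q, solution q -> d.@[q] != 0) -> adjoin idl d 1.
Proof.
move=> hd; have hI := idl_ideal E.
apply: nullstellensatz (adjoin_ideal d hI) _ _ => [j|q].
  by have [u u0 iu] := upoly_idl j; exists u => //; apply: adjoin_sub.
have [sq|[k Ek]] := solution_dec q.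
  by exists d; [exact: adjoin_gen|exact: hd].
by exists (E k) => //; apply: adjoin_sub; apply: idl_gen.
Qed.

Definition jacobian : {mpoly C[r]} := \det (\matrix_(k, j) (E k)^`M(j)).

Hypothesis simple : forall q, solution q -> jacobian.@[q] != 0.

(** At a simple zero the equations generate the maximal ideal locally, by
    Cramer's rule for the matrix of their Taylor coefficients; hence a
    polynomial vanishing at all zeros lies in the ideal. *)
Lemma vanishing_idl g : (forall q, solution q -> g.@[q] = 0) -> idl g.
Proof.
move=> hg; have [i0 iD iM] := idl_ideal E.
suff : idl (1 * g) by rewrite mul1r.
pose P h := idl (h * g).
apply: (@nullstellensatz _ _ P).
- split; rewrite /P; first by rewrite mul0r.
  + by move=> p q ip iq; rewrite mulrDl; apply: iD.
  + by move=> p q ip; rewrite -mulrA; apply: iM.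
- by move=> j; have [u u0 iu] := upoly_idl j; exists u => //; rewrite /P mulrC; apply: iM.
move=> q; have [sq|[k Ek]] := solution_dec q; last first.
  by exists (E k) => //; rewrite /P mulrC; apply: iM; apply: idl_gen.
have /fin_all_exists[t ht] k := mpoly_taylor (E k) q.
pose A : 'M[{mpoly C[r]}]_r := \matrix_(k, j) t k j.
exists (\det A); last first.
  have -> : (\det A).@[q] = jacobian.@[q]; last exact: simple.
  rewrite /jacobian -[LHS](det_map_mx (meval q)) -[RHS](det_map_mx (meval q)).
  by congr (\det _); apply/matrixP => k j; rewrite !mxE; have [_ e] := ht k; exact: e.
have AX j : \det A * ('X_j - (q j)%:MP) = \sum_k (\adj A) j k * E k.
  pose x : 'cV[{mpoly C[r]}]_r := \col_j ('X_j - (q j)%:MP).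
  have Ax : A *m x = \col_k E k.
    apply/colP => k; rewrite !mxE; have [-> _] := ht k; rewrite sq add0r.
    by apply: eq_bigr => i _; rewrite !mxE mulrC.
  have e := congr1 (fun y : 'cV_r => y j 0) (mulmxA (\adj A) A x).
  rewrite mul_adj_mx mul_scalar_mx Ax in e.
  transitivity ((\det A *: x) j 0); first by rewrite !mxE.
  rewrite -e mxE; apply: eq_bigr => k _; congr (_ * _); by rewrite mxE.
rewrite /P; have [h [-> _]] := mpoly_taylor g q.
rewrite hg // add0r mulr_sumr; apply: (big_ind idl) => // j _.
rewrite mulrA AX mulr_suml; apply: (big_ind idl) => // k _.
by rewrite mulrAC; apply: iM; apply: idl_gen.
Qed.

Lemma solution_list : exists s : seq {ffun 'I_r -> C},
  uniq s /\ forall q, (q \in s) <-> solution q.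
Proof.
have /fin_all_exists2[u u0 iu] j := upoly_idl j.
have /fin_all_exists[R hR] j : exists R : seq C, forall x, root (u j) x -> x \in R.
  have [R eR] := closed_field_poly_normal (u j); exists R => x.
  rewrite {}eR rootZ ?lead_coef_eq0 // /root horner_prod.
  move/eqP/eqP; rewrite prodf_seq_eq0 => /hasP[z zR /= ].
  by rewrite hornerXsubC subr_eq0 => /eqP ->.
pose all := flatten [seq R j | j <- enum 'I_r].
pose cand : seq {ffun 'I_r -> C} := [seq [ffun j => nth 0 all (f j : 'I_(size all))] |
    f : {ffun 'I_r -> 'I_(size all)} <- enum {: {ffun 'I_r -> 'I_(size all)}}].
pose s := undup [seq q : {ffun 'I_r -> C} <- cand | [forall k, (E k).@[q] == 0]].
exists s; split=> [|q]; first exact: undup_uniq.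
rewrite mem_undup mem_filter; split=> [/andP[/forallP h _] k|sq]; first exact/eqP.
apply/andP; split; first by apply/forallP => k; rewrite sq.
have hall j : q j \in all.
  apply/flattenP; exists (R j); first by apply: map_f; rewrite mem_enum.
  by apply: hR; rewrite /root -upoly_eval (idl_eval (iu j) sq).
apply/mapP; exists [ffun j => Ordinal (etrans (index_mem _ _) (hall j))].
  by rewrite mem_enum.
by apply/ffunP => j; rewrite !ffunE /= nth_index.
Qed.

Lemma delta_poly (s : seq {ffun 'I_r -> C}) (q : {ffun 'I_r -> C}) : uniq s ->
  exists p : {mpoly C[r]}, forall q' : {ffun 'I_r -> C}, q' \in s -> p.@[q'] = (q' == q)%:R.
Proof.
elim: s => [|a s IH] /=; first by exists 0.
move=> /andP[as' us]; have [p hp] := IH us.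
pose sep (x y : {ffun 'I_r -> C}) : {mpoly C[r]} :=
  if [pick j | x j != y j] is Some j then (x j - y j)^-1 *: ('X_j - (y j)%:MP) else 1.
have sepP (x y : {ffun 'I_r -> C}) : x != y -> (sep x y).@[x] = 1 /\ (sep x y).@[y] = 0.
  rewrite /sep; case: pickP => [j xy _|xy].
    rewrite !mevalZ !mevalB !mevalXU !mevalC subrr mulr0 mulVf ?subr_eq0 //.
  by case/eqP; apply/ffunP => j; apply/eqP; move: (xy j); case: eqP.
have [<-|aq] := eqVneq a q.
  have neq y : y \in s -> a != y by move=> ys; apply: contraNneq as' => ->.
  exists (\prod_(y <- s) sep a y) => q'; rewrite inE => /orP[/eqP ->|q's].
    rewrite eqxx rmorph_prod /= big_seq big1 // => y ys.
    by have [] := sepP a y (neq y ys).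
  rewrite eq_sym (negbTE (neq q' q's)) rmorph_prod /= (big_rem q') //=.
  by have [_ ->] := sepP a q' (neq q' q's); rewrite mul0r.
exists (p * sep q a) => q'; rewrite inE mevalM => /orP[/eqP ->|q's].
  have [|_ ->] := @sepP q a; first by rewrite eq_sym.
  by rewrite mulr0 (negbTE aq).
rewrite hp //; case: eqP => [->|_]; last by rewrite mul0r.
by have [|-> _] := @sepP q a; rewrite ?mulr1 // eq_sym.
Qed.

Theorem solution_count : exists s : seq {ffun 'I_r -> C},
  [/\ uniq s, size s = (\prod_(j < r) (j.+1 * rho j))%N & forall q, (q \in s) <-> solution q].
Proof.
have [s [us hs]] := solution_list; exists s; split=> //.
pose ms := @boxms r (level 0).
have -> : (\prod_(j < r) (j.+1 * rho j))%N = size ms.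
  by rewrite size_boxms; apply: eq_bigr => j _; rewrite levelS // addn0.
pose A := \matrix_(k < size ms, i < size s) ('X_[nth 0%MM ms k] : {mpoly C[r]}).@[nth [ffun=> 0] s i].
have evA p i : boxed (level 0) p ->
    p.@[nth [ffun=> 0] s i] = \sum_(k < size ms) p@_(nth 0%MM ms k) * ('X_[nth 0%MM ms k] : {mpoly C[r]}).@[nth [ffun=> 0] s i].
  move=> /boxed_expand e; rewrite {1}e raddf_sum; apply: eq_bigr => k _ /=.
  by rewrite mevalZ.
have free : row_free A.
  rewrite -kermx_eq0; apply/rowV0P => v; rewrite sub_kermx => /eqP vA.
  pose b : {mpoly C[r]} := \sum_(k < size ms) v 0 k *: 'X_[nth 0%MM ms k].
  have bc (k : 'I_(size ms)) : b@_(nth 0%MM ms k) = v 0 k.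
    rewrite /b raddf_sum (bigD1 k) //= mcoeffZ mcoeffX eqxx mulr1 big1 ?addr0 // => k' kk.
    by rewrite mcoeffZ mcoeffX nth_uniq ?uniq_boxms // val_eqE (negbTE kk) mulr0.
  have hb : boxed (level 0) b.
    apply: boxed_sum => k _; apply: boxedZ; apply: boxedX => j.
    have : nth 0%MM ms k \in ms by apply: mem_nth.
    by rewrite mem_boxms => /forallP.
  have b0 : b = 0.
    apply: (level0_idl rho_gt0 E_boxed hE hb); apply: vanishing_idl => q.
    move=> sq; have qs : [ffun j => q j] \in s.
      by apply/hs => k; rewrite -(sq k); apply: meval_eq => j; rewrite ffunE.
    rewrite (@meval_eq _ _ q [ffun j => q j]); last by move=> j; rewrite ffunE.
    have lt : (index [ffun j => q j] s < size s)%N by rewrite index_mem.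
    have := evA b (Ordinal lt) hb; rewrite /= nth_index // => ->.
    have := congr1 (fun x : 'rV_(size s) => x 0 (Ordinal lt)) vA; rewrite !mxE.
    by move=> e; rewrite -[RHS]e; apply: eq_bigr => k _; rewrite bc mxE /= nth_index.
  by apply/rowP => k; rewrite mxE -bc b0 mcoeff0.
have full : row_full A.
  have /fin_all_exists[p hp] (i : 'I_(size s)) := delta_poly (nth [ffun=> 0] s i) us.
  have /fin_all_exists2[b hb hi] i := reduce rho_gt0 hE (p i).
  apply/row_fullP; exists (\matrix_(i, k) (b i)@_(nth 0%MM ms k)).
  apply/matrixP => i i'; rewrite !mxE; have [a ia e] := hi i.
  have sol : solution (nth [ffun=> 0] s i') by apply/hs; apply: mem_nth.
  transitivity (b i).@[nth [ffun=> 0] s i'].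
    rewrite evA //; apply: eq_bigr => k _; by rewrite !mxE.
  have -> : b i = p i - a by rewrite e addrK.
  rewrite mevalB (idl_eval ia sol) subr0 hp ?mem_nth // nth_uniq //.
  by rewrite eq_sym.
by move: free full => /eqP e1 /eqP e2; apply: etrans (esym e2) e1.
Qed.

End CountingSolutions.


Section OpenConditions.
Local Open Scope ring_scope.
Variables (C : numClosedFieldType) (r : nat) (rho : 'I_r -> nat).
Hypothesis rho_gt0 : forall j, (0 < rho j)%N.
Variables (T : Type) (N : nat) (co : T -> 'I_N -> C).

Local Notation level := (level rho).

Lemma generation_open (k : nat) (G : 'I_k -> T -> {mpoly C[r]})
    (B : 'I_k -> 'I_r -> nat) (M : 'I_r -> nat) c0 :
  (forall i, polyfam co (G i)) ->
  (forall i c h, boxed (B i) h -> boxed M (G i c * h)) ->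
  (forall p, boxed M p -> exists2 h : 'I_k -> {mpoly C[r]},
     forall i, boxed (B i) (h i) & p = \sum_i G i c0 * h i) ->
  exists psi, [/\ polyfun co psi, psi c0 != 0 & forall c, psi c != 0 ->
    forall p, boxed M p -> exists2 h : 'I_k -> {mpoly C[r]},
      forall i, boxed (B i) (h i) & p = \sum_i G i c * h i].
Proof.
move=> hG hB hp; pose L := (\max_i size (@boxms r (B i)))%N.
have leL i : (size (@boxms r (B i)) <= L)%N by apply: leq_bigmax.
pose w (x : 'I_k * 'I_L) c : {mpoly C[r]} :=
  if (x.2 < size (@boxms r (B x.1)))%N
  then G x.1 c * 'X_[nth 0%MM (boxms (B x.1)) x.2] else 0.
have [||x c|p /boxedP/hp[h hB' ->]|psi [p1 p2 p3]] :=
  @spanning_open C T N co r (boxms M) ('I_k * 'I_L)%type w c0.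
- exact: uniq_boxms.
- move=> x; rewrite /w; case: (x.2 < _)%N; last exact: polyfam_const.
  by apply: polyfamM => //; apply: polyfam_const.
- apply/boxedP; rewrite /w; case: ifP => lt; last exact: boxed0.
  apply: hB; apply: boxedX => j; have := mem_nth 0%MM lt.
  by rewrite mem_boxms => /forallP.
- exists (fun x : 'I_k * 'I_L => (h x.1)@_(nth 0%MM (boxms (B x.1)) x.2)).
  rewrite -(pair_bigA _ (fun (i : 'I_k) (l : 'I_L) => (h i)@_(nth 0%MM (boxms (B i)) l) *: w (i, l) c0)) /=.
  apply: eq_bigr => i _; rewrite {1}(boxed_expand (hB' i)) mulr_sumr.
  pose F (l : nat) : {mpoly C[r]} := G i c0 * ((h i)@_(nth 0%MM (boxms (B i)) l) *:
     'X_[nth 0%MM (boxms (B i)) l]).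
  rewrite (big_ord_widen L F (leL i)) big_mkcond /=.
  apply: eq_bigr => l _; rewrite /w /=; case: ifP => _; last by rewrite scaler0.
  by rewrite /F scalerAr.
exists psi; split=> // c /p3 sp p /boxedP /sp [a ->].
exists (fun i => \sum_(l < L) a (i, l) *:
   (if (l < size (@boxms r (B i)))%N then 'X_[nth 0%MM (boxms (B i)) l] else 0)).
  move=> i; apply: boxed_sum => l _; apply: boxedZ; case: ifP => lt; last exact: boxed0.
  apply: boxedX => j; have := mem_nth 0%MM lt.
  by rewrite mem_boxms => /forallP.
rewrite (eq_bigr (fun x => a (x.1, x.2) *: w (x.1, x.2) c)); last by case.
rewrite -(pair_bigA _ (fun (i : 'I_k) (l : 'I_L) => a (i, l) *: w (i, l) c)) /=.
apply: eq_bigr => i _; rewrite mulr_sumr; apply: eq_bigr => l _.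
by rewrite /w /=; case: ifP => _; rewrite ?scaler0 ?mulr0 // scalerAr.
Qed.

Variable E : 'I_r -> T -> {mpoly C[r]}.
Hypothesis E_fam : forall k, polyfam co (E k).
Hypothesis E_boxed : forall k c, boxed rho (E k c).

Local Notation at_ c := (fun k => E k c).

Lemma sum_unlift (R : nmodType) (x : R) (f : 'I_r -> R) :
  \sum_(i < r.+1) (if unlift ord0 i is Some k then f k else x) = x + \sum_k f k.
Proof.
rewrite big_ord_recl unlift_none; congr (_ + _).
by apply: eq_bigr => k _; rewrite liftK.
Qed.

(** Both conditions below have the form: every polynomial of a box is a
    combination of one given polynomial and the equations. *)
Lemma combination_open (d : T -> {mpoly C[r]}) (N0 N1 M : 'I_r -> nat) c0 :
  polyfam co d ->
  (forall c h, boxed N0 h -> boxed M (d c * h)) ->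
  (forall k c h, boxed N1 h -> boxed M (E k c * h)) ->
  (forall p, boxed M p -> exists g0 (g : 'I_r -> {mpoly C[r]}), [/\ boxed N0 g0,
     forall k, boxed N1 (g k) & p = d c0 * g0 + \sum_k E k c0 * g k]) ->
  exists psi, [/\ polyfun co psi, psi c0 != 0 & forall c, psi c != 0 ->
    forall p, boxed M p -> exists g0 (g : 'I_r -> {mpoly C[r]}), [/\ boxed N0 g0,
     forall k, boxed N1 (g k) & p = d c * g0 + \sum_k E k c * g k]].
Proof.
move=> hd h0 h1 hp.
pose G (i : 'I_r.+1) c := if unlift ord0 i is Some k then E k c else d c.
pose B (i : 'I_r.+1) := if unlift ord0 i is Some _ then N1 else N0.
have [i|i c h|p /hp[g0 [g [b0 b ->]]]|psi [p1 p2 p3]] := @generation_open r.+1 G B M c0.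
- rewrite /G; case: unlift => [k|] //; exact: E_fam.
- by rewrite /G /B; case: unlift => [k|]; [exact: h1|exact: h0].
- exists (fun i => if unlift ord0 i is Some k then g k else g0).
    by move=> i; rewrite /B; case: unlift.
  rewrite -sum_unlift; apply: eq_bigr => i _.
  by rewrite /G; case: unlift.
exists psi; split=> // c /p3 h p /h [g bg ->].
exists (g ord0), (fun k => g (lift ord0 k)); split.
- by have := bg ord0; rewrite /B unlift_none.
- by move=> k; have := bg (lift ord0 k); rewrite /B liftK.
rewrite -sum_unlift; apply: eq_bigr => i _; rewrite /G.
by case: unliftP => [k|] ->.
Qed.

Lemma boxedE_level k c e h : boxed (level e) h -> boxed (level e.+1) (E k c * h).
Proof.
move=> hh; apply: boxedW (boxedM (@E_boxed k c) hh) => j.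
by rewrite -[e.+1]addn1 levelD // mul1n addnC.
Qed.

Lemma regular_open c0 : regular_system rho (at_ c0) ->
  exists psi, [/\ polyfun co psi, psi c0 != 0 &
    forall c, psi c != 0 -> regular_system rho (at_ c)].
Proof.
move=> h0.
have [||||psi [p1 p2 p3]] := @combination_open (fun=> 1) (level 0) (level 0) (level 1) c0.
- exact: polyfam_const.
- by move=> c h hh; rewrite mul1r; apply: boxedW hh => j; apply: levelW.
- by move=> k c h; apply: boxedE_level.
- by move=> p /h0[g0 [g [b0 b ->]]]; exists g0, g; rewrite mul1r; split.
exists psi; split=> // c /p3 h p /h [g0 [g [b0 b ->]]].
by exists g0, g; rewrite mul1r; split.
Qed.

(** If a polynomial has no zero among the solutions of the system at one
    parameter, then the same holds for all parameters in a nonempty open set. *)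
Lemma nonvanishing_open (d : T -> {mpoly C[r]}) c0 :
  polyfam co d -> regular_system rho (at_ c0) ->
  (forall q, solution (at_ c0) q -> (d c0).@[q] != 0) ->
  exists psi, [/\ polyfun co psi, psi c0 != 0 & forall c, psi c != 0 ->
    forall q, solution (at_ c) q -> (d c).@[q] != 0].
Proof.
move=> hd reg hq.
have [i [A [[B ->] e1]]] := unit_modulo rho_gt0 reg hq.
have [K hK] : exists K, forall c, boxed (fun=> K) (d c).
  have [K hK] := polyfam_bounded hd; exists K => c m /hK /ltnW h j.
  by apply: leq_trans h; rewrite mdegE (bigD1 j) //= leq_addr.
have [KA hA] := boxed_bound A.
have /fin_all_exists[KB hB] k := boxed_bound (B k).
pose e := (K + KA + \sum_k KB k)%N.
have [|||psi [p1 p2 p3]] := @combination_open d (fun j => KA + level 0 j)%N (level e)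
   (level e.+1) c0 hd.
- move=> c h hh; apply: boxedW (boxedM (hK c) hh) => j.
  by rewrite -[e.+1]add0n levelD // /e; have := rho_gt0 j; clear; nia.
- by move=> k c h; apply: boxedE_level.
- move=> p hp; have [b [g [hb hg ->]]] := regular_level rho_gt0 reg hp.
  exists (A * b), (fun k => B k * b + g k); split.
  + exact: boxedM.
  + move=> k; apply: boxedD => //; apply: boxedW (boxedM (hB k) hb) => j.
    rewrite -[e]add0n levelD // /e (bigD1 k) //=; have := rho_gt0 j; clear; nia.
  rewrite -[b in LHS]mul1r e1 mulrDl mulr_suml addrAC -mulrA addrC; congr (_ + _).
  by rewrite -big_split; apply: eq_bigr => k _; rewrite /= mulrDr mulrA.
exists psi; split=> // c /p3 h q sq; have [|g0 [g [_ _ e2]]] := h 1; first exact: boxed1.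
apply/eqP => dq; have := congr1 (meval q) e2.
rewrite meval1 mevalD mevalM dq mul0r add0r raddf_sum big1 => [/eqP|k _ /=].
  by rewrite oner_eq0.
by rewrite mevalM sq mul0r.
Qed.

End OpenConditions.

Section PointsAtInfinity.
Local Open Scope ring_scope.
Variables (C : numClosedFieldType) (r : nat).
Variables (mu nu : 'I_r -> C).

(** Evaluation at a point of a product of projective lines, after
    homogenization of each variable to the degree prescribed by the box. *)
Definition heval (M : 'I_r -> nat) (p : {mpoly C[r]}) : C :=
  \sum_(m <- boxms M) p@_m * \prod_j (nu j ^+ m j * mu j ^+ (M j - m j)).

Lemma hevalD M p q : heval M (p + q) = heval M p + heval M q.
Proof. by rewrite -big_split; apply: eq_bigr => m _; rewrite mcoeffD mulrDl. Qed.

Lemma hevalZ M a p : heval M (a *: p) = a * heval M p.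
Proof. by rewrite mulr_sumr; apply: eq_bigr => m _; rewrite mcoeffZ mulrA. Qed.

Lemma heval0 M : heval M 0 = 0.
Proof. by rewrite /heval big1 // => m _; rewrite mcoeff0 mul0r. Qed.

Lemma heval_sum M (I : Type) (s : seq I) f :
  heval M (\sum_(i <- s) f i) = \sum_(i <- s) heval M (f i).
Proof.
elim: s => [|i s IH]; first by rewrite !big_nil heval0.
by rewrite !big_cons hevalD IH.
Qed.

Lemma hevalX M (m : 'X_{1..r}) : (forall j, m j <= M j)%N ->
  heval M 'X_[m] = \prod_j (nu j ^+ m j * mu j ^+ (M j - m j)).
Proof.
move=> h; have mM : m \in boxms M by rewrite mem_boxms; apply/forallP.
rewrite /heval (big_rem m) //= mcoeffX eqxx mul1r [X in _ + X = _]big_seq.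
rewrite [X in _ + X = _]big1 ?addr0 // => m'.
rewrite mem_rem_uniq ?uniq_boxms // inE => /andP[nm _].
by rewrite mcoeffX eq_sym (negbTE nm) mul0r.
Qed.

Lemma eq_heval M M' p : M =1 M' -> heval M p = heval M' p.
Proof.
move=> e; rewrite /heval (perm_big (boxms M')).
  by apply: eq_bigr => m _; congr (_ * _); apply: eq_bigr => j _; rewrite e.
apply: uniq_perm; rewrite ?uniq_boxms // => m; rewrite !mem_boxms.
by apply: eq_forallb => j; rewrite e.
Qed.

Lemma hevalM M M' p q : boxed M p -> boxed M' q ->
  heval (fun j => M j + M' j)%N (p * q) = heval M p * heval M' q.
Proof.
move=> hp hq; pose h := heval (fun j => M j + M' j)%N.
move: p hp; apply: (@boxed_ind _ _ M (fun p => h (p * q) = heval M p * heval M' q)).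
- by rewrite mul0r /h !heval0 mul0r.
- by move=> p1 p2 e1 e2; rewrite mulrDl /h !hevalD -!/h e1 e2 mulrDl.
- by move=> a p e; rewrite -scalerAl /h !hevalZ -!/h e mulrA.
move=> m hm; move: q hq.
apply: (@boxed_ind _ _ M' (fun q => h ('X_[m] * q) = heval M 'X_[m] * heval M' q)).
- by rewrite mulr0 /h !heval0 mulr0.
- by move=> p1 p2 e1 e2; rewrite mulrDr /h !hevalD -!/h e1 e2 mulrDr.
- by move=> a p e; rewrite -scalerAr /h !hevalZ -!/h e mulrCA.
move=> m' hm'; rewrite -mpolyXD /h !hevalX // => [|j]; last first.
  by rewrite mnmDE leq_add.
rewrite -big_split; apply: eq_bigr => j _ /=; rewrite mnmDE exprD.
have -> : (M j + M' j - (m j + m' j) = (M j - m j) + (M' j - m' j))%N.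
  by have := hm j; have := hm' j; clear; lia.
by rewrite exprD; ring.
Qed.

Lemma no_solution_at_infinity (rho : 'I_r -> nat) (E : 'I_r -> {mpoly C[r]}) :
  (forall j, 0 < rho j)%N -> (forall k, boxed rho (E k)) -> regular_system rho E ->
  (forall j, (mu j != 0) || (nu j != 0)) -> (forall k, heval rho (E k) = 0) ->
  forall j, mu j != 0.
Proof.
move=> rho_gt0 hE reg munu hv j0; apply/eqP => mu0.
have v0 p : boxed (level rho 1) p -> heval (level rho 1) p = 0.
  move=> /reg[g0 [g [b0 b ->]]]; rewrite hevalD heval_sum big1 => [|k _]; last first.
    rewrite (@eq_heval _ (fun j => rho j + level rho 0 j)%N); last first.
      by move=> j; rewrite -[1%N in LHS]add0n levelD // mul1n addnC.
    by rewrite hevalM // hv mul0r.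
  rewrite addr0 -[g0]mulr1 (@eq_heval _ (fun j => level rho 0 j + rho j)%N); last first.
    by move=> j; rewrite -[1%N in LHS]add0n levelD // mul1n.
  rewrite hevalM //; last exact: boxed1.
  rewrite -mpolyX0 hevalX => [|j]; last by rewrite mnm0E.
  rewrite (bigD1 j0) //= mu0 mnm0E subn0 expr0n.
  by rewrite gtn_eqF ?rho_gt0 // mulr0 mul0r mulr0.
pose m := [multinom if (mu j == 0)%R then level rho 1 j else 0%N | j < r].
have hm j : (m j <= level rho 1 j)%N by rewrite mnmE; case: ifP.
have := v0 _ (boxedX hm); rewrite hevalX // => /eqP.
apply/negP; apply/prodf_neq0 => j _; rewrite mnmE.
have := munu j; case: eqP => /= [-> nj|/eqP mj _].
  by rewrite subnn mulr1 expf_neq0.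
by rewrite mul1r expf_neq0.
Qed.

End PointsAtInfinity.


Lemma function_choice (A B : Type) (P : A -> B -> Prop) :
  (forall a, exists b, P a b) -> exists f, forall a, P a (f a).
Proof.
move=> h; exists (fun a => proj1_sig (constructive_indefinite_description _ (h a))).
by move=> a; case: constructive_indefinite_description.
Qed.

Section SpecialSystem.
Local Open Scope ring_scope.
Variable C : numClosedFieldType.

(** The affine equation of a point of the projective line, the point at
    infinity having the equation 1. *)
Definition ptpoly (a : option C) : {poly C} := if a is Some x then 'X - x%:P else 1.

Lemma size_prod_ptpoly (A : seq (option C)) (P : pred (option C)) rho :
  (size (\prod_(b <- A | P b) ptpoly b ^+ rho)%R <= (count P A * rho).+1)%N.
Proof.
elim: A => [|b A IH]; first by rewrite big_nil size_poly1.
rewrite big_cons /=; case: (P b); rewrite ?add0n //.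
apply: leq_trans (size_polyMleq _ _) _.
have : (size (ptpoly b ^+ rho) <= rho.+1)%N.
  case: b => [x|] /=; first by rewrite size_exp_XsubC.
  by rewrite expr1n size_poly1.
have ar a c x : (a <= rho.+1 -> c <= x.+1 -> (a + c).-1 <= (rho + x).+1)%N by lia.
by rewrite -[nat_of_bool true]/1%N mulnDl mul1n => h; apply: ar.
Qed.

(** Partial fractions for the projective line. *)
Lemma partial_fractions (A : seq (option C)) rho (g : {poly C}) : uniq A ->
  (size g <= size A * rho)%N ->
  exists2 h : option C -> {poly C}, forall a, (size (h a) <= rho)%N &
    g = \sum_(a <- A) h a * \prod_(b <- A | b != a) ptpoly b ^+ rho.
Proof.
elim: A g => [|b A IH] g /=.
  move=> _; rewrite mul0n leqn0 size_poly_eq0 => /eqP ->.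
  by exists (fun=> 0) => [a|]; rewrite ?size_poly0 // big_nil.
move=> /andP[bA uA] sg; pose P := \prod_(a <- A) ptpoly a ^+ rho.
suff [gb [g' [sb sg' eg]]] : exists gb g' : {poly C}, [/\ (size gb <= rho)%N,
    (size g' <= size A * rho)%N & g = gb * P + ptpoly b ^+ rho * g'].
  have [h sh eh] := IH _ uA sg'.
  exists (fun a => if a == b then gb else h a) => [a|]; first by case: ifP.
  rewrite big_cons eqxx big_cons eqxx /= eg; congr (_ * _ + _).
    rewrite /P big_seq_cond [RHS]big_seq_cond; apply: eq_bigl => a.
    by case aA: (a \in A) => //=; case: (a =P b) => // e; move: bA; rewrite -e aA.
  rewrite eh mulr_sumr big_seq [RHS]big_seq; apply: eq_bigr => a aA.
  have ab : b != a by apply: contraNneq bA => ->.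
  by rewrite (negbTE (_ : a != b)) 1?eq_sym // big_cons ab mulrCA.
have sP : (size P <= (size A * rho).+1)%N.
  by have := size_prod_ptpoly A xpredT rho; rewrite count_predT.
case: b bA sg => [x|] bA sg /=; last first.
  have mP : P \is monic.
    rewrite /P big_seq; apply: monic_prod => -[y _|]; last by rewrite (negbTE bA).
    by apply: monic_exp; apply: monicXsubC.
  have sPe : size P = (size A * rho).+1.
    rewrite /P; elim: (A) bA => [|[y|] B IHB] //=.
      by rewrite big_nil size_poly1.
    rewrite inE /= => yB; rewrite big_cons /= size_monicM ?size_exp_XsubC ?IHB //.
    - by rewrite mulSn addnS.
    - by apply: monic_exp; apply: monicXsubC.
    rewrite -size_poly_eq0 IHB //.
  exists (g %/ P), (g %% P); rewrite expr1n mul1r -divp_eq; split=> //.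
    by rewrite size_divp ?monic_neq0 // sPe /= leq_subLR addnC -mulSn.
  by rewrite -ltnS -sPe ltn_modp monic_neq0.
have cop : coprimep (('X - x%:P) ^+ rho) P.
  rewrite /P big_seq; apply: (big_ind (coprimep _)) => [|p q cp cq|a aA].
  - by rewrite coprimep1.
  - by rewrite coprimepMr cp cq.
  apply: coprimep_expl; apply: coprimep_expr; case: a aA => [y yA|_] /=; last by rewrite coprimep1.
  rewrite coprimep_XsubC2 // subr_eq0; apply: contraNneq bA => e.
  by rewrite -?e // e.
have /Bezout_eq1_coprimepP[[u v] /= uv] := cop.
set H := ('X - x%:P) ^+ rho in uv *.
have H0 : H != 0 by rewrite expf_neq0 // polyXsubC_eq0.
have sH : size H = rho.+1 by rewrite size_exp_XsubC.
pose g' := g * u + (g * v) %/ H * P.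
have eg : g = (g * v) %% H * P + H * g'.
  rewrite /g' -{1}[g]mulr1 -uv; have e := divp_eq (g * v) H.
  have -> : g * (u * H + v * P) = g * u * H + (g * v) * P by ring.
  rewrite {1}e; ring.
have sm : (size ((g * v) %% H)%R <= rho)%N by rewrite -ltnS -sH ltn_modp.
exists ((g * v) %% H), g'; split=> //.
have [->|g'0] := eqVneq g' 0; first by rewrite size_poly0.
have : (size (H * g')%R <= (size A).+1 * rho)%N.
  have -> : H * g' = g - (g * v) %% H * P by rewrite {1}eg addrC addKr.
  apply: leq_trans (size_polyD _ _) _; rewrite geq_max sg size_polyN.
  apply: leq_trans (size_polyMleq _ _) _.
  have ar a c y : (a <= rho -> c <= y.+1 -> (a + c).-1 <= rho + y)%N by clear; lia.
  by rewrite mulSn; apply: ar.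
rewrite size_mul // sH mulSn /= => h.
by rewrite -(leq_add2l rho).
Qed.

Variables (r : nat) (rho : 'I_r -> nat).
Hypothesis rho_gt0 : forall j, (0 < rho j)%N.

Definition ptmpoly (a : option C) (j : 'I_r) : {mpoly C[r]} := upoly j (ptpoly a).

Lemma ptmpolyE a j : ptmpoly a j = if a is Some x then 'X_j - x%:MP else 1.
Proof.
rewrite /ptmpoly /upoly; case: a => [x|] /=; last by rewrite rmorph1 hornerC.
by rewrite rmorphB /= map_polyX map_polyC hornerXsubC.
Qed.

Definition ptprod i a : {mpoly C[r]} := \prod_(j < r | (j < i)%N) ptmpoly a j ^+ rho j.

Definition lowbox i e (j : 'I_r) : nat := if (j < i)%N then level rho e j else 0.

Lemma upoly_boxed (i : 'I_r) (u : {poly C}) K : (size u <= K.+1)%N ->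
  boxed (fun j => if j == i then K else 0%N) (upoly i u).
Proof.
move=> su; have e : upoly i u = \sum_(l < size u) u`_l *: 'X_[U_(i) *+ l].
  rewrite /upoly horner_coef size_map_inj_poly ?rmorph0 //; last first.
    by move=> x y /eqP; rewrite mpolyC_eq => /eqP.
  by apply: eq_bigr => l _; rewrite coef_map mul_mpolyC mpolyXn.
rewrite e; apply: boxed_sum => l _; apply: boxedZ; apply: boxedX => j.
rewrite mulmnE mnm1E eq_sym; case: eqP => _; rewrite ?mul1n ?mul0n //.
by rewrite -ltnS (leq_trans (ltn_ord l)).
Qed.

Lemma upolyM (i : 'I_r) (u v : {poly C}) : upoly i (u * v) = upoly i u * upoly i v.
Proof. by rewrite /upoly rmorphM hornerM. Qed.

Lemma upolyXn (i : 'I_r) (u : {poly C}) k : upoly i (u ^+ k) = upoly i u ^+ k.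
Proof. by rewrite /upoly rmorphXn horner_exp. Qed.

Lemma upoly_sum (I : Type) (s : seq I) (P : pred I) (f : I -> {poly C}) (i : 'I_r) :
  upoly i (\sum_(k <- s | P k) f k) = \sum_(k <- s | P k) upoly i (f k).
Proof. by rewrite /upoly rmorph_sum horner_sum. Qed.

Lemma ptprodS (i : 'I_r) a : ptprod i.+1 a = ptmpoly a i ^+ rho i * ptprod i a.
Proof.
rewrite /ptprod (bigD1 i) //=; congr (_ * _); apply: eq_bigl => j.
by rewrite ltnS ltn_neqAle andbC.
Qed.

(** Distributing partial fractions in the last variable over the decompositions
    obtained, by induction, for the points different from a given one. *)
Lemma special_generation i (A : seq (option C)) (p : {mpoly C[r]}) : (i <= r)%N ->
  uniq A -> size A = i.+1 -> boxed (lowbox i 1) p ->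
  exists2 g : option C -> {mpoly C[r]},
    forall a, boxed (lowbox i 0) (g a) & p = \sum_(a <- A) ptprod i a * g a.
Proof.
elim: i A p => [|i IH] A p ir uA sA.
  case: A uA sA => [|a []] // _ _ hp; exists (fun=> p); last first.
    by rewrite big_seq1 /ptprod big_pred0 ?mul1r.
  by move=> _; apply: boxedW hp.
pose oi := Ordinal ir.
pose Q p := exists2 g : option C -> {mpoly C[r]},
  forall a, boxed (lowbox i.+1 0) (g a) & p = \sum_(a <- A) ptprod i.+1 a * g a.
have Q0 : Q 0.
  exists (fun=> 0) => [a|]; first exact: boxed0.
  by rewrite big1 // => a _; rewrite mulr0.
have QD p1 p2 : Q p1 -> Q p2 -> Q (p1 + p2).
  move=> [g1 h1 ->] [g2 h2 ->]; exists (fun a => g1 a + g2 a) => [a|].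
    exact: boxedD.
  by rewrite -big_split; apply: eq_bigr => a _; rewrite mulrDr.
have QZ c p1 : Q p1 -> Q (c *: p1).
  move=> [g1 h1 ->]; exists (fun a => c *: g1 a) => [a|]; first exact: boxedZ.
  by rewrite scaler_sumr; apply: eq_bigr => a _; rewrite scalerAr.
move: p; apply: (boxed_ind Q0 QD QZ) => m hm.
have [h sh eh] : exists2 h : option C -> {poly C}, forall a, (size (h a) <= rho oi)%N &
    'X^(m oi) = \sum_(a <- A) h a * \prod_(b <- A | b != a) ptpoly b ^+ rho oi.
  apply: partial_fractions => //; rewrite size_polyXn sA.
  have := hm oi; rewrite /lowbox /= ltnSn -ltnS levelS // addn1; exact.
pose m' : 'X_{1..r} := [multinom if j == oi then 0%N else m j | j < r].
have em : 'X_[m] = upoly oi 'X^(m oi) * 'X_[m'] :> {mpoly C[r]}.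
  rewrite upolyXn {1}/upoly map_polyX hornerX mpolyXn -mpolyXD; congr 'X_[_].
  apply/mnmP => j; rewrite mnmDE mulmnE mnm1E mnmE eq_sym.
  by case: eqP => [->|_]; rewrite ?mul1n ?addn0.
have hm' : boxed (lowbox i 1) ('X_[m'] : {mpoly C[r]}).
  apply: boxedX => j; rewrite mnmE; case: eqP => // /eqP ji.
  have := hm j; rewrite /lowbox ltnS [(j <= i)%N]leq_eqVlt.
  by case: eqP => //= e; case/eqP: ji; apply: val_inj.
have cnt a B : uniq B -> a \in B -> size B = (size [seq b : option C <- B | b != a]).+1.
  move=> uB aB; rewrite size_filter -(count_predC (pred1 a)).
  by rewrite count_uniq_mem // aB add1n.
have cntA a : a \in A -> size [seq b <- A | b != a] = i.+1.
  by move=> aA; have := cnt a A uA aA; rewrite sA => -[].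
have /function_choice[G hG] (a : option C) : exists g : option C -> {mpoly C[r]},
    a \in A -> (forall b, boxed (lowbox i 0) (g b)) /\
    'X_[m'] = \sum_(b <- A | b != a) ptprod i b * g b.
  have [aA|_] := boolP (a \in A); last by exists (fun=> 0).
  have [g hg eg] := IH [seq b <- A | b != a] 'X_[m'] (ltnW ir)
    (filter_uniq _ uA) (cntA a aA) hm'.
  by exists g => _; split=> //; rewrite {1}eg big_filter.
pose R a b : {mpoly C[r]} := upoly oi (h a *
  \prod_(c <- A | (c != b) && (c != a)) ptpoly c ^+ rho oi) * G a b.
exists (fun b => if b \in A then \sum_(a <- A | (a \in A) && (b != a)) R a b else 0).
  move=> b; case: ifP => bA; last exact: boxed0.
  apply: boxed_sum => a /andP[aA ab]; have [hG1 _] := hG a aA.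
  have cab : count (fun c => (c != b) && (c != a)) A = i.
    rewrite -size_filter filter_predI; apply: succn_inj.
    by rewrite -cnt ?filter_uniq ?mem_filter ?ab // cntA.
  pose u := h a * \prod_(c <- A | (c != b) && (c != a)) ptpoly c ^+ rho oi.
  have su : (size u <= (level rho 0 oi).+1)%N.
    apply: leq_trans (size_polyMleq _ _) _; rewrite levelS // addn0.
    have := size_prod_ptpoly A (fun c => (c != b) && (c != a)) (rho oi); rewrite cab.
    have ar x y z w : (x <= z -> y <= w.+1 -> (x + y).-1 <= z + w)%N by clear; lia.
    by rewrite mulSn; apply: ar.
  apply: boxedW (boxedM (upoly_boxed (i := oi) su) (hG1 b)) => j.
  rewrite /lowbox; case: eqP => [->|/eqP ji]; first by rewrite ltnn ltnSn addn0.
  rewrite add0n ltnS [(j <= i)%N]leq_eqVlt; case: eqP => [e|] //.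
  by case/eqP: ji; apply: val_inj.
rewrite em eh upoly_sum mulr_suml.
transitivity (\sum_(a <- A) \sum_(b <- A | (a \in A) && (b != a)) ptprod i.+1 b * R a b).
  rewrite big_seq [RHS]big_seq; apply: eq_bigr => a aA; have [_ ->] := hG a aA.
  rewrite aA mulr_sumr big_seq_cond [RHS]big_seq_cond; apply: eq_bigr => b /andP[bA ba].
  rewrite (_ : i.+1 = oi.+1) // ptprodS /R !upolyM.
  rewrite -big_filter (bigD1_seq b) ?filter_uniq ?mem_filter ?ba //= big_filter_cond.
  rewrite upolyM upolyXn -/(ptmpoly b oi).
  rewrite (eq_bigl (fun c => (c != b) && (c != a))); last by move=> c; rewrite andbC.
  ring.
rewrite (exchange_big_dep xpredT) //= big_seq [RHS]big_seq; apply: eq_bigr => b bA.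
by rewrite bA mulr_sumr.
Qed.

(** At points of the line, the system of all permutations: the box of level
    one is generated in the way required of a regular system. *)
Lemma special_regular (a k : 'I_r -> C) (E : 'I_r -> {mpoly C[r]}) : injective a ->
  (forall i, k i != 0) ->
  (forall i, E i = k i *: \prod_j ('X_j - (a i)%:MP) ^+ rho j) ->
  regular_system rho E.
Proof.
move=> inj k0 hE p hp; pose A := None :: [seq Some (a i) | i <- enum 'I_r].
have lb e : level rho e =1 lowbox r e by move=> j; rewrite /lowbox ltn_ord.
have [||||g hg ->] := @special_generation r A p.
- by [].
- rewrite /= map_inj_uniq ?enum_uniq ?andbT; last by move=> i j [] /inj.
  by apply/mapP => -[].
- by rewrite /= size_map size_enum_ord.
- by apply: boxedW hp => j; rewrite lb.
exists (g None), (fun i => (k i)^-1 *: g (Some (a i))); split.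
- by apply: boxedW (hg None) => j; rewrite lb.
- by move=> i; apply: boxedZ; apply: boxedW (hg _) => j; rewrite lb.
rewrite big_cons /ptprod big1 ?mul1r => [|j _]; last by rewrite ptmpolyE expr1n.
congr (_ + _); rewrite big_map big_enum; apply: eq_bigr => i _.
rewrite hE -scalerAl -scalerAr scalerA mulfV // scale1r; congr (_ * _).
by apply: eq_big => [j|j _]; rewrite ?ltn_ord // ptmpolyE.
Qed.

Lemma special_solution (a k : 'I_r -> C) (E : 'I_r -> {mpoly C[r]}) q : injective a ->
  (forall i, k i != 0) ->
  (forall i, E i = k i *: \prod_j ('X_j - (a i)%:MP) ^+ rho j) ->
  solution E q -> exists s : 'S_r, forall j, q j = a (s j).
Proof.
move=> inj k0 hE sq.
have /fin_all_exists[f hf] i : exists j, q j = a i.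
  have /eqP := sq i; rewrite hE mevalZ mulf_eq0 (negbTE (k0 i)) /= rmorph_prod /=.
  move=> /prodf_eq0[j _]; rewrite rmorphXn expf_eq0 => /andP[_] /=.
  by rewrite mevalB mevalXU mevalC subr_eq0 => /eqP; exists j.
have fi : injective f by move=> i i' e; apply: inj; rewrite -!hf e.
exists (perm fi)^-1%g => j.
by rewrite -{1}[j](permKV (perm fi)) permE hf.
Qed.


End SpecialSystem.


Section LinearForms.
Local Open Scope ring_scope.
Variable C : numClosedFieldType.
Implicit Types (l m b x : 'rV[C]_3) (F G : {mpoly C[3]}).

Lemma mpoly_ring_ind n (Q : {mpoly C[n]} -> Prop) :
  (forall c, Q c%:MP) -> (forall i, Q 'X_i) ->
  (forall p q, Q p -> Q q -> Q (p + q)) ->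
  (forall p q, Q p -> Q q -> Q (p * q)) -> forall p, Q p.
Proof.
move=> QC QX QD QM p; rewrite [p]mpolyE; apply: (big_ind Q).
- by rewrite -mpolyC0; apply: QC.
- exact: QD.
move=> m _; rewrite -mul_mpolyC; apply: (QM); first exact: QC.
rewrite mpolyXE_id; apply: (big_ind Q).
- by rewrite -mpolyC1; apply: QC.
- exact: QM.
move=> i _; elim: (m i) => [|k IH]; first by rewrite expr0 -mpolyC1; apply: QC.
by rewrite exprS; apply: (QM).
Qed.

Definition dot l x : C := \sum_j l 0 j * x 0 j.
Definition lin l : {mpoly C[3]} := \sum_j l 0 j *: 'X_j.

Lemma lin_eval l (v : 'I_3 -> C) : (lin l).@[v] = \sum_j l 0 j * v j.
Proof. by rewrite raddf_sum; apply: eq_bigr => j _; rewrite /= mevalZ mevalXU. Qed.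

Lemma lin_dot l x : (lin l).@[x 0] = dot l x.
Proof. exact: lin_eval. Qed.

Lemma lin_homog l : lin l \is 1.-homog.
Proof.
by apply: rpred_sum => j _; apply: rpredZ; rewrite dhomogX /= mdeg1.
Qed.

Lemma lin_coef l j : (lin l)@_U_(j) = l 0 j.
Proof.
rewrite raddf_sum (bigD1 j) //= mcoeffZ mcoeffXU eqxx mulr1 big1 ?addr0 // => i ij.
by rewrite mcoeffZ mcoeffXU (negbTE ij) mulr0.
Qed.

Lemma lin_eq0 l : (lin l == 0) = (l == 0).
Proof.
apply/eqP/eqP => [e|->]; last by rewrite /lin big1 // => j _; rewrite mxE scale0r.
by apply/rowP => j; rewrite -lin_coef e mcoeff0 mxE.
Qed.

Lemma linD l m : lin (l + m) = lin l + lin m.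
Proof. by rewrite -big_split; apply: eq_bigr => j _; rewrite mxE scalerDl. Qed.

Lemma linZ c l : lin (c *: l) = c *: lin l.
Proof. by rewrite scaler_sumr; apply: eq_bigr => j _; rewrite mxE scalerA. Qed.

Lemma dotC l x : dot l x = dot x l.
Proof. by apply: eq_bigr => j _; rewrite mulrC. Qed.

Lemma dotE l x : dot l x = (l *m x^T) 0 0.
Proof. by rewrite mxE; apply: eq_bigr => j _; rewrite mxE. Qed.

Lemma dotDr l x y : dot l (x + y) = dot l x + dot l y.
Proof. by rewrite -big_split; apply: eq_bigr => j _; rewrite mxE mulrDr. Qed.

Lemma dotZr l c x : dot l (c *: x) = c * dot l x.
Proof. by rewrite mulr_sumr; apply: eq_bigr => j _; rewrite mxE mulrCA. Qed.

Lemma dotDl l m x : dot (l + m) x = dot l x + dot m x.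
Proof. by rewrite dotC dotDr !(dotC x). Qed.

Lemma dotZl l c x : dot (c *: l) x = c * dot l x.
Proof. by rewrite dotC dotZr dotC. Qed.

(** Substitutions that agree modulo m give polynomials that agree modulo m. *)
Lemma subst_congr (m : {mpoly C[3]}) (h h' : 'I_3 -> {mpoly C[3]}) F :
  (forall j, exists g, h j = h' j + m * g) ->
  exists G, mmap (@mpolyC 3 C) h F = mmap (@mpolyC 3 C) h' F + m * G.
Proof.
move=> hh; move: F; apply: mpoly_ring_ind => [c|j|p q [g eg] [g' eg']|p q [g eg] [g' eg']].
- by exists 0; rewrite !mmapC mulr0 addr0.
- by have [g eg] := hh j; exists g; rewrite !mmapX !mmap1U.
- by exists (g + g'); rewrite !mmapD eg eg'; ring.
exists (g * mmap (@mpolyC 3 C) h' q + mmap (@mpolyC 3 C) h' p * g' + m * g * g').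
by rewrite !rmorphM /= eg eg'; ring.
Qed.

Lemma subst_id F : mmap (@mpolyC 3 C) (fun j => 'X_j) F = F.
Proof.
move: F; apply: mpoly_ring_ind => [c|j|p q|p q].
- by rewrite mmapC.
- by rewrite mmapX mmap1U.
- by rewrite mmapD => -> ->.
- by rewrite rmorphM /= => -> ->.
Qed.

Lemma subst_eval (h : 'I_3 -> {mpoly C[3]}) F v :
  (mmap (@mpolyC 3 C) h F).@[v] = F.@[fun j => (h j).@[v]].
Proof.
move: F; apply: mpoly_ring_ind => [c|j|p q|p q].
- by rewrite mmapC !mevalC.
- by rewrite mmapX mmap1U mevalXU.
- by rewrite mmapD !mevalD => -> ->.
- by rewrite rmorphM /= !mevalM => -> ->.
Qed.

(** A frame: three independent linear forms, the rows of M, with the dual basis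
    of vectors, the rows of the inverse transpose. *)
Definition dualmx (M : 'M[C]_3) := (invmx M)^T.

Lemma dot_dual (M : 'M[C]_3) i j : M \in unitmx ->
  dot (row i M) (row j (dualmx M)) = (i == j)%:R.
Proof.
move=> uM; rewrite dotE -row_mul.
have := congr1 (fun A : 'M_3 => A i j) (mulmxV uM); rewrite !mxE => <-.
by apply: eq_bigr => k _; rewrite !mxE.
Qed.

Lemma frame_expand (M : 'M[C]_3) x : M \in unitmx ->
  x = \sum_i dot (row i M) x *: row i (dualmx M).
Proof.
move=> uM; apply/rowP => j; rewrite summxE.
have e := congr1 (fun y : 'cV_3 => y j 0) (mulmxA (invmx M) M x^T).
rewrite mulVmx // mul1mx [in RHS]mxE mxE in e.
rewrite -e; apply: eq_bigr => i _; rewrite dotE !mxE mulrC; congr (_ * _).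
by apply: eq_bigr => k _; rewrite !mxE.
Qed.

Lemma frame_linE (M : 'M[C]_3) j : M \in unitmx ->
  'X_j = \sum_i (dualmx M) i j *: lin (row i M) :> {mpoly C[3]}.
Proof.
move=> uM; transitivity (\sum_k ((invmx M *m M) j k) *: 'X_k : {mpoly C[3]}).
  rewrite mulVmx // (bigD1 j) //= mxE eqxx scale1r big1 ?addr0 // => k.
  by rewrite mxE eq_sym => /negbTE ->; rewrite scale0r.
under eq_bigr do rewrite mxE scaler_suml.
rewrite exchange_big; apply: eq_bigr => i _; rewrite scaler_sumr.
by apply: eq_bigr => k _; rewrite !mxE scalerA.
Qed.

Lemma mpoly_ext_off_plane F G l : l != 0 ->
  (forall x, dot l x != 0 -> F.@[x 0] = G.@[x 0]) -> F = G.
Proof.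
move=> l0 h; apply/eqP; rewrite -subr_eq0; apply/eqP.
have : lin l * (F - G) = 0.
  apply: mpoly_eq0_eval => v; rewrite mevalM mevalB.
  pose x : 'rV[C]_3 := \row_j v j.
  have ev P : P.@[v] = P.@[x 0] by apply: meval_eq => j; rewrite mxE.
  rewrite !ev lin_dot; have [->|/h ->] := eqVneq (dot l x) 0; first by rewrite mul0r.
  by rewrite subrr mulr0.
by move/eqP; rewrite mulf_eq0 lin_eq0 (negbTE l0) => /eqP.
Qed.

(** The plane l = 0 is a retract of the space, so divisibility by l is the
    vanishing of a ring morphism; in particular l is prime. *)
Lemma plane_retraction l : l != 0 -> exists h : 'I_3 -> {mpoly C[3]},
  [/\ forall F, exists G, F = mmap (@mpolyC 3 C) h F + lin l * G,
      mmap (@mpolyC 3 C) h (lin l) = 0 &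
      forall v, \sum_j l 0 j * (h j).@[v] = 0].
Proof.
move=> l0; have [i li] : exists i, l 0 i != 0 by apply/rV0Pn.
pose n : 'I_3 -> C := fun j => if j == i then (l 0 i)^-1 else 0.
have ln : \sum_j l 0 j * n j = 1.
  rewrite (bigD1 i) //= /n eqxx mulfV // big1 ?addr0 // => j /negbTE ->.
  by rewrite mulr0.
pose h j : {mpoly C[3]} := 'X_j - n j *: lin l.
have hv v : \sum_j l 0 j * (h j).@[v] = 0.
  under eq_bigr => j _ do rewrite mevalB mevalXU mevalZ lin_eval mulrBr mulrA.
  by rewrite sumrB -mulr_suml ln mul1r subrr.
exists h; split=> // [F|].
  have [G eG] : exists G, mmap (@mpolyC 3 C) (fun j => 'X_j) F
      = mmap (@mpolyC 3 C) h F + lin l * G.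
    apply: subst_congr => j; exists (n j)%:MP.
    by rewrite /h -mul_mpolyC mulrC subrK.
  by exists G; rewrite -eG subst_id.
by apply: mpoly_eq0_eval => v; rewrite subst_eval lin_eval.
Qed.

Lemma linear_divides F l : l != 0 ->
  (forall x, dot l x = 0 -> F.@[x 0] = 0) -> exists G, F = lin l * G.
Proof.
move=> l0 hF; have [h [hG _ hv]] := plane_retraction l0.
have [G eG] := hG F; exists G; rewrite {1}eG [X in X + _](_ : _ = 0) ?add0r //.
apply: mpoly_eq0_eval => v; rewrite subst_eval.
pose x : 'rV[C]_3 := \row_j (h j).@[v].
rewrite (@meval_eq _ _ _ (x 0)); last by move=> j; rewrite mxE.
by apply: hF; rewrite -(hv v); apply: eq_bigr => j _; rewrite mxE.
Qed.

Lemma linear_prime F G H l : l != 0 -> F * G = lin l * H ->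
  (exists F', F = lin l * F') \/ (exists G', G = lin l * G').
Proof.
move=> l0 e; have [h [hG hl _]] := plane_retraction l0.
have := congr1 (mmap (@mpolyC 3 C) h) e; rewrite !rmorphM /= hl mul0r => /eqP.
rewrite mulf_eq0 => /orP[] /eqP z; [left|right].
  by have [F' eF] := hG F; exists F'; rewrite {1}eF z add0r.
by have [G' eG] := hG G; exists G'; rewrite {1}eG z add0r.
Qed.

(** Restriction of a form to the plane spanned by two vectors of a frame. *)
Lemma restrict_plane (M : 'M[C]_3) d F : M \in unitmx -> F \is d.-homog ->
  exists g : {poly C}, [/\ (size g <= d.+1)%N,
    forall t, g.[t] = F.@[(row 0 (dualmx M) + t *: row 1 (dualmx M)) 0] &
    exists G, F = \sum_(i < d.+1) g`_i *: (lin (row 1 M) ^+ i * lin (row 0 M) ^+ (d - i))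
      + lin (row 2%:R M) * G].
Proof.
move=> uM hF; pose N := dualmx M.
pose g : {poly C} := \sum_(m <- msupp F) F@_m *:
   \prod_j ((N 0 j)%:P + N 1 j *: 'X) ^+ m j.
have gE t : g.[t] = F.@[(row 0 N + t *: row 1 N) 0].
  rewrite mevalE horner_sum; apply: eq_bigr => m _; rewrite hornerZ horner_prod.
  congr (_ * _); apply: eq_bigr => j _.
  by rewrite horner_exp hornerD hornerC hornerZ hornerX !mxE mulrC.
have sg : (size g <= d.+1)%N.
  move: hF => /dhomogP hF; rewrite /g big_seq.
  apply: (big_ind (fun q : {poly C} => size q <= d.+1)%N) => [|p q sp sq|m mF].
  - by rewrite size_poly0.
  - by apply: leq_trans (size_polyD _ _) _; rewrite geq_max sp.
  apply: leq_trans (size_scale_leq _ _) _; rewrite -(hF _ mF) /= mdegE.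
  have sq (s : seq 'I_3) : (size (\prod_(j <- s) ((N 0 j)%:P + N 1 j *: 'X) ^+ m j)%R
      <= (\sum_(j <- s) m j).+1)%N.
    elim: s => [|j s IH]; first by rewrite !big_nil size_poly1.
    rewrite !big_cons; apply: leq_trans (size_polyMleq _ _) _.
    have : (size ((((N 0 j)%:P + N 1 j *: 'X) ^+ m j)%R) <= (m j).+1)%N.
      apply: leq_trans (size_poly_exp_leq _ _) _; rewrite ltnS.
      have : (size (((N 0 j)%:P + N 1 j *: 'X)%R : {poly C}) <= 2)%N.
        apply: leq_trans (size_polyD _ _) _; rewrite geq_max.
        rewrite (leq_trans (size_polyC_leq1 _)) // (leq_trans (size_scale_leq _ _)) //.
        by rewrite size_polyX.
      have ar u v : (u <= 2 -> u.-1 * v <= v)%N by clear; nia.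
      exact: ar.
    have ar u v z w : (v <= w.+1 -> u <= z.+1 -> (u + v).-1 <= (z + w).+1)%N.
      by clear; lia.
    exact: ar.
  exact: sq.
exists g; split=> //.
have dN i j := dot_dual i j uM.
have l0 i : row i M != 0.
  apply/eqP => e; have := dN i i; rewrite eqxx e /dot big1 => [/eqP|j _].
    by rewrite eq_sym oner_eq0.
  by rewrite mxE mul0r.
pose S := \sum_(i < d.+1) g`_i *: (lin (row 1 M) ^+ i * lin (row 0 M) ^+ (d - i)).
have [G eG] : exists G, lin (row 0 M) * (F - S) = lin (row 2%:R M) * G.
  apply: linear_divides => // x x2.
  rewrite mevalM lin_dot; have [->|a0] := eqVneq (dot (row 0 M) x) 0.
    by rewrite mul0r.
  rewrite [X in _ * X](_ : _ = 0) ?mulr0 // mevalB; apply/eqP; rewrite subr_eq0; apply/eqP.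
  set a := dot _ _ in a0; pose b := dot (row 1 M) x.
  have ex : x = a *: (row 0 N + (b / a) *: row 1 N).
    rewrite [LHS](frame_expand x uM) !big_ord_recl big_ord0 addr0.
    have -> : lift ord0 ord0 = 1 :> 'I_3 by apply: val_inj.
    have -> : lift ord0 (lift ord0 ord0) = 2%:R :> 'I_3 by apply: val_inj.
    by rewrite x2 scale0r addr0 scalerDr scalerA mulrCA mulfV // mulr1.
  transitivity (a ^+ d * g.[b / a]).
    rewrite gE -(dhomog_eval _ _ hF); apply: meval_eq => j.
    by rewrite [in LHS]ex mxE.
  rewrite (horner_coef_wide _ sg) mulr_sumr raddf_sum; apply: eq_bigr => i _ /=.
  rewrite mevalZ mevalM !rmorphXn /= !lin_dot -/a -/b mulrCA; congr (_ * _).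
  have -> : a ^+ d = a ^+ i * a ^+ (d - i) by rewrite -exprD subnKC // -ltnS.
  by rewrite expr_div_n mulrAC mulrCA mulfV ?mulr1 // expf_neq0.
have [[H eH]|[H eH]] := linear_prime (l0 _) eG.
  have := congr1 (meval (row 0 N 0)) eH; rewrite mevalM !lin_dot !dN.
  by rewrite eqxx mul0r => /eqP; rewrite oner_eq0.
by exists H; rewrite -eH addrC subrK.
Qed.

Lemma ord3_cases (P : 'I_3 -> Prop) : P 0 -> P 1 -> P 2%:R -> forall i, P i.
Proof.
move=> p0 p1 p2 [[|[|[|//]]] h].
- by rewrite (_ : Ordinal h = 0) //; apply: val_inj.
- by rewrite (_ : Ordinal h = 1) //; apply: val_inj.
- by rewrite (_ : Ordinal h = 2%:R) //; apply: val_inj.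
Qed.

Lemma sum3 (V : nmodType) (f : 'I_3 -> V) : \sum_i f i = f 0 + f 1 + f 2%:R.
Proof.
rewrite !big_ord_recl big_ord0 addr0 addrA; congr (_ + f _ + f _); exact: val_inj.
Qed.

Lemma frame_adapted b m p : p != 0 -> dot b p = 0 -> dot m p = 0 -> m != 0 ->
  ~~ (b <= m)%MS -> exists M, [/\ M \in unitmx, row 1 M = b, row 2%:R M = m &
    row 0 (dualmx M) = p].
Proof.
move=> p0 bp mp m0 bm; have [i pi] : exists i, p 0 i != 0 by apply/rV0Pn.
pose a : 'rV[C]_3 := \row_j (if j == i then (p 0 i)^-1 else 0).
have ap : dot a p = 1.
  rewrite /dot (bigD1 i) //= mxE eqxx mulVf // big1 ?addr0 // => j /negbTE ji.
  by rewrite mxE ji mul0r.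
pose M : 'M[C]_3 := \matrix_(k, j) (if k == 0 then a else if k == 1 then b else m) 0 j.
have r0 : row 0 M = a by apply/rowP => j; rewrite !mxE.
have r1 : row 1 M = b by apply/rowP => j; rewrite !mxE.
have r2 : row 2%:R M = m by apply/rowP => j; rewrite !mxE.
have uM : M \in unitmx.
  rewrite -row_free_unit -kermx_eq0; apply/rowV0P => u; rewrite sub_kermx => /eqP uM.
  have e : u 0 0 *: a + u 0 1 *: b + u 0 2%:R *: m = 0.
    by rewrite -uM mulmx_sum_row sum3 r0 r1 r2.
  have u0 : u 0 0 = 0.
    have := congr1 (fun x => dot x p) e; rewrite !dotDl !dotZl ap bp mp !mulr0 !addr0 mulr1.
    by move=> ->; rewrite /dot big1 // => j _; rewrite mxE mul0r.
  have u1 : u 0 1 = 0.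
    apply/eqP; apply: contraNT bm => u1; move: e; rewrite u0 scale0r add0r.
    move=> /eqP; rewrite addr_eq0 => /eqP e.
    have -> : b = (u 0 1)^-1 *: (u 0 1 *: b) by rewrite scalerA mulVf // scale1r.
    by rewrite e scalemx_sub // -scaleNr scalemx_sub.
  have u2 : u 0 2%:R = 0.
    move: e; rewrite u0 u1 !scale0r !add0r => /eqP.
    by rewrite scaler_eq0 (negbTE m0) orbF => /eqP.
  by apply/rowP; apply: ord3_cases; rewrite mxE.
exists M; split=> //; rewrite [RHS](frame_expand p uM) sum3 r0 r1 r2 ap bp mp.
by rewrite !scale0r !addr0 scale1r.
Qed.

Lemma frame_through m p : p != 0 -> dot m p = 0 -> m != 0 ->
  exists M, [/\ M \in unitmx, row 2%:R M = m & row 0 (dualmx M) = p].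
Proof.
move=> p0 mp m0; suff [b bp bm] : exists2 b, dot b p = 0 & ~~ (b <= m)%MS.
  by have [M [u _ r2 rp]] := frame_adapted p0 bp mp m0 bm; exists M.
have : ~~ (kermx p^T <= m)%MS.
  apply/negP => /mxrankS; rewrite mxrank_ker mxrank_tr.
  have := rank_leq_row p; have := rank_leq_row m.
  by case: (\rank p) => [|[|]] // ; case: (\rank m) => [|[|]].
case/row_subPn => i bm; exists (row i (kermx p^T)) => //.
rewrite dotE -row_mul mulmx_ker; by rewrite !mxE.
Qed.

(** Intersection of F with the line m = 0 at p, read off in a local parameter b
    of the line. *)
Lemma local_intersection d F b m p : p != 0 -> dot b p = 0 -> dot m p = 0 -> m != 0 ->
  ~~ (b <= m)%MS -> F \is d.-homog -> (exists2 x, dot m x = 0 & F.@[x 0] != 0) ->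
  exists k H W, [/\ F = lin m * H + lin b ^+ k * W, W \is (d - k).-homog & W.@[p 0] != 0].
Proof.
move=> p0 bp mp m0 bm hF [x mx Fx].
have [M [uM r1 r2 rp]] := frame_adapted p0 bp mp m0 bm.
have [g [sg gE [G eF]]] := restrict_plane uM hF.
have ex : exists i, g`_i != 0.
  apply: NNPP => h; case/eqP: Fx; rewrite eF mevalD mevalM lin_dot r2 mx mul0r addr0.
  rewrite raddf_sum big1 // => i _ /=; have [->|gi] := eqVneq g`_i 0.
    by rewrite scale0r meval0.
  by case: h; exists i.
case: (ex_minnP ex) => k gk kmin.
have kd : (k < d.+1)%N.
  by rewrite ltnNge; apply: contraNN gk => dk; rewrite nth_default // (leq_trans sg).
pose W := \sum_(i < d.+1 | (k <= i)%N) g`_i *: (lin b ^+ (i - k) * lin (row 0 M) ^+ (d - i)).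
exists k, G, W; split.
  rewrite eF addrC r2; congr (_ + _); rewrite r1 /W mulr_sumr [RHS]big_mkcond.
  apply: eq_bigr => i _; case: leqP => ik.
    by rewrite -scalerAr mulrA -exprD subnKC.
  suff -> : g`_i = 0 by rewrite scale0r.
  by apply/eqP/contraT => /kmin; rewrite leqNgt ik.
  apply: rpred_sum => i ki; apply: rpredZ.
  have hl e l : lin l ^+ e \is e.-homog.
    by have := dhomogMn e (lin_homog l); rewrite mul1n.
  have ar (x1 x2 x3 : nat) : (x1 <= x2 -> x2 < x3.+1 -> x3 - x1 = x2 - x1 + (x3 - x2))%N by clear; lia.
  by rewrite (ar k i d) //; apply: (dhomogM (hl _ _) (hl _ _)).
have a1 : dot (row 0 M) p = 1 by rewrite -rp dot_dual.
rewrite /W (bigD1 (Ordinal kd)) //= mevalD subnn expr0 mul1r mevalZ rmorphXn /= lin_dot a1.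
rewrite expr1n mulr1 raddf_sum big1 ?addr0 // => i /andP[ki ik] /=.
rewrite mevalZ mevalM !rmorphXn /= !lin_dot bp expr0n subn_eq0.
suff -> : (i <= k)%N = false by rewrite mul0r mulr0.
by apply/negP => h; case/eqP: ik; apply: val_inj; apply/eqP; rewrite eqn_leq h ki.
Qed.

End LinearForms.


Section Valuations.
Local Open Scope ring_scope.
Variables (C K : fieldType) (iota : {rmorphism C -> K}) (v : place iota).

Lemma place1 : v 1 = 0.
Proof. by rewrite -(rmorph1 iota) place_val_const ?oner_eq0. Qed.

Lemma placeV x : x != 0 -> v x^-1 = - v x.
Proof.
move=> x0; apply/eqP; rewrite -addr_eq0 addrC -place_valM ?invr_eq0 //.
by rewrite mulfV // place1.
Qed.

Lemma placeN x : x != 0 -> v (- x) = v x.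
Proof.
move=> x0; rewrite -mulN1r place_valM ?oppr_eq0 ?oner_eq0 //.
by rewrite -(rmorphN1 iota) place_val_const ?oppr_eq0 ?oner_eq0 // add0r.
Qed.

Lemma placeX x n : x != 0 -> v (x ^+ n) = v x *+ n.
Proof.
move=> x0; elim: n => [|n IH]; first by rewrite expr0 mulr0n place1.
by rewrite exprS place_valM ?expf_neq0 // IH mulrS.
Qed.

Lemma vgeW n m x : m <= n -> val_ge v x n -> val_ge v x m.
Proof. by move=> mn [->|h]; [left|right; apply: le_trans h]. Qed.

Lemma vgeD n x y : val_ge v x n -> val_ge v y n -> val_ge v (x + y) n.
Proof.
have [-> _|x0 [//|hx]] := eqVneq x 0; first by rewrite add0r.
  by move=> e; rewrite e eqxx in x0.
have [-> _|y0 [//|hy]] := eqVneq y 0; first by rewrite addr0; right.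
  by move=> e; rewrite e eqxx in y0.
have [->|xy0] := eqVneq (x + y) 0; first by left.
by right; apply: le_trans (place_valD v x0 y0 xy0); rewrite le_min hx.
Qed.

Lemma vgeN n x : val_ge v x n -> val_ge v (- x) n.
Proof.
have [->|x0] := eqVneq x 0; first by rewrite oppr0.
by move=> [e|h]; [rewrite e eqxx in x0|right; rewrite placeN].
Qed.

Lemma vgeB n x y : val_ge v x n -> val_ge v y n -> val_ge v (x - y) n.
Proof. by move=> hx hy; apply: vgeD => //; apply: vgeN. Qed.

Lemma vgeM n m x y : val_ge v x n -> val_ge v y m -> val_ge v (x * y) (n + m).
Proof.
have [-> _ _|x0 [e|hx]] := eqVneq x 0; first by rewrite mul0r; left.
  by rewrite e eqxx in x0.
have [-> _|y0 [e|hy]] := eqVneq y 0; first by rewrite mulr0; left.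
  by rewrite e eqxx in y0.
by right; rewrite place_valM // lerD.
Qed.

Lemma vge_val n x : x != 0 -> val_ge v x n -> n <= v x.
Proof. by move=> x0 [e|//]; rewrite e eqxx in x0. Qed.

Lemma vge_const c : val_ge v (iota c) 0.
Proof.
have [->|c0] := eqVneq c 0; first by rewrite rmorph0; left.
by right; rewrite place_val_const.
Qed.

Lemma vge_const_eq0 c : val_ge v (iota c) 1 -> c = 0.
Proof.
move=> [/eqP|]; first by rewrite fmorph_eq0 => /eqP.
by have [//|c0] := eqVneq c 0; rewrite place_val_const.
Qed.

Lemma val_dominant x y : val_ge v (x - y) 1 -> y != 0 -> v y = 0 -> x != 0 /\ v x = 0.
Proof.
move=> h y0 vy; have x0 : x != 0.
  apply/eqP => e; move: h; rewrite e sub0r => /vgeN; rewrite opprK => /(vge_val y0).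
  by rewrite vy.
split=> //; apply/eqP; rewrite eq_le; apply/andP; split; last first.
  apply: vge_val x0 _; rewrite -[x](subrK y); apply: vgeD; first exact: vgeW h.
  by right; rewrite vy.
rewrite leNgt; apply/negP => vx.
have : val_ge v y 1.
  by rewrite -[y](subKr x); apply: vgeB => //; right; rewrite -gtz0_ge1.
by move=> /(vge_val y0); rewrite vy.
Qed.

End Valuations.

Section FunctionField.
Local Open Scope ring_scope.
Variable C : numClosedFieldType.

Lemma mmap_scale (S : comNzRingType) (f : {rmorphism C -> S}) n e (G : {mpoly C[n]})
    (h : 'I_n -> S) c : G \is e.-homog ->
  mmap f (fun j => c * h j) G = c ^+ e * mmap f h G.
Proof.
move=> /dhomogP hG; rewrite /mmap mulr_sumr big_seq [RHS]big_seq.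
apply: eq_bigr => m mG; rewrite mulrCA; congr (_ * _).
rewrite -(hG _ mG) /= mdegE -prodrXr -big_split; apply: eq_bigr => i _.
by rewrite exprMn.
Qed.

Lemma homogenization n (G : {mpoly C[n]}) i : exists e H, H \is e.-homog /\
  forall (S : comNzRingType) (f : {rmorphism C -> S}) (h : 'I_n -> S), h i = 1 ->
    mmap f h H = mmap f h G.
Proof.
have hX e : ('X_i ^+ e : {mpoly C[n]}) \is e.-homog.
  by rewrite mpolyXn dhomogX /= mdegMn mdeg1 mul1n.
have mX e (S : comNzRingType) (f : {rmorphism C -> S}) (h : 'I_n -> S) : h i = 1 ->
    mmap f h ('X_i ^+ e) = 1.
  by move=> hi; rewrite rmorphXn /= mmapX mmap1U hi expr1n.
move: G; apply: mpoly_ring_ind => [c|j|p q [e [P [hP eP]]] [e' [Q [hQ eQ]]]|p q].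
- exists 0%N, c%:MP; split=> //; apply/dhomogP => m; rewrite mcoeff_msupp mcoeffC.
  by case: (m =P 0%MM) => [->|_]; rewrite ?mulr0 ?eqxx //= mdeg0.
- by exists 1%N, 'X_j; split=> //; rewrite dhomogX /= mdeg1.
- exists (e + e')%N, (P * 'X_i ^+ e' + 'X_i ^+ e * Q); split.
    by apply: rpredD; apply: dhomogM.
  by move=> S f h hi; rewrite !mmapD !rmorphM /= !mX // eP // eQ // mulr1 mul1r.
move=> [e [P [hP eP]]] [e' [Q [hQ eQ]]].
exists (e + e')%N, (P * Q); split; first exact: dhomogM.
by move=> S f h hi; rewrite !rmorphM /= eP // eQ.
Qed.

Variables (d : nat) (F : {mpoly C[3]}) (K : function_field F).
Hypothesis hF : F \is d.-homog.

Local Notation xi := (ff_gen K).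
Local Notation iota := (ff_const K).

Definition ev (G : {mpoly C[3]}) : K := mmap iota xi G.
Definition evi (i : 'I_3) (G : {mpoly C[3]}) : K := mmap iota (fun j => xi j / xi i) G.

Lemma evD G H : ev (G + H) = ev G + ev H. Proof. exact: mmapD. Qed.
Lemma evM G H : ev (G * H) = ev G * ev H. Proof. exact: (rmorphM (mmap iota xi)). Qed.

Lemma eviD i G H : evi i (G + H) = evi i G + evi i H. Proof. exact: mmapD. Qed.
Lemma eviB i G H : evi i (G - H) = evi i G - evi i H. Proof. exact: mmapB. Qed.
Lemma eviM i G H : evi i (G * H) = evi i G * evi i H.
Proof. exact: (rmorphM (mmap iota _)). Qed.
Lemma eviC i c : evi i c%:MP = iota c. Proof. exact: mmapC. Qed.
Lemma eviX i j : evi i 'X_j = xi j / xi i. Proof. by rewrite /evi mmapX mmap1U. Qed.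
Lemma eviXn i G n : evi i (G ^+ n) = evi i G ^+ n.
Proof. exact: (rmorphXn (mmap iota _)). Qed.
Lemma evi0 i : evi i 0 = 0. Proof. exact: mmap0. Qed.
Lemma evi1 i : evi i 1 = 1. Proof. exact: (rmorph1 (mmap iota _)). Qed.
Lemma evi_sum i (I : Type) (s : seq I) (P : pred I) (f : I -> {mpoly C[3]}) :
  evi i (\sum_(k <- s | P k) f k) = \sum_(k <- s | P k) evi i (f k).
Proof. exact: (rmorph_sum (mmap iota _)). Qed.

Lemma evi_form i e G : G \is e.-homog -> xi i != 0 -> evi i G = ev G / xi i ^+ e.
Proof.
move=> hG xi0; transitivity (mmap iota (fun j => (xi i)^-1 * xi j) G).
  by apply: eq_bigr => m _; congr (_ * _); apply: mmap1_eq => j; rewrite mulrC.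
by rewrite (mmap_scale _ _ _ hG) exprVn mulrC.
Qed.

Lemma evF : ev F = 0.
Proof. by apply/(ff_genP K hF); exists 1; rewrite mul1r. Qed.

Lemma eviF i : xi i != 0 -> evi i F = 0.
Proof. by move=> xi0; rewrite (evi_form hF xi0) evF mul0r. Qed.

Lemma frac_evi i x : xi i != 0 -> exists A B, evi i B != 0 /\ x = evi i A / evi i B.
Proof.
move=> xi0; have [e [A [B [hA hB B0 ->]]]] := ff_fracP x; exists A, B.
rewrite (evi_form hA xi0) (evi_form hB xi0).
have x0 : xi i ^+ e != 0 by rewrite expf_neq0.
split; first by rewrite mulf_neq0 ?invr_eq0.
by rewrite -mulf_div divff ?mulr1 // invr_eq0.
Qed.

Section Chart.
Variables (i j k : 'I_3) (a : 'I_3 -> C).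
Hypotheses (xi_i : xi i != 0) (a_i : a i = 1) (a_F : F.@[a] = 0).
Hypotheses (ijk : uniq [:: i; j; k]) (a_k : (F^`M(k)).@[a] != 0).

Local Notation evi := (evi i).
Definition tau := evi ('X_j - (a j)%:MP).

Lemma evi_eq0 G : evi G = 0 -> G.@[a] = 0.
Proof.
move=> G0; have [e [H [hH eH]]] := homogenization G i.
have H0 : ev H = 0.
  have : evi H = 0.
    by rewrite /evi eH // mulfV.
  rewrite (evi_form hH xi_i) => /eqP; rewrite mulf_eq0 invr_eq0 expf_eq0 (negbTE xi_i).
  by rewrite andbF orbF => /eqP.
have /(ff_genP K hH)[Q eQ] := H0.
by have := eH C idfun a a_i; rewrite -!/(meval _ _) => <-; rewrite eQ mevalM a_F mulr0.
Qed.

Lemma sum_ijk (V : nmodType) (f : 'I_3 -> V) : \sum_l f l = f i + f j + f k.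
Proof.
have : perm_eq (index_enum 'I_3) [:: i; j; k].
  have sz : (size (index_enum 'I_3) <= size [:: i; j; k])%N.
    by rewrite -sum1_size !big_ord_recl big_ord0.
  have [_ e] := uniq_min_size ijk (fun l _ => mem_index_enum l) sz.
  by apply: uniq_perm; rewrite ?index_enum_uniq // => l; rewrite -e.
by move=> p; rewrite (perm_big _ p) /= !big_cons big_nil addr0 addrA.
Qed.

Lemma taylor_chart G : exists g : 'I_3 -> {mpoly C[3]},
  evi G = iota G.@[a] + tau * evi (g j) + evi ('X_k - (a k)%:MP) * evi (g k) /\
  forall l, (g l).@[a] = (G^`M(l)).@[a].
Proof.
have [g [eg dg]] := mpoly_taylor G a; exists g; split=> //.
rewrite {1}eg eviD eviC evi_sum sum_ijk !eviM eviB eviC eviX a_i mulfV // rmorph1 subrr.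
by rewrite mul0r add0r addrA.
Qed.

(** A function vanishing at the point is divisible by the local parameter in
    the local ring: the other coordinate is eliminated with the equation of the
    curve, whose derivative in that direction is a unit. *)
Lemma parameter_divides G : G.@[a] = 0 -> exists U G', U.@[a] != 0 /\
  evi U * evi G = tau * evi G'.
Proof.
move=> G0; have [f [ef df]] := taylor_chart F; have [g [eg _]] := taylor_chart G.
exists (f k), (f k * g j - f j * g k); split; first by rewrite df.
move: ef; rewrite eviF // a_F rmorph0 add0r => ef.
rewrite eg G0 rmorph0 add0r (eviB i (f k * g j)) !eviM.
have e : evi ('X_k - (a k)%:MP) * evi (f k) = - (tau * evi (f j)).
  by apply/eqP; rewrite -addr_eq0 addrC -ef.
rewrite mulrDr mulrCA [evi (f k) * (_ * _)]mulrA [evi (f k) * _]mulrC e; ring.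
Qed.

Definition order_at n G := exists U H, [/\ U.@[a] != 0, H.@[a] != 0 &
  evi U * evi G = tau ^+ n * evi H].

Definition bounded_at G := exists N A W, W.@[a] != 0 /\
  evi G * evi A = tau ^+ N * evi W.

Lemma evi_unit U : U.@[a] != 0 -> evi U != 0.
Proof. by apply: contra_neq; apply: evi_eq0. Qed.

Lemma tau_eq0 G : tau = 0 -> evi G != 0 -> G.@[a] != 0.
Proof.
move=> t0; apply: contra_neq => G0; have [U [G' [Ua e]]] := parameter_divides G0.
move/eqP: e; rewrite t0 mul0r mulf_eq0 => /orP[/eqP|/eqP //].
by move=> u; case/eqP: Ua; apply: evi_eq0.
Qed.

Lemma order_exists G : bounded_at G -> evi G != 0 -> exists n, order_at n G.
Proof.
move=> [N [A [W [Wa e]]]] G0; apply: NNPP => H.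
have D n : exists U G', U.@[a] != 0 /\ evi U * evi G = tau ^+ n * evi G'.
  elim: n => [|n [U [G' [Ua e']]]].
    by exists 1, G; rewrite meval1 oner_eq0 evi1 expr0.
  have [Ga|Ga] := eqVneq G'.@[a] 0; last by case: H; exists n, U, G'.
  have [V [G2 [Va e2]]] := parameter_divides Ga.
  exists (U * V), G2; split; first by rewrite mevalM mulf_neq0.
  by rewrite eviM mulrAC e' -mulrA [evi G' * _]mulrC e2 exprSr mulrA.
have [U [G' [Ua e']]] := D N.+1.
have t0 : tau != 0.
  apply/eqP => t0; move/eqP: e'; rewrite t0 expr0n mul0r mulf_eq0 (negbTE G0) orbF.
  by rewrite (negbTE (evi_unit Ua)).
have : evi (U * W - ('X_j - (a j)%:MP) * G' * A) = 0.
  rewrite eviB !eviM; apply: (mulfI (expf_neq0 N t0)).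
  rewrite mulr0 mulrBr mulrCA -e -/tau.
  have -> : tau ^+ N * (tau * evi G' * evi A) = tau ^+ N.+1 * evi G' * evi A.
    by rewrite exprSr; ring.
  by rewrite -e'; ring.
move/evi_eq0/eqP; rewrite mevalB !mevalM mevalB mevalXU mevalC subrr !mul0r subr0.
by rewrite mulf_eq0 (negbTE Ua) (negbTE Wa).
Qed.

Lemma bounded_factor G H : bounded_at (G * H) -> bounded_at G.
Proof.
move=> [N [A [W [Wa e]]]]; exists N, (H * A), W; split=> //.
by rewrite eviM mulrA -eviM.
Qed.

Lemma bounded_mul G H : bounded_at G -> bounded_at H -> bounded_at (G * H).
Proof.
move=> [N [A [W [Wa e]]]] [N' [A' [W' [Wa' e']]]].
exists (N + N')%N, (A * A'), (W * W'); split; first by rewrite mevalM mulf_neq0.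
by rewrite !eviM mulrACA e e' exprD mulrACA.
Qed.

Lemma bounded_unit G : G.@[a] != 0 -> bounded_at G.
Proof. by move=> Ga; exists 0%N, 1, G; rewrite evi1 mulr1 expr0 mul1r. Qed.

(** Valuation theory at a place centred at the point. *)
Section Centred.
Variable v : place iota.
Hypothesis v_centre : forall l, val_ge v (evi ('X_l - (a l)%:MP)) 1.

Lemma centred_diff G : val_ge v (evi (G - (G.@[a])%:MP)) 1 /\ val_ge v (evi G) 0.
Proof.
have ge0 : val_ge v (evi G) 0.
  move: G; apply: mpoly_ring_ind => [c|l|p q|p q].
  - by rewrite eviC; apply: vge_const.
  - rewrite -['X_l](subrK (a l)%:MP) eviD; apply: vgeD; first exact: vgeW (v_centre l).
    by rewrite eviC; apply: vge_const.
  - by rewrite eviD; apply: vgeD.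
  - by rewrite eviM => hp hq; rewrite -[0]addr0; apply: vgeM.
split=> //; move: {ge0} G; apply: mpoly_ring_ind => [c|l|p q hp hq|p q hp hq].
- by rewrite mevalC subrr evi0; left.
- by rewrite mevalXU.
- by rewrite mevalD mpolyCD opprD addrACA eviD; apply: vgeD.
have -> : p * q - (p * q).@[a]%:MP = (p - p.@[a]%:MP) * (q - q.@[a]%:MP)
    + p.@[a]%:MP * (q - q.@[a]%:MP) + q.@[a]%:MP * (p - p.@[a]%:MP).
  by rewrite mevalM mpolyCM; ring.
rewrite !eviD; apply: vgeD; last first.
  by rewrite eviM eviC -[1]add0r; apply: vgeM => //; apply: vge_const.
apply: vgeD; last first.
  by rewrite eviM eviC -[1]add0r; apply: vgeM => //; apply: vge_const.
by rewrite eviM; apply: (@vgeW _ _ _ v (1 + 1)) => //; apply: vgeM.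
Qed.

Lemma centred_unit U : U.@[a] != 0 -> v (evi U) = 0.
Proof.
move=> Ua; have [h _] := centred_diff U; rewrite eviB eviC in h.
have [] := val_dominant h; rewrite ?fmorph_eq0 //.
by rewrite place_val_const.
Qed.

Lemma centred_gt0 G : evi G != 0 -> (0 < v (evi G)) = (G.@[a] == 0).
Proof.
move=> G0; have [Ga|Ga] := eqVneq G.@[a] 0; last by rewrite centred_unit.
have [h _] := centred_diff G; move: h; rewrite Ga mpolyC0 subr0.
by move/(vge_val G0); rewrite gtz0_ge1.
Qed.

Lemma tau_neq0 : tau != 0.
Proof.
apply/eqP => t0; have [t tn0 vt] := place_val_unif v.
have [A [B [B0 e]]] := frac_evi t xi_i.
have A0 : evi A != 0 by apply: contra_neq tn0; rewrite e => ->; rewrite mul0r.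
move: vt; rewrite e place_valM ?invr_eq0 // placeV // !centred_unit //; exact: tau_eq0.
Qed.

Lemma centred_order G : evi G != 0 -> exists n, order_at n G.
Proof.
move=> G0; have : exists m : nat, v (evi G) <= m%:Z.
  by exists `|v (evi G)|%N; rewrite abszE ler_norm.
move=> [m]; elim: m G G0 => [|m IH] G G0 vG.
  exists 0%N, 1, G; rewrite meval1 oner_eq0 evi1 expr0; split=> //.
  by rewrite -(centred_gt0 G0) -leNgt.
have [Ga|Ga] := eqVneq G.@[a] 0; last first.
  by exists 0%N, 1, G; rewrite meval1 oner_eq0 evi1 expr0.
have [U [G' [Ua e]]] := parameter_divides Ga.
have G'0 : evi G' != 0.
  apply/eqP => z; move/eqP: e; rewrite z mulr0 mulf_eq0 (negbTE G0) orbF.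
  by rewrite (negbTE (evi_unit Ua)).
have vtau : 1 <= v tau by apply: vge_val tau_neq0 (v_centre j).
have ve : v (evi G) = v tau + v (evi G').
  have := congr1 v e; rewrite !place_valM ?(evi_unit Ua) ?tau_neq0 //.
  by rewrite (centred_unit Ua) add0r.
have [|n [V [H [Va Ha e']]]] := IH G' G'0.
  by move: vG vtau; rewrite ve; clear; lia.
exists n.+1, (U * V), H; split=> //; first by rewrite mevalM mulf_neq0.
by rewrite eviM mulrAC e -mulrA [evi G' * _]mulrC e' exprS mulrA.
Qed.

Lemma order_val n G : order_at n G -> v (evi G) = v tau *+ n.
Proof.
move=> [U [H [Ua Ha e]]]; have G0 : evi G != 0.
  apply/eqP => z; move/eqP: e; rewrite z mulr0 eq_sym mulf_eq0 (negbTE (evi_unit Ha)).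
  by rewrite orbF expf_eq0 (negbTE tau_neq0) andbF.
have := congr1 v e; rewrite !place_valM ?(evi_unit Ua) ?(evi_unit Ha) ?expf_neq0 ?tau_neq0 //.
by rewrite placeX ?tau_neq0 // (centred_unit Ua) (centred_unit Ha) add0r addr0.
Qed.

Lemma val_tau : v tau = 1.
Proof.
have vtau : 1 <= v tau by apply: vge_val tau_neq0 (v_centre j).
have [t tn0 vt] := place_val_unif v.
have [A [B [B0 e]]] := frac_evi t xi_i.
have A0 : evi A != 0 by apply: contra_neq tn0; rewrite e => ->; rewrite mul0r.
have [n /order_val vA] := centred_order A0; have [m /order_val vB] := centred_order B0.
move: vt; rewrite e place_valM ?invr_eq0 // placeV // vA vB.
have ar (x y z : int) : 1 <= x -> x * y - x * z = 1 -> x = 1.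
  clear; rewrite -mulrBr; move: (y - z) => w x1 xw.
  have w0 : 0 < w by rewrite -(pmulr_rgt0 _ (lt_le_trans ltr01 x1)) xw.
  apply/eqP; rewrite eq_le x1 andbT -xw ler_peMr ?(le_trans ler01 x1) //.
by rewrite -[v tau *+ n]mulr_natr -[v tau *+ m]mulr_natr; apply: ar.
Qed.

End Centred.

End Chart.
End FunctionField.


Section Branches.
Local Open Scope ring_scope.
Variable C : numClosedFieldType.
Implicit Types (p l m b : 'rV[C]_3) (i j k : 'I_3).


Definition smooth_form (F : {mpoly C[3]}) :=
  forall p : 'rV[C]_3, p != 0 -> F.@[p 0] = 0 -> exists j, (F^`M(j)).@[p 0] != 0.

Definition aff (p : 'rV[C]_3) i : 'I_3 -> C := fun j => p 0 j / p 0 i.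

Lemma aff_id p i : p 0 i != 0 -> aff p i i = 1.
Proof. by move=> pi; rewrite /aff mulfV. Qed.

Lemma form_aff e (G : {mpoly C[3]}) p i : G \is e.-homog ->
  G.@[aff p i] = (p 0 i)^-1 ^+ e * G.@[p 0].
Proof. by move=> hG; rewrite -(dhomog_eval _ _ hG); apply: meval_eq => j; rewrite mulrC. Qed.

Lemma form_aff_eq0 e (G : {mpoly C[3]}) p i : G \is e.-homog -> p 0 i != 0 ->
  (G.@[aff p i] == 0) = (G.@[p 0] == 0).
Proof.
by move=> hG pi; rewrite (form_aff _ _ hG) mulf_eq0 expf_eq0 invr_eq0 (negbTE pi) andbF.
Qed.

Lemma lin_aff_eq0 l p i : p 0 i != 0 -> ((lin l).@[aff p i] == 0) = (dot l p == 0).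
Proof. by move=> pi; rewrite (form_aff_eq0 (lin_homog l) pi) lin_dot. Qed.

Lemma third (i j : 'I_3) : i != j -> exists k, uniq [:: i; j; k].
Proof.
move: i j; do 2 apply: ord3_cases => //=; move=> _;
  first [by exists 0 | by exists 1 | by exists 2%:R].
Qed.

Lemma swap3 (i j k : 'I_3) : uniq [:: i; j; k] -> uniq [:: i; k; j].
Proof. by rewrite /= !inE !andbT negb_or => /andP[/andP[a b] c]; rewrite negb_or a b eq_sym. Qed.

Lemma chart_exists d (F : {mpoly C[3]}) p i : F \is d.-homog -> (0 < d)%N ->
    smooth_form F -> p 0 i != 0 -> F.@[p 0] = 0 ->
  exists j k, uniq [:: i; j; k] /\ (F^`M(k)).@[aff p i] != 0.
Proof.
case: d => // d hF _ smF pi Fp.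
have p0 : p != 0 by apply: contraNneq pi => ->; rewrite mxE.
suff [k ki Fk] : exists2 k, i != k & (F^`M(k)).@[p 0] != 0.
  have [j] := third ki; move=> /swap3 u; exists j, k; split=> //.
  by rewrite (form_aff_eq0 (dhomog_deriv k hF)).
apply: NNPP => h; have z k : i != k -> (F^`M(k)).@[p 0] = 0.
  by move=> ik; apply/eqP/contraT => Fk; case: h; exists k.
have [j] := smF p p0 Fp; have [<-|/z -> /eqP //] := eqVneq i j.
have := congr1 (meval (p 0)) (mpoly_euler hF); rewrite mevalZ Fp mulr0 raddf_sum.
rewrite (bigD1 i) //= big1 => [|k ik]; last by rewrite mevalM z ?mulr0 // eq_sym.
by rewrite addr0 mevalM mevalXU => /eqP; rewrite mulf_eq0 (negbTE pi) => /= ->.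
Qed.

Section Curve.
Variables (d : nat) (F : {mpoly C[3]}) (K : function_field F).
Hypotheses (hF : F \is d.-homog) (d_gt0 : (0 < d)%N).

Local Notation xi := (ff_gen K).
Local Notation iota := (ff_const K).

Lemma affine_evi p i j : affine_coord K p i j = evi K i ('X_j - (aff p i j)%:MP).
Proof. by rewrite eviB eviC eviX. Qed.

Lemma ev_eq0_at e (G : {mpoly C[3]}) v : G \is e.-homog -> ev K G = 0 -> F.@[v] = 0 ->
  G.@[v] = 0.
Proof. by move=> hG /(ff_genP K hG)[H ->] Fv; rewrite mevalM Fv mulr0. Qed.

Lemma xi_neq0 p i : F.@[p 0] = 0 -> p 0 i != 0 -> xi i != 0.
Proof.
move=> Fp; apply: contra_neq => xi0.
have hX : ('X_i : {mpoly C[3]}) \is 1.-homog by rewrite dhomogX /= mdeg1.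
have := ev_eq0_at hX _ Fp; rewrite mevalXU; apply.
by rewrite /ev mmapX mmap1U.
Qed.

Lemma branch_point (v : place iota) p : branch_at v p -> F.@[p 0] = 0.
Proof.
move=> [i [pi xi0 h]]; have c (l : 'I_3) : val_ge v (evi K i ('X_l - (aff p i l)%:MP)) 1.
  by rewrite -affine_evi.
have [] := centred_diff c F; rewrite eviB (eviF hF) // sub0r eviC.
move/vgeN; rewrite opprK => /vge_const_eq0/eqP.
by rewrite (form_aff_eq0 hF) // => /eqP.
Qed.

Lemma branch_chart (v : place iota) p i : branch_at v p -> p 0 i != 0 ->
  xi i != 0 /\ forall l : 'I_3, val_ge v (evi K i ('X_l - (aff p i l)%:MP)) 1.
Proof.
move=> b pi; have Fp := branch_point b; have xi0 := xi_neq0 Fp pi.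
split=> // l; case: b => i' [pi' xi0' h].
have c (l' : 'I_3) : val_ge v (evi K i' ('X_l' - (aff p i' l')%:MP)) 1 by rewrite -affine_evi.
have ai : ('X_i : {mpoly C[3]}).@[aff p i'] != 0.
  by rewrite mevalXU /aff mulf_neq0 ?invr_eq0.
have ui := centred_unit c ai; rewrite eviX in ui.
pose G : {mpoly C[3]} := 'X_(l : 'I_3) - (aff p i l)%:MP * 'X_i.
have -> : evi K i ('X_l - (aff p i l)%:MP) = evi K i' G / (xi i / xi i').
  rewrite !eviB eviM !eviC !eviX mulrBl mulfK; last by rewrite mulf_neq0 ?invr_eq0.
  by rewrite invf_div mulrA divfK.
rewrite -[1]addr0; apply: vgeM; last first.
  by right; rewrite placeV ?ui ?oppr0 // mulf_neq0 ?invr_eq0.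
have [] := centred_diff c G; suff -> : G.@[aff p i'] = 0 by rewrite mpolyC0 subr0.
rewrite mevalB mevalM mevalC !mevalXU /aff mulrA divfK ?subrr //.
Qed.


Lemma evi_lin i l : evi K i (lin l) = (\sum_j iota (l 0 j) * xi j) / xi i.
Proof.
rewrite evi_sum mulr_suml; apply: eq_bigr => j _.
by rewrite -mul_mpolyC eviM eviC eviX mulrA.
Qed.

Lemma span_two b l m p : p != 0 -> l != 0 -> dot l p = 0 -> dot b p = 0 ->
  dot m p = 0 -> ~~ (b <= l)%MS -> exists x y : C, lin m = x%:MP * lin b + y%:MP * lin l.
Proof.
move=> p0 l0 lp bp mp bl; have [M [uM r1 r2 rp]] := frame_adapted p0 bp lp l0 bl.
have e : m = \sum_i (m *m invmx M) 0 i *: row i M by rewrite -mulmx_sum_row mulmxKV.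
exists ((m *m invmx M) 0 1), ((m *m invmx M) 0 2%:R).
have z : (m *m invmx M) 0 0 = 0.
  rewrite -[RHS]mp -rp dotE !mxE; apply: eq_bigr => j _.
  by rewrite !mxE.
by rewrite {1}e sum3 z scale0r add0r r1 r2 linD !linZ !mul_mpolyC.
Qed.

(** At a smooth branch meeting the line l to order k, a form vanishing to order
    k has contact at least k with l: when k > 1 every other line through the
    point has order one. *)
Lemma contact_mult (v : place iota) i l b p (k k' e : nat) A H W : p != 0 -> l != 0 ->
    dot l p = 0 -> dot b p = 0 -> ~~ (b <= l)%MS -> A = lin l * H + lin b ^+ k' * W ->
    W \is e.-homog -> W.@[p 0] != 0 -> branch_at v p -> branch_smooth v p -> p 0 i != 0 ->
    evi K i (lin l) != 0 -> v (evi K i (lin l)) = k -> val_ge v (evi K i A) k%:Z ->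
  (k <= k')%N.
Proof.
move=> p0 l0 lp bp bl eA hW Wp bv [i0 [j0 [pi0 xi0 a0 va]]] pi f0 vf hA.
have [xii c] := branch_chart bv pi; have Fp := branch_point bv.
have ge1 m : dot m p = 0 -> val_ge v (evi K i (lin m)) 1.
  move=> mp; have [] := centred_diff c (lin m).
  have /eqP -> : (lin m).@[aff p i] == 0 by rewrite lin_aff_eq0 // mp.
  by rewrite mpolyC0 subr0.
have Wa : W.@[aff p i] != 0 by rewrite (form_aff_eq0 hW).
have vW := centred_unit c Wa.
have W0 : evi K i W != 0.
  by apply: evi_unit Wa => //; rewrite ?aff_id // (form_aff _ _ hF) Fp mulr0.
have ebW : evi K i (lin b) ^+ k' * evi K i W = evi K i A - evi K i (lin l) * evi K i H.
  by rewrite eA eviD !eviM eviXn [evi K i (lin l) * _ + _]addrC addrK.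
have hbW : val_ge v (evi K i (lin b) ^+ k' * evi K i W) k%:Z.
  rewrite ebW; apply: vgeB => //; rewrite -[k%:Z]addr0.
  by apply: vgeM; [right; rewrite vf|have [] := centred_diff c H].
have [k1|k1] := leqP k 1.
  case: k' hbW {eA ebW} => [|k' _]; last exact: leq_trans k1 _.
  by rewrite expr0 mul1r => /(vge_val W0); rewrite vW.
(* The smooth branch has a linear form of order one, and l is not. *)
pose m : 'rV[C]_3 := \row_j ((j == j0)%:R - (j == i0)%:R * aff p i0 j0).
have mE : lin m = 'X_j0 - (aff p i0 j0)%:MP * 'X_i0.
  rewrite mul_mpolyC /lin; under eq_bigr do rewrite mxE scalerBl -scalerA; rewrite sumrB.
  rewrite (bigD1 j0) //= eqxx scale1r big1 ?addr0 => [|j /negbTE ->]; last by rewrite scale0r.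
  rewrite (bigD1 i0) //= eqxx scale1r big1 ?addr0 => [//|j /negbTE ->]; by rewrite scale0r.
have mp : dot m p = 0.
  by rewrite -lin_dot mE mevalB mevalM mevalC !mevalXU /aff divfK ?subrr.
have ui : ('X_i0 : {mpoly C[3]}).@[aff p i] != 0.
  by rewrite mevalXU /aff mulf_neq0 ?invr_eq0.
have vi := centred_unit c ui.
have x0 : xi i0 / xi i != 0 by rewrite mulf_neq0 ?invr_eq0.
have em : affine_coord K p i0 j0 = evi K i (lin m) / evi K i 'X_i0.
  rewrite mE eviB eviM eviC !eviX mulrBl mulfK // invf_div mulrA divfK //.
have [x [y exy]] := span_two p0 l0 lp bp mp bl.
have b1 : val_ge v (evi K i (lin b)) 2 -> False.
  move=> hb; have : val_ge v (evi K i (lin m)) 2.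
    rewrite exy eviD !eviM !eviC; apply: vgeD.
      by rewrite -[2]add0r; apply: vgeM => //; apply: vge_const.
    rewrite -[2]add0r; apply: vgeM; first exact: vge_const.
    by right; rewrite vf.
  have m0 : evi K i (lin m) != 0.
    by apply: contraNneq a0; rewrite em => ->; rewrite mul0r.
  move/(vge_val m0); move: va; rewrite em place_valM ?invr_eq0 ?placeV ?eviX //.
  by move: vi; rewrite eviX => ->; rewrite subr0 => ->.
have b0 : evi K i (lin b) != 0 by apply/eqP => z; apply: (b1); left.
have vb : v (evi K i (lin b)) = 1.
  have h := vge_val b0 (ge1 b bp); apply/eqP; rewrite eq_le h andbT leNgt.
  by apply/negP => h2; apply: (b1); right; rewrite -[2]/(1 + 1) lezD1.
have vbW : v (evi K i (lin b) ^+ k' * evi K i W) = k'.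
  by rewrite place_valM ?expf_neq0 // placeX // vb vW addr0 natz.
by move/(vge_val _): hbW; rewrite vbW; apply; rewrite mulf_neq0 ?expf_neq0.
Qed.

Lemma tangency_mult l b p (k k' e : nat) H W : p != 0 -> l != 0 -> dot l p = 0 ->
    dot b p = 0 -> ~~ (b <= l)%MS -> F = lin l * H + lin b ^+ k' * W -> W \is e.-homog ->
    W.@[p 0] != 0 -> tangency K l p k -> (k <= k')%N.
Proof.
move=> p0 l0 lp bp bl eF hW Wp [v [bv _ sv [i [pi xii]]]] /=; rewrite -evi_lin => f0 vf.
by apply: (contact_mult p0 l0 lp bp bl eF hW Wp bv sv pi f0 vf); left; exact: eviF hF _ xii.
Qed.

(** Every function is a quotient of a form by a product of lines through a fixed
    point o off the curve. *)
Variable o : 'rV[C]_3.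
Hypotheses (Fo : F.@[o 0] != 0) (smF : smooth_form F).

Definition pencil_denominators := forall x : K, exists (A : {mpoly C[3]}) (s : seq 'rV[C]_3),
  [/\ A \is (size s).-homog, forall m, m \in s -> m != 0 /\ dot m o = 0 &
      x = ev K A / \prod_(m <- s) ev K (lin m)].

Hypothesis dn : pencil_denominators.

Lemma line_neq0 m : m != 0 -> dot m o = 0 -> ev K (lin m) != 0.
Proof.
move=> m0 mo; apply/eqP => /(ff_genP K (lin_homog m))[H eH].
have HF0 : H * F != 0 by rewrite -eH lin_eq0.
have [|e [f [ef hH hF']]] := @dhomog_factor _ _ 1 H F _ HF0; first by rewrite -eH lin_homog.
have F0 : F != 0 by apply: contraNneq HF0 => ->; rewrite mulr0.
have fd : f = d by apply: (dhomog_uniq F0 hF' hF).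
have e0 : e = 0%N by move: d_gt0 ef; rewrite fd; clear; lia.
have := congr1 (meval (o 0)) eH; rewrite lin_dot mo mevalM => /esym/eqP.
rewrite mulf_eq0 (negbTE Fo) orbF => Ho; case/eqP: HF0; rewrite (_ : H = 0) ?mul0r //.
apply: mpoly_eq0_eval => w; move: hH Ho; rewrite e0 => hH /eqP.
have const w' : H.@[w'] = H.@[fun=> 0].
  rewrite -[LHS]mul1r -[1](expr0 0) -(dhomog_eval _ _ hH).
  by apply: meval_eq => r; rewrite mul0r.
by rewrite !const.
Qed.

Lemma point_neq0 (G : {mpoly C[3]}) p e : G \is e.-homog -> G.@[p 0] != 0 -> F.@[p 0] = 0 -> ev K G != 0.
Proof.
by move=> hG Gp Fp; apply: contra_neq Gp => h; apply: ev_eq0_at hG h Fp.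
Qed.

Lemma lins_homog (s : seq 'rV[C]_3) : \prod_(m <- s) lin m \is (size s).-homog.
Proof.
elim: s => [|m s IH]; first by rewrite big_nil dhomog1.
by rewrite big_cons -[size _]/(1 + size s)%N; apply: (dhomogM (lin_homog m) IH).
Qed.

Lemma frac_line i x : xi i != 0 -> exists A s, [/\ A \is (size s).-homog,
  forall m, m \in s -> m != 0 /\ dot m o = 0,
  evi K i (\prod_(m <- s) lin m) != 0 & x = evi K i A / evi K i (\prod_(m <- s) lin m)].
Proof.
move=> xi0; have [A [s [hA hs ->]]] := dn x; exists A, s.
have hP := lins_homog s.
have eP : ev K (\prod_(m <- s) lin m) = \prod_(m <- s) ev K (lin m).
  exact: (rmorph_prod (mmap iota xi)).
have x0 : xi i ^+ size s != 0 by rewrite expf_neq0.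
rewrite (evi_form hA xi0) (evi_form hP xi0) eP; split=> //.
  rewrite mulf_neq0 ?invr_eq0 // prodf_seq_neq0; apply/allP => m ms.
  by have [m0 mo] := hs m ms; rewrite line_neq0.
by rewrite -mulf_div divff ?mulr1 // invr_eq0.
Qed.

Section AtPoint.
Variables (p : 'rV[C]_3) (i j k : 'I_3).
Hypotheses (Fp : F.@[p 0] = 0) (pi : p 0 i != 0) (ijk : uniq [:: i; j; k]).
Hypothesis Fk : (F^`M(k)).@[aff p i] != 0.

Local Notation a := (aff p i).
Local Notation evi := (evi K i).
Local Notation tau := (tau K i j a).

Let xi0 : xi i != 0. Proof. exact: xi_neq0 Fp pi. Qed.
Let ai : a i = 1. Proof. exact: aff_id. Qed.
Let Fa : F.@[a] = 0. Proof. by rewrite (form_aff _ _ hF) Fp mulr0. Qed.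
Let p0 : p != 0. Proof. by apply: contraNneq pi => ->; rewrite mxE. Qed.

Definition tau_line : 'rV[C]_3 := \row_l ((l == j)%:R - (l == i)%:R * a j).

Lemma tau_lineE : lin tau_line = 'X_j - (a j)%:MP * 'X_i.
Proof.
rewrite mul_mpolyC /lin; under eq_bigr do rewrite mxE scalerBl -scalerA.
rewrite sumrB (bigD1 j) //= eqxx scale1r big1 ?addr0 => [|l /negbTE ->].
  rewrite (bigD1 i) //= eqxx scale1r big1 ?addr0 => [//|l /negbTE ->].
  by rewrite scale0r.
by rewrite scale0r.
Qed.

Lemma evi_tau_line : evi (lin tau_line) = tau.
Proof.
by rewrite tau_lineE /tau !eviB eviM !eviC !eviX mulfV // mulr1.
Qed.

Lemma bounded_line m : m != 0 -> dot m o = 0 -> bounded_at K i j a (lin m).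
Proof.
move=> m0 mo; have [mp|mp] := eqVneq (dot m p) 0; last first.
  by apply: bounded_unit; rewrite lin_aff_eq0.
have tp : dot tau_line p = 0.
  by rewrite -lin_dot tau_lineE mevalB mevalM mevalC !mevalXU /aff divfK ?subrr.
have [/sub_rVP[c ec]|tm] := boolP (tau_line <= m)%MS.
  exists 1%N, c%:MP, 1; rewrite meval1 oner_eq0; split=> //.
  by rewrite evi1 mulr1 expr1 -evi_tau_line ec linZ -mul_mpolyC eviM mulrC.
have [|n [H [W [eF hW Wp]]]] := local_intersection p0 tp mp m0 tm hF.
  by exists o.
exists n, (- H), W; split; first by rewrite (form_aff_eq0 hW).
have : evi (lin m * H + lin tau_line ^+ n * W) = 0 by rewrite -eF; exact: eviF hF _ xi0.
rewrite eviD !eviM eviXn evi_tau_line => /eqP; rewrite addr_eq0 => /eqP e.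
by rewrite -sub0r eviB evi0 sub0r mulrN e opprK.
Qed.

Lemma line_through q : exists m : 'rV[C]_3, [/\ m != 0, dot m o = 0 & dot m q = 0].
Proof.
have : kermx (col_mx o q)^T != 0.
  rewrite kermx_eq0 /row_free neq_ltn; apply/orP; left.
  by rewrite mxrank_tr ltnS; apply: rank_leq_row.
case/rowV0Pn => m /sub_kermxP e m0; exists m; split=> //.
  have := congr1 (fun A : 'M_(1, 1 + 1) => A 0 (lshift 1 0)) e.
  by rewrite tr_col_mx mul_mx_row row_mxEl !mxE dotE !mxE.
have := congr1 (fun A : 'M_(1, 1 + 1) => A 0 (rshift 1 0)) e.
by rewrite tr_col_mx mul_mx_row row_mxEr !mxE dotE !mxE.
Qed.

Lemma tau_at_neq0 : tau != 0.
Proof.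
have [m [m0 mo mp]] := line_through p.
apply/eqP => t0; have m1 : evi (lin m) != 0.
  rewrite (evi_form (lin_homog m) xi0) mulf_neq0 ?invr_eq0 ?expf_neq0 //.
  exact: line_neq0.
by have := tau_eq0 hF xi0 ai Fa ijk Fk t0 m1; rewrite lin_aff_eq0 // mp eqxx.
Qed.

Definition order_is x (n : int) := exists U H, [/\ U.@[a] != 0, H.@[a] != 0 &
  evi U * x = tau ^ n * evi H].

Lemma order_is_div (x y : K) (n m : int) : y != 0 -> order_is x n -> order_is y m ->
  order_is (x / y) (n - m).
Proof.
move=> y0 [U [H [Ua Ha eA]]] [V [G [Va Ga eP]]]; have t0 := tau_at_neq0.
exists (U * G), (H * V); rewrite !mevalM !mulf_neq0 //; split=> //.
apply: (mulIf y0); apply: (mulfI (expfz_neq0 m t0)).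
rewrite -(mulrA (evi _)) divfK // !mulrA -expfzDr // subrKC eviM.
transitivity (evi U * x * (tau ^ m * evi G)); first by ring.
by rewrite eA -eP eviM; ring.
Qed.

Lemma order_is_exists x : x != 0 -> exists n, order_is x n.
Proof.
move=> x0.
have bP (s : seq 'rV[C]_3) : (forall m, m \in s -> m != 0 /\ dot m o = 0) ->
    bounded_at K i j a (\prod_(m <- s) lin m).
  elim: s => [|m s IH] hs; first by rewrite big_nil; apply: bounded_unit; rewrite meval1 oner_eq0.
  rewrite big_cons; apply: bounded_mul; last by apply: IH => l ls; apply: hs; rewrite inE ls orbT.
  by have [m0 mo] := hs m (mem_head _ _); apply: bounded_line.
have [A [s [_ hs P0 ex]]] := frac_line x xi0.
have [B [t [_ ht Q0 ey]]] := frac_line x^-1 xi0.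
have A0 : evi A != 0 by apply: contraNneq x0; rewrite ex => ->; rewrite mul0r.
have bA : bounded_at K i j a A.
  apply: (@bounded_factor _ _ _ _ _ _ _ B).
  have [N [D [W [Wa e]]]] := bounded_mul (bP s hs) (bP t ht); exists N, D, W; split=> //.
  rewrite -e !eviM; congr (_ * _).
  have := mulfV x0; rewrite ey ex mulf_div => /(canRL (mulfVK _)) -> //.
    by rewrite mul1r.
  by rewrite mulf_neq0.
have [n [U [H [Ua Ha eA]]]] := order_exists hF xi0 ai Fa ijk Fk bA A0.
have [m [V [G [Va Ga eP]]]] := order_exists hF xi0 ai Fa ijk Fk (bP s hs) P0.
exists (n%:Z - m%:Z); rewrite ex; apply: order_is_div P0 _ _; first by exists U, H.
by exists V, G.
Qed.

(** Orders are compared by evaluating at the point. *)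
Lemma order_is_ge x n r U G : order_is x n -> U.@[a] != 0 ->
  evi U * x = tau ^ r * evi G -> r <= n.
Proof.
move=> [V [H [Va Ha e]]] Ua e'; rewrite leNgt; apply/negP => nr.
have t0 := tau_at_neq0.
pose q := `|r - n|%N.
have q0 : q != 0%N by rewrite /q absz_eq0 subr_eq0 gt_eqF.
have eq : tau ^ r = tau ^ n * tau ^+ q.
  by rewrite exprnP -expfzDr // /q abszE ger0_norm ?subr_ge0 1?ltW // subrKC.
have : evi (U * H - ('X_j - (a j)%:MP) ^+ q * G * V) = 0.
  rewrite eviB !eviM eviXn -/tau; apply: (mulfI (expfz_neq0 n t0)); rewrite mulr0 mulrBr.
  rewrite mulrCA -e mulrA mulrA mulrA -eq -e'; ring.
move/(evi_eq0 xi0 ai Fa)/eqP; rewrite mevalB !mevalM rmorphXn /= mevalB mevalXU mevalC subrr.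
rewrite expr0n (negbTE q0) !mul0r subr0 mulf_eq0.
by rewrite (negbTE Ua) (negbTE Ha).
Qed.

Lemma order_is_uniq x n r : order_is x n -> order_is x r -> n = r.
Proof.
move=> hn hr; apply/eqP; rewrite eq_le.
have [U [H [Ua _ e]]] := hn; have [V [G [Va _ e']]] := hr.
by rewrite (order_is_ge hr Ua e) (order_is_ge hn Va e').
Qed.

Definition order x : int := epsilon (inhabits 0) (fun n => order_is x n).

Lemma orderP x : x != 0 -> order_is x (order x).
Proof. by move=> /order_is_exists; apply: epsilon_spec. Qed.

Lemma orderE x n : x != 0 -> order_is x n -> order x = n.
Proof. by move=> /orderP; apply: order_is_uniq. Qed.

Lemma place_exists : exists v : place iota, branch_at v p.
Proof.
have t0 := tau_at_neq0.
have one : (1 : {mpoly C[3]}).@[a] != 0 by rewrite meval1 oner_eq0.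
have vM x y : x != 0 -> y != 0 -> order (x * y) = order x + order y.
  move=> x0 y0; apply: orderE; first by rewrite mulf_neq0.
  have [U [H [Ua Ha e]]] := orderP x0; have [V [G [Va Ga e']]] := orderP y0.
  exists (U * V), (H * G); rewrite !mevalM !mulf_neq0 //; split=> //.
  by rewrite !eviM expfzDr // mulrACA e e' mulrACA.
have vD x y : x != 0 -> y != 0 -> x + y != 0 -> Num.min (order x) (order y) <= order (x + y).
  move=> x0 y0 xy0; wlog le : x y x0 y0 xy0 / order x <= order y.
    move=> h; case/orP: (le_total (order x) (order y)) => le; first exact: h.
    by rewrite addrC minC; apply: h => //; rewrite addrC.
  rewrite min_l //.
  have [U [H [Ua Ha e]]] := orderP x0; have [V [G [Va Ga e']]] := orderP y0.
  pose q := `|order y - order x|%N.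
  apply: (order_is_ge (orderP xy0) (U := U * V)
    (G := H * V + ('X_j - (a j)%:MP) ^+ q * G * U)).
    by rewrite mevalM mulf_neq0.
  have eq : tau ^ order y = tau ^ order x * tau ^+ q.
    by rewrite exprnP -expfzDr // /q abszE ger0_norm ?subr_ge0 // subrKC.
  transitivity (evi U * x * evi V + evi V * y * evi U); first by rewrite eviM; ring.
  rewrite e e' eq.
  rewrite eviD !eviM eviXn -/tau.
  by move: (tau ^ _) (evi H) (evi V) (evi G) (evi U) (tau ^+ q) => *; ring.
have vC c : c != 0 -> order (iota c) = 0.
  move=> c0; apply: orderE; first by rewrite fmorph_eq0.
  by exists 1, c%:MP; split; [exact: one|rewrite mevalC|rewrite evi1 eviC expr0z].
have vt : order tau = 1.
  by apply: orderE => //; exists 1, 1; rewrite evi1 mulr1 mul1r.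
pose v := @Place C K iota order vM vD vC (ex_intro2 _ _ tau t0 vt).
exists v, i; split=> // l; rewrite affine_evi.
have [->|x0] := eqVneq (evi ('X_l - (a l)%:MP)) 0; first by left.
right; have [|U [G [Ua e]]] := parameter_divides hF xi0 ai Fa ijk Fk (G := 'X_l - (a l)%:MP).
  by rewrite mevalB mevalXU mevalC subrr.
by apply: (order_is_ge (orderP x0) Ua); rewrite e expr1z.
Qed.


Lemma branch_order (v : place iota) x n : branch_at v p -> x != 0 -> order_is x n -> v x = n.
Proof.
move=> b x0 [U [H [Ua Ha e]]]; have [_ c] := branch_chart b pi.
have t0 := tau_at_neq0; have vt := val_tau hF xi0 ai Fa ijk Fk c.
have := congr1 v e; rewrite !place_valM ?expfz_neq0 ?(evi_unit xi0 ai Fa Ua) //;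
  last by rewrite (evi_unit xi0 ai Fa Ha).
rewrite (centred_unit c Ua) (centred_unit c Ha) add0r addr0 => ->.
case: n {e} => n; first by rewrite -exprnP placeX // vt natz.
by rewrite NegzE -exprnN placeV ?expf_neq0 // placeX // vt natz.
Qed.

End AtPoint.

Lemma branch_exists p : p != 0 -> F.@[p 0] = 0 -> exists v : place iota, branch_at v p.
Proof.
move=> /rV0Pn[i pi] Fp; have [j [k [u Fk]]] := chart_exists hF d_gt0 smF pi Fp.
exact: place_exists Fp pi u Fk.
Qed.

Lemma branch_uniq (v w : place iota) p : branch_at v p -> branch_at w p ->
  forall x, x != 0 -> w x = v x.
Proof.
move=> bv bw x x0; have Fp := branch_point bv; have [i [pi _ _]] := bv.
have [j [k [u Fk]]] := chart_exists hF d_gt0 smF pi Fp.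
have [n hn] := order_is_exists Fp pi u Fk x0.
by rewrite (branch_order Fp pi u Fk bv x0 hn) (branch_order Fp pi u Fk bw x0 hn).
Qed.

Lemma branch_param (v : place iota) p i : branch_at v p -> p 0 i != 0 ->
  exists j k, [/\ uniq [:: i; j; k], (F^`M(k)).@[aff p i] != 0, tau K i j (aff p i) != 0 &
    v (tau K i j (aff p i)) = 1].
Proof.
move=> b pi; have Fp := branch_point b; have [xi0 c] := branch_chart b pi.
have [j [k [u Fk]]] := chart_exists hF d_gt0 smF pi Fp; exists j, k; split=> //.
  exact: tau_at_neq0 Fp pi u Fk.
apply: (val_tau hF xi0 _ _ u Fk c); first exact: aff_id.
by rewrite (form_aff _ _ hF) Fp mulr0.
Qed.

(** A line whose intersection multiplicity with the curve at p is k, computed on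
    the equation, is met by the branch at p to order k. *)
Lemma tangency_local l b p (k e : nat) H W : p != 0 -> l != 0 -> dot l p = 0 ->
    dot b p = 0 -> ~~ (b <= l)%MS -> F = lin l * H + lin b ^+ k * W -> W \is e.-homog ->
    W.@[p 0] != 0 -> (0 < k)%N -> tangency K l p k.
Proof.
move=> p0 l0 lp bp bl eF hW Wp k0.
have Fp : F.@[p 0] = 0.
  by rewrite eF mevalD !mevalM rmorphXn /= !lin_dot lp bp expr0n gtn_eqF // !mul0r addr0.
have [v bv] := branch_exists p0 Fp; exists v.
have /rV0Pn[i pi] := p0; have [xi0 c] := branch_chart bv pi.
have [j [r [u Fr t0 vt]]] := branch_param bv pi.
split=> //; first by move=> w bw; apply: branch_uniq bv bw.
  by exists i, j; split=> //; rewrite affine_evi -/(tau K i j (aff p i)).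
have Wa : W.@[aff p i] != 0 by rewrite (form_aff_eq0 hW).
have vW := centred_unit c Wa.
have W0 : evi K i W != 0.
  by apply: evi_unit Wa => //; rewrite ?aff_id // (form_aff _ _ hF) Fp mulr0.
have ge1 m : dot m p = 0 -> val_ge v (evi K i (lin m)) 1.
  move=> mp; have [] := centred_diff c (lin m).
  have /eqP -> : (lin m).@[aff p i] == 0 by rewrite lin_aff_eq0 // mp.
  by rewrite mpolyC0 subr0.
exists i => /=; rewrite -evi_lin.
suff [f0 vf] : evi K i (lin l) != 0 /\ v (evi K i (lin l)) = k by [].
have eH : evi K i (lin l) * evi K i H = - (evi K i (lin b) ^+ k * evi K i W).
  apply/eqP; rewrite -addr_eq0 -eviXn -!eviM -eviD -eF; apply/eqP; exact: eviF hF _ xi0.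
have tp : dot (tau_line p i j) p = 0.
  by rewrite -lin_dot tau_lineE mevalB mevalM mevalC !mevalXU /aff divfK ?subrr.
have [x [y exy]] := span_two p0 l0 lp bp tp bl.
have et : tau K i j (aff p i) = iota x * evi K i (lin b) + iota y * evi K i (lin l).
  by rewrite -evi_tau_line // ?(xi_neq0 Fp) // exy eviD !eviM !eviC.
have t2 : val_ge v (evi K i (lin b)) 2 -> val_ge v (evi K i (lin l)) 2 -> False.
  move=> h1 h2; have : val_ge v (tau K i j (aff p i)) 2.
    rewrite et; apply: vgeD; rewrite -[2]add0r; apply: vgeM => //; exact: vge_const.
  by move/(vge_val t0); rewrite vt.
have le2 z : z != 0 -> val_ge v z 1 -> v z = 1 \/ val_ge v z 2.
  move=> z0 /(vge_val z0); rewrite le_eqVlt => /orP[/eqP <-|h]; first by left.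
  by right; right; rewrite -[2]/(1 + 1) lezD1.
have [Ha|Ha] := eqVneq H.@[aff p i] 0; last first.
  have vH := centred_unit c Ha; have H0 : evi K i H != 0.
    by apply: evi_unit Ha => //; rewrite ?aff_id // (form_aff _ _ hF) Fp mulr0.
  have el : evi K i (lin l) = - (evi K i (lin b) ^+ k * evi K i W) / evi K i H.
    by rewrite -eH mulfK.
  have [b0|b0] := eqVneq (evi K i (lin b)) 0.
    case: t2; first by left.
    by left; rewrite el b0 expr0n gtn_eqF // mul0r oppr0 mul0r.
  have l1 : evi K i (lin l) != 0.
    by rewrite el mulf_neq0 ?invr_eq0 ?oppr_eq0 ?mulf_neq0 ?expf_neq0.
  have vl : v (evi K i (lin l)) = v (evi K i (lin b)) *+ k.
    rewrite el place_valM ?placeV ?placeN ?place_valM ?placeX ?oppr_eq0 ?mulf_neq0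
      ?invr_eq0 ?expf_neq0 //.
    by rewrite vH vW subr0 addr0.
  split=> //; rewrite vl; have [->|h] := le2 _ b0 (ge1 b bp); first by rewrite natz.
  case: t2 => //; right; rewrite vl; apply: le_trans (vge_val b0 h) _.
  rewrite -[X in X <= _]mulr1n ler_wpMn2l //.
  by apply: le_trans (vge_val b0 h).
have [k1|k1] := leqP k 1; last first.
  case/eqP: Fr; rewrite eF mderivD !mderivM.
  have la : (lin l).@[aff p i] = 0 by apply/eqP; rewrite lin_aff_eq0 // lp.
  have ba : (lin b).@[aff p i] = 0 by apply/eqP; rewrite lin_aff_eq0 // bp.
  case: k k1 {eF eH k0} => [//|[//|k]] _; rewrite exprS mderivM exprS.
  by rewrite !(mevalD, mevalM) la ba Ha !(mul0r, mulr0, addr0).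
have {k1} k1 : k = 1%N by apply/eqP; rewrite eqn_leq k1.
have hH : val_ge v (evi K i H) 1.
  by have [] := centred_diff c H; rewrite Ha mpolyC0 subr0.
have eb : evi K i (lin b) = - (evi K i (lin l) * evi K i H) / evi K i W.
  by rewrite eH k1 expr1 opprK mulfK.
have b2 n : val_ge v (evi K i (lin l)) n -> val_ge v (evi K i (lin b)) (n + 1).
  move=> h; rewrite eb -[n + 1]addr0; apply: vgeM; first by apply: vgeN; apply: vgeM.
  by right; rewrite placeV // vW.
have l1 : evi K i (lin l) != 0.
  by apply/eqP => z; apply: t2; [apply: (b2 1)|]; left.
split=> //; rewrite k1; have [//|h] := le2 _ l1 (ge1 l lp).
by case: t2 => //; apply: vgeW (b2 _ h).
Qed.

(** Every place is centred at a point of the curve: the forms of positive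
    value include a line through o, and then a second one. *)
Lemma place_center (v : place iota) : exists2 p, p != 0 & branch_at v p.
Proof.
have [i [xi0 ge0]] : exists i, xi i != 0 /\ forall j : 'I_3, val_ge v (xi j / xi i) 0.
  have [m [m0 mo _]] := line_through o; have m1 := line_neq0 m0 mo.
  have [j0 hj0] : exists j0 : 'I_3, xi j0 != 0.
    apply: NNPP => h; case/eqP: m1; rewrite /ev (raddf_sum (mmap iota xi)).
    rewrite big1 // => j _ /=; rewrite mmapZ mmapX mmap1U.
    by have [->|xj] := eqVneq (xi j) 0; [rewrite mulr0|case: h; exists j].
  case: (@Order.TotalTheory.arg_minP _ _ _ j0 (fun j => xi j != 0) (fun j => v (xi j)) hj0).
  move=> i xi0 imin; exists i; split=> // j; have [->|xj] := eqVneq (xi j) 0.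
    by rewrite mul0r; left.
  by right; rewrite place_valM ?invr_eq0 // placeV // subr_ge0 imin.
have [t t0 vt] := place_val_unif v.
have [A [s [hA hs P0 et]]] := frac_line t^-1 xi0.
have g0 G : val_ge v (evi K i G) 0.
  move: G; apply: mpoly_ring_ind => [c|l|p q|p q].
  - by rewrite eviC; apply: vge_const.
  - by rewrite eviX.
  - by rewrite eviD; apply: vgeD.
  - by rewrite eviM => hp hq; rewrite -[0]addr0; apply: vgeM.
have prime x y : val_ge v (x * y) 1 -> val_ge v x 0 -> val_ge v y 0 ->
    val_ge v x 1 \/ val_ge v y 1.
  have [->|x0] := eqVneq x 0; first by left; left.
  have [->|y0] := eqVneq y 0; first by right; left.
  move=> /(vge_val (mulf_neq0 x0 y0)); rewrite place_valM // => h.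
  move=> /(vge_val x0) hx /(vge_val y0) hy.
  have [x1|x1] := leP 1 (v x); first by left; right.
  right; right; apply: le_trans h _; rewrite gerDr.
  by rewrite -(lerD2r 1) add0r -ltzD1 ltrD2r.
have [m ms m1] : exists2 m, m \in s & val_ge v (evi K i (lin m)) 1.
  have : val_ge v (evi K i (\prod_(m <- s) lin m)) 1.
    have A0 : evi K i A != 0.
      by apply: contraNneq t0 => z; rewrite -invr_eq0 et z mul0r.
    have := congr1 v et; rewrite place_valM ?invr_eq0 // !placeV // vt => e.
    right; have := vge_val A0 (g0 A); move: e; move: (v _) (v _) => x y.
    by clear; lia.
  elim: s {hA hs P0 et} => [|m s IH].
    by rewrite big_nil evi1 => /(vge_val (oner_neq0 _)); rewrite place1.
  rewrite big_cons eviM => /prime/(_ (g0 _) (g0 _))[h|/IH[l ls hl]]; first by exists m; rewrite ?mem_head.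
  by exists l; rewrite // inE ls orbT.
have [m0 mo] := hs m ms.
have cst c x : val_ge v x 1 -> val_ge v (iota c * x) 1.
  by move=> h; rewrite -[1]add0r; apply: vgeM => //; apply: vge_const.
have centre p L : (forall j : 'I_3, val_ge v (evi K i ('X_j - (p 0 j)%:MP * L)) 1) ->
    p 0 i != 0 /\ branch_at v p.
  move=> h; have hi := h i; rewrite eviB eviX divff // eviM eviC in hi.
  have pi : p 0 i != 0.
    apply/eqP => z; move: hi; rewrite z rmorph0 mul0r subr0.
    by move/(vge_val (oner_neq0 _)); rewrite place1.
  split=> //; exists i; split=> // j; rewrite affine_evi.
  have -> : evi K i ('X_j - (aff p i j)%:MP) = evi K i ('X_j - (p 0 j)%:MP * L)
      - iota (aff p i j) * (1 - iota (p 0 i) * evi K i L).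
    rewrite mulrBr mulr1 mulrA -rmorphM /aff divfK // !eviB eviM !eviC; ring.
  by apply: vgeB => //; apply: cst.
have o0 : o != 0.
  apply: contraNneq Fo => z; rewrite (@meval_eq _ _ _ (fun j => 0 * o 0 j)); last first.
    by move=> j; rewrite mul0r z mxE.
  by rewrite (dhomog_eval _ _ hF) expr0n gtn_eqF // mul0r.
have [M [uM r2 r0]] := frame_through o0 mo m0.
have [g [sg gE [G eF]]] := restrict_plane uM hF; rewrite r2 in eF.
have XE (j : 'I_3) : 'X_j = (o 0 j)%:MP * lin (row 0 M) + (dualmx M 1 j)%:MP * lin (row 1 M)
    + (dualmx M 2%:R j)%:MP * lin m :> {mpoly C[3]}.
  have -> : o 0 j = dualmx M 0 j by rewrite -r0 mxE.
  by rewrite {1}(frame_linE j uM) sum3 -!mul_mpolyC r2.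
pose a := evi K i (lin (row 0 M)); pose b := evi K i (lin (row 1 M)).
have b1 : val_ge v b 1 -> False.
  move=> hb; have [|_ /branch_point/eqP] := centre o (lin (row 0 M)); last exact/negP.
  move=> j; have -> : 'X_j - (o 0 j)%:MP * lin (row 0 M) =
      (dualmx M 1 j)%:MP * lin (row 1 M) + (dualmx M 2%:R j)%:MP * lin m by rewrite XE; ring.
  rewrite eviD !eviM !eviC.
  by apply: vgeD; apply: cst.
have b0 : b != 0 by apply/eqP => z; apply: b1; left.
have vb : v b = 0.
  apply/eqP; rewrite eq_le (vge_val b0 (g0 _)) andbT leNgt; apply/negP => h.
  by apply: b1; right; rewrite -gtz0_ge1.
have [r hr] : exists r, val_ge v (a - iota r * b) 1.
  pose q := \poly_(k < d.+1) g`_(d - k).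
  have q0 : q != 0.
    apply: contraNneq Fo => qz; have := congr1 (fun f : {poly C} => f`_d) qz.
    rewrite coef_poly ltnSn subnn coef0 -horner_coef0 gE scale0r addr0 r0 => ->.
    by [].
  have eq : (map_poly iota q).[a / b] * b ^+ d = - (evi K i (lin m) * evi K i G).
    apply/eqP; rewrite -addr_eq0 -eviM.
    apply/eqP; rewrite -[RHS](eviF hF xi0).
    transitivity (evi K i (\sum_(k < d.+1) g`_k *:
      (lin (row 1 M) ^+ k * lin (row 0 M) ^+ (d - k)) + lin m * G)); last by rewrite -eF.
    rewrite eviD evi_sum; congr (_ + _).
    rewrite (@horner_coef_wide _ d.+1); last by rewrite size_map_poly size_poly.
    rewrite mulr_suml (reindex_inj rev_ord_inj); apply: eq_bigr => k _ /=.
    rewrite coef_map coef_poly subSS ltnS leq_subr subKn; last by rewrite -ltnS.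
    rewrite -mul_mpolyC !eviM eviC !eviXn -/a -/b -mulrA; congr (_ * _).
    have -> : b ^+ d = b ^+ k * b ^+ (d - k) by rewrite -exprD subnKC // -ltnS.
    by rewrite mulrCA -exprMn divfK.
  have : val_ge v (map_poly iota q).[a / b] 1.
    have -> : (map_poly iota q).[a / b] = - (evi K i (lin m) * evi K i G) * (b ^+ d)^-1.
      by rewrite -eq mulfK ?expf_neq0.
    rewrite -[1]addr0; apply: vgeM.
      by apply: vgeN; rewrite -[1]addr0; apply: vgeM.
    by right; rewrite placeV ?expf_neq0 // placeX // vb mul0rn.
  have [rs ->] := closed_field_poly_normal q.
  rewrite map_polyZ hornerZ => h.
  have {h} : val_ge v (map_poly iota (\prod_(z <- rs) ('X - z%:P))).[a / b] 1.
    set x := _.[_] in h *; have l0 : iota (lead_coef q) != 0.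
      by rewrite fmorph_eq0 lead_coef_eq0.
    by rewrite -[x](mulKf l0) -fmorphV; apply: cst.
  have vab : val_ge v (a / b) 0.
    rewrite -[0]addr0; apply: vgeM; first exact: g0.
    by right; rewrite placeV // vb.
  have vr r : val_ge v (a / b - iota r) 0 by apply: vgeB => //; apply: vge_const.
  elim: rs => [|r rs IH].
    by rewrite big_nil rmorph1 hornerC => /(vge_val (oner_neq0 _)); rewrite place1.
  rewrite big_cons rmorphM /= map_polyXsubC hornerM hornerXsubC.
  have prod0 : val_ge v (map_poly iota (\prod_(z <- rs) ('X - z%:P))).[a / b] 0.
    elim: rs {IH} => [|z rs IH].
      by rewrite big_nil rmorph1 hornerC; right; rewrite place1.
    rewrite big_cons rmorphM /= map_polyXsubC hornerM hornerXsubC.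
    by rewrite -[0]addr0; apply: vgeM.
  move=> /prime/(_ (vr r) prod0)[h|/IH //]; exists r.
  have -> : a - iota r * b = (a / b - iota r) * b by rewrite mulrBl divfK.
  by rewrite -[1]addr0; apply: vgeM => //; right; rewrite vb.
pose p := r *: o + row 1 (dualmx M).
have [j|pi bp] := centre p (lin (row 1 M)).
  have -> : 'X_j - (p 0 j)%:MP * lin (row 1 M) =
      (o 0 j)%:MP * (lin (row 0 M) - r%:MP * lin (row 1 M)) + (dualmx M 2%:R j)%:MP * lin m.
    by rewrite XE /p !mxE mpolyCD mpolyCM; ring.
  rewrite eviD !eviM !eviC eviB eviM eviC.
  by apply: vgeD; apply: cst.
by exists p => //; apply: contraNneq pi => ->; rewrite mxE.
Qed.

End Curve.
End Branches.


Section ResidueField.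
Local Open Scope ring_scope.

Lemma residue_field (k : fieldType) (p : {poly k}) : p \is monic -> irreducible_poly p ->
  exists (K : fieldType) (psi : {rmorphism {poly k} -> K}),
    (forall q, psi q = 0 <-> p %| q) /\ forall x, exists q, x = psi q.
Proof.
move=> mp ip; pose K : fieldType := {poly %/ p with (ip, mp)}.
have e : mk_monic p = p by rewrite /mk_monic ip.1 mp.
pose f (q : {poly k}) : K := in_qpoly p q.
have fB : zmod_morphism f.
  by move=> q r; rewrite /f -[- r]scaleN1r in_qpolyD in_qpolyZ scaleN1r.
have fM : monoid_morphism f.
  by split=> [|q r]; rewrite /f ?in_qpoly1 // in_qpolyM.
pose fadd := GRing.isZmodMorphism.Build _ _ f fB.
pose fmul := GRing.isMonoidMorphism.Build _ _ f fM.
pose psi : {rmorphism {poly k} -> K} := HB.pack f fadd fmul.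
have fE q : f q = q %% p :> {poly k}.
  by rewrite /f /= e; rewrite Pdiv.IdomainMonic.modpE.
exists K, psi; split=> [q|x]; last first.
  exists (val x); apply: val_inj; apply/esym; apply: etrans (fE _) _; rewrite modp_small //.
  by apply: leq_trans (size_mk_monic x) _; rewrite e.
rewrite -[psi q]/(f q) /dvdp -fE; split=> [->|/eqP h]; last exact: val_inj.
by apply/eqP.
Qed.

Lemma frac_repr (R : idomainType) (x : {fraction R}) : exists n m : R, m != 0 /\ x = FracField.tofrac n / FracField.tofrac m.
Proof.
elim/generic_quotient.quotW: x => x; exists (\n_x), (\d_x); split; first exact: denom_ratioP.
have d0 : FracField.tofrac \d_x != 0 by rewrite tofrac_eq0; exact: denom_ratioP.
apply: (mulIf d0); rewrite divfK //.
unlock FracField.tofrac.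
rewrite -[LHS]FracField.pi_mul.
apply/generic_quotient.eqmodP; rewrite /= FracField.equivfE /FracField.mulf !numden_Ratio ?mulr1 ?oner_eq0 ?mulf_neq0 //;
rewrite ?denom_ratioP //. 
by rewrite mulrC.
Qed.

Lemma eqp_mul_const (k : fieldType) (q h : {poly k}) : h != 0 -> (size h <= 1)%N ->
  q %= h * q.
Proof.
move=> h0 /size1_polyC eh; move: h0; rewrite eh polyC_eq0 => c0.
by rewrite mul_polyC eqp_sym eqp_scale.
Qed.

Lemma monic_associate (k : fieldType) (f : {poly k}) : irreducible_poly f ->
  exists p, [/\ p \is monic, irreducible_poly p & forall q, (p %| q) = (f %| q)].
Proof.
move=> [s1 h]; have f0 : f != 0 by rewrite -size_poly_gt0 (ltn_trans _ s1).
have l0 : lead_coef f != 0 by rewrite lead_coef_eq0.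
exists ((lead_coef f)^-1 *: f); split=> [||q].
- by rewrite monicE lead_coefZ mulVf.
- split=> [|q q1]; first by rewrite size_scale ?invr_eq0.
  rewrite dvdpZr ?invr_eq0 // => /(h q q1) e; apply: eqp_trans e _.
  by rewrite eqp_sym eqp_scale ?invr_eq0.
by rewrite dvdpZl ?invr_eq0.
Qed.

Lemma rmorph_unit_const (k K : fieldType) (psi : {rmorphism {poly k} -> K}) (a : k) :
  a != 0 -> psi a%:P != 0.
Proof.
move=> a0; apply/eqP => z; have := rmorph1 psi.
by rewrite -polyC1 -(mulfV a0) polyCM rmorphM z mul0r => /eqP; rewrite eq_sym oner_eq0.
Qed.

Lemma rmorph_scale (k K : fieldType) (psi : {rmorphism {poly k} -> K}) (a : k) q :
  psi a%:P != 0 -> psi q = psi (a *: q) / psi a%:P.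
Proof. by move=> a0; rewrite -mul_polyC rmorphM mulrAC mulfV // mul1r. Qed.

End ResidueField.

Section Existence.
Local Open Scope ring_scope.
Variable C : numClosedFieldType.

Local Notation frac := {fraction {poly C}}.

Local Notation tofrac := (@FracField.tofrac {poly C}).

Lemma clear_denominators (q : {poly frac}) : exists (c : {poly C}) (q0 : {poly {poly C}}),
  c != 0 /\ map_poly tofrac q0 = tofrac c *: q.
Proof.
elim/poly_ind: q => [|q x [c [q0 [c0 e]]]].
  by exists 1, 0; rewrite oner_eq0 rmorph0 scaler0.
have [n [m [m0 ->]]] := frac_repr x; exists (m * c), (m *: q0 * 'X + (n * c)%:P).
rewrite mulf_neq0 //; split=> //.
have tm : tofrac m != 0 by rewrite tofrac_eq0.
rewrite rmorphD rmorphM /= map_polyX map_polyZ map_polyC /= e.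
rewrite scalerDr !tofracM -scalerA; congr (_ + _); first by rewrite -!scalerAl.
have ar (T : fieldType) (a b z : T) : b != 0 -> (z * a)%:P = (b * a) *: (z / b)%:P.
  by move=> b0; rewrite -mul_polyC -polyCM [b * _]mulrC mulrACA mulfV // mulr1 mulrC.
exact: ar.
Qed.

Lemma tofrac_poly_inj : injective (map_poly tofrac : {poly {poly C}} -> {poly frac}).
Proof.
by apply: map_inj_poly; [move=> x y /eqP; rewrite tofrac_eq => /eqP|exact: tofrac0].
Qed.

(** The affine chart X_2 = 1, with the coordinate X_1 as main variable. *)
Definition chart_coord (j : 'I_3) : {poly {poly C}} :=
  if j == 0 then ('X)%:P else if j == 1 then 'X else 1.

Definition chart (G : {mpoly C[3]}) : {poly {poly C}} :=
  mmap (polyC \o polyC) chart_coord G.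

Lemma chartM G H : chart (G * H) = chart G * chart H.
Proof. exact: (rmorphM (mmap _ _)). Qed.
Lemma chartB G H : chart (G - H) = chart G - chart H.
Proof. exact: (rmorphB (mmap _ _)). Qed.
Lemma chart_prod (I : Type) (s : seq I) (f : I -> {mpoly C[3]}) :
  chart (\prod_(i <- s) f i) = \prod_(i <- s) chart (f i).
Proof. exact: (rmorph_prod (mmap _ _)). Qed.
Lemma chartC c : chart c%:MP = c%:P%:P.
Proof. exact: mmapC. Qed.
Lemma chartX j : chart 'X_j = chart_coord j.
Proof. by rewrite /chart mmapX mmap1U. Qed.

Lemma chart_eval G x y : (chart G).[y%:P].[x] =
  G.@[fun j : 'I_3 => if j == 0 then x else if j == 1 then y else 1].
Proof.
move: G; apply: mpoly_ring_ind => [c|j|p q|p q].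
- by rewrite chartC mevalC !hornerC.
- rewrite chartX mevalXU /chart_coord; case: (j == 0); first by rewrite hornerC hornerX.
  by case: (j == 1); rewrite ?hornerX !hornerC.
- by rewrite /chart mmapD mevalD !hornerD => -> ->.
- by rewrite chartM mevalM !hornerM => -> ->.
Qed.

Lemma chart_form_eq0 e (G : {mpoly C[3]}) : G \is e.-homog -> chart G = 0 -> G = 0.
Proof.
move=> hG z; have z0 : delta_mx 0 2%:R != 0 :> 'rV[C]_3.
  by apply/rV0Pn; exists 2%:R; rewrite mxE !eqxx oner_eq0.
apply: (mpoly_ext_off_plane z0) => p; rewrite {1}/dot sum3 !mxE /= !mul0r !add0r mul1r => p2.
rewrite meval0; have := chart_eval G (p 0 0 / p 0 2%:R) (p 0 1 / p 0 2%:R).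
rewrite z !hornerC => e0; have /eqP : G.@[p 0] = p 0 2%:R ^+ e * 0.
  rewrite e0 -(dhomog_eval _ _ hG); apply: meval_eq; apply: ord3_cases => /=.
  - by rewrite mulrCA mulfV ?mulr1.
  - by rewrite mulrCA mulfV ?mulr1.
  - by rewrite mulr1.
by rewrite mulr0 => /eqP.
Qed.

Lemma chart_surj (q : {poly {poly C}}) : exists e (G : {mpoly C[3]}),
  G \is e.-homog /\ chart G = q.
Proof.
suff [G0 <-] : exists G, chart G = q.
  have [e [H [hH eH]]] := homogenization G0 2%:R; exists e, H; split=> //.
  exact: (eH {poly {poly C}} (polyC \o polyC) chart_coord).
elim/poly_ind: q => [|q c [G <-]]; first by exists 0; rewrite /chart mmap0.
have [H eH] : exists H, chart H = c%:P.
  elim/poly_ind: c => [|c a [H eH]]; first by exists 0; rewrite /chart mmap0.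
  exists (H * 'X_0 + a%:MP); rewrite /chart mmapD -!/(chart _) chartM chartX chartC eH.
  by rewrite -polyCM -polyCD.
by exists (G * 'X_1 + H); rewrite /chart mmapD -!/(chart _) chartM chartX eH.
Qed.

Definition e1 : 'rV[C]_3 := delta_mx 0 1.

(** A form of degree e has degree at most e in the main variable, with constant
    coefficient its value at the point e1 at infinity. *)
Lemma chart_lead e (G : {mpoly C[3]}) : G \is e.-homog ->
  (size (chart G) <= e.+1)%N /\ (chart G)`_e = (G.@[e1 0])%:P.
Proof.
move=> /dhomogP hG; rewrite /chart /mmap [G.@[_]]mevalE.
have p3 (T : comNzRingType) (f : 'I_3 -> T) : \prod_i f i = f 0 * f 1 * f 2%:R.
  by rewrite !big_ord_recl big_ord0 mulr1 mulrA; congr (_ * f _ * f _); exact: val_inj.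
have hm m : mdeg m = e -> (size (mmap1 chart_coord m) <= e.+1)%N /\
    (mmap1 chart_coord m)`_e = (\prod_j e1 0 j ^+ m j)%:P.
  move=> me; have {}me : (m 0%R + m 1%R + m 2%:R%R = e)%N by rewrite -me mdegE sum3.
  rewrite /mmap1 !p3 /chart_coord /= expr1n mulr1 !mxE /= expr1n mulr1 -polyC_exp mul_polyC.
  split.
    apply: leq_trans (size_scale_leq _ _) _; rewrite size_polyXn ltnS -me.
    by rewrite -addnA addnCA leq_addr.
  have ar u v w : (u + v + w == v)%N = (u == 0%N) && (w == 0%N) by clear; lia.
  rewrite coefZ coefXn -me ar !expr0n.
  case: (m 0 =P 0%N) => [->|_] /=; last by rewrite ?(mulr0, mul0r).
  by case: (m 2%:R == 0%N); rewrite ?expr0 ?expr1n ?(mul1r, mulr1).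
split.
  rewrite big_seq; apply: (big_ind (fun q : {poly {poly C}} => size q <= e.+1)%N).
  - by rewrite size_poly0.
  - by move=> p q sp sq; apply: leq_trans (size_polyD _ _) _; rewrite geq_max sp.
  move=> m mG; rewrite mul_polyC; apply: leq_trans (size_scale_leq _ _) _.
  by have [] := hm _ (hG _ mG).
rewrite coef_sum rmorph_sum /= big_seq [RHS]big_seq; apply: eq_bigr => m mG.
have [_ e0] := hm _ (hG _ mG).
by rewrite mul_polyC coefZ e0 -polyCM.
Qed.


Definition pencil (s : seq 'rV[C]_3) := forall m, m \in s -> m != 0 /\ dot m e1 = 0.
Local Notation lines s := (\prod_(m <- s) lin m).

Lemma dot_e1 m : dot m e1 = m 0 1.
Proof.
rewrite /dot (bigD1 1) //= mxE !eqxx mulr1 big1 ?addr0 // => j /negbTE j1.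
by rewrite mxE j1 andbF mulr0.
Qed.

Lemma pencil_cat s t : pencil s -> pencil t -> pencil (s ++ t).
Proof. by move=> hs ht m; rewrite mem_cat => /orP[/hs|/ht]. Qed.

Definition line_z : 'rV[C]_3 := delta_mx 0 2%:R.

Lemma line_zE : lin line_z = 'X_2%:R.
Proof.
rewrite /lin (bigD1 2%:R) //= mxE !eqxx scale1r big1 ?addr0 // => j /negbTE j1.
by rewrite mxE j1 andbF scale0r.
Qed.

Lemma pencil_z n : pencil (nseq n line_z).
Proof.
move=> m /nseqP[-> _]; rewrite dot_e1 mxE; split=> //.
by apply/rV0Pn; exists 2%:R; rewrite mxE !eqxx oner_eq0.
Qed.

Lemma lines_z n : lines (nseq n line_z) = 'X_2%:R ^+ n.
Proof. by rewrite big_nseq line_zE -Monoid.iteropE. Qed.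

Lemma chart_z n : chart ('X_2%:R ^+ n) = 1.
Proof.
have -> : chart ('X_2%:R ^+ n) = chart 'X_2%:R ^+ n by exact: (rmorphXn (mmap _ _)).
by rewrite chartX expr1n.
Qed.

Lemma chart_lin m : dot m e1 = 0 -> chart (lin m) = (m 0 0 *: 'X + (m 0 2%:R)%:P)%:P.
Proof.
rewrite dot_e1 => m1; rewrite /lin sum3 m1 scale0r addr0 -!mul_mpolyC.
rewrite /chart mmapD -!/(chart _) !chartM !chartC !chartX /chart_coord /=.
by rewrite mulr1 -polyCM -polyCD mul_polyC.
Qed.

Lemma chart_lines s : pencil s -> exists c, chart (lines s) = c%:P.
Proof.
elim: s => [|m s IH] hs; first by exists 1; rewrite big_nil -[1]/(1%:MP) chartC.
have [_ m1] := hs m (mem_head _ _); have [c e] := IH (fun l ls => hs l (mem_behead (s:=m::s) ls)).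
by eexists; rewrite big_cons chartM e chart_lin // -polyCM.
Qed.

Lemma lines_chart (c : {poly C}) : c != 0 -> exists k s,
  [/\ k != 0, pencil s & chart (lines s) = (k *: c)%:P].
Proof.
move=> c0; have [rs ec] := closed_field_poly_normal c.
have l0 : lead_coef c != 0 by rewrite lead_coef_eq0.
pose m a : 'rV[C]_3 := \row_j (if j == 0 then 1 else if j == 1 then 0 else - a).
exists (lead_coef c)^-1, [seq m a | a <- rs]; rewrite invr_eq0; split=> //.
  move=> _ /mapP[a _ ->]; rewrite dot_e1 mxE; split=> //.
  by apply/rV0Pn; exists 0; rewrite mxE oner_eq0.
rewrite {2}ec scalerA mulVf // scale1r big_map chart_prod rmorph_prod; apply: eq_bigr => a _.
by rewrite chart_lin ?dot_e1 !mxE //= scale1r polyCN.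
Qed.

Lemma chart_form_eq e f (P Q : {mpoly C[3]}) : P \is e.-homog -> Q \is f.-homog ->
  chart P = chart Q -> P * 'X_2%:R ^+ f = Q * 'X_2%:R ^+ e.
Proof.
move=> hP hQ h; apply/eqP; rewrite -subr_eq0; apply/eqP.
have hX n : ('X_2%:R ^+ n : {mpoly C[3]}) \is n.-homog.
  by rewrite -lines_z -{2}(size_nseq n line_z) lins_homog.
have hPQ : P * 'X_2%:R ^+ f - Q * 'X_2%:R ^+ e \is (e + f).-homog.
  by apply: rpredB; [|rewrite addnC]; apply: dhomogM.
by apply: (chart_form_eq0 hPQ); rewrite chartB !chartM !chart_z !mulr1 h subrr.
Qed.

Lemma lines_split F s G H : pencil s -> G * H = F * lines s ->
  exists s1 s2 G' H', [/\ pencil s1, pencil s2, G = G' * lines s1, H = H' * lines s2 &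
    G' * H' = F].
Proof.
elim: s G H => [|m s IH] G H hs e.
  exists [::], [::], G, H; rewrite !big_nil !mulr1 e big_nil mulr1.
  by split=> // m; rewrite in_nil.
have [m0 m1] := hs m (mem_head _ _).
have hs' : pencil s by move=> l ls; apply: hs; rewrite inE ls orbT.
have L0 : lin m != 0 by rewrite lin_eq0.
have hm t : pencil t -> pencil (m :: t).
  by move=> ht l; rewrite inE => /orP[/eqP ->|/ht].
have [|[G1 eG]|[H1 eH]] := linear_prime (F:=G) (G:=H) (H:=F * lines s) m0.
- by rewrite e big_cons mulrCA.
- have [|s1 [s2 [G' [H' [p1 p2 e1' e2 e3]]]]] := IH G1 H hs'.
    by apply: (mulfI L0); rewrite mulrA -eG e big_cons mulrCA.
  exists (m :: s1), s2, G', H'; split=> //; first exact: hm.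
  by rewrite big_cons mulrCA -e1'.
have [|s1 [s2 [G' [H' [p1 p2 e1' e2 e3]]]]] := IH G H1 hs'.
  by apply: (mulfI L0); rewrite mulrCA -eH e big_cons mulrCA.
exists s1, (m :: s2), G', H'; split=> //; first exact: hm.
by rewrite big_cons mulrCA -e2.
Qed.

Lemma lines_cancel F s G H : F.@[e1 0] != 0 -> pencil s -> G * lines s = H * F ->
  exists H', G = H' * F.
Proof.
move=> Fe; elim: s H => [|m s IH] H hs e; first by exists H; rewrite -e big_nil mulr1.
have [m0 m1] := hs m (mem_head _ _).
have [|[H1 eH]|[F1 eF]] := linear_prime (F:=H) (G:=F) (H:=G * lines s) m0.
- by rewrite -e big_cons mulrCA.
- apply: (IH H1) => [l ls|]; first by apply: hs; rewrite inE ls orbT.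
  have L0 : lin m != 0 by rewrite lin_eq0.
  by apply: (mulfI L0); rewrite mulrCA [RHS]mulrA -eH -e big_cons.
by case/eqP: Fe; rewrite eF mevalM lin_dot m1 mul0r.
Qed.

Local Notation Phi G := (map_poly tofrac (chart G)).

Lemma frac_form (q : {poly frac}) : exists e (H : {mpoly C[3]}) s a,
  [/\ H \is e.-homog, pencil s, a != 0, Phi (lines s) = a%:P & a *: q = Phi H].
Proof.
have [c [q0 [c0 eq]]] := clear_denominators q.
have [k [s [k0 hs es]]] := lines_chart c0.
have [e [H [hH eH]]] := chart_surj q0.
exists e, (k%:MP * H), s, (tofrac (k *: c)); split=> //.
- by rewrite mul_mpolyC rpredZ.
- by rewrite tofrac_eq0 scaler_eq0 negb_or k0.
- by rewrite es map_polyC.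
rewrite chartM chartC eH rmorphM /= map_polyC /= eq.
by rewrite -[k *: c]mul_polyC tofracM -scalerA mul_polyC.
Qed.

Lemma PhiM G H : Phi (G * H) = Phi G * Phi H.
Proof. by rewrite chartM rmorphM. Qed.

Lemma Phi_divides F G d e : F \is d.-homog -> F.@[e1 0] != 0 -> G \is e.-homog ->
  Phi F %| Phi G -> mpoly_dvd F G.
Proof.
move=> hF Fe hG /dvdpP[q eG]; have [f [H [s [a [hH hs a0 ea eq]]]]] := frac_form q.
have : chart (G * lines s) = chart (H * F).
  by apply: tofrac_poly_inj; rewrite !PhiM ea -eq eG mulrC mul_polyC scalerAl.
move/(chart_form_eq (dhomogM hG (lins_homog s)) (dhomogM hH hF)).
rewrite mulrAC -(mulrA G) -lines_z -big_cat [H * F * _]mulrAC => E.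
by apply: (lines_cancel Fe _ E); apply: pencil_cat => //; apply: pencil_z.
Qed.


Lemma Phi_lead F d : F \is d.-homog -> F.@[e1 0] != 0 ->
  size (Phi F) = d.+1 /\ lead_coef (Phi F) = tofrac (F.@[e1 0])%:P.
Proof.
move=> hF Fe; have [sz ld] := chart_lead hF.
have s1 : size (chart F) = d.+1.
  apply/eqP; rewrite eqn_leq sz ltnNge; apply/negP => h.
  move: Fe; rewrite -(polyC_eq0 (F.@[e1 0])) -ld nth_default ?eqxx //.
have inj : injective tofrac by move=> x y /eqP; rewrite tofrac_eq => /eqP.
rewrite (size_map_inj_poly inj (tofrac0 _)) s1; split=> //.
by rewrite (lead_coef_map_inj inj (tofrac0 _)) lead_coefE s1 ld.
Qed.

Lemma Phi_irreducible F d : F \is d.-homog -> F.@[e1 0] != 0 -> mpoly_irreducible F ->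
  (0 < d)%N -> irreducible_poly (Phi F).
Proof.
move=> hF Fe [_ irF] d0; have [sF _] := Phi_lead hF Fe.
split=> [|q q1 /dvdpP[h eF]]; first by rewrite sF.
have F0 : Phi F != 0 by rewrite -size_poly_eq0 sF.
have h0 : h != 0 by apply: contraNneq F0 => z; rewrite eF z mul0r.
have q0 : q != 0 by apply: contraNneq F0 => z; rewrite eF z mulr0.
have [f1 [H1 [s1 [a1 [hH1 p1 a10 e1' eq1]]]]] := frac_form q.
have [f2 [H2 [s2 [a2 [hH2 p2 a20 e2' eq2]]]]] := frac_form h.
have E : chart (H1 * H2) = chart (F * \prod_(m <- s1 ++ s2) lin m).
  apply: tofrac_poly_inj; rewrite !PhiM big_cat PhiM e1' e2' -eq1 -eq2 eF.
  have ar (T : fieldType) (a b : T) (q' h' : {poly T}) :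
      a *: q' * (b *: h') = h' * q' * (a%:P * b%:P).
    by rewrite -polyCM -!mul_polyC polyCM mulrACA mulrC [q' * _]mulrC.
  exact: ar.
move/(chart_form_eq (dhomogM hH1 hH2) (dhomogM hF (lins_homog _))): E.
rewrite -(mulrA F) -!lines_z -big_cat -mulrA => E.
have [|t1 [t2 [G1 [G2 [q1' q2' eH1 eH2 eG]]]]] := lines_split _ E.
  by apply: pencil_cat; [apply: pencil_cat|apply: pencil_z].
have small G s : (msize G <= 1)%N -> pencil s ->
    (size (Phi (G * \prod_(m <- s) lin m)) <= 1)%N.
  move=> /msize1_polyC -> hs; have [c ec] := chart_lines hs.
  by rewrite chartM chartC ec -polyCM map_polyC size_polyC_leq1.
have sza (a : frac) (r : {poly frac}) : a != 0 -> size (a *: r) = size r.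
  by move=> a0; rewrite size_scale.
case: (irF _ _ (esym eG)) => /small sm.
  have sq : (size (a1 *: q) <= 1)%N by rewrite eq1 eH1; exact: sm q1'.
  rewrite (sza _ _ a10) in sq.
  by move: q0 q1 sq; rewrite -size_poly_eq0; case: (size q) => [|[|]].
have sh : (size h <= 1)%N.
  rewrite -(sza _ _ a20) eq2; have := sm _ q2'; rewrite -eH2 chartM.
  by rewrite lines_z chart_z mulr1.
by rewrite eF; apply: eqp_mul_const.
Qed.

Lemma function_field_exists F d : F \is d.-homog -> (0 < d)%N -> F.@[e1 0] != 0 ->
  mpoly_irreducible F -> exists K : function_field F, pencil_denominators K e1.
Proof.
move=> hF d0 Fe irF.
have [p [mp ip dp]] := monic_associate (Phi_irreducible hF Fe irF d0).
have [K [psi [psi0 psiS]]] := residue_field mp ip.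
pose iota : {rmorphism C -> K} := psi \o (polyC \o (tofrac \o polyC)).
pose xi j : K := psi (Phi 'X_j).
have evE G : mmap iota xi G = psi (Phi G).
  move: G; apply: mpoly_ring_ind => [c|j|r q er eq|r q er eq].
  - by rewrite mmapC chartC map_polyC.
  - by rewrite mmapX mmap1U.
  - by rewrite mmapD er eq /chart mmapD !rmorphD.
  - by rewrite rmorphM /= er eq PhiM rmorphM.
have gP e (G : {mpoly C[3]}) : G \is e.-homog -> (mmap iota xi G = 0 <-> mpoly_dvd F G).
  move=> hG; rewrite evE psi0 dp; split; first exact: Phi_divides hF Fe hG.
  by move=> [H ->]; rewrite PhiM dvdp_mull.
have frac x : exists (A : {mpoly C[3]}) (s : seq 'rV[C]_3),
    [/\ A \is (size s).-homog, pencil s, mmap iota xi (\prod_(m <- s) lin m) != 0 &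
        x = mmap iota xi A / mmap iota xi (\prod_(m <- s) lin m)].
  have [q ->] := psiS x; have [e [H [s [a [hH hs a0 ea eq]]]]] := frac_form q.
  have za := rmorph_unit_const psi a0.
  have es : mmap iota xi (\prod_(m <- s ++ nseq e line_z) lin m) = psi a%:P.
    by rewrite evE big_cat chartM lines_z chart_z mulr1 ea.
  exists (H * \prod_(m <- nseq (size s) line_z) lin m), (s ++ nseq e line_z).
  rewrite es size_cat size_nseq addnC; split=> //.
  - by apply: dhomogM => //; rewrite -{2}(size_nseq (size s) line_z) lins_homog.
  - by apply: pencil_cat => //; apply: pencil_z.
  by rewrite (rmorph_scale _ za) evE chartM lines_z chart_z mulr1 eq.
have fP x : exists e (G H : {mpoly C[3]}),
    [/\ G \is e.-homog, H \is e.-homog, mmap iota xi H != 0 &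
        x = mmap iota xi G / mmap iota xi H].
  have [A [s [hA hs n0 ->]]] := frac x.
  by exists (size s), A, (\prod_(m <- s) lin m); split=> //; apply: lins_homog.
exists (FunctionField gP fP) => x; have [A [s [hA hs _ ->]]] := frac x.
exists A, s; split=> //; congr (_ / _); exact: (rmorph_prod (mmap iota xi)).
Qed.

End Existence.


Section BoundedFunctions.
Local Open Scope ring_scope.
Variable C : numClosedFieldType.
Implicit Types (p l m b w : 'rV[C]_3) (i j k : 'I_3).

Lemma poly_ext (p q : {poly C}) : (forall t, p.[t] = q.[t]) -> p = q.
Proof.
move=> h; apply/eqP; rewrite -subr_eq0; apply/contraT => n0.
have := max_poly_roots n0 (rs := [seq n%:R | n : nat <- iota 0 (size (p - q))]).
rewrite size_map size_iota ltnn => -> //.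
  by apply/allP => _ /mapP[i _ ->]; rewrite /root !hornerE h subrr.
by rewrite map_inj_uniq ?iota_uniq // => a b /eqP; rewrite eqr_nat => /eqP.
Qed.

Lemma dvdp_by_roots (f g : {poly C}) : g != 0 ->
  (forall t, root g t -> exists (k : nat) g' f', [/\ g = ('X - t%:P) ^+ k * g', ~~ root g' t &
    f = ('X - t%:P) ^+ k * f']) -> g %| f.
Proof.
move=> g0 h; pose c := gcdp g f; have c0 : c != 0 by rewrite gcdp_eq0 negb_and g0.
have /dvdpP[u eu] : c %| g by exact: dvdp_gcdl.
have [s1|s1] := eqVneq (size u) 1%N.
  have /size_poly1P[a a0 ea] : size u == 1%N by rewrite s1.
  by rewrite eu ea mul_polyC dvdpZl // dvdp_gcdr.
have /closed_rootP[t ut] := s1.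
have gt : root g t by rewrite eu rootM ut.
have [k [g' [f' [eg ng' ef]]]] := h t gt.
have : ('X - t%:P) ^+ k %| c by rewrite dvdp_gcd eg ef !dvdp_mulr.
move/dvdpP => [c' ec]; case/negP: ng'.
have X0 : ('X - t%:P) ^+ k != 0 by rewrite expf_neq0 // polyXsubC_eq0.
have -> : g' = u * c' by apply: (mulfI X0); rewrite -eg eu ec [RHS]mulrC mulrA.
by rewrite rootM ut.
Qed.

(** Restriction to the affine line w + t o. *)
Definition res w (o : 'rV[C]_3) (G : {mpoly C[3]}) : {poly C} :=
  mmap polyC (fun j => (w 0 j)%:P + (o 0 j) *: 'X) G.

Lemma res_eval w o G t : (res w o G).[t] = G.@[(w + t *: o) 0].
Proof.
move: G; apply: mpoly_ring_ind => [c|j|p q ep eq|p q ep eq].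
- by rewrite /res mmapC hornerC mevalC.
- by rewrite /res mmapX mmap1U mevalXU !hornerE !mxE mulrC.
- by rewrite /res mmapD hornerD mevalD ep eq.
- by rewrite /res rmorphM hornerM mevalM ep eq.
Qed.

Lemma resM w o G H : res w o (G * H) = res w o G * res w o H.
Proof. exact: rmorphM. Qed.

Lemma dual_unique (M N : 'M[C]_3) :
  (forall i j, dot (row i M) (row j N) = (i == j)%:R) -> M \in unitmx /\ N = dualmx M.
Proof.
move=> h; have e : M *m N^T = 1%:M.
  apply/matrixP => i j; rewrite !mxE -h; apply: eq_bigr => k _; by rewrite !mxE.
have [uM _] := mulmx1_unit e; split=> //.
by rewrite /dualmx -[N]trmxK; congr trmx; rewrite -[RHS]mulmx1 -e mulKmx.
Qed.

Lemma frame_infinity o m : o != 0 -> dot m o = 0 -> m != 0 ->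
  exists M, [/\ M \in unitmx, row 2%:R M = m & row 1 (dualmx M) = o].
Proof.
move=> o0 mo m0; have [M [uM r2 r0]] := frame_through o0 mo m0.
pose s : 'S_3 := tperm 0 1.
have [i j|uM' eN] := @dual_unique (row_perm s M) (row_perm s (dualmx M)).
  have rp (A : 'M[C]_3) k : row k (row_perm s A) = row (s k) A.
    by apply/rowP => l; rewrite !mxE.
  by rewrite !rp dot_dual // (inj_eq perm_inj).
have rp (A : 'M[C]_3) k : row k (row_perm s A) = row (s k) A by apply/rowP => l; rewrite !mxE.
exists (row_perm s M); split=> //; first by rewrite rp tpermD.
by rewrite -eN rp tpermR.
Qed.

Lemma meval_pt0 d (F : {mpoly C[3]}) (o : 'rV[C]_3) : F \is d.-homog -> (0 < d)%N ->
  F.@[o 0] != 0 -> o != 0.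
Proof.
move=> hF d0; apply: contraNneq => z.
rewrite (@meval_eq _ _ _ (fun j => 0 * o 0 j)); last by move=> j; rewrite mul0r z mxE.
by rewrite (dhomog_eval _ _ hF) expr0n gtn_eqF // mul0r.
Qed.

Lemma dhomog0_const (G : {mpoly C[3]}) : G \is 0.-homog -> exists c, G = c%:MP.
Proof.
move=> hG; exists (G.@[fun=> 0]); apply/eqP; rewrite -subr_eq0; apply/eqP.
apply: mpoly_eq0_eval => v; rewrite mevalB mevalC.
rewrite -[G.@[v]]mul1r -[1](expr0 0) -(dhomog_eval _ _ hG).
rewrite (@meval_eq _ _ _ (fun=> 0)) ?subrr // => r; by rewrite mul0r.
Qed.

Lemma ev_lines (F : {mpoly C[3]}) (K : function_field F) s :
  ev K (\prod_(l <- s) lin l) = \prod_(l <- s) ev K (lin l).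
Proof. exact: (rmorph_prod (mmap (ff_const K) (ff_gen K))). Qed.

Lemma evi_lines (F : {mpoly C[3]}) (K : function_field F) i s :
  evi K i (\prod_(l <- s) lin l) = \prod_(l <- s) evi K i (lin l).
Proof. exact: (rmorph_prod (mmap (ff_const K) _)). Qed.

Lemma evB (F : {mpoly C[3]}) (K : function_field F) G H : ev K (G - H) = ev K G - ev K H.
Proof. exact: (rmorphB (mmap (ff_const K) (ff_gen K))). Qed.

Lemma evXn (F : {mpoly C[3]}) (K : function_field F) G n : ev K (G ^+ n) = ev K G ^+ n.
Proof. exact: (rmorphXn (mmap (ff_const K) (ff_gen K))). Qed.

Section Curve.
Variables (d : nat) (F : {mpoly C[3]}) (K : function_field F) (o : 'rV[C]_3).
Hypotheses (hF : F \is d.-homog) (d_gt0 : (0 < d)%N) (Fo : F.@[o 0] != 0).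
Hypotheses (smF : smooth_form F) (dn : pencil_denominators K o).

Local Notation evi := (evi K).
Local Notation ev := (ev K).

(** If a form A is divisible by the line m at every place of the curve over m,
    then it is divisible by m modulo F: along the line, which passes through a
    point off the curve, every root of F is a root of A of at least the same
    multiplicity. *)
Lemma cancel_line m (D : nat) A : m != 0 -> dot m o = 0 -> A \is D.-homog ->
    (forall (v : place (ff_const K)) p i, branch_at v p -> p 0 i != 0 ->
       val_ge v (evi i A / evi i (lin m)) 0) ->
  exists A1 B1, A - F * B1 \is D.-homog /\ A - F * B1 = lin m * A1.
Proof.
move=> m0 mo hA reg; have o0 := meval_pt0 hF d_gt0 Fo.
have [M [uM r2 r1]] := frame_infinity o0 mo m0.
have dN i j := dot_dual i j uM.
have lhom e l : lin l ^+ e \is e.-homog.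
  by have := dhomogMn e (lin_homog l); rewrite mul1n.
pose w := row 0 (dualmx M); pose al := row 0 M; pose be := row 1 M.
have alw : dot al w = 1 by rewrite dN. have alo : dot al o = 0 by rewrite -r1 dN.
have bew : dot be w = 0 by rewrite dN. have beo : dot be o = 1 by rewrite -r1 dN.
have mw : dot m w = 0 by rewrite -r2 dN.
have rp e (G : {mpoly C[3]}) : G \is e.-homog -> (size (res w o G) <= e.+1)%N /\ exists H,
    G = \sum_(i < e.+1) (res w o G)`_i *: (lin be ^+ i * lin al ^+ (e - i)) + lin m * H.
  move=> hG; have [g [sg gE [H eH]]] := restrict_plane uM hG.
  have <- : g = res w o G by apply: poly_ext => t; rewrite gE res_eval r1.
  by split=> //; exists H; rewrite -r2.
have [sg [GF eF]] := rp _ _ hF; have [sf [GA eA]] := rp _ _ hA.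
set g := res w o F in sg eF; set f := res w o A in sf eA.
have gd : g`_d != 0.
  apply: contraNneq Fo => z; rewrite eF mevalD mevalM lin_dot mo mul0r addr0 raddf_sum.
  rewrite big1 // => i _ /=; rewrite mevalZ mevalM !rmorphXn /= !lin_dot alo expr0n.
  have [id|id] := eqVneq (i : nat) d; first by rewrite id z mul0r.
  rewrite subn_eq0 [(d <= i)%N]leq_eqVlt eq_sym (negbTE id) ltnNge -ltnS ltn_ord /=.
  by rewrite !mulr0.
have g0 : g != 0 by apply: contraNneq gd => ->; rewrite coef0.
have szg : size g = d.+1.
  by apply/eqP; rewrite eqn_leq sg ltnNge; apply: contra gd => h; rewrite nth_default.
have gf : g %| f.
  have [->|f0] := eqVneq f 0; first exact: dvdp0.
  apply: dvdp_by_roots g0 _ => t gt; pose p := w + t *: o.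
  have alp : dot al p = 1 by rewrite dotDr dotZr alw alo mulr0 addr0.
  have p0 : p != 0.
    by apply/eqP => z; move/eqP: alp; rewrite z -(scale0r al) dotZr mul0r eq_sym oner_eq0.
  pose b := be - t *: al.
  have bp : dot b p = 0.
    by rewrite dotDl -scaleNr dotZl alp dotDr dotZr bew beo add0r !mulr1 addrN.
  have bo : dot b o = 1 by rewrite dotDl -scaleNr dotZl alo beo mulr0 addr0.
  have mp : dot m p = 0 by rewrite dotDr dotZr mw mo mulr0 addr0.
  have bm : ~~ (b <= m)%MS.
    apply/sub_rVP => -[c ec]; move/eqP: bo; rewrite ec dotZl mo mulr0.
    by rewrite eq_sym oner_eq0.
  have Fp : F.@[p 0] = 0 by rewrite -res_eval; apply/eqP.
  have [|k [H [W [e1 hW Wp]]]] := local_intersection p0 bp mp m0 bm hF; first by exists o.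
  have [|k' [H' [W' [e2 hW' Wp']]]] := local_intersection p0 bp mp m0 bm hA.
    apply: NNPP => h; case/eqP: f0; apply: poly_ext => u; rewrite horner0 res_eval.
    apply/eqP/contraT => Au; case: h; exists (w + u *: o) => //.
    by rewrite dotDr dotZr mw mo mulr0 addr0.
  have rb : res w o (lin b) = 'X - t%:P.
    apply: poly_ext => u; rewrite res_eval lin_dot dotDr dotZr bo hornerXsubC mulr1 addrC.
    by congr (_ + _); rewrite dotDl -scaleNr dotZl alw bew mulr1 add0r.
  have rm : res w o (lin m) = 0.
    by apply: poly_ext => u; rewrite res_eval lin_dot dotDr dotZr mw mo mulr0 addr0 horner0.
  have rX n : res w o (lin b ^+ n) = ('X - t%:P) ^+ n by rewrite -rb; exact: rmorphXn.
  have rD G1 G2 : res w o (G1 + G2) = res w o G1 + res w o G2 by exact: mmapD.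
  have k0 : (0 < k)%N.
    rewrite lt0n; apply: contraNneq Wp => k0; move: Fp.
    by rewrite e1 k0 expr0 mul1r mevalD mevalM lin_dot mp mul0r add0r => ->.
  have [v [bv _ sv [i [pi xi0]]]] := tangency_local hF d_gt0 Fo smF dn p0 m0 mp bp bm e1 hW Wp k0.
  rewrite /= -evi_lin => m1 vm.
  have kk : (k <= k')%N.
    apply: (contact_mult hF p0 m0 mp bp bm e2 hW' Wp' bv sv pi m1 vm).
    have := reg v p i bv pi; have [->|A0] := eqVneq (evi i A) 0; first by left.
    move=> /(vge_val _) h; right; move: h; rewrite place_valM ?invr_eq0 // placeV // vm.
    by rewrite subr_ge0; apply; rewrite mulf_neq0 ?invr_eq0.
  exists k, (res w o W), (('X - t%:P) ^+ (k' - k) * res w o W'); split.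
  - by rewrite /g e1 rD !resM rm mul0r add0r rX.
  - by rewrite /root res_eval.
  - by rewrite /f e2 rD !resM rm mul0r add0r rX mulrA -exprD subnKC.
have [B1 [hB eB]] : exists B1, A - F * B1 \is D.-homog /\ res w o (F * B1) = f.
  have [f0|f0] := eqVneq f 0.
    by exists 0; rewrite mulr0 subr0 /res mmap0.
  have /dvdpP[h eh] := gf.
  have h0 : h != 0 by apply: contraNneq f0 => z; rewrite eh z mul0r.
  have sh : (size h + d <= D.+1)%N.
    by apply: leq_trans sf; rewrite eh size_mul // szg addnS.
  have ad : (d <= D)%N.
    move: h0 sh; rewrite -size_poly_gt0; move: (size h) => n; clear; lia.
  have sh' : (size h <= (D - d).+1)%N by move: sh ad; clear; move: (size h) => n; lia.
  pose B := \sum_(i < (D - d).+1) h`_i *: (lin be ^+ i * lin al ^+ (D - d - i)).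
  exists B; split.
    apply: rpredB => //; rewrite -(subnKC ad); apply: (dhomogM hF).
    apply: rpred_sum => i _; apply: rpredZ.
    have := dhomogM (lhom i be) (lhom (D - d - i)%N al).
    by rewrite subnKC // -ltnS.
  rewrite resM -/g eh mulrC; congr (_ * _); apply: poly_ext => t; rewrite res_eval.
  rewrite (horner_coef_wide _ sh') raddf_sum; apply: eq_bigr => i _ /=.
  rewrite mevalZ mevalM !rmorphXn /= !lin_dot !dotDr !dotZr alw alo bew beo.
  by rewrite mulr0 addr0 expr1n !mulr1 add0r.
have [_ [H eH]] := rp _ _ hB; exists H, B1; split=> //; rewrite {1}eH.
have -> : res w o (A - F * B1) = 0 by rewrite -[LHS]/(mmap _ _ _) mmapB -!/(res w o _) eB subrr.
by rewrite big1 ?add0r // => i _; rewrite coef0 scale0r.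
Qed.

(** A function without poles is a form: the denominators cancel one line at a
    time.  Here e - f is the degree of the function. *)
Lemma bounded_form (e f : nat) s n A : A \is n.-homog ->
    (forall m, m \in s -> m != 0 /\ dot m o = 0) -> (n + f = size s + e)%N ->
    (forall (v : place (ff_const K)) p i, branch_at v p -> p 0 i != 0 ->
       val_ge v (evi i A / evi i (\prod_(m <- s) lin m)) 0) ->
  ev A / ev (\prod_(m <- s) lin m) = 0 \/ exists G n', [/\ G \is n'.-homog, (n' + f = e)%N &
    ev A / ev (\prod_(m <- s) lin m) = ev G].
Proof.
have ev1 : ev 1 = 1 by exact: (rmorph1 (mmap _ _)).
elim: s n A => [|m s IH] n A hA hs en reg.
  by right; exists A, n; rewrite big_nil ev1 divr1.
have [m0 mo] := hs m (mem_head _ _).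
have hs' l : l \in s -> l != 0 /\ dot l o = 0 by move=> ls; apply: hs; rewrite inE ls orbT.
have lnz (v : place (ff_const K)) p i l : branch_at v p -> p 0 i != 0 -> l != 0 ->
    dot l o = 0 -> evi i (lin l) != 0.
  move=> bv pi l0 lo; have [xi0 _] := branch_chart hF bv pi.
  rewrite (evi_form (lin_homog l) xi0) mulf_neq0 ?invr_eq0 ?expf_neq0 //.
  exact (line_neq0 K hF d_gt0 Fo l0 lo).
have pnz (v : place (ff_const K)) p i : branch_at v p -> p 0 i != 0 ->
    evi i (\prod_(l <- s) lin l) != 0.
  move=> bv pi; rewrite evi_lines prodf_seq_neq0; apply/allP => l /hs'[l0 lo].
  exact: lnz bv pi l0 lo.
have [|A1 [B1 [hD eD]]] := cancel_line m0 mo hA.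
  move=> v p i bv pi; have P0 := pnz v p i bv pi; have [_ c] := branch_chart hF bv pi.
  have -> : evi i A / evi i (lin m) = evi i A / evi i (\prod_(l <- m :: s) lin l)
      * evi i (\prod_(l <- s) lin l).
    by rewrite big_cons eviM invfM -!mulrA mulVf // mulr1.
  rewrite -[0]addr0; apply: vgeM; first exact: (reg v p i bv pi).
  by have [] := centred_diff c (\prod_(l <- s) lin l).
have eA : ev A = ev (lin m) * ev A1.
  by rewrite -evM -eD evB evM (evF K hF) mul0r subr0.
have m1 : ev (lin m) != 0 by exact (line_neq0 K hF d_gt0 Fo m0 mo).
have eq : ev A / ev (\prod_(l <- m :: s) lin l) = ev A1 / ev (\prod_(l <- s) lin l).
  by rewrite big_cons evM eA -mulf_div divff // mul1r.
have [D0|D0] := eqVneq (lin m * A1) 0.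
  left; rewrite eq; suff -> : ev A1 = 0 by rewrite mul0r.
  by apply: (mulfI m1); rewrite -evM D0 mulr0; exact: mmap0.
rewrite eD in hD; have [e' [n1 [en1 hm hA1]]] := dhomog_factor hD D0.
have e'1 : e' = 1%N by apply: dhomog_uniq hm (lin_homog m); rewrite lin_eq0.
rewrite eq; apply: (IH n1) => //.
  by move: en1 en; rewrite e'1 /=; clear; lia.
move=> v p i bv pi; have [xi0 _] := branch_chart hF bv pi.
have := reg v p i bv pi; rewrite big_cons eviM.
have -> : evi i A = evi i (lin m) * evi i A1.
  by rewrite -eviM -eD eviB eviM (eviF hF) // mul0r subr0.
by rewrite -mulf_div divff ?mul1r //; apply: lnz bv pi m0 mo.
Qed.

End Curve.

Lemma const_homog c : (c%:MP : {mpoly C[3]}) \is 0.-homog.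
Proof. by rewrite -[c%:MP]mulr1 mul_mpolyC rpredZ // dhomog1. Qed.

Lemma form_msize d (F : {mpoly C[3]}) : F \is d.-homog -> F != 0 -> (0 < d)%N -> (1 < msize F)%N.
Proof.
move=> hF F0 d0; rewrite ltnNge; apply/negP => /msize1_polyC eF.
have h0 : F \is 0.-homog by rewrite eF const_homog.
by move: d0; rewrite (dhomog_uniq F0 hF h0).
Qed.

Lemma form_factor d (F : {mpoly C[3]}) : F \is d.-homog -> F != 0 -> (0 < d)%N ->
  exists G H e f, [/\ F = G * H, G \is e.-homog, H \is f.-homog, (0 < e)%N &
    mpoly_irreducible G].
Proof.
elim/ltn_ind: d F => d IH F hF F0 d0.
have [irr|red] := classic (mpoly_irreducible F).
  by exists F, 1, d, 0%N; rewrite mulr1; split=> //; apply: dhomog1.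
have [G [H [eF sG sH]]] : exists G H, [/\ F = G * H, (1 < msize G)%N & (1 < msize H)%N].
  apply: NNPP => h; apply: red; split; first exact: form_msize hF F0 d0.
  move=> G H eF; have [|sG] := leqP (msize G) 1; first by left.
  by have [|sH] := leqP (msize H) 1; [right|case: h; exists G, H].
have [e [f [ef hG hH]]] : exists e f, [/\ (e + f = d)%N, G \is e.-homog & H \is f.-homog].
  by rewrite eF in hF F0; apply: dhomog_factor hF F0.
have pos n (P : {mpoly C[3]}) : P \is n.-homog -> (1 < msize P)%N -> (0 < n)%N.
  case: n => // /dhomog0_const[c ->]; rewrite msizeC; by case: (c != 0).
have e0 := pos _ _ hG sG; have f0 := pos _ _ hH sH.
have G0 : G != 0 by apply: contraNneq F0 => z; rewrite eF z mul0r.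
have [|G1 [H1 [e1 [f1 [eG hG1 hH1 e10 irr]]]]] := IH e _ G hG G0 e0.
  by move: ef f0; clear; lia.
by exists G1, (H1 * H), e1, (f1 + f)%N; rewrite eF eG mulrA; split=> //; apply: dhomogM.
Qed.

(** Two curves without common point cannot exist: on the curve of an irreducible
    factor G, the quotient of a power of a line by the cofactor H would have no
    poles, hence be constant, although the line can be chosen to meet G. *)
Lemma smooth_irreducible d (F : {mpoly C[3]}) : F \is d.-homog -> (0 < d)%N ->
  F.@[e1 C 0] != 0 -> smooth_form F -> mpoly_irreducible F.
Proof.
move=> hF d0 Fe smF; have F0 : F != 0 by apply: contraNneq Fe => ->; rewrite meval0.
have [G [H [e [f [eF hG hH e0 irG]]]]] := form_factor hF F0 d0.
have Ge : G.@[e1 C 0] != 0 by apply: contraNneq Fe => z; rewrite eF mevalM z mul0r.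
have sm p : p != 0 -> G.@[p 0] = 0 -> H.@[p 0] != 0 /\ exists j, (G^`M(j)).@[p 0] != 0.
  move=> p0 Gp; have [|j] := smF p p0; first by rewrite eF mevalM Gp mul0r.
  rewrite eF mderivM mevalD !mevalM Gp mul0r addr0 mulf_eq0 negb_or => /andP[h1 h2].
  by split=> //; exists j.
have smG : smooth_form G by move=> p p0 /(sm p p0)[].
have [K dn] := function_field_exists hG e0 Ge irG.
have o0 := meval_pt0 hG e0 Ge.
have [p [p0 Gp]] : exists p, p != 0 /\ G.@[p 0] = 0.
  have [m [m0 mo _]] := line_through (e1 C) (e1 C).
  have [M [uM r2 r1]] := frame_infinity o0 mo m0; have [g [sg gE [Q eG]]] := restrict_plane uM hG.
  have gd : g`_e = G.@[e1 C 0].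
    rewrite eG mevalD mevalM lin_dot r2 mo mul0r addr0 raddf_sum big_ord_recr /=.
    rewrite mevalZ mevalM !rmorphXn /= !lin_dot subnn mulr1 -r1 !dot_dual // expr1n mulr1.
    rewrite big1 ?add0r // => i _; rewrite mevalZ mevalM !rmorphXn /= !lin_dot.
    by rewrite !dot_dual // expr0n subn_eq0 leqNgt ltn_ord /= !mulr0.
  have g1 : size g != 1%N.
    rewrite neq_ltn; apply/orP; right; apply: leq_ltn_trans e0 _.
    rewrite ltnNge; apply: contra Ge => h; by rewrite -gd nth_default.
  have /closed_rootP[t gt] := g1; exists (row 0 (dualmx M) + t *: row 1 (dualmx M)).
  split; last by rewrite -gE; apply/eqP.
  apply/eqP => /(congr1 (dot (row 0 M))); rewrite dotDr dotZr !dot_dual //= mulr0 addr0.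
  by rewrite -(scale0r (row 0 M)) dotZr mul0r => /eqP; rewrite oner_eq0.
have [Hp _] := sm p p0 Gp.
have [m [m0 mo mp]] := line_through (e1 C) p.
have evH : ev K H != 0 by apply: (point_neq0 K hH Hp Gp).
have hm : lin m ^+ f \is f.-homog by have := dhomogMn f (lin_homog m); rewrite mul1n.
have evm : ev K (lin m ^+ f) != 0.
  by rewrite evXn expf_neq0 //; exact (line_neq0 K hG e0 Ge m0 mo).
have [A [s [hA hs ey]]] := dn (ev K (lin m ^+ f) / ev K H).
have evP : \prod_(m <- s) ev K (lin m) = ev K (\prod_(m <- s) lin m).
  by rewrite ev_lines.
rewrite evP in ey.
have lnz l : l \in s -> ev K (lin l) != 0.
  by move=> /hs[l0 lo]; exact (line_neq0 K hG e0 Ge l0 lo).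
have P0 : ev K (\prod_(m <- s) lin m) != 0.
  by rewrite -evP prodf_seq_neq0; apply/allP => l /lnz.
have [|||z|[Q [n [hQ n0 eQ]]]] := @bounded_form _ _ K _ hG e0 Ge smG dn 0 0 s _ _ hA.
- exact: hs.
- by rewrite !addn0.
- move=> v q i bv qi; have [xi0 c] := branch_chart hG bv qi.
  have -> : evi K i A / evi K i (\prod_(m <- s) lin m) = evi K i (lin m ^+ f) / evi K i H.
    rewrite (evi_form hA xi0) (evi_form (lins_homog s) xi0) (evi_form hm xi0) (evi_form hH xi0).
    by rewrite -!mulf_div !divff ?invr_eq0 ?expf_neq0 // !mulr1 -ey.
  rewrite -[0]addr0; apply: vgeM; first by have [] := centred_diff c (lin m ^+ f).
  have q0 : q != 0 by apply: contraNneq qi => ->; rewrite mxE.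
  have [Hq _] := sm q q0 (branch_point hG bv).
  have Ha : H.@[aff q i] != 0 by rewrite (form_aff_eq0 hH).
  have vH := centred_unit c Ha; right; rewrite placeV ?vH ?oppr0 //.
  by rewrite (evi_form hH xi0) mulf_neq0 ?invr_eq0 ?expf_neq0.
- by case/eqP: evm; move/eqP: z; rewrite -ey mulf_eq0 invr_eq0 (negbTE evH) orbF => /eqP.
rewrite addn0 in n0; rewrite n0 in hQ; have [c eC] := dhomog0_const hQ.
have : ev K (lin m ^+ f - c%:MP * H) = 0.
  by rewrite evB evM -eC -eQ -ey divfK ?subrr.
have hD : lin m ^+ f - c%:MP * H \is f.-homog.
  by apply: rpredB => //; rewrite mul_mpolyC rpredZ.
move/(ev_eq0_at hD)/(_ Gp); rewrite mevalB mevalM mevalC rmorphXn /= lin_dot mp expr0n.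
have [f0 _|f0] := eqVneq f 0%N; last first.
  rewrite sub0r => /eqP; rewrite oppr_eq0 mulf_eq0 (negbTE Hp) orbF => /eqP c0.
  have /eqP : ev K (lin m ^+ f) / ev K H = 0 by rewrite ey eQ eC c0 mpolyC0; exact: mmap0.
  by rewrite mulf_eq0 invr_eq0 (negbTE evH) orbF (negbTE evm).
rewrite f0 in hH; have [b eb] := dhomog0_const hH.
have b0 : b != 0 by apply: contraNneq Hp => z; rewrite eb z mevalC.
split; first exact: form_msize hF F0 d0.
move=> P Q' ePQ; case: irG => _ irG.
have [|h|h] := irG P (Q' * b^-1%:MP); first by rewrite mulrA -ePQ eF eb -mulrA -mpolyCM mulfV // mulr1.
  by left.
right; have -> : Q' = (Q' * b^-1%:MP) * b%:MP by rewrite -mulrA -mpolyCM mulVf // mulr1.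
by rewrite (msize1_polyC h) -mpolyCM msizeC; case: (_ != 0).
Qed.

End BoundedFunctions.


Section Derivations.
Local Open Scope ring_scope.
Variables (C K : fieldType) (iota : {rmorphism C -> K}) (M : lmodType K).

Lemma der1 (E : K -> M) : is_derivation iota E -> E 1 = 0.
Proof. by move=> [_ _ h]; rewrite -(rmorph1 iota) h. Qed.

Lemma der_quot (E : K -> M) x y : is_derivation iota E -> y != 0 ->
  y *: E (x / y) = E x - (x / y) *: E y.
Proof.
move=> [_ hM _] y0; apply/eqP; rewrite eq_sym subr_eq -{1}(divfK y0 x) hM.
by rewrite addrC.
Qed.

Lemma der_linear (N : lmodType K) (phi : {linear M -> N}) (E : K -> M) :
  is_derivation iota E -> is_derivation iota (fun x => phi (E x)).
Proof.
move=> [hD hM hC]; split=> [x y|x y|c]; first by rewrite hD linearD.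
  by rewrite hM linearD !linearZ.
by rewrite hC linear0.
Qed.

End Derivations.

Section Differentials.
Local Open Scope ring_scope.
Variable C : numClosedFieldType.
Variables (d : nat) (F : {mpoly C[3]}) (K : function_field F).
Hypotheses (hF : F \is d.-homog) (d_gt0 : (0 < d)%N).

Local Notation xi := (ff_gen K).
Local Notation iota := (ff_const K).
Local Notation evi := (evi K).
Local Notation ev := (ev K).
Implicit Types (p : 'rV[C]_3) (i j k : 'I_3).

Lemma mderiv_var l l' : ('X_l)^`M(l') = (l == l')%:R :> {mpoly C[3]}.
Proof.
rewrite mderivX mnm1E; have [->|ll] := eqVneq l l'; last by rewrite scale0r.
rewrite scale1r (_ : (_ - _)%MM = 0%MM) ?mpolyX0 //.
by apply/mnmP => x; rewrite mnmBE subnn mnm0E.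
Qed.

Section Chain.
Variables (M : lmodType K) (E : K -> M).
Hypothesis hE : is_derivation iota E.

Lemma der_evi i G : E (evi i G) = \sum_l evi i (G^`M(l)) *: E (xi l / xi i).
Proof.
case: hE => hD hM hC; move: G; apply: mpoly_ring_ind => [c|j|P Q eP eQ|P Q eP eQ].
- by rewrite eviC hC big1 // => l _; rewrite mderivC evi0 scale0r.
- rewrite eviX (bigD1 j) //= mderiv_var eqxx evi1 scale1r big1 ?addr0 // => l lj.
  by rewrite mderiv_var eq_sym (negbTE lj) evi0 scale0r.
- by rewrite eviD hD eP eQ -big_split; apply: eq_bigr => l _; rewrite mderivD eviD scalerDl.
rewrite eviM hM eP eQ !scaler_sumr -big_split; apply: eq_bigr => l _ /=.
by rewrite mderivM eviD !eviM scalerDl !scalerA addrC [evi i (P^`M(l)) * _]mulrC.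
Qed.

Lemma der_relation i j k : xi i != 0 -> uniq [:: i; j; k] ->
  evi i (F^`M(j)) *: E (xi j / xi i) + evi i (F^`M(k)) *: E (xi k / xi i) = 0.
Proof.
move=> xi0 ijk; have := der_evi i F; rewrite (eviF hF xi0) (sum_ijk ijk) divff // (der1 hE).
rewrite scaler0 add0r => <-; rewrite -(rmorph0 iota); by case: hE.
Qed.

End Chain.

Lemma der_ext i (M : lmodType K) (E E' : K -> M) : is_derivation iota E ->
  is_derivation iota E' -> xi i != 0 ->
  (forall l : 'I_3, E (xi l / xi i) = E' (xi l / xi i)) -> E =1 E'.
Proof.
move=> hE hE' xi0 h x; have [A [B [B0 ->]]] := frac_evi x xi0.
have eG G : E (evi i G) = E' (evi i G).
  by rewrite !der_evi //; apply: eq_bigr => l _; rewrite h.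
apply: (scalerI B0); by rewrite (der_quot _ hE B0) (der_quot _ hE' B0) !eG.
Qed.

(** The vector field F_1 d/dX_0 - F_0 d/dX_1, tangent to the curve in the chart
    X_2 = 1. *)
Definition field G : {mpoly C[3]} := locked (F^`M(1) * G^`M(0) - F^`M(0) * G^`M(1)).

Lemma fieldD G H : field (G + H) = field G + field H.
Proof. by rewrite /field -!lock !mderivD; ring. Qed.
Lemma fieldM G H : field (G * H) = field G * H + G * field H.
Proof. by rewrite /field -!lock !mderivM; ring. Qed.

Lemma ev_field_eq e G H : G \is e.-homog -> H \is e.-homog -> ev G = ev H ->
  ev (field G) = ev (field H).
Proof.
move=> hG hH e0; have hB : G - H \is e.-homog by apply: rpredB.
have /(ff_genP K hB)[Q eQ] : ev (G - H) = 0 by rewrite evB e0 subrr.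
have -> : G = Q * F + H by rewrite -eQ subrK.
have F0 : field F = 0 by rewrite /field -lock; ring.
by rewrite fieldD fieldM F0 mulr0 addr0 evD evM (evF K hF) mulr0 add0r.
Qed.

Hypothesis xi2 : xi 2%:R != 0.
Local Notation kap := (xi 2%:R ^+ 2 / xi 2%:R ^+ d).

Lemma field_quotient e f A B A' B' : A \is e.-homog -> B \is e.-homog ->
    A' \is f.-homog -> B' \is f.-homog -> ev B != 0 -> ev B' != 0 ->
    ev A / ev B = ev A' / ev B' ->
  (ev (field A) - ev A / ev B * ev (field B)) / ev B =
  (ev (field A') - ev A' / ev B' * ev (field B')) / ev B'.
Proof.
move=> hA hB hA' hB' B0 B0' e0.
have eA : ev A = ev A' / ev B' * ev B by rewrite -e0 divfK.
have eA' : ev A' = ev A' / ev B' * ev B' by rewrite divfK.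
have : ev (field (A * B')) = ev (field (A' * B)).
  apply: (ev_field_eq (e := e + f)); rewrite ?[(e + f)%N in A' * B \is _]addnC.
  - exact: dhomogM.
  - by rewrite mulrC; apply: dhomogM.
  by rewrite !evM {1}eA mulrAC divfK.
rewrite e0 !fieldM !evD !evM eA {2}eA'; move: (ev A' / ev B') => x E.
apply: (mulIf B0); rewrite divfK //; apply: (mulIf B0').
rewrite [RHS]mulrAC divfK //; apply/eqP; rewrite -subr_eq0; apply/eqP.
transitivity (ev (field A) * ev B' + x * ev B * ev (field B') -
  (ev (field A') * ev B + x * ev B' * ev (field B))); first by ring.
by rewrite E subrr.
Qed.

Definition derivative (x : K) : K := epsilon (inhabits 0) (fun y =>
  exists e A B, [/\ A \is e.-homog, B \is e.-homog, ev B != 0, x = ev A / ev B &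
    y = kap * ((ev (field A) - x * ev (field B)) / ev B)]).

Lemma derivativeE e A B : A \is e.-homog -> B \is e.-homog -> ev B != 0 ->
  derivative (ev A / ev B) = kap * ((ev (field A) - ev A / ev B * ev (field B)) / ev B).
Proof.
move=> hA hB B0; rewrite /derivative; set P := (fun y => _).
have [|e' [A' [B' [hA' hB' B0' ex ->]]]] := @epsilon_spec _ (inhabits 0) P.
  by eexists; exists e, A, B; split.
by rewrite {1}ex (field_quotient hA' hB' hA hB).
Qed.

Lemma derivative_der : is_derivation iota (derivative : K -> K^o).
Proof.
split=> [x y|x y|c].
- have [e [A [B [hA hB B0 ->]]]] := ff_fracP x; have [f [A' [B' [hA' hB' B0' ->]]]] := ff_fracP y.
  rewrite -!/(ev _) in B0 B0' *.
  have -> : ev A / ev B + ev A' / ev B' = ev (A * B' + B * A') / ev (B * B').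
    by rewrite evD !evM addf_div // [ev B * ev A']mulrC.
  rewrite (derivativeE (e := e + f)) ?evM ?mulf_neq0 //; first last.
  - exact: dhomogM.
  - by apply: rpredD; apply: dhomogM.
  rewrite (derivativeE hA hB B0) (derivativeE hA' hB' B0').
  rewrite fieldD !fieldM !evD !evM; move: (ev (field _)) (ev (field _)) (ev (field _)) (ev (field _)) => u1 u2 u3 u4.
  by field; rewrite ?B0 ?B0' ?expf_neq0.
- have [e [A [B [hA hB B0 ->]]]] := ff_fracP x; have [f [A' [B' [hA' hB' B0' ->]]]] := ff_fracP y.
  rewrite -!/(ev _) in B0 B0' *.
  have -> : ev A / ev B * (ev A' / ev B') = ev (A * A') / ev (B * B').
    by rewrite mulf_div !evM.
  rewrite (derivativeE (e := e + f)) ?evM ?mulf_neq0 //; first last.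
  - exact: dhomogM.
  - exact: dhomogM.
  rewrite (derivativeE hA hB B0) (derivativeE hA' hB' B0') /GRing.scale /=.
  rewrite !fieldM !evD !evM; move: (ev (field _)) (ev (field _)) (ev (field _)) (ev (field _)) => u1 u2 u3 u4.
  by field; rewrite ?B0 ?B0' ?expf_neq0.
have e1 : ev 1 = 1 by exact: (rmorph1 (mmap _ _)).
have f0 a : field a%:MP = 0 by rewrite /field -!lock !mderivC; ring.
have -> : iota c = ev c%:MP / ev 1 by rewrite e1 divr1 /ev mmapC.
rewrite (derivativeE (const_homog c) (dhomog1 _ _)) ?e1 ?oner_eq0 //.
have f1 : field 1 = 0 by rewrite -(f0 1) mpolyC1.
by rewrite f0 f1 (_ : ev 0 = 0) ?mulr0 ?subrr ?mul0r ?mulr0 //; exact: mmap0.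
Qed.

(** In every chart the coordinate differentials are, up to sign, the partial
    derivatives of F, scaled to degree zero. *)
Definition chart_scale i : K := xi 2%:R ^+ 3 * xi i ^+ d / (xi 2%:R ^+ d * xi i ^+ 3).

Lemma derivative_coord i j k : uniq [:: i; j; k] -> xi i != 0 ->
  exists2 c : C, c != 0 & derivative (xi j / xi i) = iota c * evi i (F^`M(k)) * chart_scale i.
Proof.
move=> ijk xi0.
have evX l : ev 'X_l = xi l by rewrite /ev mmapX mmap1U.
have hX l : ('X_l : {mpoly C[3]}) \is 1.-homog by rewrite dhomogX /= mdeg1.
have := derivativeE (hX j) (hX i); rewrite !evX => -> //.
have euler : xi 0 * ev (F^`M(0)) + xi 1 * ev (F^`M(1)) + xi 2%:R * ev (F^`M(2%:R)) = 0.
  have := congr1 ev (mpoly_euler hF); rewrite sum3 !evD !evM !evX => ->.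
  by rewrite -mul_mpolyC evM (evF K hF) mulr0.
have [c c0 ec] : exists2 c : C, c != 0 &
    ev (field 'X_j) * xi i - xi j * ev (field 'X_i) = iota c * xi 2%:R * ev (F^`M(k)).
  have m1 : (-1 : C) != 0 by rewrite oppr_eq0 oner_eq0.
  have ev1 : ev 1 = 1 by exact: (rmorph1 (mmap _ _)).
  have ev0 : ev 0 = 0 by exact: mmap0.
  rewrite /field -!lock !mderiv_var !evB !evM.
  move: i j k ijk {xi0}; do 3 apply: ord3_cases => //; move=> _ /=;
  rewrite ?ev1 ?ev0 ?(mulr0, mulr1, subr0, sub0r);
  first [ by exists 1; [exact: oner_neq0|rewrite rmorph1; ring]
        | by exists (-1); [exact: m1|rewrite rmorphN1; ring]
        | by exists 1; [exact: oner_neq0|rewrite rmorph1 -[RHS]subr0 -euler; ring]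
        | by exists (-1); [exact: m1|rewrite rmorphN1 -[RHS]addr0 -euler; ring] ].
exists c => //.
have hk : F^`M(k) \is (d.-1).-homog by apply: dhomog_deriv; rewrite prednK.
rewrite (evi_form hk xi0) /chart_scale.
have -> : xi i ^+ d = xi i ^+ d.-1 * xi i by rewrite -exprSr prednK.
have -> : (ev (field 'X_j) - xi j / xi i * ev (field 'X_i)) / xi i =
   (iota c * xi 2%:R * ev F^`M(k)) / xi i ^+ 2.
  by rewrite -ec; field.
by field; rewrite xi0 !expf_neq0.
Qed.


Hypotheses (Fe : F.@[e1 C 0] != 0) (smF : smooth_form F) (dn : pencil_denominators K (e1 C)).

Lemma ev_F1_neq0 : ev (F^`M(1)) != 0.
Proof.
have hk : F^`M(1) \is (d.-1).-homog by apply: dhomog_deriv; rewrite prednK.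
have euler := congr1 (meval (e1 C 0)) (mpoly_euler hF).
apply/eqP => /(ff_genP K hk)[Q eQ].
have Fx : (F^`M(1)).@[e1 C 0] != 0.
  apply: contraNneq Fe => z; move/eqP: euler.
  rewrite mevalZ sum3 !mevalD !mevalM !mevalXU z !mxE /= !mul0r mulr0 !addr0.
  by rewrite eq_sym mulf_eq0 pnatr_eq0 (gtn_eqF d_gt0).
have QF : Q * F != 0 by rewrite -eQ; apply: contraNneq Fx => ->; rewrite meval0.
rewrite eQ in hk; have [a [b [ab _ hF']]] := dhomog_factor hk QF.
have F0 : F != 0 by apply: contraNneq QF => ->; rewrite mulr0.
have bd := dhomog_uniq F0 hF' hF; move: ab d_gt0; rewrite bd; clear; lia.
Qed.

Lemma derivative_0 : derivative (xi 0 / xi 2%:R) != 0.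
Proof.
have [|c c0 ->] := @derivative_coord 2%:R 0 1 _ xi2; first by [].
have hk : F^`M(1) \is (d.-1).-homog by apply: dhomog_deriv; rewrite prednK.
rewrite (evi_form hk xi2) /chart_scale.
by rewrite !mulf_neq0 ?invr_eq0 ?mulf_neq0 ?expf_neq0 ?fmorph_eq0 ?ev_F1_neq0.
Qed.

(** The field itself is the module of differentials, because derivations are
    determined by the value at one coordinate function. *)
Lemma kaehler_universal (M : lmodType K) (E : K -> M) : is_derivation iota E ->
  exists phi : {linear K^o -> M}, (forall x, E x = phi (derivative x)) /\
    (forall psi : {linear K^o -> M}, (forall x, E x = psi (derivative x)) -> psi =1 phi).
Proof.
move=> hE; have D0 := derivative_0; set x0 := xi 0 / xi 2%:R in D0.
pose f (u : K^o) : M := u *: ((derivative x0)^-1 *: E x0).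
have fl : linear f.
  by move=> a u v; rewrite /f scalerDl; congr (_ + _); apply: esym (scalerA _ _ _).
pose phi : {linear K^o -> M} := HB.pack f (GRing.isLinear.Build K K^o M *:%R f fl).
exists phi; split; last first.
  move=> psi h u; rewrite -[psi u](_ : psi ((u / derivative x0) *: (derivative x0 : K^o)) = _).
    by rewrite linearZ -h /= /f scalerA.
  by rewrite /GRing.scale /= divfK.
have hphi := der_linear phi derivative_der.
have e0 : E x0 = phi (derivative x0) by rewrite /= /f scalerA divff // scale1r.
apply: (der_ext hE hphi xi2); apply: ord3_cases => //; last first.
  by rewrite divff // (der1 hE) (der1 hphi).
have F1 : evi 2%:R (F^`M(1)) != 0.
  have hk : F^`M(1) \is (d.-1).-homog by apply: dhomog_deriv; rewrite prednK.
  by rewrite (evi_form hk xi2) mulf_neq0 ?invr_eq0 ?expf_neq0 ?ev_F1_neq0.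
have r1 := der_relation hE xi2 (j := 0) (k := 1) isT.
have r2 := der_relation hphi xi2 (j := 0) (k := 1) isT.
apply: (scalerI F1); apply: (addrI (evi 2%:R (F^`M(0)) *: E (xi 0 / xi 2%:R))).
by rewrite r1 e0 r2.
Qed.

Definition differentials : kaehler iota :=
  @Kaehler C K iota K^o (derivative : K -> K^o) derivative_der kaehler_universal.

(** At a place over p, differentials are functions times the differential of the
    local parameter. *)
Lemma regular_at (v : place iota) p i (w : K) : branch_at v p -> p 0 i != 0 ->
  (exists t u : K, [/\ t != 0, v t = 1, val_ge v u 0 & w = u * derivative t]) <->
  val_ge v (w / chart_scale i) 0.
Proof.
move=> bv pi; have [xi0 c] := branch_chart hF bv pi.
have [j [k [ijk Fk t0 vt]]] := branch_param hF d_gt0 Fe smF bv pi.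
have Fp := branch_point hF bv.
have [e e0 De] := derivative_coord ijk xi0.
have [hD hM hC] := derivative_der.
set tj := tau K i j (aff p i) in t0 vt.
have Dt : derivative tj = derivative (xi j / xi i).
  rewrite /tj /tau eviB eviC eviX -[xi j / xi i in RHS](subrK (iota (aff p i j))).
  by rewrite [RHS]hD hC addr0.
have s0 : chart_scale i != 0.
  by rewrite /chart_scale mulf_neq0 ?invr_eq0 ?mulf_neq0 ?expf_neq0.
have vF := centred_unit c Fk.
have F0 : evi i (F^`M(k)) != 0.
  by apply: evi_unit Fk => //; rewrite ?aff_id // (form_aff _ _ hF) Fp mulr0.
have ie : iota e != 0 by rewrite fmorph_eq0.
have Ds : derivative tj / chart_scale i = iota e * evi i (F^`M(k)) by rewrite Dt De mulfK.
have vDs : v (derivative tj / chart_scale i) = 0.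
  by rewrite Ds place_valM // vF place_val_const.
have Dt0 : derivative tj != 0.
  by rewrite Dt De; apply: mulf_neq0 => //; apply: mulf_neq0.
have g0 G : val_ge v (evi i G) 0 by have [] := centred_diff c G.
split=> [[t [u [tn0 vt1 hu ->]]]|hw]; last first.
  exists tj, (w / derivative tj); split=> //; last by rewrite divfK.
  have -> : w / derivative tj = w / chart_scale i / (derivative tj / chart_scale i).
    by rewrite invf_div mulrA divfK.
  rewrite -[0]addr0; apply: vgeM => //; right; rewrite placeV ?vDs ?oppr0 //.
  by rewrite mulf_neq0 ?invr_eq0.
have DG G : val_ge v (derivative (evi i G) / derivative tj) 0.
  have rel := der_relation derivative_der xi0 ijk.
  have Dk : derivative (xi k / xi i) = - (evi i (F^`M(j)) / evi i (F^`M(k))) * derivative tj.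
    apply: (mulfI F0); rewrite mulrA mulrN mulrCA divff // mulr1.
    by apply/eqP; rewrite mulNr -addr_eq0 addrC Dt; apply/eqP.
  rewrite (der_evi derivative_der) (sum_ijk ijk) divff // (der1 derivative_der) scaler0 add0r.
  rewrite mulrDl -Dt /GRing.scale /= mulfK // Dk mulrA mulfK //.
  apply: vgeD => //; rewrite -[0]addr0; apply: vgeM => //; apply: vgeN.
  by rewrite -[0]addr0; apply: vgeM => //; right; rewrite placeV ?vF.
have [n hn] := order_is_exists hF d_gt0 Fe dn Fp pi ijk Fk tn0.
have n1 := branch_order hF d_gt0 Fe Fp pi ijk Fk bv tn0 hn.
move: hn; rewrite -n1 vt1 => -[U [H [Ua Ha]]]; rewrite expr1z -/tj => eU.
have U0 : evi i U != 0.
  by apply: evi_unit Ua => //; rewrite ?aff_id // (form_aff _ _ hF) Fp mulr0.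
have vU := centred_unit c Ua.
have hDt : val_ge v (derivative t / derivative tj) 0.
  have := congr1 derivative eU; rewrite !hM /GRing.scale /= => /(canRL (addrK _)) => eD.
  have -> : derivative t / derivative tj =
     (evi i U)^-1 * (tj * (derivative (evi i H) / derivative tj) + evi i H
       - t * (derivative (evi i U) / derivative tj)).
    apply: (mulfI U0); rewrite [LHS]mulrA eD [RHS]mulrA divff // mul1r.
    by field.
  rewrite -[0]addr0; apply: vgeM; first by right; rewrite placeV ?vU.
  apply: vgeB.
    apply: vgeD => //; rewrite -[0]addr0; apply: vgeM => //; right; by rewrite vt.
  by rewrite -[0]addr0; apply: vgeM => //; right; rewrite vt1.
have -> : u * derivative t / chart_scale i =
    u * (derivative t / derivative tj) * (derivative tj / chart_scale i).
  by field; rewrite s0.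
rewrite -[0]addr0; apply: vgeM; last by right; rewrite vDs.
by rewrite -[0]addr0; apply: vgeM.
Qed.

Definition canonical_forms : seq 'X_{1..3} := if d is n.+3 then formms 3 n else [::].

Lemma size_canonical_forms : size canonical_forms = (d.-1 * d.-2)./2.
Proof.
rewrite /canonical_forms; case: d => [|[|[|n]]] //.
rewrite size_formms (_ : 'C(n + 2, n) = 'C(n + 2, 2)); first by rewrite bin2 addn2.
by rewrite -bin_sub ?leq_addr // addKn.
Qed.

Lemma uniq_canonical_forms : uniq canonical_forms.
Proof. by rewrite /canonical_forms; case: d => [|[|[|n]]] //; apply: uniq_formms. Qed.

Lemma canonicalP (G : {mpoly C[3]}) n : G \is n.-homog -> (n + 3 = d)%N -> supported canonical_forms G.
Proof. by move=> hG; rewrite addn3 /canonical_forms => <-; apply/dhomog_supported. Qed.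

Lemma canonical_nth (a : 'I_(size canonical_forms)) :
  exists2 n, (n + 3 = d)%N & ('X_[nth 0%MM canonical_forms a] : {mpoly C[3]}) \is n.-homog.
Proof.
have := mem_nth 0%MM (ltn_ord a); move: {a}(nth _ _ _) => m; rewrite /canonical_forms.
case: d => [|[|[|n]]] //; rewrite mem_formms => /eqP e; exists n; first by rewrite addn3.
by rewrite dhomogX /= e.
Qed.

(** The regular differentials are the forms of degree d - 3. *)
Lemma smooth_genus : geometric_genus K ((d.-1 * d.-2)./2).
Proof.
rewrite -size_canonical_forms; exists differentials.
pose s0 : K := xi 2%:R ^+ 3 / xi 2%:R ^+ d.
have s00 : s0 != 0 by rewrite mulf_neq0 ?invr_eq0 ?expf_neq0.
pose mon (a : 'I_(size canonical_forms)) : {mpoly C[3]} := 'X_[nth 0%MM canonical_forms a].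
exists (fun a => ev (mon a) * s0).
have scaleE n G i : G \is n.-homog -> (n + 3 = d)%N -> xi i != 0 ->
    ev G * s0 / chart_scale i = evi i G.
  move=> hG nd xi0; rewrite (evi_form hG xi0) /s0 /chart_scale.
  have -> : xi i ^+ d = xi i ^+ n * xi i ^+ 3 by rewrite -exprD nd.
  by field; rewrite xi0 xi2 !expf_neq0.
split=> [a v|c hc a|w hw].
- have [p p0 bv] := place_center hF d_gt0 Fe dn v; have /rV0Pn[i pi] := p0.
  apply/(regular_at _ bv pi); have [n nd hn] := canonical_nth a.
  have [xi0 c] := branch_chart hF bv pi; rewrite (scaleE n) //.
  by have [] := centred_diff c (mon a).
- pose G := \sum_a (c a)%:MP * mon a.
  have evG : ev G = 0.
    apply: (mulIf s00); rewrite mul0r -[RHS]hc /ev (raddf_sum (mmap iota xi)) mulr_suml.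
    apply: eq_bigr => b _; rewrite -[X in X * _]/(ev ((c b)%:MP * mon b)) evM -mulrA.
    by rewrite [X in X * _](_ : _ = iota (c b)) //; apply: mmapC.
  have cG : G@_(nth 0%MM canonical_forms a) = c a.
    rewrite raddf_sum (bigD1 a) //= mul_mpolyC mcoeffZ mcoeffX eqxx mulr1 big1 ?addr0 // => b ba.
    rewrite mul_mpolyC mcoeffZ mcoeffX nth_uniq ?uniq_canonical_forms //.
    by rewrite -val_eqE /= in ba; rewrite (negbTE ba) mulr0.
  rewrite -cG; suff -> : G = 0 by rewrite mcoeff0.
  have [n nd _] := canonical_nth a.
  have hG : G \is n.-homog.
    apply: rpred_sum => b _; have [n' nd' hn'] := canonical_nth b.
    have -> : n = n' by apply/eqP; rewrite -(eqn_add2r 3) nd nd'.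
    by rewrite mul_mpolyC rpredZ.
  have /(ff_genP K hG)[Q eQ] := evG; apply/eqP/contraT => G0.
  rewrite eQ in hG G0; have [e [f [ef _ hF']]] := dhomog_factor hG G0.
  have F0 : F != 0 by apply: contraNneq G0 => ->; rewrite mulr0.
  have fd := dhomog_uniq F0 hF' hF; move: ef nd; rewrite fd; clear; lia.
have [A [s [hA hs ew]]] := dn w.
pose s' := s ++ nseq 3 (line_z C); pose A' := A * 'X_2%:R ^+ d.
have hs' m : m \in s' -> m != 0 /\ dot m (e1 C) = 0.
  by rewrite mem_cat => /orP[/hs|/pencil_z].
have hX : ('X_2%:R ^+ d : {mpoly C[3]}) \is d.-homog.
  by rewrite -(lines_z C) -{2}(size_nseq d (line_z C)) lins_homog.
have hA' : A' \is (size s + d).-homog by apply: dhomogM.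
have evP : ev (\prod_(m <- s') lin m) = \prod_(m <- s) ev (lin m) * xi 2%:R ^+ 3.
  rewrite ev_lines big_cat big_nseq line_zE /= /ev mmapX mmap1U -/ev.
  by rewrite mulr1 !exprS expr0 mulr1.
have evA : ev A' = ev A * xi 2%:R ^+ d by rewrite evM evXn /ev mmapX mmap1U.
have ey : ev A' / ev (\prod_(m <- s') lin m) = w / s0.
  rewrite evP evA ew /s0 invf_div -[LHS]mulf_div; congr (_ * _).
have sz : (size s + d + 3 = size s' + d)%N.
  by rewrite size_cat size_nseq addnAC.
have [|y0|[G [n [hG nd eG]]]] := bounded_form hF d_gt0 Fe smF dn hA' hs' sz.
- move=> v p i bv pi; have [xi0 c] := branch_chart hF bv pi.
  have := hw v => /(regular_at _ bv pi); rewrite (evi_form hA' xi0) (evi_form (lins_homog s') xi0).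
  have -> : ev A' / xi i ^+ (size s + d) / (ev (\prod_(m <- s') lin m) / xi i ^+ size s') =
      ev A' / ev (\prod_(m <- s') lin m) * (xi i ^+ 3 / xi i ^+ d).
    rewrite size_cat size_nseq !exprD; 
    have P0 : ev (\prod_(m <- s') lin m) != 0.
      rewrite ev_lines prodf_seq_neq0; apply/allP => m /hs'[m0 mo].
      exact (line_neq0 K hF d_gt0 Fe m0 mo).
    by field; rewrite P0 xi0 !expf_neq0.
  rewrite ey (_ : w / s0 * _ = w / chart_scale i) //.
  by rewrite /s0 /chart_scale; field; rewrite xi0 xi2 !expf_neq0.
- exists (fun=> 0); rewrite big1 => [|a _]; last by rewrite rmorph0 scale0r.
  by move/eqP: y0; rewrite ey mulf_eq0 invr_eq0 (negbTE s00) orbF => /eqP.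
exists (fun a => G@_(nth 0%MM canonical_forms a)).
have -> : w = ev G * s0 by rewrite -eG ey divfK.
transitivity (ev (\sum_(a < size canonical_forms) G@_(nth 0%MM canonical_forms a) *: mon a) * s0).
  by rewrite -(supportedE uniq_canonical_forms (canonicalP hG nd)).
rewrite /ev (raddf_sum (mmap iota xi)) mulr_suml; apply: eq_bigr => b _.
rewrite -mul_mpolyC -[X in X * _]/(ev (_%:MP * mon b)) evM -mulrA.
by rewrite [X in X * _](_ : _ = iota (G@_(nth 0%MM canonical_forms b))) //; apply: mmapC.
Qed.

End Differentials.


Section Stabilizer.
Variables (r : nat) (rho : 'I_r -> nat).

Definition stab : {set 'S_r} := [set s : 'S_r | [forall j, rho (s j) == rho j]].

Lemma stabP (s : 'S_r) : reflect (forall j, rho (s j) = rho j) (s \in stab).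
Proof. by rewrite inE; apply: (iffP forallP) => h j; apply/eqP. Qed.

Lemma stab_group_set : group_set stab.
Proof.
apply/group_setP; split; first by apply/stabP => j; rewrite perm1.
by move=> s t /stabP hs /stabP ht; apply/stabP => j; rewrite permM ht hs.
Qed.
Canonical stab_group := Group stab_group_set.

Let low n : {set 'S_r} :=
  [set s : 'S_r | [forall j, (rho (s j) == rho j) && ((n <= rho j) ==> (s j == j))]].

Let lowP n (s : 'S_r) : reflect (forall j, rho (s j) = rho j /\ (n <= rho j -> s j = j)) (s \in low n).
Proof.
rewrite inE; apply: (iffP forallP) => h j.
  by have /andP[/eqP h1 /implyP h2] := h j; split=> // /h2/eqP.
by have [-> h2] := h j; rewrite eqxx; apply/implyP => /h2 ->.
Qed.

Let fiber n := [set j | rho j == n].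

(** A permutation preserving rho is built from one permutation of each fibre. *)
Let low_step n : #|low n.+1| = #|low n| * #|fiber n|`!.
Proof.
have -> : #|fiber n|`! = #|[set t : 'S_r | perm_on (fiber n) t]|.
  by rewrite -card_perm; apply: eq_card => t; rewrite !inE.
rewrite -cardsX; set D := setX _ _.
have closed (t : 'S_r) j : perm_on (fiber n) t -> rho (t j) = rho j.
  move=> ht; have [jA|jA] := boolP (j \in fiber n); last by rewrite (out_perm ht).
  have : t j \in fiber n by rewrite perm_closed.
  by rewrite inE => /eqP ->; rewrite inE in jA; rewrite (eqP jA).
have -> : low n.+1 = [set (u.1 * u.2)%g | u in D].
  apply/setP => p; apply/idP/imsetP => [/lowP hp|[[s t]]]; last first.
    rewrite inE /= => /andP[/lowP hs]; rewrite inE => ht ->; apply/lowP => j.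
    have [hs1 hs2] := hs j; rewrite permM closed //; split=> // nj.
    by rewrite hs2 1?ltnW // (out_perm ht) // inE gtn_eqF.
  have pA : p \in 'N(fiber n | 'P)%g.
    rewrite !inE /=; apply/subsetP => j; rewrite !inE /= => /eqP <-.
    by have [e _] := hp j; rewrite /aperm e.
  pose t := restr_perm (fiber n) p; have ht : perm_on (fiber n) t := restr_perm_on _ _.
  have tA j : j \in fiber n -> t j = p j by exact: restr_permE.
  have tV j : j \notin fiber n -> (t^-1)%g j = j.
    by move=> jA; apply: (can_inj (permK t)); rewrite permKV (out_perm ht).
  exists ((p * t^-1)%g, t); last by rewrite mulgKV.
  rewrite inE /= [t \in _]inE ht andbT; apply/lowP => j; rewrite permM.
  have [pj pfix] := hp j.
  have [jA|jA] := boolP (j \in fiber n); first by rewrite -tA // permK.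
  have pjA : p j \notin fiber n by rewrite inE pj; rewrite inE in jA.
  rewrite tV //; split=> //; rewrite leq_eqVlt => /orP[/eqP e|/pfix //].
  by rewrite inE -e eqxx in jA.
rewrite card_in_imset // => -[s t] [s' t']; rewrite !inE /= => /andP[hs ht] /andP[hs' ht'] e.
have et : t = t'.
  apply/permP => j; have [jA|jA] := boolP (j \in fiber n); last first.
    by rewrite (out_perm ht) // (out_perm ht').
  have nj : (n <= rho j) by rewrite inE in jA; rewrite (eqP jA).
  have := congr1 (fun p : 'S_r => p j) e; rewrite !permM.
  have /lowP/(_ j)[_ /(_ nj) ->] : s \in low n by rewrite inE.
  by have /lowP/(_ j)[_ /(_ nj) ->] : s' \in low n by rewrite inE.
by move: e; rewrite et => /mulIg ->.
Qed.

Lemma card_stab d : (forall j, 0 < rho j <= d) ->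
  #|stab| = \prod_(1 <= i < d.+1) #|[set j | rho j == i]|`!.
Proof.
move=> h; have -> : stab = low d.+1.
  apply/setP => s; apply/stabP/lowP => hs j; last by have [] := hs j.
  by split=> //; have /andP[_ jd] := h j; rewrite ltnNge jd.
have low1 : #|low 1| = 1.
  rewrite (_ : low 1 = [set 1%g]) ?cards1 //; apply/setP => s; rewrite in_set1.
  apply/lowP/eqP => [hs|-> j]; last by rewrite perm1.
  by apply/permP => j; rewrite perm1; have [_ ->] := hs j; case/andP: (h j).
elim: d {h} => [|d IH]; first by rewrite big_geq.
rewrite big_nat_recr //= -IH; exact: low_step.
Qed.

End Stabilizer.

Section OrbitRepresentatives.
Variables (T : eqType) (r : nat) (G : {group 'S_r}).
Implicit Types (q : {ffun 'I_r -> T}) (s : seq {ffun 'I_r -> T}).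

Definition permute (p : 'S_r) q : {ffun 'I_r -> T} := [ffun j => q (p j)].

Lemma permuteM p p' q : permute p (permute p' q) = permute (p * p')%g q.
Proof. by apply/ffunP => j; rewrite !ffunE permM. Qed.

Lemma permute1 q : permute 1%g q = q.
Proof. by apply/ffunP => j; rewrite ffunE perm1. Qed.

(** Representatives for a free action of a group of permutations. *)
Lemma orbit_representatives s : uniq s -> (forall q, q \in s -> injective q) ->
  (forall q p, q \in s -> p \in G -> permute p q \in s) ->
  exists t, [/\ uniq t, {subset t <= s},
    forall q q' p, q \in t -> q' \in t -> p \in G -> q = permute p q' -> q = q',
    forall q, q \in s -> exists q' p, [/\ q' \in t, p \in G & q = permute p q'] &
    size s = (size t * #|G|)%N].
Proof.
have [n] := ubnP (size s); elim: n s => // n IH [|q s'] sn us inj cl.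
  by exists [::].
set s := q :: s' in us inj cl sn *; pose O := [seq permute p q | p <- enum G].
have qs : q \in s by exact: mem_head.
have memO x : reflect (exists2 p, p \in G & x = permute p q) (x \in O).
  apply: (iffP mapP) => -[p]; first by rewrite mem_enum; exists p.
  by move=> pG ->; exists p; rewrite ?mem_enum.
have uO : uniq O.
  rewrite map_inj_uniq ?enum_uniq // => p p' e; apply/permP => j.
  by apply: (inj q qs); have := congr1 (fun f : {ffun 'I_r -> T} => f j) e; rewrite !ffunE.
pose s1 := [seq x <- s | x \notin O].
have sz : size s = (size s1 + #|G|)%N.
  rewrite -(count_predC (mem O) s) addnC size_filter; congr (_ + _)%N.
  rewrite cardE -(size_map (permute^~ q)) -/O -size_filter; apply: perm_size.
  apply: uniq_perm => //; first exact: filter_uniq.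
  move=> x; rewrite mem_filter /= andb_idr // => /memO[p pG ->]; exact: cl.
have qO : q \in O by apply/memO; exists 1%g; rewrite ?group1 ?permute1.
have [|||x p|t [ut ts tinj tcov tsz]] := IH s1.
- rewrite -ltnS; apply: leq_trans sn; rewrite ltnS sz -addn1 leq_add2l.
  by apply/card_gt0P; exists 1%g; apply: group1.
- exact: filter_uniq.
- by move=> x; rewrite mem_filter => /andP[_ xs]; apply: inj.
- rewrite !mem_filter => /andP[xO xs] pG; rewrite cl // andbT; apply: contra xO.
  move/memO => [p' p'G e]; apply/memO; exists (p^-1 * p')%g; first by rewrite groupM ?groupV.
  by rewrite -permuteM -e permuteM mulVg permute1.
have tO x : x \in t -> x \notin O by move=> /ts; rewrite mem_filter => /andP[].
exists (q :: t); split=> /=.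
- by rewrite ut andbT; apply/negP => /tO; rewrite qO.
- by move=> x; rewrite inE => /orP[/eqP -> //|/ts]; rewrite mem_filter => /andP[].
- move=> x y p; rewrite !inE => /orP[/eqP ->|xt] /orP[/eqP ->|yt] // pG e.
  + case/negP: (tO _ yt); apply/memO; exists (p^-1)%g; first by rewrite groupV.
    by rewrite e permuteM mulVg permute1.
  + by case/negP: (tO _ xt); apply/memO; exists p.
  + exact: tinj xt yt pG e.
- move=> x xs; have [/memO[p pG ->]|xO] := boolP (x \in O).
    by exists q, p; rewrite mem_head.
  have [|y [p [yt pG ->]]] := tcov x; first by rewrite mem_filter xO.
  by exists y, p; rewrite inE yt orbT.
by rewrite -[(size s').+1]/(size s) sz tsz mulSn addnC.
Qed.

End OrbitRepresentatives.

Section Unisolvence.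
Local Open Scope ring_scope.
Variables (C : numClosedFieldType) (X : Type) (Z : X -> Prop) (N : nat) (f : 'I_N -> X -> C).

(** Functions that are independent on Z are so on as many points of Z. *)
Lemma unisolvent : (forall u : 'cV[C]_N, (forall x, Z x -> \sum_a f a x * u a 0 = 0) -> u = 0) ->
  exists x : 'I_N -> X, (forall i, Z (x i)) /\ \det (\matrix_(i, a) f a (x i)) != 0.
Proof.
move=> indep; pose ev x : 'rV[C]_N := \row_a f a x.
suff [x [Zx rf]] : exists x : 'I_N -> X, (forall i, Z (x i)) /\
    row_free (\matrix_(i < N) ev (x i)).
  exists x; split=> //; rewrite -unitfE -unitmxE -row_free_unit.
  by congr (row_free _): rf; apply/matrixP => i a; rewrite !mxE.
suff H k : (k <= N)%N -> exists x : 'I_k -> X, (forall i, Z (x i)) /\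
    row_free (\matrix_(i < k) ev (x i)) by exact: H.
elim: k => [|k IH] kN.
  by exists (fun i : 'I_0 => False_rect X (notF (ltn_ord i))); split=> [[]//|]; rewrite /row_free flatmx0 mxrank0.
have [x [Zx rf]] := IH (ltnW kN); set A := \matrix_(i < k) ev (x i) in rf.
have [u Au u0] : exists2 u : 'cV[C]_N, A *m u = 0 & u != 0.
  have : kermx A^T != 0.
    rewrite kermx_eq0 /row_free mxrank_tr neq_ltn; apply/orP; left.
    by apply: leq_ltn_trans kN; apply: rank_leq_row.
  case/rowV0Pn => v /sub_kermxP e v0; exists v^T; last by rewrite trmx_eq0.
  by rewrite -[A]trmxK -trmx_mul e trmx0.
have [y [Zy fy]] : exists y, Z y /\ ev y *m u != 0.
  apply: NNPP => h; case/eqP: u0; apply: indep => y Zy; apply/eqP/contraT => ne.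
  case: h; exists y; split=> //; apply: contraNneq ne => e.
  have := congr1 (fun M : 'M[C]_1 => M 0 0) e; rewrite !mxE => e'.
  by apply/eqP; rewrite -[RHS]e'; apply: eq_bigr => a _; rewrite mxE.
pose x' (i : 'I_k.+1) := if unlift ord0 i is Some j then x j else y.
exists x'; split=> [i|]; first by rewrite /x'; case: unliftP.
rewrite -kermx_eq0; apply/eqP/row_matrixP => i0; rewrite row0.
have : (row i0 (kermx (\matrix_(i < k.+1) ev (x' i))) <= kermx (\matrix_(i < k.+1) ev (x' i)))%MS.
  exact: row_sub.
move: (row i0 _) => w /sub_kermxP; rewrite mulmx_sum_row big_ord_recl rowK {1}/x' unlift_none.
pose w' := \row_j w 0 (lift ord0 j).
have -> : \sum_(j < k) w 0 (lift ord0 j) *: row (lift ord0 j) (\matrix_(i < k.+1) ev (x' i)) = w' *m A.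
  by rewrite mulmx_sum_row; apply: eq_bigr => j _; rewrite !rowK /x' liftK mxE.
move=> e; have w0 : w 0 ord0 = 0.
  have := congr1 (fun M : 'rV_N => M *m u) e; rewrite mulmxDl -scalemxAl -mulmxA Au mulmx0 addr0.
  by rewrite mul0mx => /eqP; rewrite scaler_eq0 (negbTE fy) orbF => /eqP.
move: e; rewrite w0 scale0r add0r => e.
have w'0 : w' = 0 by apply: (row_free_inj rf); rewrite e mul0mx.
apply/rowP => j; rewrite mxE; case: (unliftP ord0 j) => [j' ->|-> //].
by have := congr1 (fun v : 'rV_k => v 0 j') w'0; rewrite !mxE.
Qed.

End Unisolvence.


Section Certificate.
Local Open Scope ring_scope.
Variable C : numClosedFieldType.
Implicit Types (F G H : {mpoly C[3]}) (p v : 'rV[C]_3).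

Lemma pihomogM n e f (g F : {mpoly C[n]}) : F \is f.-homog ->
  pihomog mdeg (e + f) (g * F) = pihomog mdeg e g * F.
Proof.
move=> hF; rewrite (mpolyE g) mulr_suml !raddf_sum mulr_suml /=; apply: eq_bigr => m _.
rewrite -scalerAl !linearZ /= pihomogX -scalerAl; congr (_ *: _).
have hm : ('X_[m] : {mpoly C[n]}) \is (mdeg m).-homog by rewrite dhomogX.
case: eqP => [<-|ne]; first by rewrite (pihomog_dE (dhomogM hm hF)).
rewrite mul0r (pihomog_ne0 _ (dhomogM hm hF)) // eqn_add2r; exact/eqP.
Qed.

(** The multiples of the partial derivatives of F in degree e + d - 1. *)
Definition partial_multiples e F (i : ('I_3 * 'I_(size (formms 3 e)))%type) : {mpoly C[3]} :=
  'X_[nth 0%MM (formms 3 e) i.2] * F^`M(i.1).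

Definition certified d e F := spanning (formms 3 (e + d)) (partial_multiples (e:=e) F).

Lemma form_nth e (k : 'I_(size (formms 3 e))) :
  ('X_[nth 0%MM (formms 3 e) k] : {mpoly C[3]}) \is e.-homog.
Proof. by rewrite dhomogX /= -mem_formms mem_nth. Qed.

Lemma certified_smooth d e F : certified d e F -> smooth_form F.
Proof.
move=> h p /rV0Pn[i pi] _; apply: NNPP => nj.
have [a ea] : exists a : 'I_3 * 'I_(size (formms 3 e)) -> C,
    'X_i ^+ (e + d) = \sum_k a k *: partial_multiples F k.
  apply: h; apply/dhomog_supported.
  by rewrite mpolyXn dhomogX /= mdegMn mdeg1 mul1n.
have := congr1 (meval (p 0)) ea; rewrite rmorphXn /= mevalXU raddf_sum big1 => [/eqP|k _].
  by rewrite expf_eq0 (negbTE pi) andbF.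
rewrite /= mevalZ mevalM [X in _ * (_ * X)](_ : _ = 0) ?mulr0 //.
by apply/eqP/contraT => ne; case: nj; exists k.1.
Qed.

Definition partial_ideal F G := exists g : 'I_3 -> {mpoly C[3]}, G = \sum_j g j * F^`M(j).

Lemma partial_idealP F : is_ideal (partial_ideal F).
Proof.
split; first by exists (fun=> 0); rewrite big1 // => j _; rewrite mul0r.
- move=> _ _ [g ->] [h ->]; exists (fun j => g j + h j).
  by rewrite -big_split; apply: eq_bigr => j _; rewrite mulrDl.
by move=> _ q [g ->]; exists (fun j => q * g j); rewrite mulr_sumr; apply: eq_bigr => j _; rewrite mulrA.
Qed.

Lemma ideal_sum (P : {mpoly C[3]} -> Prop) (I : Type) (s : seq I) (f : I -> {mpoly C[3]}) :
  is_ideal P -> (forall i, P (f i)) -> P (\sum_(i <- s) f i).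
Proof.
move=> [i0 iD _] h; elim: s => [|i s IH]; rewrite ?big_nil // big_cons; exact: iD.
Qed.

Lemma certificate_exists d F k : F \is d.+1.-homog ->
  (forall i : 'I_3, partial_ideal F ('X_i ^+ k)) -> certified d (3 * k) F.
Proof.
move=> hF hk G /dhomog_supported hG; have iI := partial_idealP F; have [_ _ iM] := iI.
have hj j := dhomog_deriv j hF.
have mon m : (3 * k <= mdeg m)%N -> partial_ideal F 'X_[m].
  move=> mk; have [i im] : exists i : 'I_3, (k <= m i)%N.
    apply: NNPP => h; move: mk; rewrite mdegE leqNgt => /negP[].
    have lt (i : 'I_3) : (m i < k)%N by rewrite ltnNge; apply/negP => h'; apply: h; exists i.
    rewrite sum3; move: (lt 0) (lt 1) (lt 2%:R); move: (m 0) (m 1) (m 2%:R) => a b c.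
    by clear; lia.
  have -> : 'X_[m] = 'X_[m - (U_(i) *+ k)] * 'X_i ^+ k :> {mpoly C[3]}.
    rewrite mpolyXn -mpolyXD submK //; apply/mnm_lepP => j.
    by rewrite mulmnE mnm1E; case: eqP => [<-|_]; rewrite ?mul1n ?mul0n.
  exact: iM.
have [g eg] : partial_ideal F G.
  rewrite (mpolyE G) big_seq.
  apply: (big_ind (partial_ideal F)) => [|x y|m mG]; [exact: (ideal0 iI)|exact: (idealD iI)|].
  rewrite -mul_mpolyC; apply: iM; apply: mon.
  by have /dhomogP/(_ m mG) /= -> := hG; rewrite leq_addr.
exists (fun i : 'I_3 * 'I_(size (formms 3 (3 * k))) => (pihomog mdeg (3 * k) (g i.1))@_(nth 0%MM (formms 3 (3 * k)) i.2)).
transitivity (\sum_j pihomog mdeg (3 * k) (g j) * F^`M(j)).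
  rewrite -{1}(pihomog_dE hG) eg raddf_sum; apply: eq_bigr => j _; exact: pihomogM.
rewrite -(pair_bigA_idem _ (fun (j : 'I_3) (a : 'I_(size (formms 3 (3 * k)))) =>
  (pihomog mdeg (3 * k) (g j))@_(nth 0%MM (formms 3 (3 * k)) a) *:
   partial_multiples F (j, a))) /=; last by rewrite addr0.
apply: eq_bigr => j _.
have sj : supported (formms 3 (3 * k)) (pihomog mdeg (3 * k) (g j)).
  by apply/dhomog_supported; apply: pihomogP.
rewrite {1}(supportedE (uniq_formms _ _) sj) mulr_suml; apply: eq_bigr => a _.
by rewrite -scalerAl.
Qed.

Section Radical.
Variable P : {mpoly C[3]} -> Prop.
Hypothesis hP : is_ideal P.

Definition radical x := exists k, P (x ^+ k).

Lemma radical_le x k n : P (x ^+ k) -> (k <= n)%N -> P (x ^+ n).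
Proof. by move=> h kn; rewrite -(subnK kn) exprD; apply: (idealM hP). Qed.

Lemma radical_gen x : P x -> radical x.
Proof. by exists 1%N; rewrite expr1. Qed.

Lemma radicalM x y : radical x -> radical (y * x).
Proof. by move=> [k h]; exists k; rewrite exprMn; apply: (idealM hP). Qed.

Lemma radicalX x n : radical (x ^+ n) -> radical x.
Proof. by move=> [k h]; exists (n * k)%N; rewrite exprM. Qed.

Lemma radicalD x y : radical x -> radical y -> radical (x + y).
Proof.
move=> [k hk] [n hn]; exists (k + n)%N; rewrite exprDn.
apply: ideal_sum => // i; rewrite -mulr_natl; apply: (idealM hP).
have [ik|ik] := leqP i n.
  rewrite mulrC; apply: (idealM hP); apply: radical_le hk _.
  by move: ik; clear; case: i => i /= _; lia.
by apply: (idealM hP); apply: radical_le hn (ltnW ik).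
Qed.

(** Avoiding the union of the loci h_i = 0 by a power of u is avoiding each. *)
Lemma adjoin_prod (I : eqType) (s : seq I) (h : I -> {mpoly C[3]}) u n :
  (forall i, i \in s -> adjoin P (h i) (u ^+ n)) ->
  exists k, adjoin P (\prod_(i <- s) h i) (u ^+ k).
Proof.
elim: s => [|i s IH] hs; first by exists 0%N, 0, 1; rewrite big_nil expr0 mul1r add0r; split=> //; exact: (ideal0 hP).
have [j js|k [a [b [Pa e]]]] := IH; first by apply: hs; rewrite inE js orbT.
have [a' [b' [Pa' e']]] := hs i (mem_head _ _).
exists (n + k)%N, (a' * a + a' * (\prod_(i <- s) h i * b) + h i * b' * a), (b' * b).
split; last by rewrite big_cons exprD e e'; ring.
apply: (idealD hP); last exact: (idealM hP).
by apply: (idealD hP); [exact: (idealM hP)|rewrite mulrC; exact: (idealM hP)].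
Qed.

End Radical.

Definition dirderiv v F := \sum_j v 0 j *: F^`M(j).

Lemma dirderivD v F G : dirderiv v (F + G) = dirderiv v F + dirderiv v G.
Proof. by rewrite -big_split; apply: eq_bigr => j _; rewrite mderivD scalerDr. Qed.

Lemma dirderivM v F G : dirderiv v (F * G) = dirderiv v F * G + F * dirderiv v G.
Proof.
rewrite mulr_suml mulr_sumr -big_split; apply: eq_bigr => j _ /=.
by rewrite mderivM scalerDr scalerAl scalerAr.
Qed.

Lemma dirderivZ v a F : dirderiv v (a *: F) = a *: dirderiv v F.
Proof.
by rewrite scaler_sumr; apply: eq_bigr => j _; rewrite mderivZ !scalerA mulrC.
Qed.

Lemma dirderiv1 v : dirderiv v 1 = 0.
Proof. by rewrite /dirderiv big1 // => j _; rewrite -mpolyC1 mderivC scaler0. Qed.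

Lemma dirderiv_lin v l : dirderiv v (lin l) = (dot l v)%:MP.
Proof.
have dl j : (lin l)^`M(j) = (l 0 j)%:MP.
  rewrite /lin raddf_sum (bigD1 j) //= mderivZ mderiv_var eqxx big1 ?addr0.
    by rewrite -mul_mpolyC mulr1.
  by move=> k kj; rewrite mderivZ mderiv_var (negbTE kj) scaler0.
rewrite /dirderiv /dot; under eq_bigr do rewrite dl -mul_mpolyC -mpolyCM mulrC.
by rewrite rmorph_sum.
Qed.

Lemma dirderivXn v F n : dirderiv v (F ^+ n) = n%:R * F ^+ n.-1 * dirderiv v F.
Proof.
elim: n => [|n IH]; first by rewrite expr0 dirderiv1 mulr0n !mul0r.
rewrite exprS dirderivM IH /=; case: n {IH} => [|n]; first by rewrite !mul0r mulr0 addr0 expr0 !mul1r mulr1.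
by rewrite -[n.+2%:R]natr1 exprS /=; ring.
Qed.

Lemma partial_ideal_dir v F : partial_ideal F (dirderiv v F).
Proof. by exists (fun j => (v 0 j)%:MP); apply: eq_bigr => j _; rewrite mul_mpolyC. Qed.

Lemma partial_ideal_self d F : F \is d.-homog -> (0 < d)%N -> partial_ideal F F.
Proof.
move=> hF d0; exists (fun j => d%:R^-1%:MP * 'X_j).
under eq_bigr do rewrite -mulrA; rewrite -mulr_sumr (mpoly_euler hF) mul_mpolyC scalerA.
by rewrite mulVf ?scale1r // pnatr_eq0 -lt0n.
Qed.

Section ExplicitCurve.
Variables (M : 'M[C]_3) (uM : M \in unitmx) (al : seq C) (gam : C).

Local Notation s := (lin (row 0 M)).
Local Notation t := (lin (row 1 M)).
Local Notation l := (lin (row 2%:R M)).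
Local Notation d := (size al).
Local Notation b := (\prod_(a <- al) ('X - a%:P)).

Definition explicit_curve : {mpoly C[3]} :=
  \prod_(a <- al) (s - a%:MP * t) + l * (t ^+ d.-1 + gam%:MP * l ^+ d.-1).

Hypotheses (d_gt0 : (0 < d)%N) (gam0 : gam != 0).

Lemma explicit_homog : explicit_curve \is d.-homog.
Proof.
have hl k n : lin (row k M) ^+ n \is n.-homog.
  by have := dhomogMn n (lin_homog (row k M)); rewrite mul1n.
apply: rpredD.
  elim: al => [|a r IH]; first by rewrite big_nil dhomog1.
  rewrite big_cons -[size _]/(1 + size r)%N; apply: (dhomogM (d := 1) _ IH).
  by apply: rpredB; rewrite ?mul_mpolyC ?rpredZ // lin_homog.
have h2 : t ^+ d.-1 + gam%:MP * l ^+ d.-1 \is (d.-1).-homog.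
  by apply: rpredD; rewrite ?mul_mpolyC ?rpredZ // hl.
by have := dhomogM (lin_homog (row 2%:R M)) h2; rewrite add1n prednK.
Qed.

Lemma product_mod mu (r : seq C) : exists Q, \prod_(a <- r) (s - a%:MP * t) =
  (\prod_(a <- r) (mu - a))%:MP * t ^+ size r + (s - mu%:MP * t) * Q.
Proof.
elim: r => [|a r [Q IH]]; first by exists 0; rewrite !big_nil /= mulr0 addr0 expr0 mulr1.
exists (\prod_(a <- r) (s - a%:MP * t) + (mu - a)%:MP * t * Q).
rewrite !big_cons /= exprS mpolyCM {1}IH.
have -> : s - a%:MP * t = (s - mu%:MP * t) + (mu - a)%:MP * t by rewrite mpolyCB; ring.
rewrite [in RHS]IH; ring.
Qed.

Lemma product_deriv x (r : seq C) : dot (row 1 M) x != 0 ->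
  let tau := dot (row 1 M) x in let y := dot (row 0 M) x / tau in
  (\prod_(a <- r) (s - a%:MP * t)).@[x 0] = tau ^+ size r * (\prod_(a <- r) ('X - a%:P)).[y] /\
  tau * (dirderiv (row 0 (dualmx M)) (\prod_(a <- r) (s - a%:MP * t))).@[x 0] =
    tau ^+ size r * (\prod_(a <- r) ('X - a%:P))^`().[y].
Proof.
move=> t0 /=; set tau := dot (row 1 M) x in t0 *; set y := _ / tau.
have ey : dot (row 0 M) x = y * tau by rewrite divfK.
elim: r => [|a r [e1 e2]].
  by rewrite !big_nil dirderiv1 meval0 meval1 hornerC derivC horner0 !mulr0 expr0 mulr1.
rewrite !big_cons dirderivM derivM derivXsubC mul1r !hornerE.
have -> : dirderiv (row 0 (dualmx M)) (s - a%:MP * t) = 1.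
  rewrite -[- (_ * _)]mulNr -mpolyCN mul_mpolyC dirderivD dirderivZ !dirderiv_lin !dot_dual //=.
  by rewrite mpolyC0 scaler0 addr0 mpolyC1.
rewrite mul1r !mevalD !mevalM mulrDr mulrCA e2 e1 mevalB mevalM mevalC !lin_dot -/tau ey /=.
by rewrite !exprS; split; ring.
Qed.

(** With F_s and F_l denoting derivatives in the directions of the frame, F_s is
    a product of lines s = mu t; on such a line F_l and F leave only the origin. *)
Lemma explicit_certified : (forall mu, root b^`() mu ->
    (1 - d%:R) ^+ d.-1 + d%:R * gam * (d%:R * \prod_(a <- al) (mu - a)) ^+ d.-1 != 0) ->
  exists e, certified d.-1 e explicit_curve.
Proof.
move=> hmu; set F := explicit_curve; have hF := explicit_homog.
have iI := partial_idealP F; pose P := partial_ideal F.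
have [rs ers] := closed_field_poly_normal b^`().
have szb : size b = d.+1 by rewrite size_prod_XsubC.
have d0 : d%:R != 0 :> C by rewrite pnatr_eq0 -lt0n.
have cb : b^`()`_(d.-1) = d%:R.
  have : lead_coef b = 1 by apply/eqP; exact: monic_prod_XsubC.
  by rewrite lead_coefE szb coef_deriv prednK //= => ->.
have szd : size b^`() = d.
  apply/eqP; rewrite eqn_leq -ltnS -szb lt_size_deriv -?size_poly_gt0 ?szb //=.
  rewrite -[X in (X <= _)%N](prednK d_gt0) ltnNge; apply/negP => h.
  by case/eqP: d0; rewrite -cb nth_default.
have lcb : lead_coef b^`() = d%:R by rewrite lead_coefE szd.
have szr : d = (size rs).+1.
  by have := congr1 (fun p : {poly C} => size p) ers; rewrite szd lcb size_scale // size_prod_XsubC.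
have row_neq0 k : row k M != 0.
  apply/eqP => z; have := dot_dual k k uM; rewrite eqxx z -(scale0r 0) dotZl mul0r.
  by move/eqP; rewrite eq_sym oner_eq0.
have Fs : P (\prod_(mu <- rs) (s - mu%:MP * t)).
  have := partial_ideal_dir (row 0 (dualmx M)) F.
  have -> : dirderiv (row 0 (dualmx M)) F = d%:R%:MP * \prod_(mu <- rs) (s - mu%:MP * t).
    rewrite /F /explicit_curve dirderivD [X in _ + X](_ : _ = 0) ?addr0; last first.
      rewrite mul_mpolyC dirderivM dirderivD dirderivZ !dirderivXn !dirderiv_lin !dot_dual //=.
      by rewrite mpolyC0 !mulr0 scaler0 mul0r addr0 mulr0 addr0.
    apply: (mpoly_ext_off_plane (row_neq0 1)) => x tx.
    have [_ e1'] := product_deriv al tx; have [e2 _] := product_deriv rs tx.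
    apply: (mulfI tx); rewrite e1' ers lcb hornerZ mevalM mevalC e2 szr /= exprS.
    by ring.
  move=> h; have := idealM iI (d%:R^-1%:MP) h; by rewrite mulrA -mpolyCM mulVf // mul1r.
have Fl : P (t ^+ d.-1 + (d%:R * gam)%:MP * l ^+ d.-1).
  have := partial_ideal_dir (row 2%:R (dualmx M)) F; congr (P _).
  have B0 : dirderiv (row 2%:R (dualmx M)) (\prod_(a <- al) (s - a%:MP * t)) = 0.
    elim: al => [|a r IH]; first by rewrite big_nil dirderiv1.
    rewrite big_cons dirderivM IH mulr0 addr0.
    rewrite -[- (_ * _)]mulNr -mpolyCN mul_mpolyC dirderivD dirderivZ !dirderiv_lin !dot_dual //=.
    by rewrite mpolyC0 scaler0 addr0 mul0r.
  rewrite /F /explicit_curve dirderivD B0 add0r mul_mpolyC dirderivM dirderivD dirderivZ.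
  rewrite !dirderivXn !dirderiv_lin !dot_dual //= mpolyC0 mpolyC1 mul1r !mulr0 add0r mulr1.
  rewrite -!mul_mpolyC; case: d d_gt0 => // n _ /=.
  rewrite -addrA; congr (_ + _); case: n => [|n].
    by rewrite mulr0n mul0r !mulr0 addr0 mul1r.
  by rewrite exprS /= mpolyCM mpolyC_nat -[n.+2%:R]natr1; ring.
have FF : P F by apply: partial_ideal_self hF d_gt0.
have [k lk] : exists k, adjoin P (\prod_(mu <- rs) (s - mu%:MP * t)) (l ^+ k).
  apply: (adjoin_prod iI (n := (d.-1 + d.-1)%N)) => mu mrs.
  have rmu : root b^`() mu by rewrite ers lcb rootZ // root_prod_XsubC.
  have nz := hmu mu rmu; set bet := \prod_(a <- al) (mu - a) in nz.
  have iJ := adjoin_ideal (s - mu%:MP * t) iI.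
  set J := adjoin P _ in iJ *; have PJ q : P q -> J q by exact: adjoin_sub.
  have hJ : J (s - mu%:MP * t) by exact: adjoin_gen.
  have JN q : J q -> J (- q) by rewrite -mulN1r; exact: (idealM iJ).
  have [Q eQ] := product_mod mu al; pose n := d.-1.
  have td : t ^+ d = t * t ^+ n by rewrite -exprS prednK.
  have J1 : J (l ^+ n * ((1 - d%:R)%:MP * l - (d%:R * bet)%:MP * t)).
    have -> : l ^+ n * ((1 - d%:R)%:MP * l - (d%:R * bet)%:MP * t) =
        gam^-1%:MP * (F - Q * (s - mu%:MP * t) -
          (bet%:MP * t + l) * (t ^+ n + (d%:R * gam)%:MP * l ^+ n)).
      have gg : gam^-1%:MP * gam%:MP = 1 :> {mpoly C[3]} by rewrite -mpolyCM mulVf // mpolyC1.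
      rewrite /F /explicit_curve eQ td -/n mpolyCB !mpolyCM mpolyC1.
      transitivity (gam^-1%:MP * gam%:MP * (l ^+ n * ((1 - d%:R%:MP) * l - d%:R%:MP * bet%:MP * t))).
        by rewrite gg mul1r.
      by rewrite -/bet; ring.
    apply: (idealM iJ); apply: (idealD iJ); last by apply: JN; apply: (idealM iJ); apply: PJ.
    by apply: (idealD iJ); [exact: PJ|apply: JN; apply: (idealM iJ)].
  set y := (1 - d%:R)%:MP * l in J1; set z := (d%:R * bet)%:MP * t in J1.
  have J2 : J (l ^+ n * (y ^+ n - z ^+ n)).
    by rewrite subrXX mulrA mulrC; apply: (idealM iJ).
  pose c := (1 - d%:R) ^+ n + d%:R * gam * (d%:R * bet) ^+ n.
  have -> : l ^+ (n + n) = c^-1%:MP * (l ^+ n * (y ^+ n - z ^+ n) +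
      ((d%:R * bet) ^+ n)%:MP * l ^+ n * (t ^+ n + (d%:R * gam)%:MP * l ^+ n)).
    have cc : c^-1%:MP * c%:MP = 1 :> {mpoly C[3]} by rewrite -mpolyCM mulVf // mpolyC1.
    transitivity (c^-1%:MP * c%:MP * l ^+ (n + n)); first by rewrite cc mul1r.
    rewrite -mulrA; congr (_ * _); rewrite /c; set w := (_ * bet) ^+ n.
    have -> : z ^+ n = w%:MP * t ^+ n by rewrite /z exprMn -rmorphXn.
    have -> : y ^+ n = ((1 - d%:R) ^+ n)%:MP * l ^+ n by rewrite /y exprMn -rmorphXn.
    by rewrite mpolyCD !mpolyCM exprD; ring.
  by apply: (idealM iJ); apply: (idealD iJ) => //; apply: (idealM iJ); apply: PJ.
have radl : radical P l.
  have [a [q [Pa e]]] := lk; exists k; rewrite e; apply: (idealD iI) => //.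
  by rewrite mulrC; apply: (idealM iI).
have radt : radical P t.
  case: (posnP d.-1) => [n0|n0].
    exists 0%N; move: Fs; rewrite (_ : rs = [::]) ?big_nil //.
    by apply/eqP; rewrite -size_eq0 -n0 szr.
  apply: (@radicalX P _ d.-1).
  rewrite -[t ^+ _](addrK ((d%:R * gam)%:MP * l ^+ d.-1)); apply: (radicalD iI).
    exact: radical_gen.
  rewrite -mulNr; apply: (radicalM iI).
  by rewrite -(prednK n0) exprSr; apply: (radicalM iI).
have rads : radical P s.
  apply: (@radicalX P _ (size rs)).
  have [Q eQ] : exists Q, \prod_(mu <- rs) (s - mu%:MP * t) = s ^+ size rs + Q * t.
    elim: (rs) => [|mu r [Q IH]]; first by exists 0; rewrite big_nil mul0r addr0.
    exists ((s - mu%:MP * t) * Q - mu%:MP * s ^+ size r); rewrite big_cons IH /= exprS; ring.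
  rewrite -[s ^+ _](addrK (Q * t)) -eQ -mulNr; apply: (radicalD iI); first exact: radical_gen.
  exact: radicalM.
have radX (j : 'I_3) : radical P 'X_j.
  rewrite (frame_linE j uM) sum3 -!mul_mpolyC.
  by do 2?apply: (radicalD iI); apply: radicalM.
have [k0 h0] := radX 0; have [k1 h1] := radX 1; have [k2 h2] := radX 2%:R.
exists (3 * (k0 + k1 + k2))%N; apply: certificate_exists; first by rewrite prednK.
apply: ord3_cases; [apply: radical_le h0 _|apply: radical_le h1 _|apply: radical_le h2 _] => //.
all: by clear; lia.
Qed.


Lemma explicit_on_line x : dot (row 2%:R M) x = 0 ->
  explicit_curve.@[x 0] = \prod_(a <- al) (dot (row 0 M) x - a * dot (row 1 M) x).
Proof.
move=> lx; rewrite mevalD mevalM lin_dot lx mul0r addr0 rmorph_prod; apply: eq_bigr => a _ /=.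
by rewrite mevalB mevalM mevalC !lin_dot.
Qed.

End ExplicitCurve.

Lemma avoid_finite (bad : seq C) : exists a : C, a \notin bad.
Proof.
apply: NNPP => h; pose s := [seq n%:R : C | n <- iota 0 (size bad).+1].
have us : uniq s by rewrite map_inj_uniq ?iota_uniq // => x y /eqP; rewrite eqr_nat => /eqP.
have := uniq_leq_size us (s2 := bad); rewrite size_map size_iota ltnn => H.
suff : false by []; apply: H => x _.
by apply/negPn/negP => xb; apply: h; exists x.
Qed.

(** For all but finitely many values of the parameter the explicit curve is
    certified to be smooth and avoids the given point. *)
Lemma good_explicit_curve (M : 'M[C]_3) (al : seq C) e : M \in unitmx -> (0 < size al)%N ->
  (dot (row 2%:R M) e = 0 -> \prod_(a <- al) (dot (row 0 M) e - a * dot (row 1 M) e) != 0) ->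
  exists gam, [/\ gam != 0, 1 + gam != 0,
    exists k, certified (size al).-1 k (explicit_curve M al gam) &
    (explicit_curve M al gam).@[e 0] != 0].
Proof.
move=> uM d0 he; set d := size al in d0 *; pose b : {poly C} := \prod_(a <- al) ('X - a%:P).
have b'0 : b^`() != 0.
  have szb : size b = d.+1 by rewrite size_prod_XsubC.
  have : lead_coef b = 1 by apply/eqP; exact: monic_prod_XsubC.
  rewrite lead_coefE szb /= => bd; apply: contraTneq d0 => z.
  have := congr1 (fun p : {poly C} => p`_(d.-1)) z; rewrite coef_deriv coef0.
  case: (posnP d) => // d0; rewrite prednK // bd => /eqP; by rewrite pnatr_eq0 (gtn_eqF d0).
have [rs ers] := closed_field_poly_normal b^`().
pose cm mu := d%:R * (d%:R * \prod_(a <- al) (mu - a)) ^+ d.-1.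
pose L := dot (row 2%:R M) e.
pose A := (explicit_curve M al 0).@[e 0].
pose bad := [:: 0; -1; - A / L ^+ d] ++ [seq - (1 - d%:R) ^+ d.-1 / cm mu | mu <- rs].
have [gam gb] := avoid_finite bad; exists gam.
move: gb; rewrite mem_cat !inE !negb_or => /andP[/andP[g0 /andP[g1 gA]] grs].
have g1' : 1 + gam != 0 by rewrite addrC addr_eq0.
split=> //.
- apply: explicit_certified => // mu rmu.
  have mrs : mu \in rs.
    by move: rmu; rewrite ers rootZ ?lead_coef_eq0 // root_prod_XsubC.
  rewrite -/d -mulrA [gam * _]mulrC mulrA -/(cm mu).
  have [c0|c0] := eqVneq (cm mu) 0.
    rewrite c0 mul0r addr0.
    have [d1|d1] := eqVneq d.-1 0%N; first by rewrite d1 expr0 oner_eq0.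
    rewrite expf_neq0 // subr_eq0 -[1]/(1%:R) eqr_nat eq_sym.
    by apply: contraNneq d1 => ->.
  apply: contraNneq grs => /eqP; rewrite addr_eq0 => /eqP z; apply/mapP; exists mu => //.
  by rewrite z opprK mulrAC mulfV ?mul1r.
have eA : (explicit_curve M al gam).@[e 0] = A + gam * L ^+ d.
  rewrite /A /explicit_curve !mevalD !mevalM !mevalD !mevalM !mevalC !rmorphXn /= !lin_dot -/L -/d.
  have -> : L ^+ d = L * L ^+ d.-1 by rewrite -exprS prednK.
  by ring.
have [L0|L0] := eqVneq L 0.
  by rewrite explicit_on_line //; apply: he.
rewrite eA; apply: contraNneq gA => /eqP; rewrite addr_eq0 => /eqP ->.
by rewrite opprK mulfK // expf_neq0.
Qed.

(** A nonzero function has its zeros on finitely many lines of the pencil,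
    because its inverse has a product of such lines as denominator. *)
Lemma form_zero_on_curve d e F G : F \is d.-homog -> (0 < d)%N -> F.@[e1 C 0] != 0 ->
  mpoly_irreducible F -> G \is e.-homog ->
  (forall p, p != 0 -> F.@[p 0] = 0 -> G.@[p 0] = 0) -> mpoly_dvd F G.
Proof.
move=> hF d0 Fe irF hG hz; have [K dn] := function_field_exists hF d0 Fe irF.
apply/(ff_genP K hG); apply/eqP/contraT => G0; rewrite -/(ev K G) in G0.
have zz : line_z C != 0 /\ dot (line_z C) (e1 C) = 0.
  by apply: (@pencil_z C 1); rewrite mem_head.
have lnz m : m != 0 -> dot m (e1 C) = 0 -> ev K (lin m) != 0.
  by move=> m0 mo; exact (line_neq0 K hF d0 Fe m0 mo).
have [A [s [hA hs ex]]] := dn (ev K (lin (line_z C) ^+ e) / ev K G).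
have P0 : ev K (\prod_(m <- s) lin m) != 0.
  by rewrite ev_lines prodf_seq_neq0; apply/allP => m /hs[m0 mo]; apply: lnz.
rewrite -ev_lines in ex.
have hX : lin (line_z C) ^+ e \is e.-homog.
  by have := dhomogMn e (lin_homog (line_z C)); rewrite mul1n.
have [Q eQ] : mpoly_dvd F (A * G - lin (line_z C) ^+ e * \prod_(m <- s) lin m).
  apply/(ff_genP K (e := size s + e)).
    by apply: rpredB; [apply: dhomogM|rewrite addnC; apply: dhomogM => //; apply: lins_homog].
  rewrite -/(ev K _) evB !evM; apply/eqP; rewrite subr_eq0; apply/eqP.
  have -> : ev K (lin (line_z C) ^+ e) = ev K A / ev K (\prod_(m <- s) lin m) * ev K G.
    by rewrite -ex divfK.
  by rewrite mulrAC divfK // mulrC.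
(* A line of the pencil, other than those in the denominator. *)
pose ln a : 'rV[C]_3 := \row_j (if j == 0 then 1 else if j == 1 then 0 else - a).
have [a ha] := avoid_finite [seq - m 0 2%:R / m 0 0 | m : 'rV[C]_3 <- s].
have lno : dot (ln a) (e1 C) = 0 by rewrite dot_e1 mxE.
have ln0 : ln a != 0 by apply/rV0Pn; exists 0; rewrite mxE oner_eq0.
have o0 := meval_pt0 hF d0 Fe.
have [M [uM r2 r1]] := frame_infinity o0 lno ln0; have [g [sg gE [H eF]]] := restrict_plane uM hF.
have gd : g`_d != 0.
  apply: contraNneq Fe => z; rewrite eF mevalD mevalM lin_dot r2 lno mul0r addr0 raddf_sum.
  rewrite big1 // => i _ /=; rewrite mevalZ mevalM !rmorphXn /= !lin_dot -r1 !dot_dual //= expr0n.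
  have [id|id] := eqVneq (i : nat) d; first by rewrite id z mul0r.
  by rewrite subn_eq0 leq_eqVlt eq_sym (negbTE id) ltnNge -ltnS ltn_ord /= !mulr0.
have g1 : size g != 1%N.
  rewrite neq_ltn; apply/orP; right; apply: leq_ltn_trans d0 _.
  by rewrite ltnNge; apply: contra gd => h; rewrite nth_default.
have [p [Fp lp p0]] : exists p : 'rV[C]_3, [/\ F.@[p 0] = 0, dot (ln a) p = 0 & p != 0].
  have /closed_rootP[t gt] := g1; exists (row 0 (dualmx M) + t *: row 1 (dualmx M)); split.
  - by rewrite -gE; apply/eqP.
  - by rewrite -r2 dotDr dotZr !dot_dual //= mulr0 addr0.
  apply/eqP => /(congr1 (dot (row 0 M))); rewrite dotDr dotZr !dot_dual //= mulr0 addr0.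
  by rewrite -(scale0r (row 0 M)) dotZr mul0r => /eqP; rewrite oner_eq0.
have Gp := hz p p0 Fp.
have lpE : p 0 0 = a * p 0 2%:R.
  move: lp; rewrite /dot sum3 !mxE /= mul1r mul0r addr0 mulNr => /eqP.
  by rewrite subr_eq0 => /eqP.
have p2 : p 0 2%:R != 0.
  apply/eqP => z; rewrite z mulr0 in lpE; case/eqP: Fe.
  have p1 : p 0 1 != 0.
    by apply: contraNneq p0 => z1; apply/eqP/rowP; apply: ord3_cases; rewrite mxE.
  have -> : e1 C = (p 0 1)^-1 *: p.
    by apply/rowP; apply: ord3_cases; rewrite !mxE /= ?lpE ?z ?mulr0 // mulVf.
  rewrite (@meval_eq _ _ _ (fun j => (p 0 1)^-1 * p 0 j)); last by move=> j; rewrite mxE.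
  by rewrite (dhomog_eval _ _ hF) Fp mulr0.
have := congr1 (meval (p 0)) eQ; rewrite mevalB !mevalM Fp Gp !mulr0 sub0r rmorph_prod /= => /eqP.
rewrite oppr_eq0 mulf_eq0 rmorphXn /= expf_eq0 lin_dot; apply: contraTT => _.
rewrite negb_or negb_and; apply/andP; split.
  by apply/orP; right; rewrite -lin_dot line_zE mevalXU.
rewrite prodf_seq_neq0; apply/allP => m ms; rewrite lin_dot /=.
have [m0 mo] := hs m ms; rewrite dot_e1 in mo.
rewrite /dot sum3 mo mul0r addr0 lpE mulrA -mulrDl mulf_neq0 //.
have [m00|m00] := eqVneq (m 0 0) 0.
  rewrite m00 mul0r add0r; apply: contraNneq m0 => z.
  by apply/eqP/rowP; apply: ord3_cases; rewrite mxE.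
apply: contraNneq ha => z; apply/mapP; exists m => //.
by apply: (mulfI m00); rewrite mulrCA mulfV // mulr1; apply/eqP; rewrite -addr_eq0 z.
Qed.

End Certificate.


Section HomogeneousProducts.
Local Open Scope ring_scope.
Variables (C : numClosedFieldType) (r : nat) (mu nu : 'I_r -> C).
Implicit Types (M : 'I_r -> nat).

Lemma heval1 M : (forall j, M j = 0%N) -> heval mu nu M 1 = 1.
Proof.
move=> M0; rewrite -[1]mpolyX0 hevalX => [|j]; last by rewrite mnm0E.
by rewrite big1 // => j _; rewrite mnm0E M0 !expr0 mul1r.
Qed.

Lemma boxedXn M e (p : {mpoly C[r]}) : boxed M p -> boxed (fun j => e * M j)%N (p ^+ e).
Proof.
move=> hp; elim: e => [|e IH]; first by rewrite expr0; apply: boxed1.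
by rewrite exprS; apply: boxedW (boxedM hp IH) => j; rewrite mulSn.
Qed.

Lemma hevalXn M e (p : {mpoly C[r]}) : boxed M p ->
  heval mu nu (fun j => e * M j)%N (p ^+ e) = heval mu nu M p ^+ e.
Proof.
move=> hp; elim: e => [|e IH]; first by rewrite !expr0; apply: heval1 => j; rewrite mul0n.
rewrite !exprS -IH -(hevalM _ _ hp (boxedXn (e:=e) hp)); apply: eq_heval => j.
by rewrite mulSn.
Qed.

Lemma boxed_prod (s : seq 'I_r) (N : 'I_r -> 'I_r -> nat) (p : 'I_r -> {mpoly C[r]}) :
  (forall i, boxed (N i) (p i)) -> boxed (fun j => \sum_(i <- s) N i j)%N (\prod_(i <- s) p i).
Proof.
move=> hp; elim: s => [|i s IH]; first by rewrite big_nil; apply: boxed1.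
by rewrite big_cons; apply: boxedW (boxedM (hp i) IH) => j; rewrite big_cons.
Qed.

Lemma heval_prod (s : seq 'I_r) (N : 'I_r -> 'I_r -> nat) (p : 'I_r -> {mpoly C[r]}) :
  (forall i, boxed (N i) (p i)) ->
  heval mu nu (fun j => \sum_(i <- s) N i j)%N (\prod_(i <- s) p i) =
  \prod_(i <- s) heval mu nu (N i) (p i).
Proof.
move=> hp; elim: s => [|i s IH]; first by rewrite !big_nil; apply: heval1 => j; rewrite big_nil.
rewrite !big_cons -IH -(hevalM _ _ (hp i) (boxed_prod (s:=s) hp)); apply: eq_heval => j.
by rewrite big_cons.
Qed.

Let unit_box (j i : 'I_r) : nat := (i == j).

Let linear_boxed (a b : C) j : boxed (unit_box j) (a%:MP - 'X_j * b%:MP).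
Proof.
apply: boxedD; first exact: boxedC.
rewrite -mulrN -mpolyCN mulrC mul_mpolyC; apply: boxedZ; apply: boxedX => i.
by rewrite mnm1E eq_sym.
Qed.

Variable rho : 'I_r -> nat.

Let box_sum j : (\sum_i rho i * unit_box i j = rho j)%N.
Proof.
rewrite (bigD1 j) //= /unit_box eqxx muln1 big1 ?addn0 // => i ij.
by rewrite eq_sym (negbTE ij) muln0.
Qed.

Lemma linear_product_boxed (a b : C) : boxed rho (\prod_j (a%:MP - 'X_j * b%:MP) ^+ rho j).
Proof.
have := boxed_prod (s:=index_enum 'I_r) (fun i => boxedXn (e:=rho i) (@linear_boxed a b i)).
by apply: boxedW => j; rewrite box_sum.
Qed.

Lemma heval_linear_product (a b : C) :
  heval mu nu rho (\prod_j (a%:MP - 'X_j * b%:MP) ^+ rho j) =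
  \prod_j (mu j * a - nu j * b) ^+ rho j.
Proof.
have := heval_prod (index_enum 'I_r) (fun i => boxedXn (e:=rho i) (@linear_boxed a b i)).
rewrite (@eq_heval _ _ mu nu _ rho) => [->|j]; last exact: box_sum.
apply: eq_bigr => j _; rewrite (hevalXn (rho j) (@linear_boxed a b j)); congr (_ ^+ _).
have pm (m : 'X_{1..r}) : (forall i, i != j -> m i = 0%N) -> (m j <= 1)%N ->
    heval mu nu (unit_box j) 'X_[m] = nu j ^+ m j * mu j ^+ (1 - m j).
  move=> m0 mj; rewrite hevalX => [|i]; last first.
    by rewrite /unit_box; case: eqP => [->//|/eqP/m0 ->].
  rewrite (bigD1 j) //= /unit_box eqxx big1 ?mulr1 // => i ij.
  by rewrite m0 // (negbTE ij) !expr0 mulr1.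
rewrite hevalD -[a%:MP]mulr1 mul_mpolyC hevalZ -[1]mpolyX0 pm; last 2 first.
- by move=> i _; rewrite mnm0E.
- by rewrite mnm0E.
rewrite -mulrN -mpolyCN ['X_j * _]mulrC mul_mpolyC hevalZ pm; last 2 first.
- by move=> i ij; rewrite mnm1E eq_sym (negbTE ij).
- by rewrite mnm1E eqxx.
by rewrite mnm0E mnm1E eqxx expr0 mul1r expr1 expr0 mulr1; ring.
Qed.

End HomogeneousProducts.

Section Family.
Local Open Scope ring_scope.
Variables (C : numClosedFieldType) (M : 'M[C]_3).
Hypothesis uM : M \in unitmx.
Variables (m r d : nat) (lam : 'I_m -> nat) (rho : 'I_r -> nat).
Hypotheses (d_gt0 : (0 < d)%N) (deg : (\sum_i lam i + \sum_j rho j = d)%N).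

Local Notation n0 := (size (formms 3 d.-1)).
Local Notation cS x := ((lin (row 0 M)).@[x]).
Local Notation cT x := ((lin (row 1 M)).@[x]).
Local Notation cL x := ((lin (row 2%:R M)).@[x]).
Local Notation l := (row 2%:R M).

Implicit Types (P : 'M[C]_(m, 3)) (X : 'M[C]_(n0, 3)) (x : 'I_3 -> C) (q : 'I_r -> C).

Definition basis_form (a : 'I_n0) : {mpoly C[3]} := 'X_[nth 0%MM (formms 3 d.-1) a].

Definition interp_mx X : 'M[C]_n0 := \matrix_(i, a) (cL (X i) * (basis_form a).@[X i]).

(** The form that agrees with B on the line, up to a factor, and vanishes at the
    points X, by Cramer's rule. *)
Definition interp_part X (b : 'I_n0 -> C) : {mpoly C[3]} :=
  \sum_a (\sum_i (\adj (interp_mx X)) a i * b i) *: basis_form a.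

Definition interp X (B : {mpoly C[3]}) : {mpoly C[3]} :=
  \det (interp_mx X) *: B - lin l * interp_part X (fun i => B.@[X i]).

Lemma basis_form_homog a : basis_form a \is (d.-1).-homog.
Proof. exact: form_nth. Qed.

Lemma interp_homog X B : B \is d.-homog -> interp X B \is d.-homog.
Proof.
move=> hB; apply: rpredB; first exact: rpredZ.
have hG : interp_part X (fun i => B.@[X i]) \is (d.-1).-homog.
  by apply: rpred_sum => a _; apply: rpredZ; apply: basis_form_homog.
by have := dhomogM (lin_homog l) hG; rewrite add1n prednK.
Qed.

Lemma interp_part_eval X b x : (interp_part X b).@[x] =
  \sum_a (\sum_i (\adj (interp_mx X)) a i * b i) * (basis_form a).@[x].
Proof. by rewrite /interp_part (raddf_sum (meval x)); apply: eq_bigr => a _; apply: mevalZ. Qed.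

Lemma interp_eval X B x : (interp X B).@[x] = \det (interp_mx X) * B.@[x] -
  cL x * (interp_part X (fun i => B.@[X i])).@[x].
Proof. by rewrite /interp mevalB mevalZ mevalM. Qed.

Lemma interp_on_line X B x : cL x = 0 -> (interp X B).@[x] = \det (interp_mx X) * B.@[x].
Proof. by move=> Lx; rewrite interp_eval Lx mul0r subr0. Qed.

Lemma interp_vanish X B i : (interp X B).@[X i] = 0.
Proof.
rewrite interp_eval interp_part_eval; apply/eqP; rewrite subr_eq0; apply/eqP.
pose b := \col_k B.@[X k].
have e : interp_mx X *m (\adj (interp_mx X) *m b) = \det (interp_mx X) *: b.
  by rewrite mulmxA mul_mx_adj mul_scalar_mx.
have bE k : b k 0 = B.@[X k] by rewrite mxE.
have := congr1 (fun A : 'cV_n0 => A i 0) e.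
rewrite [(_ *m _) i 0]mxE [(_ *: b) i 0]mxE bE => <-.
rewrite mulr_sumr; apply: eq_bigr => a _ /=.
rewrite [(_ *m _) a 0]mxE [interp_mx X i a]mxE.
have -> : \sum_k (\adj (interp_mx X)) a k * b k 0 = \sum_k (\adj (interp_mx X)) a k * B.@[X k].
  by apply: eq_bigr => k _; rewrite bE.
by ring.
Qed.

Lemma interp_unique X (F B G : {mpoly C[3]}) k : G \is (d.-1).-homog ->
  F = k *: B + lin l * G -> (forall i, F.@[X i] = 0) ->
  \det (interp_mx X) *: F = k *: interp X B.
Proof.
move=> hG eF Fx.
have sG : supported (formms 3 d.-1) G by apply/dhomog_supported.
pose g := \col_(a < n0) G@_(nth 0%MM (formms 3 d.-1) a).
have Gx x : G.@[x] = \sum_a g a 0 * (basis_form a).@[x].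
  rewrite {1}(supportedE (uniq_formms _ _) sG) raddf_sum; apply: eq_bigr => a _ /=.
  by rewrite mevalZ mxE.
have eg : interp_mx X *m g = - k *: \col_i B.@[X i].
  apply/colP => i; rewrite !mxE; have := Fx i; rewrite eF mevalD mevalZ mevalM => /eqP.
  rewrite addrC addr_eq0 mulNr => /eqP <-; rewrite Gx mulr_sumr; apply: eq_bigr => a _.
  by rewrite !mxE; ring.
have dg : \det (interp_mx X) *: g = - k *: (\adj (interp_mx X) *m \col_i B.@[X i]).
  by rewrite -mul_scalar_mx -mul_adj_mx -mulmxA eg scalemxAr.
rewrite eF scalerDr scalerBr !scalerA mulrC; congr (_ + _).
rewrite scalerAr -scaleNr scalerAr; congr (_ * _).
rewrite (supportedE (uniq_formms _ _) sG) !scaler_sumr; apply: eq_bigr => a _.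
rewrite !scalerA; congr (_ *: _).
have := congr1 (fun A : 'cV_n0 => A a 0) dg.
rewrite [(_ *: g) a 0]mxE [g a 0]mxE [(_ *: (_ *m _)) a 0]mxE [(_ *m _) a 0]mxE => ->.
by congr (_ * _); apply: eq_bigr => i _; congr (_ * _); rewrite mxE.
Qed.

(** The equation of a point of the line. *)
Definition line_pt x : 'rV[C]_3 := cT x *: row 0 M - cS x *: row 1 M.
Definition line_root (a : C) : 'rV[C]_3 := row 0 M - a *: row 1 M.

Lemma line_ptE x y : (lin (line_pt x)).@[y] = cT x * cS y - cS x * cT y.
Proof. by rewrite /line_pt -scaleNr linD !linZ mevalD !mevalZ mulNr. Qed.

Lemma line_rootE a y : (lin (line_root a)).@[y] = cS y - a * cT y.
Proof. by rewrite /line_root -scaleNr linD !linZ mevalD !mevalZ mulNr. Qed.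

Definition fixed_part P : {mpoly C[3]} := \prod_i lin (line_pt (P i)) ^+ lam i.
Definition contact P q : {mpoly C[3]} :=
  fixed_part P * \prod_j lin (line_root (q j)) ^+ rho j.

(** The value at x of the interpolated form, as a polynomial in q. *)
Definition contact_at P x : {mpoly C[r]} :=
  locked ((fixed_part P).@[x] *: \prod_j ((cS x)%:MP - 'X_j * (cT x)%:MP) ^+ rho j).
Definition curve_at P X x : {mpoly C[r]} :=
  \det (interp_mx X) *: contact_at P x -
  cL x *: \sum_a \sum_i ((\adj (interp_mx X)) a i * (basis_form a).@[x]) *: contact_at P (X i).
Definition curve P X q := interp X (contact P q).

Lemma contact_at_eval P x q : (contact_at P x).@[q] = (contact P q).@[x].
Proof.
rewrite /contact_at -lock mevalZ mevalM !rmorph_prod; congr (_ * _); apply: eq_bigr => j _ /=.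
by rewrite !rmorphXn /= line_rootE mevalB mevalM !mevalC mevalXU.
Qed.

Lemma curve_at_eval P X x q : (curve_at P X x).@[q] = (curve P X q).@[x].
Proof.
rewrite /curve_at mevalB mevalZ contact_at_eval /curve interp_eval; congr (_ - _).
rewrite mevalZ interp_part_eval; congr (_ * _).
rewrite (raddf_sum (meval q)); apply: eq_bigr => a _ /=.
rewrite (raddf_sum (meval q)) mulr_suml; apply: eq_bigr => i _ /=.
by rewrite mevalZ contact_at_eval mulrAC.
Qed.

Lemma curve_at_boxed P X x : boxed rho (curve_at P X x).
Proof.
have bB y : boxed rho (contact_at P y).
  by rewrite /contact_at -lock; apply: boxedZ; apply: linear_product_boxed.
apply: boxedD; first exact: boxedZ.
rewrite -scaleN1r; do 2 apply: boxedZ; apply: boxed_sum => a _; apply: boxed_sum => i _.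
exact: boxedZ.
Qed.

Lemma line_forms_homog (I : finType) (f : I -> 'rV[C]_3) (e : I -> nat) :
  \prod_i lin (f i) ^+ e i \is (\sum_i e i).-homog.
Proof.
elim: (index_enum I) => [|i s IH]; first by rewrite !big_nil dhomog1.
by rewrite !big_cons; apply: (dhomogM _ IH); have := dhomogMn (e i) (lin_homog (f i)); rewrite mul1n.
Qed.

Lemma contact_homog P q : contact P q \is d.-homog.
Proof. by rewrite -deg; apply: dhomogM; apply: line_forms_homog. Qed.

Lemma curve_homog P X q : curve P X q \is d.-homog.
Proof. by apply: interp_homog; apply: contact_homog. Qed.

Definition proj_contact P (Q : 'M[C]_(r, 3)) : {mpoly C[3]} :=
  fixed_part P * \prod_j lin (line_pt (Q j)) ^+ rho j.

Lemma heval_curve_at P X x (Q : 'M[C]_(r, 3)) :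
  heval (fun j => cT (Q j)) (fun j => cS (Q j)) rho (curve_at P X x) =
  (interp X (proj_contact P Q)).@[x].
Proof.
have hB y : heval (fun j => cT (Q j)) (fun j => cS (Q j)) rho (contact_at P y) =
    (proj_contact P Q).@[y].
  rewrite /contact_at -lock hevalZ heval_linear_product /proj_contact mevalM; congr (_ * _).
  by rewrite rmorph_prod; apply: eq_bigr => j _ /=; rewrite rmorphXn /= line_ptE.
rewrite /curve_at hevalD -scaleN1r !hevalZ mulN1r hB interp_eval; congr (_ - _ * _).
rewrite heval_sum interp_part_eval; apply: eq_bigr => a _ /=; rewrite heval_sum mulr_suml.
by apply: eq_bigr => i _; rewrite hevalZ hB mulrAC.
Qed.


Lemma interpZ X a B : interp X (a *: B) = a *: interp X B.
Proof.
rewrite /interp scalerBr !scalerA mulrC; congr (_ - _); rewrite scalerAr; congr (_ * _).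
rewrite scaler_sumr; apply: eq_bigr => b _; rewrite scalerA mulr_sumr; congr (_ *: _).
by apply: eq_bigr => i _; rewrite mevalZ mulrCA.
Qed.

Lemma line_coords (x : 'rV[C]_3) : dot l x = 0 -> x = dot (row 0 M) x *: row 0 (dualmx M) +
  dot (row 1 M) x *: row 1 (dualmx M).
Proof. by move=> lx; rewrite {1}(frame_expand x uM) sum3 lx scale0r addr0. Qed.

Lemma line_pt_zero (x y : 'rV[C]_3) : x != 0 -> y != 0 -> dot l x = 0 -> dot l y = 0 ->
  (lin (line_pt (x 0))).@[y 0] = 0 -> proportional x y.
Proof.
move=> x0 y0 lx ly; rewrite line_ptE !lin_dot => /eqP; rewrite subr_eq0 => /eqP e.
have [c ec] : exists c, y = c *: x.
  rewrite (line_coords lx) in x0 *; rewrite (line_coords ly).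
  have [Sx|Sx] := eqVneq (dot (row 0 M) x) 0.
    have Tx : dot (row 1 M) x != 0.
      by apply: contraNneq x0 => Tx; rewrite Sx Tx !scale0r addr0.
    exists (dot (row 1 M) y / dot (row 1 M) x); rewrite scalerDr !scalerA divfK //.
    move: e; rewrite Sx mul0r => /eqP; rewrite mulf_eq0 (negbTE Tx) => /eqP ->.
    by rewrite mulr0.
  exists (dot (row 0 M) y / dot (row 0 M) x); rewrite scalerDr !scalerA divfK //.
  by congr (_ + _ *: _); apply: (mulfI Sx); rewrite -e; field.
by exists c => //; apply: contraNneq y0 => c0; rewrite ec c0 scale0r.
Qed.

Lemma line_pt_prop (x y : 'rV[C]_3) : proportional x y -> (lin (line_pt (x 0))).@[y 0] = 0.
Proof.
move=> [c _ ->]; rewrite line_ptE !lin_dot !dotZr; ring.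
Qed.

Lemma line_pt_neq0 (x : 'rV[C]_3) : x != 0 -> dot l x = 0 ->
  exists2 y, dot l y = 0 & (lin (line_pt (x 0))).@[y 0] != 0.
Proof.
move=> x0 lx; have [Sx|Sx] := eqVneq (dot (row 0 M) x) 0.
  exists (row 0 (dualmx M)); first by rewrite dot_dual.
  rewrite line_ptE !lin_dot !dot_dual //= mulr1 mulr0 subr0.
  by apply: contraNneq x0 => Tx; rewrite (line_coords lx) Sx Tx !scale0r addr0.
exists (row 1 (dualmx M)); first by rewrite dot_dual.
by rewrite line_ptE !lin_dot !dot_dual //= mulr1 mulr0 sub0r oppr_eq0.
Qed.

Lemma line_pt_sub (x : 'rV[C]_3) : x != 0 -> dot l x = 0 -> ~~ (line_pt (x 0) <= l)%MS.
Proof.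
move=> x0 lx; have [y ly] := line_pt_neq0 x0 lx; apply: contraNN => /sub_rVP[c ->].
by rewrite lin_dot dotZl ly mulr0.
Qed.

Definition mult (k : 'I_(m + r)) : nat :=
  match split k with inl i => lam i | inr j => rho j end.

Lemma proj_contactE P (Q : 'M[C]_(r, 3)) :
  proj_contact P Q = \prod_k lin (line_pt (row k (col_mx P Q) 0)) ^+ mult k.
Proof.
rewrite big_split_ord /=; congr (_ * _); apply: eq_bigr => i _.
  by rewrite /mult (unsplitK (inl i)) rowKu; congr (lin _ ^+ _); rewrite /line_pt !mevalE;
    congr (_ *: _ - _ *: _); apply: eq_bigr => e _; congr (_ * _); apply: eq_bigr => j _; rewrite mxE.
by rewrite /mult (unsplitK (inr i)) rowKd; congr (lin _ ^+ _); rewrite /line_pt !mevalE;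
    congr (_ *: _ - _ *: _); apply: eq_bigr => e _; congr (_ * _); apply: eq_bigr => j _; rewrite mxE.
Qed.

Lemma sum_mult : (\sum_k mult k = d)%N.
Proof.
rewrite -deg big_split_ord /=; congr (_ + _)%N; apply: eq_bigr => i _.
  by rewrite /mult (unsplitK (inl i)).
by rewrite /mult (unsplitK (inr i)).
Qed.

(** A form whose contacts with the line at given points add up to its degree is
    determined on the line. *)
Lemma line_restriction (F : {mpoly C[3]}) (R : 'M[C]_(m + r, 3)) : F \is d.-homog ->
  l != 0 -> (forall k, row k R != 0) -> (forall k, dot l (row k R) = 0) ->
  (forall i j, proportional (row i R) (row j R) -> i = j) ->
  (forall x : 'rV[C]_3, x != 0 -> dot l x = 0 -> F.@[x 0] = 0 ->
     exists i, proportional (row i R) x) ->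
  (forall k (e c : nat) b H W, dot b (row k R) = 0 -> ~~ (b <= l)%MS ->
     F = lin l * H + lin b ^+ e * W -> W \is c.-homog -> W.@[row k R 0] != 0 ->
     (mult k <= e)%N) ->
  exists kap G, [/\ kap != 0, G \is (d.-1).-homog &
    F = kap *: \prod_k lin (line_pt (row k R 0)) ^+ mult k + lin l * G].
Proof.
move=> hF l0 R0 lR inj hz hm.
have [t ht] := avoid_finite [seq dot (row 1 M) (row k R) / dot (row 0 M) (row k R) | k : 'I_(m + r)].
pose o := row 0 (dualmx M) + t *: row 1 (dualmx M).
have lo : dot l o = 0 by rewrite dotDr dotZr !dot_dual //= mulr0 addr0.
have o0 : o != 0.
  apply/eqP => /(congr1 (dot (row 0 M))); rewrite dotDr dotZr !dot_dual //= mulr0 addr0.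
  by rewrite -(scale0r (row 0 M)) dotZr mul0r => /eqP; rewrite oner_eq0.
have plo k : (lin (line_pt (row k R 0))).@[o 0] != 0.
  rewrite line_ptE !lin_dot /o !dotDr !dotZr !dot_dual //= !mulr0 !mulr1 add0r addr0 mulr1.
  have [Sx|Sx] := eqVneq (dot (row 0 M) (row k R)) 0.
    rewrite Sx mul0r subr0; apply: contraNneq (R0 k) => Tx.
    by rewrite (line_coords (lR k)) Sx Tx !scale0r addr0.
  rewrite subr_eq0; apply: contraNneq ht => e; apply/mapP; exists k; rewrite ?mem_enum //.
  by rewrite e mulrAC mulfV // mul1r.
have Fo : F.@[o 0] != 0.
  apply/eqP => /(hz o o0 lo)[k /line_pt_prop]; exact/eqP.
have [M' [uM' r2 r1]] := frame_infinity o0 lo l0; pose w := row 0 (dualmx M').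
have rl : res w o (lin l) = 0.
  apply: poly_ext => u; rewrite res_eval lin_dot horner0 dotDr dotZr lo mulr0 addr0.
  by rewrite -r2 dot_dual.
have rXn G n : res w o (G ^+ n) = res w o G ^+ n by exact: rmorphXn.
have rD G1 G2 : res w o (G1 + G2) = res w o G1 + res w o G2 by exact: mmapD.
have rZ a G : res w o (a *: G) = a *: res w o G.
  by rewrite /res mmapZ mul_polyC.
pose b k := line_pt (row k R 0).
have sb k : size (res w o (lin (b k))) = 2%N.
  have -> : res w o (lin (b k)) = dot (b k) o *: 'X + (dot (b k) w)%:P.
    by apply: poly_ext => u; rewrite res_eval lin_dot dotDr dotZr !hornerE addrC mulrC.
  rewrite size_polyDl size_scale ?size_polyX -?lin_dot ?plo // size_polyC.
  by case: (_ != 0).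
have cop i j : i != j -> coprimep (res w o (lin (b i))) (res w o (lin (b j))).
  move=> ij; apply/Pdiv.ClosedField.coprimepP => u; rewrite /root !res_eval => /eqP hi.
  apply/eqP => hj; case/eqP: ij; apply: inj.
  have ly : dot l (w + u *: o) = 0 by rewrite -lin_dot -res_eval rl horner0.
  have y0 : w + u *: o != 0.
    apply/eqP => /(congr1 (dot (row 0 M'))); rewrite dotDr dotZr /w -r1 !dot_dual //= mulr0 addr0.
    by rewrite -(scale0r (row 0 M')) dotZr mul0r => /eqP; rewrite oner_eq0.
  have [c c0 ec] := line_pt_zero (R0 i) y0 (lR i) ly hi.
  have [c' c'0 ec'] := line_pt_zero (R0 j) y0 (lR j) ly hj.
  exists (c / c'); first by rewrite mulf_neq0 ?invr_eq0.
  by rewrite mulrC -scalerA -ec ec' scalerA mulVf // scale1r.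
have dv k : res w o (lin (b k)) ^+ mult k %| res w o F.
  have bk : dot (b k) (row k R) = 0.
    by rewrite -lin_dot; apply: line_pt_prop; exists 1; rewrite ?oner_eq0 ?scale1r.
  have [|e [H [W [eF hW Wk]]]] := local_intersection (R0 k) bk (lR k) l0 (line_pt_sub (R0 k) (lR k)) hF.
    by exists o.
  have le := hm k e (d - e)%N (b k) H W bk (line_pt_sub (R0 k) (lR k)) eF hW Wk.
  rewrite eF rD !resM rl mul0r add0r rXn; apply: dvdp_mulr; exact: dvdp_exp2l.
have /dvdpP[h eh] : \prod_k res w o (lin (b k)) ^+ mult k %| res w o F.
  have : uniq (index_enum ('I_(m + r))) by exact: index_enum_uniq.
  elim: (index_enum _) => [|k s IH]; first by rewrite big_nil dvd1p.
  rewrite big_cons => /= /andP[ks us]; rewrite Gauss_dvdp; first by rewrite dv IH.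
  apply: coprimep_expl; rewrite big_seq.
  apply: (big_ind (fun p => coprimep (res w o (lin (b k))) p)) => [|p q hp hq|j js].
  - exact: coprimep1.
  - by rewrite coprimepMr hp.
  by apply: coprimep_expr; apply: cop; apply: contraNneq ks => ->.
have [g [sg gE [G eG]]] := restrict_plane uM' hF.
have eg : g = res w o F by apply: poly_ext => u; rewrite gE res_eval -r1.
have f0 : res w o F != 0.
  apply: contraNneq Fo => z; rewrite eG eg z mevalD mevalM lin_dot r2 lo mul0r addr0.
  by rewrite big1 ?meval0 // => i _; rewrite coef0 scale0r.
have h0 : h != 0 by apply: contraNneq f0 => z; rewrite eh z mul0r.
have p0 : \prod_k res w o (lin (b k)) ^+ mult k != 0.
  by apply: contraNneq f0 => z; rewrite eh z mulr0.
have sp : size (\prod_k res w o (lin (b k)) ^+ mult k) = d.+1.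
  rewrite -sum_mult; have nz j : res w o (lin (b j)) != 0 by rewrite -size_poly_eq0 sb.
  elim: (index_enum _) => [|k s IH]; first by rewrite !big_nil size_poly1.
  rewrite !big_cons size_mul ?IH ?expf_neq0 //; last first.
    by rewrite prodf_seq_neq0; apply/allP => j _; apply/implyP => _; rewrite expf_neq0.
  have := size_exp (res w o (lin (b k))) (mult k); rewrite sb mul1n.
  have : (0 < size (res w o (lin (b k)) ^+ mult k))%N by rewrite lt0n size_poly_eq0 expf_neq0.
  by move=> h1 h2; rewrite addnS /= -addSn; congr (_ + _)%N; rewrite -[in RHS]h2 prednK.
have /eqP/size_poly1P[kap kap0 ek] : size h = 1%N.
  have : (size (h * \prod_k res w o (lin (b k)) ^+ mult k)%R <= d.+1)%N.
    by rewrite -eh -eg.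
  have : (0 < size h)%N by rewrite lt0n size_poly_eq0.
  by rewrite size_mul // sp; move: (size h) d; clear; lia.
pose B := \prod_k lin (b k) ^+ mult k.
have hB : B \is d.-homog by rewrite -sum_mult; apply: line_forms_homog.
have rB : res w o B = \prod_k res w o (lin (b k)) ^+ mult k.
  rewrite /B; elim: (index_enum _) => [|k s IH].
    by rewrite !big_nil; apply: poly_ext => u; rewrite res_eval meval1 hornerE.
  by rewrite !big_cons resM IH rXn.
pose D := F - kap *: B.
have hD : D \is d.-homog by apply: rpredB => //; apply: rpredZ.
have rD0 : res w o D = 0.
  by rewrite /D rD -scaleNr rZ rB eh ek mul_polyC scaleNr subrr.
have [g' [sg' g'E [G' eG']]] := restrict_plane uM' hD.
have eg' : g' = 0 by rewrite -rD0; apply: poly_ext => u; rewrite g'E res_eval -r1.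
have eD : D = lin l * G'.
  by rewrite eG' eg' r2 big1 ?add0r // => i _; rewrite coef0 scale0r.
have eF : F = kap *: B + D by rewrite /D addrC subrK.
exists kap; have [D0|D0] := eqVneq D 0.
  exists 0; split=> //; first exact: rpred0.
  by rewrite {1}eF D0 mulr0.
exists G'; split=> //; last by rewrite {1}eF eD.
have hD' := hD; have D1 := D0; rewrite eD in hD' D1.
have [e [f [ef hl hG']]] := dhomog_factor hD' D1.
move: D0; rewrite eD mulf_eq0 negb_or => /andP[l1 G1].
by move: hG'; rewrite (_ : f = d.-1) // -ef (dhomog_uniq l1 hl (lin_homog l)).
Qed.

End Family.


Section Correspondence.
Local Open Scope ring_scope.
Variables (C : numClosedFieldType) (M : 'M[C]_3).
Hypothesis uM : M \in unitmx.
Variables (d : nat) (lam rho : seq nat).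
Hypotheses (d_gt0 : (0 < d)%N) (deg : (sumn lam + sumn rho = d)%N).
Hypotheses (lam_gt0 : all (ltn 0) lam) (rho_gt0 : all (ltn 0) rho).

Local Notation m := (size lam).
Local Notation r := (size rho).
Local Notation n0 := (size (formms 3 d.-1)).
Local Notation l := (row 2%:R M).
Definition part_of (s : seq nat) (i : 'I_(size s)) : nat := nth 0%N s i.
Local Notation lam' := (@part_of lam).
Local Notation rho' := (@part_of rho).
Local Notation S := (row 0 M).
Local Notation T := (row 1 M).

Lemma part_gt0 (s : seq nat) (i : 'I_(size s)) : all (ltn 0) s -> (0 < part_of i)%N.
Proof. by move/(all_nthP 0%N)/(_ i (ltn_ord i)). Qed.

Lemma sum_parts (s : seq nat) : (\sum_(i < size s) part_of i = sumn s)%N.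
Proof. by rewrite sumnE (big_nth 0%N) big_mkord. Qed.

Lemma deg' : (\sum_i lam' i + \sum_j rho' j = d)%N.
Proof. by rewrite !sum_parts. Qed.

Variables (P : 'M[C]_(m, 3)) (X : 'M[C]_(n0, 3)) (Y : 'M[C]_(r, 3)).

Local Notation system := (fun k : 'I_r => curve_at M lam' rho' P X (Y k)).
Local Notation curve_of q := (curve M lam' rho' P X q).

Record good_configuration : Prop := GoodConfiguration {
  good_det : \det (interp_mx M X) != 0;
  good_points : forall i j, proportional (row i P) (row j P) -> i = j;
  good_regular : regular_system rho' system;
  good_simple : forall q, solution system q -> (jacobian system).@[q] != 0;
  good_distinct : forall q, solution system q -> injective q;
  good_apart : forall q, solution system q ->
    forall i j, dot S (row i P) - q j * dot T (row i P) != 0;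
  good_e1 : forall q, solution system q -> (curve_of q).@[e1 C 0] != 0;
  good_smooth : forall q, solution system q -> smooth_form (curve_of q)
}.

Hypothesis good : good_configuration.
Hypotheses (P0 : forall i, row i P != 0) (Pl : forall i, on_line l (row i P)).

Lemma row_pt n (A : 'M[C]_(n, 3)) j (p : {mpoly C[3]}) : p.@[row j A 0] = p.@[A j].
Proof. by apply: meval_eq => i; rewrite mxE. Qed.

Lemma lin_row n (A : 'M[C]_(n, 3)) j a : (lin a).@[A j] = dot a (row j A).
Proof. by rewrite -lin_dot row_pt. Qed.

Lemma system_boxed k : boxed rho' (system k).
Proof. exact: curve_at_boxed. Qed.

Lemma good_det_neq0 : \det (interp_mx M X) != 0.
Proof. exact: good_det good. Qed.

Lemma line_neq : l != 0.
Proof.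
apply/eqP => z; have : dot l (row 2%:R (dualmx M)) = 1 by rewrite dot_dual.
by rewrite z -(scale0r (0 : 'rV[C]_3)) dotZl mul0r => /eqP; rewrite eq_sym oner_eq0.
Qed.

Lemma line_pt_root (x : 'rV[C]_3) : dot T x != 0 ->
  line_pt M (x 0) = dot T x *: line_root M (dot S x / dot T x).
Proof. by move=> Tx; rewrite /line_pt /line_root !lin_dot scalerBr scalerA mulrC divfK. Qed.

(** The contacts with the line of an admissible curve are at the prescribed
    points and at further ones, which determine the curve; as the latter are not
    at infinity, they solve the system. *)
Lemma admissible_proportional g F : admissible_curve d g rho l P (col_mx X Y) F ->
  exists2 q, solution system q & proportional (curve_of q) F.
Proof.
move=> [hF _ FX [K [_ [Q [inj Q0 zs tP tQ]]]]].
have FX' i : F.@[X i] = 0.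
  by rewrite -row_pt -(rowKu i X Y) row_pt.
have FY k : F.@[Y k] = 0.
  by rewrite -row_pt -(rowKd k X Y) row_pt.
have Ql j : dot l (row j Q) = 0.
  have [_ h] := zs _ (Q0 j); have [|//] := h.
  by exists (rshift m j); exists 1; rewrite ?oner_eq0 // scale1r rowKd.
have R0 k : row k (col_mx P Q) != 0.
  by case: (splitP k) => j e; [rewrite (_ : k = lshift r j) ?rowKu|rewrite (_ : k = rshift m j) ?rowKd]; try exact: val_inj.
have Rl k : dot l (row k (col_mx P Q)) = 0.
  case: (splitP k) => j e; [rewrite (_ : k = lshift r j) ?rowKu|rewrite (_ : k = rshift m j) ?rowKd]; try exact: val_inj.
  - exact: Pl.
  - exact: Ql.
have Rt k : tangency K l (row k (col_mx P Q)) (mult lam' rho' k).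
  case: (splitP k) => j e; [rewrite (_ : k = lshift r j)|rewrite (_ : k = rshift m j)]; try exact: val_inj.
  - by rewrite rowKu /mult (unsplitK (inl j)); apply: tP.
  - by rewrite rowKd /mult (unsplitK (inr j)); apply: tQ.
have [|k e c b H W bR bl eF hW Wk|kap [G [kap0 hG eF]]] :=
    line_restriction uM deg' hF line_neq R0 Rl inj.
- by move=> x x0 lx Fx; apply/(zs x x0).
- exact (tangency_mult hF (R0 k) line_neq (Rl k) bR bl eF hW Wk (Rt k)).
rewrite -proj_contactE in eF.
have eI := interp_unique hG eF FX'.
have TQ j : dot T (row j Q) != 0.
  have hv k : heval (fun j => (lin T).@[Q j]) (fun j => (lin S).@[Q j]) rho' (system k) = 0.
    rewrite heval_curve_at; apply: (mulfI kap0).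
    by rewrite -mevalZ -eI mevalZ FY !mulr0.
  have := @no_solution_at_infinity _ _ _ _ _ _ (fun j => part_gt0 j rho_gt0)
    system_boxed (good_regular good) _ hv j.
  rewrite lin_row; apply => i; rewrite !lin_row.
  apply/orP; have [Tq|] := eqVneq (dot T (row i Q)) 0; last by left.
  right; apply: contraNneq (Q0 i) => Sq.
  by rewrite (line_coords uM (Ql i)) Tq Sq !scale0r addr0.
pose q j := dot S (row j Q) / dot T (row j Q).
have eC : proj_contact M lam' rho' P Q =
    (\prod_j dot T (row j Q) ^+ rho' j) *: contact M lam' rho' P q.
  rewrite /proj_contact /contact scalerAr -scaler_prod; congr (_ * _).
  apply: eq_bigr => j _; rewrite -exprZn -linZ -line_pt_root //; congr (lin _ ^+ _).
  by rewrite /line_pt !row_pt.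
set c := \prod_j _ in eC; have c0 : c != 0.
  by rewrite /c prodf_seq_neq0; apply/allP => j _; rewrite expf_neq0.
have eD : \det (interp_mx M X) *: F = (kap * c) *: curve_of q.
  rewrite /curve -scalerA -interpZ -eC; exact: eI.
have eF' : F = (kap * c / \det (interp_mx M X)) *: curve_of q.
  by rewrite mulrC -scalerA -eD scalerA mulVf ?scale1r ?good_det_neq0.
have k0 : kap * c / \det (interp_mx M X) != 0.
  by rewrite !mulf_neq0 ?invr_eq0 ?good_det_neq0.
exists q; last by exists (kap * c / \det (interp_mx M X)).
move=> k; rewrite curve_at_eval; apply: (mulfI k0).
by rewrite -mevalZ -eF' FY mulr0.
Qed.

Lemma solution_admissible q : solution system q ->
  admissible_curve d ((d.-1 * d.-2)./2) rho l P (col_mx X Y) (curve_of q).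
Proof.
move=> sq; have hF := curve_homog M d_gt0 deg' P X q.
have smF := good_smooth good sq; have Fe := good_e1 good sq.
have irF := smooth_irreducible hF d_gt0 Fe smF.
split=> //.
  move=> k; case: (splitP k) => j e.
    rewrite (_ : k = lshift r j); last exact: val_inj.
    rewrite -row_pt rowKu row_pt; exact: interp_vanish.
  rewrite (_ : k = rshift n0 j); last exact: val_inj.
  by rewrite -row_pt rowKd row_pt -curve_at_eval; apply: sq.
have [K dn] := function_field_exists hF d_gt0 Fe irF.
exists K; split.
  apply: (smooth_genus hF d_gt0 _ Fe smF dn).
  have [z0 ze] := @pencil_z C 1 (line_z C) (mem_head _ _).
  have := line_neq0 K hF d_gt0 Fe z0 ze.
  by rewrite line_zE /ev mmapX mmap1U.
pose Q := \matrix_j (q j *: row 0 (dualmx M) + row 1 (dualmx M)).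
have rQ j : row j Q = q j *: row 0 (dualmx M) + row 1 (dualmx M) by rewrite rowK.
have SQ j : dot S (row j Q) = q j by rewrite rQ dotDr dotZr !dot_dual //= mulr1 addr0.
have TQ j : dot T (row j Q) = 1 by rewrite rQ dotDr dotZr !dot_dual //= mulr0 add0r.
have Ql j : dot l (row j Q) = 0 by rewrite rQ dotDr dotZr !dot_dual //= mulr0 add0r.
have Q0 j : row j Q != 0.
  apply/eqP => z; have := TQ j; rewrite z -(scale0r (0 : 'rV[C]_3)) dotZr mul0r => /eqP.
  by rewrite eq_sym oner_eq0.
pose R := col_mx P Q.
have RE k : (exists2 i, k = lshift r i & row k R = row i P) \/
            (exists2 j, k = rshift m j & row k R = row j Q).
  case: (splitP k) => j e; [left|right]; exists j; try exact: val_inj.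
    by rewrite (_ : k = lshift r j) ?rowKu //; apply: val_inj.
  by rewrite (_ : k = rshift m j) ?rowKd //; apply: val_inj.
have R0 k : row k R != 0 by case: (RE k) => [[i _ ->]|[j _ ->]].
have Rl k : dot l (row k R) = 0 by case: (RE k) => [[i _ ->]|[j _ ->]]; [exact: Pl|].
have ptE (x y : 'rV[C]_3) : (lin (line_pt M (x 0))).@[y 0] = dot T x * dot S y - dot S x * dot T y.
  by rewrite line_ptE !lin_dot.
have prC (x y : 'rV[C]_3) : proportional x y -> proportional y x.
  by move=> [c c0 ->]; exists c^-1; rewrite ?invr_eq0 // scalerA mulVf // scale1r.
have inj i j : proportional (row i R) (row j R) -> i = j.
  have PQ a b : ~ proportional (row a P) (row b Q).
    move=> /prC/(line_pt_prop M); rewrite ptE SQ TQ mul1r; exact/eqP/(good_apart good sq).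
  case: (RE i) => [[a -> ->]|[a -> ->]]; case: (RE j) => [[b -> ->]|[b -> ->]].
  - by move/(good_points good) => ->.
  - by move/PQ.
  - by move/prC/PQ.
  move/(line_pt_prop M); rewrite ptE !SQ !TQ mul1r mulr1 => /eqP; rewrite subr_eq0 => /eqP e.
  by rewrite (good_distinct good sq e).
have eC : contact M lam' rho' P q = proj_contact M lam' rho' P Q.
  rewrite /contact /proj_contact; congr (_ * _); apply: eq_bigr => j _; congr (lin _ ^+ _).
  by rewrite /line_pt !lin_row SQ TQ scale1r.
have mult_gt0 k : (0 < mult lam' rho' k)%N.
  by rewrite /mult; case: split => j; apply: part_gt0.
pose B e : {mpoly C[3]} := \prod_k lin (line_pt M (row k R 0)) ^+ e k.
have eF : curve_of q = \det (interp_mx M X) *: B (mult lam' rho') -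
    lin l * interp_part M X (fun i => (contact M lam' rho' P q).@[X i]).
  by rewrite /curve /interp {1}eC proj_contactE.
have BE e x : (B e).@[x] = \prod_k (lin (line_pt M (row k R 0))).@[x] ^+ e k.
  by rewrite /B rmorph_prod; apply: eq_bigr => k _; apply: rmorphXn.
have zs (x : 'rV[C]_3) : x != 0 ->
    on_line l x /\ (curve_of q).@[x 0] = 0 <-> exists i, proportional (row i R) x.
  move=> x0; split=> [[lx]|[k pk]].
    rewrite eF mevalB mevalZ mevalM (lin_dot l x) (_ : dot l x = 0) // mul0r subr0 => /eqP.
    rewrite mulf_eq0 (negbTE good_det_neq0) BE prodf_seq_eq0 => /hasP[k _ /andP[_]].
    rewrite expf_eq0 => /andP[_ /eqP /(line_pt_zero uM (R0 k) x0 (Rl k) lx) pk].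
    by exists k.
  have lx : dot l x = 0 by case: pk => c _ ->; rewrite dotZr Rl mulr0.
  split=> //; rewrite eF mevalB mevalZ mevalM (lin_dot l x) lx mul0r subr0 BE (bigD1 k) //=.
  by rewrite (line_pt_prop M pk) expr0n gtn_eqF // mul0r mulr0.
have tan k : tangency K l (row k R) (mult lam' rho' k).
  pose e k' := if k' == k then 0%N else mult lam' rho' k'.
  have bk : dot (line_pt M (row k R 0)) (row k R) = 0.
    by rewrite -lin_dot; apply: line_pt_prop; exists 1; rewrite ?oner_eq0 ?scale1r.
  have eF' : curve_of q = lin l * - interp_part M X (fun i => (contact M lam' rho' P q).@[X i]) +
      lin (line_pt M (row k R 0)) ^+ mult lam' rho' k * (\det (interp_mx M X) *: B e).
    rewrite eF mulrN addrC -scalerAr; congr (_ + _ *: _).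
    rewrite /B (bigD1 k) //= [in RHS](bigD1 k) //= {1}/e eqxx expr0 mul1r; congr (_ * _).
    by apply: eq_bigr => k' /negbTE kk; rewrite /e kk.
  have hW : \det (interp_mx M X) *: B e \is (\sum_k e k).-homog.
    by apply: rpredZ; apply: line_forms_homog.
  apply: (tangency_local hF d_gt0 Fe smF dn (R0 k) line_neq (Rl k) bk _ eF' hW) => //.
    exact: line_pt_sub.
  rewrite mevalZ mulf_neq0 ?good_det_neq0 // BE prodf_seq_neq0; apply/allP => k' _.
  rewrite implyTb /e; case: (eqVneq k' k) => [_|kk]; first by rewrite expr0 oner_eq0.
  apply: expf_neq0; apply/eqP => /(line_pt_zero uM (R0 k') (R0 k) (Rl k') (Rl k))/inj.
  exact/eqP.
exists Q; split=> //.
- move=> i; have := tan (lshift r i); by rewrite rowKu /mult (unsplitK (inl i)).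
- move=> i; have := tan (rshift m i); by rewrite rowKd /mult (unsplitK (inr i)).
Qed.

Lemma curve_permute q (p : {perm 'I_r}) : p \in stab rho' -> curve_of (permute p q) = curve_of q.
Proof.
move=> hp; rewrite /curve /contact; congr (interp _ _ (_ * _)).
rewrite [RHS](reindex_inj (@perm_inj _ p)) /=; apply: eq_bigr => j _.
by rewrite ffunE (stabP _ _ hp).
Qed.

Lemma curve_injective (q q' : {ffun 'I_r -> C}) : injective q -> injective q' ->
  proportional (curve_of q) (curve_of q') -> exists2 p, p \in stab rho' & q = permute p q'.
Proof.
move=> iq iq' [c c0 e].
pose pol (f : 'I_r -> C) : {poly C} := \prod_j ('X - (f j)%:P) ^+ rho' j.
pose fix_pol : {poly C} := \prod_i ((dot T (row i P)) *: 'X - (dot S (row i P))%:P) ^+ lam' i.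
have fix0 : fix_pol != 0.
  rewrite prodf_seq_neq0; apply/allP => i _; apply: expf_neq0; apply: contraNneq (P0 i) => z.
  rewrite (line_coords uM (Pl i)).
  have := congr1 (fun p : {poly C} => p`_0) z; have := congr1 (fun p : {poly C} => p`_1) z.
  rewrite !coef0 !coefB !coefZ !coefC !coefX /= mulr1 mulr0 subr0 sub0r => -> /eqP.
  by rewrite oppr_eq0 => /eqP ->; rewrite !scale0r addr0.
have cE (f : 'I_r -> C) (t : C) :
    (curve_of f).@[(t *: row 0 (dualmx M) + row 1 (dualmx M)) 0] =
    \det (interp_mx M X) * (fix_pol * pol f).[t].
  set x := _ + _; have lx : dot l x = 0 by rewrite dotDr dotZr !dot_dual //= mulr0 addr0.
  rewrite interp_on_line ?lin_dot // mevalM hornerM !rmorph_prod /= !horner_prod.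
  congr (_ * (_ * _)); apply: eq_bigr => i _; rewrite rmorphXn horner_exp /=; congr (_ ^+ _).
    rewrite line_ptE !lin_dot !lin_row /x !dotDr !dotZr !dot_dual //= hornerD hornerN hornerZ hornerX hornerC; ring.
  by rewrite line_rootE !lin_dot /x !dotDr !dotZr !dot_dual //= hornerD hornerN hornerX hornerC; ring.
have e1' : fix_pol * pol q' = c *: (fix_pol * pol q).
  apply: poly_ext => t; apply: (mulfI good_det_neq0).
  by rewrite -cE e mevalZ cE hornerZ mulrCA.
have e2 : pol q' = c *: pol q by apply: (mulfI fix0); rewrite e1' scalerAr.
have muE (f : 'I_r -> C) j : injective f -> mup (f j) (pol f) = rho' j.
  move=> jf; rewrite /pol (bigD1 j) //= mupMl ?mup_XsubCX ?eqxx //.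
  rewrite /root horner_prod prodf_seq_neq0; apply/allP => i _; apply/implyP => ij.
  rewrite horner_exp hornerXsubC expf_neq0 // subr_eq0.
  by apply: contraNneq ij => /jf ->.
have [p hp] : exists p : {ffun 'I_r -> 'I_r}, forall j, q j = q' (p j).
  have h j : exists i, q j = q' i.
    apply: NNPP => hn.
    have : root (pol q') (q j).
      rewrite /root e2 hornerZ /pol (bigD1 j) //= hornerM horner_exp hornerXsubC subrr.
      by rewrite expr0n gtn_eqF ?part_gt0 // mul0r mulr0.
    rewrite /pol; rewrite /root horner_prod prodf_seq_eq0 => /hasP[i _ /andP[_]].
    rewrite horner_exp expf_eq0 hornerXsubC => /andP[_]; rewrite subr_eq0 => /eqP hi.
    by apply: hn; exists i.
  exists [ffun j => proj1_sig (constructive_indefinite_description _ (h j))] => j.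
  by rewrite ffunE; case: constructive_indefinite_description.
have ip : injective p by move=> i j eij; apply: iq; rewrite !hp eij.
exists (perm ip).
  apply/stabP => j; rewrite permE.
  by rewrite -(muE q j iq) hp -(muE q' (p j) iq') e2 -mul_polyC mupMr // rootC.
by apply/ffunP => j; rewrite ffunE permE hp.
Qed.

Lemma count_of_solutions : curve_count (admissible_curve d ((d.-1 * d.-2)./2) rho l P (col_mx X Y))
  ((\prod_(x <- rho) x) * (r`! %/ \prod_(1 <= i < d.+1) (count_mem i rho)`!))%N.
Proof.
have rp j := @part_gt0 rho j rho_gt0.
have [s [us ss sE]] := solution_count rp system_boxed
   (good_regular good) (good_simple good).
have inj (q : {ffun 'I_r -> C}) : q \in s -> injective q by move/sE/(good_distinct good).
have [|t [ut ts tI tE st]] := @orbit_representatives _ _ [group of stab rho'] _ us inj.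
  move=> q p /sE sq hp; apply/sE => k.
  by rewrite curve_at_eval curve_permute // -curve_at_eval; apply: sq.
have -> : ((\prod_(x <- rho) x) * (r`! %/ \prod_(1 <= i < d.+1) (count_mem i rho)`!) = size t)%N.
  have cs : #|stab rho'| = \prod_(1 <= i < d.+1) (count_mem i rho)`!.
    rewrite (@card_stab _ _ d) => [|j].
      apply: eq_bigr => i _; congr (_ `!).
      rewrite -sum1dep_card -sum1_count (big_nth 0%N) big_mkord; exact: eq_bigl.
    rewrite rp /= -deg' addnC; apply: leq_trans (leq_addr _ _).
    by rewrite (bigD1 j) //= leq_addr.
  have dvd : (#|stab rho'| %| r`!)%N.
    rewrite -card_Sn -cardsT; apply: (@cardSg _ [group of setT] [group of stab rho']).
    exact: subsetT.
  have B0 : (0 < #|stab rho'|)%N := cardG_gt0 [group of stab rho'].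
  apply/eqP; rewrite -cs -(eqn_pmul2r B0) -mulnA divnK // -st ss big_split /=.
  rewrite mulnC; apply/eqP; congr (_ * _)%N; last by rewrite (big_nth 0%N) big_mkord.
  by rewrite fact_prod big_add1 /= big_mkord.
exists (fun i => curve_of (tnth (in_tuple t) i)); split.
- by move=> i; apply: solution_admissible; apply/sE/ts/mem_tnth.
- move=> i j h; have ti := mem_tnth i (in_tuple t); have tj := mem_tnth j (in_tuple t).
  have [p hp e] := curve_injective (inj _ (ts _ ti)) (inj _ (ts _ tj)) h.
  have := tI _ _ _ ti tj hp e; rewrite !(tnth_nth [ffun=> 0]) => /eqP.
  by rewrite nth_uniq // => /eqP; apply: val_inj.
move=> F /admissible_proportional[q sq pF].
have [|q' [p [q't hp e]]] := tE [ffun j => q j].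
  apply/sE => k; rewrite -(sq k); apply: meval_eq => j; exact: ffunE.
have eq : curve_of q = curve_of q'.
  rewrite -(curve_permute q' hp) -e; rewrite /curve /contact; congr (interp _ _ (_ * _)).
  by apply: eq_bigr => j _; rewrite ffunE.
have /tnthP[i ei] : q' \in in_tuple t by [].
by exists i; rewrite -ei -eq.
Qed.

End Correspondence.


Section InterpolationFamilies.
Local Open Scope ring_scope.
Variables (C : numClosedFieldType) (M : 'M[C]_3) (m r d : nat).
Variables (lam : 'I_m -> nat) (rho : 'I_r -> nat).
Local Notation n0 := (size (formms 3 d.-1)).
Variables (T : Type) (N : nat) (co : T -> 'I_N -> C).
Variables (P : T -> 'M[C]_(m, 3)) (X : T -> 'M[C]_(n0, 3)).
Hypotheses (P_fun : forall i j, polyfun co (fun c => P c i j))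
  (X_fun : forall i j, polyfun co (fun c => X c i j)).

Lemma polyfun_subst n (p : {mpoly C[n]}) (x : T -> 'I_n -> C) :
  (forall j, polyfun co (fun c => x c j)) -> polyfun co (fun c => p.@[x c]).
Proof.
move=> hx; apply: polyfun_ext (fun c => esym (mevalE (x c) p)) _.
apply: polyfun_sum => e; apply: polyfunM; first exact: polyfun_const.
by apply: polyfun_prod => j; apply: polyfunX; apply: hx.
Qed.

Lemma polyfamZ k (a : T -> C) (f : T -> {mpoly C[k]}) : polyfun co a -> polyfam co f ->
  polyfam co (fun c => a c *: f c).
Proof.
move=> ha hf; apply: polyfam_ext (polyfamM (polyfam_lift k ha) hf) => c.
by rewrite mul_mpolyC.
Qed.

Lemma interp_mx_fun i a : polyfun co (fun c => interp_mx M (X c) i a).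
Proof.
apply: (@polyfun_ext _ _ _ _ (fun c => (lin (row 2%:R M)).@[X c i] * (basis_form C a).@[X c i])).
  by move=> c; rewrite [RHS]mxE.
by apply: polyfunM; apply: polyfun_subst.
Qed.

Lemma interp_det_fun : polyfun co (fun c => \det (interp_mx M (X c))).
Proof. by apply: polyfun_det => i j; apply: interp_mx_fun. Qed.

Lemma contact_at_fam (x : T -> 'I_3 -> C) : (forall j, polyfun co (fun c => x c j)) ->
  polyfam co (fun c => contact_at M lam rho (P c) (x c)).
Proof.
move=> hx; pose f c := (fixed_part M lam (P c)).@[x c] *:
  \prod_(j < r) (((lin (row 0 M)).@[x c])%:MP - 'X_j * ((lin (row 1 M)).@[x c])%:MP) ^+ rho j.
apply: (@polyfam_ext _ _ _ _ _ f) => [c|]; first by rewrite /contact_at -lock.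
apply: polyfamZ.
  apply: (@polyfun_ext _ _ _ _ (fun c => \prod_i (lin (line_pt M (P c i))).@[x c] ^+ lam i)).
    by move=> c; rewrite /fixed_part rmorph_prod; apply: eq_bigr => i _; rewrite /= rmorphXn.
  apply: polyfun_prod => i; apply: polyfunX.
  apply: (@polyfun_ext _ _ _ _ (fun c => _ * _ - _ * _)).
    by move=> c; rewrite line_ptE.
  by apply: polyfunB; apply: polyfunM; apply: polyfun_subst.
apply: polyfam_prod => j; apply: polyfamX; apply: polyfamB.
  by apply: polyfam_lift; apply: polyfun_subst.
by apply: polyfamM; [apply: polyfam_const|apply: polyfam_lift; apply: polyfun_subst].
Qed.

Definition part_at (P : 'M[C]_(m, 3)) (X : 'M[C]_(n0, 3)) (x : 'I_3 -> C) : {mpoly C[r]} :=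
  \sum_a \sum_i ((\adj (interp_mx M X)) a i * (basis_form C a).@[x]) *:
    contact_at M lam rho P (X i).

Lemma part_at_eval P' X' x q : (part_at P' X' x).@[q] =
  (interp_part M X' (fun i => (contact M lam rho P' q).@[X' i])).@[x].
Proof.
rewrite interp_part_eval /part_at (raddf_sum (meval q)); apply: eq_bigr => a _ /=.
rewrite (raddf_sum (meval q)) mulr_suml; apply: eq_bigr => i _ /=.
by rewrite mevalZ contact_at_eval mulrAC.
Qed.

Lemma part_at_fam (x : T -> 'I_3 -> C) : (forall j, polyfun co (fun c => x c j)) ->
  polyfam co (fun c => part_at (P c) (X c) (x c)).
Proof.
move=> hx; apply: polyfam_sum => a; apply: polyfam_sum => i; apply: polyfamZ.
  apply: polyfunM; last exact: polyfun_subst.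
  by apply: polyfun_adj => ? ?; apply: interp_mx_fun.
exact: contact_at_fam.
Qed.

Lemma curve_at_fam (x : T -> 'I_3 -> C) : (forall j, polyfun co (fun c => x c j)) ->
  polyfam co (fun c => curve_at M lam rho (P c) (X c) (x c)).
Proof.
move=> hx; apply: polyfamB.
  by apply: polyfamZ; [apply: interp_det_fun|apply: contact_at_fam].
by apply: polyfamZ; [apply: polyfun_subst|apply: part_at_fam].
Qed.

End InterpolationFamilies.

Section OpenProperties.
Local Open Scope ring_scope.
Variables (C : numClosedFieldType) (T : Type) (N : nat) (co : T -> 'I_N -> C).

(** Finitely many nonempty open conditions can be met at once. *)
Lemma open_inter (I : finType) (Pr : I -> T -> Prop) :
  (forall v, exists c, co c =1 v) ->
  (forall i, exists psi, [/\ polyfun co psi, exists c, psi c != 0 &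
     forall c, psi c != 0 -> Pr i c]) -> exists c, forall i, Pr i c.
Proof.
move=> surj h.
have h' i : exists p : {mpoly C[N]}, p != 0 /\ forall c, p.@[co c] != 0 -> Pr i c.
  have [psi [[p pE] [c c0] hc]] := h i; exists p; split=> [|c' hp]; last first.
    by apply: hc; rewrite pE.
  by apply: contraNneq c0 => z; rewrite pE z meval0.
have [p hp] := fin_all_exists h'.
have [v hv] : exists v, (\prod_i p i).@[v] != 0.
  apply: mpoly_neq0_point; rewrite prodf_seq_neq0; apply/allP => i _.
  by rewrite implyTb (hp i).1.
have [c cv] := surj v; exists c => i; apply: (hp i).2; apply: contraNneq hv => z.
rewrite rmorph_prod (bigD1 i) //=; rewrite -(meval_eq (p i) cv) z mul0r //.
Qed.

Variables (r : nat) (rho : 'I_r -> nat).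
Hypothesis rho_gt0 : forall j, (0 < rho j)%N.
Variable E : 'I_r -> T -> {mpoly C[r]}.
Hypothesis E_fam : forall k, polyfam co (E k).
Hypothesis E_boxed : forall k c, boxed rho (E k c).
Local Notation at_ c := (fun k => E k c).

(** If near each of the finitely many solutions at one parameter a property
    follows from the nonvanishing of a polynomial, then for general parameters it
    holds at all solutions: Lagrange interpolation combines the polynomials into
    one that vanishes at none of the solutions. *)
Lemma open_property (Pr : T -> ('I_r -> C) -> Prop) c0 (s : seq {ffun 'I_r -> C}) :
  regular_system rho (at_ c0) -> uniq s ->
  (forall q, solution (at_ c0) q -> exists2 q', q' \in s & q =1 q') ->
  (forall q, q \in s -> solution (at_ c0) q -> exists d, [/\ polyfam co d, (d c0).@[q] != 0 &
     forall c q', solution (at_ c) q' -> (d c).@[q'] != 0 -> Pr c q']) ->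
  exists psi, [/\ polyfun co psi, psi c0 != 0 &
    forall c, psi c != 0 -> forall q, solution (at_ c) q -> Pr c q].
Proof.
move=> reg us hs h.
have h' (q : {ffun 'I_r -> C}) : exists d, [/\ polyfam co d,
    q \in s -> solution (at_ c0) q -> (d c0).@[q] != 0 &
    forall c q', solution (at_ c) q' -> (d c).@[q'] != 0 -> Pr c q'].
  have [[qs sq]|hn] := classic (q \in s /\ solution (at_ c0) q).
    by have [d [d1 d2 d3]] := h q qs sq; exists d.
  exists (fun=> 0); split=> [|qs sq|c q' _]; [exact: polyfam_const|by case: hn|].
  by rewrite meval0 eqxx.
pose D q := proj1_sig (constructive_indefinite_description _ (h' q)).
have hD q := proj2_sig (constructive_indefinite_description _ (h' q)).
pose L q := proj1_sig (constructive_indefinite_description _ (delta_poly q us)).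
have hL q := proj2_sig (constructive_indefinite_description _ (delta_poly q us)).
pose dd c := \sum_(q <- s) L q * D q c.
have [||psi [p1 p2 p3]] := @nonvanishing_open _ _ _ rho_gt0 _ _ co E E_fam E_boxed dd c0 _ reg.
- apply: polyfam_sum => q; apply: polyfamM; first exact: polyfam_const.
  by case: (hD q).
- move=> q sq; have [q' q's e] := hs q sq; rewrite (meval_eq _ e).
  have sq' : solution (at_ c0) q' by move=> k; rewrite -(meval_eq _ e); apply: sq.
  rewrite /dd (raddf_sum (meval q')) (bigD1_seq q') //= big1_seq => [|q2 /andP[q2q q2s]]; last first.
    by rewrite mevalM (hL q2) // eq_sym (negbTE q2q) mul0r.
  by rewrite addr0 mevalM (hL q') // eqxx mul1r; case: (hD q') => _ /(_ q's sq').
exists psi; split=> // c /p3 hc q sq; have := hc q sq.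
rewrite /dd (raddf_sum (meval q)) => hne.
have [q' ne] : exists q', ((L q' * D q' c).@[q] : C) != 0.
  apply: NNPP => hn; case/eqP: hne; rewrite big1 // => q' _.
  by apply/eqP/contraT => ne; case: hn; exists q'.
by move: ne; rewrite mevalM mulf_eq0 negb_or => /andP[_]; case: (hD q') => _ _; apply.
Qed.

End OpenProperties.

Section SimpleSolutions.
Local Open Scope ring_scope.
Variables (C : numClosedFieldType) (r : nat) (rho : 'I_r -> nat) (s : {perm 'I_r}).
Hypothesis rho_gt0 : forall j, (0 < rho j)%N.
Variables (E x U H : 'I_r -> {mpoly C[r]}) (eps t : 'I_r -> C).

Definition contact_mx : 'M[{mpoly C[r]}]_r := \matrix_(j, i)
  (x j * (H j * (U j)^`M(i) - U j * (H j)^`M(i)) - (t j *+ (rho j * (i == j)))%:MP * (U j * H j)).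

Definition contact_discriminant : {mpoly C[r]} := \det contact_mx * \prod_j H j.

Hypothesis E_eq : forall j, E (s j) = x j ^+ rho j * U j + eps j *: H j.
Hypothesis x_deriv : forall j i, (x j)^`M(i) = - (t j *+ (i == j))%:MP.
Hypothesis eps_neq0 : forall j, eps j != 0.

(** Eliminating the small factors eps from the system and its differential at a
    singular solution leaves a polynomial that no longer involves them, so it can
    be tested where they vanish. *)
Lemma simple_of_discriminant q : solution E q -> contact_discriminant.@[q] != 0 ->
  (jacobian E).@[q] != 0.
Proof.
move=> sq; rewrite mevalM rmorph_prod mulf_eq0 negb_or => /andP[W0 /prodf_neq0 H0].
have Hj j : (H j).@[q] != 0 by apply: H0.
have eE j : eps j * (H j).@[q] = - ((x j).@[q] ^+ rho j * (U j).@[q]).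
  apply/eqP; rewrite -addr_eq0 addrC; have := sq (s j).
  by rewrite E_eq mevalD mevalZ mevalM rmorphXn => ->.
have x0 j : (x j).@[q] != 0.
  apply/eqP => z; have /eqP := eE j; rewrite z expr0n gtn_eqF // mul0r oppr0.
  by rewrite mulf_eq0 (negbTE (eps_neq0 j)) (negbTE (Hj j)).
have dE j i : (H j).@[q] * ((E (s j))^`M(i)).@[q] = (x j).@[q] ^+ (rho j).-1 * (contact_mx j i).@[q].
  rewrite E_eq mderivD mderivZ mderivM.
  have dX n : (x j ^+ n)^`M(i) = (x j)^`M(i) * x j ^+ n.-1 *+ n.
    elim: n => [|n IH]; first by rewrite expr0 mulr0n -mpolyC1 mderivC.
    rewrite exprS mderivM IH; case: n {IH} => [|n]; first by rewrite mulr0n mulr0 addr0 !expr0.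
    by rewrite [n.+1.-1]/= [n.+2.-1]/= -mulrnAr [in RHS]mulrS exprS; ring.
  rewrite dX x_deriv; set K := t j *+ (rho j * (i == j)).
  have eK : (- (t j *+ (i == j))%:MP * x j ^+ (rho j).-1 *+ rho j : {mpoly C[r]}) =
      - (K%:MP * x j ^+ (rho j).-1).
    by rewrite mulNr mulNrn -mulrnAl -mpolyCMn -mulrnA mulnC.
  have Wv : (contact_mx j i).@[q] = (x j).@[q] * ((H j).@[q] * ((U j)^`M(i)).@[q] -
      (U j).@[q] * ((H j)^`M(i)).@[q]) - K * ((U j).@[q] * (H j).@[q]).
    by rewrite mxE mevalB !mevalM mevalB !mevalM mevalC.
  have eX : (x j).@[q] ^+ rho j = (x j).@[q] * (x j).@[q] ^+ (rho j).-1.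
    by rewrite -exprS prednK.
  have eP n : (x j ^+ n).@[q] = (x j).@[q] ^+ n by apply: rmorphXn.
  have eD : (- (t j *+ (i == j))%:MP * x j ^+ (rho j).-1 *+ rho j * U j +
      x j ^+ rho j * (U j)^`M(i) + eps j *: (H j)^`M(i)).@[q] =
      - K * (x j).@[q] ^+ (rho j).-1 * (U j).@[q] +
      (x j).@[q] ^+ rho j * ((U j)^`M(i)).@[q] + eps j * ((H j)^`M(i)).@[q].
    by rewrite eK !mevalD mevalZ !mevalM mevalN mevalM mevalC !eP !mulNr.
  rewrite Wv eD; move: (eE j) eX.
  move: ((x j).@[q]) ((H j).@[q]) ((U j).@[q]) (((U j)^`M(i)).@[q]) (((H j)^`M(i)).@[q]).
  move: (eps j) K {eK Wv eD} => e K X' H' U' dU dH; move: (X' ^+ rho j) (X' ^+ (rho j).-1) => Y Z h1 h2.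
  transitivity (H' * (- K * Z * U' + Y * dU) + (e * H') * dH); first by ring.
  by rewrite h1 h2; ring.
pose A := \matrix_(j, i) ((E (s j))^`M(i)).@[q].
have detA : (\prod_j (H j).@[q]) * \det A = (\prod_j (x j).@[q] ^+ (rho j).-1) * (\det contact_mx).@[q].
  have -> : (\det contact_mx).@[q] = \det (map_mx (meval q) contact_mx) by rewrite det_map_mx.
  pose rowof (f : 'I_r -> C) := \row_j f j.
  have dd (f : 'I_r -> C) : \prod_j f j = \det (diag_mx (rowof f)).
    by rewrite det_diag; apply: eq_bigr => j _; rewrite mxE.
  rewrite !dd -!det_mulmx; congr (\det _); apply/matrixP => j i.
  by rewrite !mul_diag_mx !mxE dE /contact_mx mxE.
have A0 : \det A != 0.
  apply: contraNneq W0 => z; move: detA; rewrite z mulr0 => /esym/eqP.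
  rewrite mulf_eq0 => /orP[|//]; rewrite prodf_seq_eq0 => /hasP[j _ /andP[_]].
  by rewrite expf_eq0 (negbTE (x0 j)) andbF.
apply: contraNneq A0 => z.
have -> : A = row_perm s (map_mx (meval q) (\matrix_(k, j) (E k)^`M(j))).
  by apply/matrixP => j i; rewrite !mxE.
by rewrite row_permE det_mulmx det_map_mx [X in _ * X](_ : _ = 0) ?mulr0.
Qed.

End SimpleSolutions.

Section SmoothnessTest.
Local Open Scope ring_scope.
Variable C : numClosedFieldType.

Lemma combination_eq0 k (u : 'I_(size (formms 3 k)) -> C) :
  \sum_a u a *: ('X_[nth 0%MM (formms 3 k) a] : {mpoly C[3]}) = 0 -> forall a, u a = 0.
Proof.
move=> /(congr1 (fun p => p@_(nth 0%MM (formms 3 k) _))) h a; have {h} := h a.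
rewrite mcoeff0 raddf_sum (bigD1 a) //= big1 => [|b ba].
  by rewrite addr0 mcoeffZ mcoeffX eqxx mulr1.
rewrite /= mcoeffZ mcoeffX (nth_uniq _ (ltn_ord b) (ltn_ord a) (uniq_formms _ _)).
by rewrite (_ : (nat_of_ord b == a) = false) ?mulr0 //; apply/negbTE.
Qed.

Lemma forms_interpolation k : exists N (z : 'I_N -> 'rV[C]_3) (L : 'I_N -> {mpoly C[3]}),
  forall F, F \is k.-homog -> F = \sum_i F.@[z i 0] *: L i.
Proof.
pose N := size (formms 3 k); pose f (a : 'I_N) (x : 'rV[C]_3) : C :=
  'X_[nth 0%MM (formms 3 k) a].@[x 0].
have [|z [_ dz]] := @unisolvent _ _ (fun=> True) _ f.
  move=> u hu; apply/colP => a; rewrite mxE; move: a; apply: combination_eq0.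
  apply: mpoly_eq0_eval => v; rewrite raddf_sum -[RHS](hu (\row_j v j) I).
  apply: eq_bigr => a _ /=; rewrite mevalZ mulrC; congr (_ * _).
  by apply: meval_eq => j; rewrite mxE.
set V := \matrix_(i, a) _ in dz; have uV : V \in unitmx by rewrite unitmxE unitfE.
exists N, z, (fun i => \sum_a invmx V a i *: 'X_[nth 0%MM (formms 3 k) a]).
move=> F /dhomog_supported sF; pose g := \col_(a < N) F@_(nth 0%MM (formms 3 k) a).
have Fz i : F.@[z i 0] = (V *m g) i 0.
  rewrite {1}(supportedE (uniq_formms _ _) sF) raddf_sum mxE; apply: eq_bigr => a _ /=.
  by rewrite mevalZ !mxE mulrC.
rewrite {1}(supportedE (uniq_formms _ _) sF).
under [RHS]eq_bigr do rewrite scaler_sumr.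
rewrite exchange_big; apply: eq_bigr => a _ /=.
under eq_bigr do rewrite scalerA; rewrite -scaler_suml; congr (_ *: _).
transitivity ((invmx V *m (V *m g)) a 0); first by rewrite mulKmx // mxE.
by rewrite mxE; apply: eq_bigr => i _; rewrite Fz mulrC.
Qed.

(** That a form is certified smooth like a given one is an open condition on its
    values at finitely many points. *)
Lemma smoothness_test d k F0 : (0 < d)%N -> F0 \is d.-homog -> certified d.-1 k F0 ->
  exists N (z : 'I_N -> 'rV[C]_3) b (A : 'I_N -> 'M[C]_b),
    \det (\sum_i F0.@[z i 0] *: A i) != 0 /\ forall F, F \is d.-homog ->
      \det (\sum_i F.@[z i 0] *: A i) != 0 -> smooth_form F.
Proof.
move=> d0 hF0 c0; have [N [z [L hL]]] := forms_interpolation d.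
pose ms := formms 3 (k + d.-1); pose cm (F : {mpoly C[3]}) := coefmx ms (partial_multiples (e:=k) F).
have sup (F : {mpoly C[3]}) : F \is d.-homog -> forall i, supported ms (partial_multiples (e:=k) F i).
  move=> hF i; apply/dhomog_supported; apply: (dhomogM (form_nth _ _)).
  by apply: dhomog_deriv; rewrite prednK.
have rf (F : {mpoly C[3]}) : F \is d.-homog -> certified d.-1 k F <-> row_full (cm F).
  move=> hF; exact (spanning_row_full (uniq_formms _ _) (sup F hF)).
have /row_fullP[B hB] : row_full (cm F0) by apply/rf.
have cmE F : F \is d.-homog -> B *m cm F = \sum_i F.@[z i 0] *: (B *m cm (L i)).
  move=> hF; under eq_bigr do rewrite scalemxAr; rewrite -mulmx_sumr; congr (_ *m _).
  apply/matrixP => a b; rewrite summxE mxE {1}(hL F hF) /partial_multiples.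
  rewrite (raddf_sum (mderiv (enum_val a).1)) mulr_sumr raddf_sum; apply: eq_bigr => i _ /=.
  by rewrite mderivZ -scalerAr mcoeffZ !mxE.
exists N, z, _, (fun i => B *m cm (L i)); split.
  by rewrite -cmE // hB det1 oner_neq0.
move=> F hF; rewrite -cmE // => dn; apply: (@certified_smooth _ d.-1 k); apply/rf => //.
apply/row_fullP; exists (invmx (B *m cm F) *m B).
by rewrite -mulmxA mulVmx // unitmxE unitfE.
Qed.

End SmoothnessTest.


Section SimpleSpecialization.
Local Open Scope ring_scope.
Variables (C : numClosedFieldType) (r : nat) (rho : 'I_r -> nat).

Lemma discriminant_neq0 (x U H : 'I_r -> {mpoly C[r]}) (t : 'I_r -> C) q :
  (forall j, 0 < rho j)%N -> (forall j, (x j).@[q] = 0) -> (forall j, t j != 0) ->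
  (forall j, (U j).@[q] != 0) -> (forall j, (H j).@[q] != 0) ->
  (contact_discriminant rho x U H t).@[q] != 0.
Proof.
move=> rho0 x0 t0 U0 H0; rewrite mevalM mulf_neq0 //; last first.
  by rewrite rmorph_prod prodf_seq_neq0; apply/allP => j _; apply: H0.
have -> : (\det (contact_mx rho x U H t)).@[q] = \det (map_mx (meval q) (contact_mx rho x U H t)).
  by rewrite det_map_mx.
have -> : map_mx (meval q) (contact_mx rho x U H t) =
    diag_mx (\row_j (- (t j *+ rho j) * ((U j).@[q] * (H j).@[q]))).
  apply/matrixP => j i; rewrite !mxE mevalB !mevalM x0 mul0r sub0r mevalC -mulNr.
  rewrite [j == i]eq_sym; case: (i == j); first by rewrite muln1 mulr1n.
  by rewrite muln0 mulr0n oppr0 mul0r.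
rewrite det_diag prodf_seq_neq0; apply/allP => j _; rewrite mxE !mulf_neq0 // oppr_eq0.
by rewrite mulrn_eq0 negb_or t0 andbT -lt0n.
Qed.

Lemma contact_discriminant_fam (T : Type) (N : nat) (co : T -> 'I_N -> C)
    (x U H : T -> 'I_r -> {mpoly C[r]}) (t : T -> 'I_r -> C) :
  (forall j, polyfam co (fun c => x c j)) -> (forall j, polyfam co (fun c => U c j)) ->
  (forall j, polyfam co (fun c => H c j)) -> (forall j, polyfun co (fun c => t c j)) ->
  polyfam co (fun c => contact_discriminant rho (x c) (U c) (H c) (t c)).
Proof.
move=> hx hU hH ht; apply: polyfamM; last exact: polyfam_prod.
apply: polyfam_det => j i.
pose f c := x c j * (H c j * (U c j)^`M(i) - U c j * (H c j)^`M(i)) -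
  (t c j *+ (rho j * (i == j)))%:MP * (U c j * H c j).
apply: (@polyfam_ext _ _ _ _ _ f) => [c|]; first by rewrite mxE.
apply: polyfamB.
  apply: polyfamM => //; apply: polyfamB; apply: polyfamM => //; exact: polyfam_deriv.
apply: polyfamM; last exact: polyfamM.
apply: polyfam_lift; apply: (@polyfun_ext _ _ _ _ (fun c => t c j * (rho j * (i == j))%:R)).
  by move=> c; rewrite mulr_natr.
by apply: polyfunM => //; apply: polyfun_const.
Qed.

End SimpleSpecialization.

Section Witness.
Local Open Scope ring_scope.
Variables (C : numClosedFieldType) (M : 'M[C]_3).
Hypothesis uM : M \in unitmx.
Variables (d : nat) (lam rho : seq nat).
Hypotheses (d_gt0 : (0 < d)%N) (deg : (sumn lam + sumn rho = d)%N).
Hypotheses (lam_gt0 : all (ltn 0) lam) (rho_gt0 : all (ltn 0) rho).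

Local Notation m := (size lam).
Local Notation r := (size rho).
Local Notation n0 := (size (formms 3 d.-1)).
Local Notation l := (row 2%:R M).
Local Notation lam' := (@part_of lam).
Local Notation rho' := (@part_of rho).
Local Notation S := (row 0 M).
Local Notation T := (row 1 M).

Lemma prod_flatten_nseq (I : Type) (s : seq I) (e : I -> nat) (f : I -> C) (G : C -> {mpoly C[3]}) :
  \prod_(a <- flatten [seq nseq (e k) (f k) | k <- s]) G a = \prod_(k <- s) G (f k) ^+ e k.
Proof.
elim: s => [|k s IH]; first by rewrite !big_nil.
by rewrite /= big_cat big_nseq iter_mulr_1 big_cons IH.
Qed.

Lemma size_flatten_nseq (I : Type) (s : seq I) (e : I -> nat) (f : I -> C) :
  (size (flatten [seq nseq (e k) (f k) | k <- s]) = \sum_(k <- s) e k)%N.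
Proof. by elim: s => [|k s IH]; rewrite ?big_nil // big_cons /= size_cat size_nseq IH. Qed.

Variable f : 'I_(m + r) -> C.
Hypothesis f_inj : injective f.
Hypothesis f_bad : dot l (e1 C) = 0 -> forall k, dot S (e1 C) - f k * dot T (e1 C) != 0.

Definition special_pt (a : C) : 'rV[C]_3 := a *: row 0 (dualmx M) + row 1 (dualmx M).
Definition special_fixed : 'M[C]_(m, 3) := \matrix_i special_pt (f (lshift r i)).
Definition special_free : 'M[C]_(r, 3) := \matrix_j special_pt (f (rshift m j)).
Definition special_q (s : {perm 'I_r}) : {ffun 'I_r -> C} := [ffun j => f (rshift m (s j))].

Local Notation P0 := special_fixed.
Local Notation Y0 := special_free.

Lemma special_ptE a : [/\ dot S (special_pt a) = a, dot T (special_pt a) = 1 &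
  dot l (special_pt a) = 0].
Proof. by split; rewrite dotDr dotZr !dot_dual //= ?mulr1 ?mulr0 ?addr0 ?add0r. Qed.

Lemma special_fixedE i : row i P0 = special_pt (f (lshift r i)).
Proof. by rewrite rowK. Qed.

Lemma special_freeE j : row j Y0 = special_pt (f (rshift m j)).
Proof. by rewrite rowK. Qed.

Lemma special_q_inj s : injective (special_q s).
Proof. by move=> i j; rewrite !ffunE => /f_inj/rshift_inj/perm_inj. Qed.

Definition specialized (q : 'I_r -> C) (X : 'M[C]_(n0, 3)) : Prop :=
  [/\ \det (interp_mx M X) != 0,
      exists N (z : 'I_N -> 'rV[C]_3) b (A : 'I_N -> 'M[C]_b),
        \det (\sum_i (curve_at M lam' rho' P0 X (z i 0)).@[q] *: A i) != 0 /\
        forall F, F \is d.-homog -> \det (\sum_i F.@[z i 0] *: A i) != 0 -> smooth_form F,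
      (curve_at M lam' rho' P0 X (e1 C 0)).@[q] != 0 &
      forall k, (part_at M lam' rho' P0 X (Y0 k)).@[q] != 0].

Let coX (X : 'M[C]_(n0, 3)) := mxvec X 0.

(** Among the points of a suitable smooth curve with the given contacts there
    are enough to determine it, so interpolation returns this curve. *)
Lemma special_curve (s : {perm 'I_r}) : exists psi, [/\ polyfun coX psi,
  exists X, psi X != 0 & forall X, psi X != 0 -> specialized (special_q s) X].
Proof.
set q := special_q s.
pose root k := match split k with inl i => f (lshift r i) | inr j => q j end.
have rootE k : exists k', root k = f k'.
  by rewrite /root; case: split => i; [exists (lshift r i)|exists (rshift m (s i)); rewrite ffunE].
pose al := flatten [seq nseq (mult lam' rho' k) (root k) | k <- index_enum 'I_(m + r)].
have sz : size al = d by rewrite size_flatten_nseq (sum_mult (deg' deg)).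
have al0 : (0 < size al)%N by rewrite sz.
have bad : dot l (e1 C) = 0 -> \prod_(a <- al) (dot S (e1 C) - a * dot T (e1 C)) != 0.
  move=> le; rewrite prodf_seq_neq0; apply/allP => a /flatten_mapP[k _].
  rewrite mem_nseq => /andP[_ /eqP ->]; have [k' ->] := rootE k.
  exact: f_bad.
have [gam [g0 g1 [k]]] := good_explicit_curve uM al0 bad.
set F := explicit_curve M al gam; rewrite sz => cF Fe.
have hF : F \is d.-homog by rewrite -sz; apply: explicit_homog.
pose G : {mpoly C[3]} := lin T ^+ d.-1 + gam%:MP * lin l ^+ d.-1.
have linX (a : 'rV[C]_3) n : lin a ^+ n \is n.-homog.
  by have := dhomogMn n (lin_homog a); rewrite mul1n.
have hG : G \is (d.-1).-homog 
  by apply: rpredD; [|rewrite mul_mpolyC; apply: rpredZ]; apply: linX.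
have eF : F = 1 *: contact M lam' rho' P0 q + lin l * G.
  rewrite scale1r /F /explicit_curve sz; congr (_ + _).
  rewrite prod_flatten_nseq big_split_ord /contact /fixed_part; congr (_ * _); apply: eq_bigr => i _.
    rewrite /mult /root !(unsplitK (inl i)) /line_pt !lin_row special_fixedE.
    case: (special_ptE (f (lshift r i))) => -> -> _.
    by rewrite scale1r -scaleNr linD linZ scaleNr mul_mpolyC.
  rewrite /mult /root !(unsplitK (inr i)) /line_root.
  by rewrite -scaleNr linD linZ scaleNr mul_mpolyC.
have l0 := line_neq uM.
have irF := smooth_irreducible hF d_gt0 Fe (certified_smooth cF).
pose h (a : 'I_n0) (x : 'rV[C]_3) := (lin l).@[x 0] * (basis_form C a).@[x 0].
have [|z [Fz dz]] := @unisolvent _ _ (fun x : 'rV[C]_3 => x != 0 /\ F.@[x 0] = 0) _ h.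
  move=> u hu; pose A : {mpoly C[3]} := \sum_a u a 0 *: basis_form C a.
  have hA : A \is (d.-1).-homog by apply: rpred_sum => a _; apply: rpredZ; apply: basis_form_homog.
  have hlA : lin l * A \is d.-homog.
    by have := dhomogM (lin_homog l) hA; rewrite add1n prednK.
  have [B eB] : mpoly_dvd F (lin l * A).
    apply: (form_zero_on_curve hF d_gt0 Fe irF hlA) => x x0 Fx.
    have AE : A.@[x 0] = \sum_a u a 0 * (basis_form C a).@[x 0].
      by rewrite /A raddf_sum; apply: eq_bigr => a _; apply: mevalZ.
    rewrite mevalM -[RHS](hu x (conj x0 Fx)) AE mulr_sumr.
    by apply: eq_bigr => a _; rewrite /h mulrCA mulrC.
  have A0 : A = 0.
    have [z0|lA0] := eqVneq (lin l * A) 0.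
      by apply/eqP; move/eqP: z0; rewrite mulf_eq0 lin_eq0 (negbTE l0).
    case/eqP: (lA0); have lA1 := lA0; rewrite eB in hlA lA1.
    have [e [f' [ef hB hF']]] := dhomog_factor hlA lA1.
    have F0 : F != 0 by apply: contraNneq lA1 => ->; rewrite mulr0.
    have fd := dhomog_uniq F0 hF' hF.
    have e0 : e = 0%N by move: ef; rewrite fd; clear; lia.
    rewrite e0 in hB; have [c ec] := dhomog0_const hB.
    pose x := row 0 (dualmx M); have lx : dot l x = 0 by rewrite dot_dual.
    have Fx : F.@[x 0] != 0.
      rewrite explicit_on_line // prodf_seq_neq0; apply/allP => a _.
      by rewrite !dot_dual //= mulr0 subr0 oner_eq0.
    have := congr1 (meval (x 0)) eB; rewrite mevalM lin_dot lx mul0r mevalM ec mevalC.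
    move=> /esym/eqP; rewrite mulf_eq0 (negbTE Fx) orbF => /eqP c0.
    by rewrite eB ec c0 mul0r.
  by apply/colP => a; rewrite mxE; move: a; apply: combination_eq0.
pose X : 'M[C]_(n0, 3) := \matrix_i z i.
have Xz i (p : {mpoly C[3]}) : p.@[X i] = p.@[z i 0] by rewrite -row_pt rowK.
have dX : \det (interp_mx M X) != 0.
  rewrite (_ : interp_mx M X = \matrix_(i, a) h a (z i)) //.
  by apply/matrixP => i a; rewrite !mxE !Xz.
have eD : \det (interp_mx M X) *: F = curve M lam' rho' P0 X q.
  by rewrite (interp_unique hG eF) ?scale1r // => i; rewrite Xz; case: (Fz i).
have cE x : (curve_at M lam' rho' P0 X x).@[q] = \det (interp_mx M X) * F.@[x].
  by rewrite curve_at_eval -eD mevalZ.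
have pE : interp_part M X (fun i => (contact M lam' rho' P0 q).@[X i]) = - \det (interp_mx M X) *: G.
  apply: (mulfI (x := lin l)); first by rewrite lin_eq0.
  have := eD; rewrite /curve /interp eF scale1r scalerDr => /addrI e2.
  by rewrite scaleNr mulrN -scalerAr e2 opprK.
have [N [zz [b [A [dA hA]]]]] := smoothness_test d_gt0 hF cF.
pose psi (X' : 'M[C]_(n0, 3)) := \det (interp_mx M X') *
  (\det (\sum_i (curve_at M lam' rho' P0 X' (zz i 0)).@[q] *: A i) *
  ((curve_at M lam' rho' P0 X' (e1 C 0)).@[q] *
  \prod_k (part_at M lam' rho' P0 X' (Y0 k)).@[q])).
have Xfun i j : polyfun coX (fun X' => X' i j).
  by apply: polyfun_ext (polyfun_coord _ (mxvec_index i j)) => X'; rewrite /coX mxvecE.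
have Pfun i j : polyfun coX (fun _ => P0 i j) by apply: polyfun_const.
have cfun (x : 'I_3 -> C) : polyfun coX (fun X' => (curve_at M lam' rho' P0 X' x).@[q]).
  apply: polyfam_eval.
  by apply: (curve_at_fam M lam' rho' Pfun Xfun) => j; apply: polyfun_const.
exists psi; split.
- apply: polyfunM; first exact: interp_det_fun.
  apply: polyfunM.
    apply: polyfun_det => i j.
    apply: (@polyfun_ext _ _ _ _ (fun X' => \sum_k (curve_at M lam' rho' P0 X' (zz k 0)).@[q] * A k i j)).
      by move=> X'; rewrite summxE; apply: eq_bigr => k' _; rewrite mxE.
    by apply: polyfun_sum => k'; apply: polyfunM; [apply: cfun|apply: polyfun_const].
  apply: polyfunM; first exact: cfun.
  apply: polyfun_prod => k'; apply: polyfam_eval.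
  by apply: (part_at_fam M lam' rho' Pfun Xfun) => j; apply: polyfun_const.
- exists X; rewrite /psi !mulf_neq0 //.
  + under eq_bigr do rewrite cE -scalerA; rewrite -scaler_sumr detZ mulf_neq0 // expf_neq0 //.
  + by rewrite cE mulf_neq0.
  rewrite prodf_seq_neq0; apply/allP => k' _; rewrite implyTb part_at_eval pE mevalZ mulf_neq0 ?oppr_eq0 //.
  rewrite /G mevalD mevalM mevalC !rmorphXn /= !lin_row special_freeE.
  case: (special_ptE (f (rshift m k'))) => _ -> ->; rewrite expr1n.
  by case: (d.-1) => [|n]; rewrite ?expr0 ?mulr1 ?expr0n //= mulr0 addr0 oner_eq0.
move=> X'; rewrite /psi !mulf_eq0 !negb_or => /and4P[h1 h2 h3 /prodf_neq0 h4].
by split=> // [|k']; [exists N, zz, b, A|apply: h4].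
Qed.

Lemma special_points : exists X, forall s, specialized (special_q s) X.
Proof.
apply: (@open_inter _ _ _ coX) => [v|s]; last exact: special_curve.
by exists (vec_mx (\row_i v i)) => i; rewrite /coX vec_mxK mxE.
Qed.

End Witness.


Section GenericCount.
Local Open Scope ring_scope.
Variables (C : numClosedFieldType) (M : 'M[C]_3).
Hypothesis uM : M \in unitmx.
Variables (d : nat) (lam rho : seq nat).
Hypotheses (d_gt0 : (0 < d)%N) (deg : (sumn lam + sumn rho = d)%N).
Hypotheses (lam_gt0 : all (ltn 0) lam) (rho_gt0 : all (ltn 0) rho).

Local Notation m := (size lam).
Local Notation r := (size rho).
Local Notation n0 := (size (formms 3 d.-1)).
Local Notation l := (row 2%:R M).
Local Notation lam' := (@part_of lam).
Local Notation rho' := (@part_of rho).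
Local Notation S := (row 0 M).
Local Notation T := (row 1 M).

(** Pairwise distinct coordinates on the line, all different from that of the
    vertex of the pencil if the latter is on the line. *)
Lemma special_coordinates : exists f : 'I_(m + r) -> C, injective f /\
  (dot l (e1 C) = 0 -> forall k, dot S (e1 C) - f k * dot T (e1 C) != 0).
Proof.
exists (fun k => dot S (e1 C) / dot T (e1 C) + k.+1%:R); split=> [i j /addrI/eqP|le k].
  by rewrite eqr_nat => /eqP[]; apply: val_inj.
have e0 : e1 C != 0 by apply/eqP => /rowP/(_ 1)/eqP; rewrite !mxE oner_eq0.
have [Tz|Tnz] := eqVneq (dot T (e1 C)) 0.
  rewrite Tz mulr0 subr0; apply: contraNneq e0 => Sz.
  by rewrite (line_coords uM le) Sz Tz !scale0r addr0.
by rewrite mulrDl divfK // opprD addrA subrr sub0r oppr_eq0 mulf_neq0 // pnatr_eq0.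
Qed.

Local Notation configs := ('M[C]_(m, 3) * 'M[C]_(n0 + r, 3))%type.
Let co (c : configs) := mxvec (col_mx c.1 c.2) 0.
Local Notation P_ c := c.1.
Local Notation X_ c := (usubmx c.2).
Local Notation Y_ c := (dsubmx c.2).

Let P_fun i j : polyfun co (fun c => P_ c i j).
Proof.
apply: polyfun_ext (polyfun_coord _ (mxvec_index (lshift _ i) j)) => c.
by rewrite /co mxvecE col_mxEu.
Qed.

Let XY_fun i j : polyfun co (fun c => c.2 i j).
Proof.
apply: polyfun_ext (polyfun_coord _ (mxvec_index (rshift _ i) j)) => c.
by rewrite /co mxvecE col_mxEd.
Qed.

Let X_fun i j : polyfun co (fun c => X_ c i j).
Proof. by apply: polyfun_ext (XY_fun (lshift _ i) j) => c; rewrite mxE. Qed.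

Let Y_fun i j : polyfun co (fun c => Y_ c i j).
Proof. by apply: polyfun_ext (XY_fun (rshift _ i) j) => c; rewrite mxE. Qed.

Let E (k : 'I_r) (c : configs) := curve_at M lam' rho' (P_ c) (X_ c) (Y_ c k).

Let E_fam k : polyfam co (E k).
Proof. by apply: curve_at_fam => //; exact: Y_fun. Qed.

Let E_boxed k c : boxed rho' (E k c).
Proof. exact: curve_at_boxed. Qed.

Let rho0 j : (0 < rho' j)%N := @part_gt0 rho j rho_gt0.

Let lin_fun (a : 'rV[C]_3) (x : configs -> 'I_3 -> C) : (forall j, polyfun co (fun c => x c j)) ->
  polyfun co (fun c => (lin a).@[x c]).
Proof. exact: polyfun_subst. Qed.

Section SpecialConfiguration.
Variables (f : 'I_(m + r) -> C) (f_inj : injective f) (X0 : 'M[C]_(n0, 3)).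
Hypothesis spec : forall s, specialized M f (special_q f s) X0.

Local Notation P0 := (special_fixed M f).
Local Notation Y0 := (special_free M f).
Let c0 : configs := (P0, col_mx X0 Y0).
Let alpha j := f (rshift m j).

Let det0 : \det (interp_mx M X0) != 0.
Proof. by case: (spec 1). Qed.

Let freeE k : [/\ (lin S).@[Y0 k] = alpha k, (lin T).@[Y0 k] = 1 & (lin l).@[Y0 k] = 0].
Proof. by rewrite !lin_row special_freeE; apply: special_ptE. Qed.

Let fixedE i : [/\ (lin S).@[P0 i] = f (lshift r i), (lin T).@[P0 i] = 1 & (lin l).@[P0 i] = 0].
Proof. by rewrite !lin_row special_fixedE; apply: special_ptE. Qed.

Let fixed_neq0 k : (fixed_part M lam' P0).@[Y0 k] != 0.
Proof.
rewrite rmorph_prod prodf_seq_neq0; apply/allP => i _; rewrite implyTb rmorphXn expf_neq0 //=.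
rewrite line_ptE; have [-> -> _] := freeE k; have [-> -> _] := fixedE i.
by rewrite mul1r mulr1 subr_eq0 (inj_eq f_inj) eq_rlshift.
Qed.

Let kap k := \det (interp_mx M X0) * (fixed_part M lam' P0).@[Y0 k] * \prod_j (-1) ^+ rho' j.

(** When the free points are on the line, the curve is in contact with the line
    exactly there. *)
Let special_system k : E k c0 = kap k *: \prod_j ('X_j - (alpha k)%:MP) ^+ rho' j.
Proof.
rewrite /E /c0 /= col_mxKu col_mxKd /curve_at; have [eS eT el] := freeE k.
rewrite el scale0r subr0 /contact_at -lock eS eT scalerA /kap -[RHS]scalerA; congr (_ *: _).
rewrite -scaler_prod; apply: eq_bigr => j _.
by rewrite -exprZn scaleN1r opprB mulr1.
Qed.

Let kap0 k : kap k != 0.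
Proof.
rewrite !mulf_neq0 // prodf_seq_neq0; apply/allP => j _.
by rewrite expf_neq0 // oppr_eq0 oner_eq0.
Qed.

Let alpha_inj : injective alpha.
Proof. by move=> i j /f_inj/rshift_inj. Qed.

Let reg0 : regular_system rho' (fun k => E k c0).
Proof. exact (special_regular rho0 alpha_inj kap0 special_system). Qed.

Definition good_solution (c : configs) (q : 'I_r -> C) : Prop :=
  [/\ injective q, forall i j, dot S (row i (P_ c)) - q j * dot T (row i (P_ c)) != 0,
      (curve M lam' rho' (P_ c) (X_ c) q).@[e1 C 0] != 0,
      smooth_form (curve M lam' rho' (P_ c) (X_ c) q) &
      (forall k, (lin l).@[Y_ c k] != 0) -> (jacobian (fun k => E k c)).@[q] != 0].

Let contact_root (c : configs) k j : {mpoly C[r]} :=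
  ((lin S).@[Y_ c k])%:MP - 'X_j * ((lin T).@[Y_ c k])%:MP.

Let contact_root_fam k j : polyfam co (fun c => contact_root c k j).
Proof.
apply: polyfamB; first by apply: polyfam_lift; apply: lin_fun; exact: Y_fun.
by apply: polyfamM; [apply: polyfam_const|apply: polyfam_lift; apply: lin_fun; exact: Y_fun].
Qed.

Let cofactor_ (s : {perm 'I_r}) (c : configs) j : {mpoly C[r]} :=
  (\det (interp_mx M (X_ c)) * (fixed_part M lam' (P_ c)).@[Y_ c (s j)]) *:
  \prod_(i | i != j) contact_root c (s j) i ^+ rho' i.

Let fixed_fun (x : configs -> 'I_3 -> C) : (forall j, polyfun co (fun c => x c j)) ->
  polyfun co (fun c => (fixed_part M lam' (P_ c)).@[x c]).
Proof.
move=> hx; apply: (@polyfun_ext _ _ _ _ (fun c : configs => \prod_i ((lin T).@[P_ c i] * (lin S).@[x c] -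
   (lin S).@[P_ c i] * (lin T).@[x c]) ^+ lam' i)).
  by move=> c; rewrite rmorph_prod; apply: eq_bigr => i _; rewrite -line_ptE rmorphXn.
apply: polyfun_prod => i; apply: polyfunX; apply: polyfunB; apply: polyfunM; exact: lin_fun.
Qed.

Let cofactor_fam s j : polyfam co (fun c => cofactor_ s c j).
Proof.
apply: polyfamZ.
  by apply: polyfunM; [apply: interp_det_fun X_fun|apply: fixed_fun; exact: Y_fun].
apply: (@polyfam_ext _ _ _ _ _ (fun c => \prod_(i <- [seq i <- index_enum 'I_r | i != j])
    contact_root c (s j) i ^+ rho' i)) => [c|]; first by rewrite big_filter.
by apply: polyfam_prod => i; apply: polyfamX; apply: contact_root_fam.
Qed.

Let system_eq (s : {perm 'I_r}) c j : E (s j) c = contact_root c (s j) j ^+ rho' j * cofactor_ s c j +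
  (- (lin l).@[Y_ c (s j)]) *: part_at M lam' rho' (P_ c) (X_ c) (Y_ c (s j)).
Proof.
rewrite /E /curve_at scaleNr; congr (_ - _).
rewrite /contact_at -lock (bigD1 j) //= scalerA /cofactor_ -scalerAr; congr (_ *: _).
Qed.

Let contact_root_deriv c k j i : (contact_root c k j)^`M(i) = - ((lin T).@[Y_ c k] *+ (i == j))%:MP.
Proof.
rewrite /contact_root mderivB mderivC sub0r [_ * _%:MP]mulrC mul_mpolyC mderivZ mderivX; congr (- _).
rewrite mnm1E eq_sym; case: eqP => [->|_]; rewrite ?mulr0n ?scale0r ?scaler0 // ?mpolyC0 //.
rewrite mulr1n scale1r -[RHS]mulr1 mul_mpolyC -mpolyX0; congr (_ *: 'X_[_]).
by apply/mnmP => a; rewrite mnmBE mnm0E subnn.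
Qed.

Lemma solutions_open : exists psi, [/\ polyfun co psi, psi c0 != 0 &
  forall c, psi c != 0 -> forall q, solution (fun k => E k c) q -> good_solution c q].
Proof.
pose sols := undup [seq special_q f s | s : {perm 'I_r}].
apply: (open_property rho0 E_fam E_boxed (s := sols) reg0) => [|q sq|q].
- exact: undup_uniq.
- have [s hs] := special_solution alpha_inj kap0 special_system sq.
  exists (special_q f s); last by move=> j; rewrite ffunE hs.
  by rewrite mem_undup; apply/mapP; exists s; rewrite ?mem_enum.
rewrite mem_undup => /mapP[s _ ->] _.
have [_ [N [z [b [A [dA hA]]]]] Ae Ap] := spec s.
pose q0 := special_q f s.
pose d1 (c : configs) : {mpoly C[r]} := \prod_(p <- enum [pred p : 'I_r * 'I_r | p.1 != p.2]) ('X_p.1 - 'X_p.2).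
pose d2 (c : configs) : {mpoly C[r]} := \prod_(i < m) \prod_(j < r)
  (((lin S).@[P_ c i])%:MP - 'X_j * ((lin T).@[P_ c i])%:MP).
pose d3 (c : configs) : {mpoly C[r]} := curve_at M lam' rho' (P_ c) (X_ c) (e1 C 0).
pose d4 (c : configs) : {mpoly C[r]} := \det (\sum_i \matrix_(a, a')
  (curve_at M lam' rho' (P_ c) (X_ c) (z i 0) * (A i a a')%:MP)).
pose d5 (c : configs) : {mpoly C[r]} := contact_discriminant rho' (fun j => contact_root c (s j) j)
  (cofactor_ s c) (fun j => part_at M lam' rho' (P_ c) (X_ c) (Y_ c (s j)))
  (fun j => (lin T).@[Y_ c (s j)]).
have d4E c q1 : (d4 c).@[q1] = \det (\sum_i (curve_at M lam' rho' (P_ c) (X_ c) (z i 0)).@[q1] *: A i).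
  rewrite /d4 -[LHS](det_map_mx (meval q1)); congr (\det _); apply/matrixP => a a'.
  rewrite !mxE !summxE (raddf_sum (meval q1)); apply: eq_bigr => i _ /=.
  by rewrite !mxE mevalM mevalC.
exists (fun c => d1 c * (d2 c * (d3 c * (d4 c * d5 c)))); split.
- have cfam (x : 'I_3 -> C) : polyfam co (fun c => curve_at M lam' rho' (P_ c) (X_ c) x).
    by apply: (curve_at_fam M lam' rho' P_fun X_fun) => j; apply: polyfun_const.
  apply: polyfamM; first exact: polyfam_const.
  apply: polyfamM.
    apply: polyfam_prod => i; apply: polyfam_prod => j; apply: polyfamB.
      by apply: polyfam_lift; apply: lin_fun; exact: P_fun.
    by apply: polyfamM; [apply: polyfam_const|apply: polyfam_lift; apply: lin_fun; exact: P_fun].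
  apply: polyfamM; first exact: cfam.
  apply: polyfamM.
    apply: polyfam_det => a a'.
    apply: (@polyfam_ext _ _ _ _ _ (fun c => \sum_i (curve_at M lam' rho' (P_ c) (X_ c) (z i 0) * (A i a a')%:MP))).
      by move=> c; rewrite summxE; apply: eq_bigr => i _; rewrite mxE.
    by apply: polyfam_sum => i; apply: polyfamM; [apply: cfam|apply: polyfam_const].
  apply: contact_discriminant_fam => j.
  + exact: contact_root_fam.
  + exact: cofactor_fam.
  + by apply: (part_at_fam M lam' rho' P_fun X_fun) => i; apply: Y_fun.
  by apply: lin_fun; exact: Y_fun.
- have q0E j : special_q f s j = alpha (s j) by rewrite ffunE.
  have YE k : Y_ c0 k = Y0 k by rewrite /c0 /= col_mxKd.
  have XE : X_ c0 = X0 by rewrite /c0 /= col_mxKu.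
  have rootE k j : (contact_root c0 k j).@[special_q f s] = alpha k - alpha (s j).
    rewrite /contact_root mevalB mevalM !mevalC mevalXU YE q0E.
    by have [-> -> _] := freeE k; rewrite mulr1.
  have n1 : (d1 c0).@[special_q f s] != 0.
    rewrite rmorph_prod prodf_seq_neq0; apply/allP => p; rewrite mem_enum inE => pp.
    rewrite implyTb /= mevalB !mevalXU subr_eq0 (inj_eq (special_q_inj (s := s) f_inj)) //.
  have n2 : (d2 c0).@[special_q f s] != 0.
    rewrite rmorph_prod prodf_seq_neq0; apply/allP => i _; rewrite implyTb /= rmorph_prod.
    rewrite prodf_seq_neq0; apply/allP => j _; rewrite implyTb /= mevalB mevalM !mevalC mevalXU q0E.
    have [-> -> _] := fixedE i.
    by rewrite mulr1 subr_eq0 (inj_eq f_inj) eq_lrshift.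
  have n3 : (d3 c0).@[special_q f s] != 0 by rewrite /d3 XE.
  have n4 : (d4 c0).@[special_q f s] != 0 by rewrite d4E XE.
  have n5 : (d5 c0).@[special_q f s] != 0.
    apply: discriminant_neq0 => // j.
    + by rewrite rootE subrr.
    + by rewrite YE; have [_ -> _] := freeE (s j); rewrite oner_eq0.
    + rewrite /cofactor_ mevalZ XE YE !mulf_neq0 // rmorph_prod prodf_seq_neq0.
      apply/allP => i _; apply/implyP => ij; rewrite /= rmorphXn /= rootE expf_neq0 // subr_eq0.
      by rewrite (inj_eq alpha_inj) (inj_eq perm_inj) eq_sym.
    by rewrite XE YE.
  by rewrite mevalM mulf_neq0 // mevalM mulf_neq0 // mevalM mulf_neq0 // mevalM mulf_neq0.
move=> c q1 sq; rewrite mevalM mulf_eq0 negb_or => /andP[h1].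
rewrite mevalM mulf_eq0 negb_or => /andP[h2]; rewrite mevalM mulf_eq0 negb_or => /andP[h3].
rewrite mevalM mulf_eq0 negb_or => /andP[h4 h5].
have hc x : (curve_at M lam' rho' (P_ c) (X_ c) x).@[q1] = (curve M lam' rho' (P_ c) (X_ c) q1).@[x].
  exact: curve_at_eval.
split.
- move=> i j eij; apply/eqP/contraT => ij; move: h1.
  rewrite rmorph_prod prodf_seq_neq0 => /allP/(_ (i, j)); rewrite mem_enum inE /= ij.
  by move=> /(_ isT); rewrite mevalB !mevalXU eij subrr eqxx.
- move=> i j; move: h2; rewrite rmorph_prod => /prodf_neq0/(_ i isT).
  rewrite /= rmorph_prod => /prodf_neq0/(_ j isT).
  by rewrite /= mevalB mevalM !mevalC mevalXU !lin_row.
- by rewrite -hc.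
- apply: hA; first exact: curve_homog (deg' deg) _ _ _.
  by move: h4; rewrite d4E; under eq_bigr do rewrite hc.
move=> hl; apply: (simple_of_discriminant rho0 (system_eq s c) (fun j i => contact_root_deriv c _ j i) _ sq h5).
by move=> j; rewrite oppr_eq0.
Qed.

(** All the requirements on a configuration that hold on a nonempty open set;
    the free points being off the line is imposed separately, as it fails at the
    special configuration. *)
Lemma configurations_open : exists psi, [/\ polyfun co psi, psi c0 != 0 &
  forall c, psi c != 0 -> (forall k, (lin l).@[Y_ c k] != 0) ->
    good_configuration M (P_ c) (X_ c) (Y_ c)].
Proof.
have [p1 [p1f p10 hp1]] := regular_open rho0 E_fam E_boxed reg0.
have [p2 [p2f p20 hp2]] := solutions_open.
pose p3 (c : configs) := \prod_(i < m) \prod_(j < m | j != i)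
  ((lin T).@[P_ c i] * (lin S).@[P_ c j] - (lin S).@[P_ c i] * (lin T).@[P_ c j]).
exists (fun c => \det (interp_mx M (X_ c)) * (p1 c * (p2 c * p3 c))); split.
- apply: polyfunM; first exact: interp_det_fun X_fun.
  apply: polyfunM => //; apply: polyfunM => //; apply: polyfun_prod => i.
  apply: (@polyfun_ext _ _ _ _ (fun c : configs => \prod_(j <- [seq j <- index_enum 'I_m | j != i])
    ((lin T).@[P_ c i] * (lin S).@[P_ c j] - (lin S).@[P_ c i] * (lin T).@[P_ c j]))).
    by move=> c; rewrite big_filter.
  apply: polyfun_prod => j; apply: polyfunB; apply: polyfunM; apply: lin_fun; exact: P_fun.
- rewrite !mulf_neq0 //; first by rewrite /= col_mxKu.
  rewrite prodf_seq_neq0; apply/allP => i _; rewrite implyTb prodf_seq_neq0.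
  apply/allP => j _; apply/implyP => ij; rewrite /c0 /=.
  have [-> -> _] := fixedE i; have [-> -> _] := fixedE j.
  by rewrite mul1r mulr1 subr_eq0 (inj_eq f_inj) (inj_eq (@lshift_inj _ _)).
move=> c; rewrite !mulf_eq0 !negb_or => /and4P[h1 /hp1 reg /hp2 hq /prodf_neq0 h3] hl.
split=> //.
- move=> i j hij; apply/eqP/contraT => ij; have := h3 i isT => /prodf_neq0/(_ j).
  rewrite eq_sym => /(_ ij); rewrite !lin_row; have := line_pt_prop M hij.
  by rewrite line_ptE !lin_dot => ->; rewrite eqxx.
- by move=> q /hq[_ _ _ _]; apply.
- by move=> q /hq[].
- by move=> q /hq[].
- by move=> q /hq[].
by move=> q /hq[].
Qed.

End SpecialConfiguration.

Theorem generic_count : generically l (fun (P : 'M[C]_(m, 3)) (XY : 'M[C]_(n0 + r, 3)) =>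
  curve_count (admissible_curve d ((d.-1 * d.-2)./2) rho l P XY)
    ((\prod_(x <- rho) x) * (r`! %/ \prod_(1 <= i < d.+1) (count_mem i rho)`!))%N).
Proof.
have [f [f_inj f_bad]] := special_coordinates.
have [X0 spec] := special_points uM d_gt0 deg f_bad.
have [psi [[p pE] psi0 hpsi]] := configurations_open f_inj spec.
pose off (c : configs) := \prod_i (lin l).@[c.2 i].
have [po poE] : polyfun co off.
  by apply: polyfun_prod => i; apply: lin_fun; exact: XY_fun.
exists (p * po); split.
  pose c1 (XY : 'M[C]_(n0 + r, 3)) : configs := (special_fixed M f, XY).
  pose co1 (XY : 'M[C]_(n0 + r, 3)) := mxvec XY 0.
  have cfun i : polyfun co1 (fun XY => co (c1 XY) i).
    case/mxvec_indexP: i => i j.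
    case: (splitP i) => k e.
      rewrite (_ : i = lshift _ k); last exact: val_inj.
      by apply: polyfun_ext (polyfun_const _ (special_fixed M f k j)) => XY; rewrite /co mxvecE col_mxEu.
    rewrite (_ : i = rshift _ k); last exact: val_inj.
    apply: polyfun_ext (polyfun_coord _ (mxvec_index k j)) => XY.
    by rewrite /co /co1 !mxvecE col_mxEd.
  have [||XY hXY] := @open_inter _ _ _ co1 _
      (fun (b : bool) XY => if b then psi (c1 XY) != 0 else off (c1 XY) != 0).
  - by move=> v; exists (vec_mx (\row_i v i)) => i; rewrite /co1 vec_mxK mxE.
  - case.
      exists (fun XY => psi (c1 XY)); split=> //; last by exists (col_mx X0 (special_free M f)).
      apply: (@polyfun_ext _ _ _ _ (fun XY => p.@[co (c1 XY)])) => [XY|]; first by rewrite pE.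
      exact: polyfun_subst.
    exists (fun XY => off (c1 XY)); split=> //.
      apply: (@polyfun_ext _ _ _ _ (fun XY => po.@[co (c1 XY)])) => [XY|]; first by rewrite poE.
      exact: polyfun_subst.
    exists (\matrix_i row 2%:R (dualmx M)); rewrite prodf_seq_neq0; apply/allP => i _.
    by rewrite implyTb lin_row rowK dot_dual // oner_eq0.
  have hP := hXY true; have hO := hXY false; rewrite /= in hP hO.
  exists (special_fixed M f), XY; split.
    split=> [i|i|k].
    + rewrite special_fixedE; apply/eqP => z; have [_ + _] := special_ptE uM (f (lshift r i)).
      rewrite z -(scale0r (0 : 'rV[C]_3)) dotZr mul0r => /eqP; by rewrite eq_sym oner_eq0.
    + by rewrite special_fixedE; have [] := special_ptE uM (f (lshift r i)).
    move/prodf_neq0/(_ k isT): hO; rewrite lin_row; apply: contraNneq => /= ->.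
    by rewrite -(scale0r (0 : 'rV[C]_3)) dotZr mul0r.
  by move: hP hO; rewrite pE poE mevalM => hP hO; apply: mulf_neq0.
move=> P XY [Pn Pl _]; rewrite mevalM mulf_eq0 negb_or => /andP[hp ho].
have {}hp : psi (P, XY) != 0 by rewrite pE.
have {}ho : off (P, XY) != 0 by rewrite poE.
have gc : good_configuration M P (usubmx XY) (dsubmx XY).
  apply: (hpsi (P, XY) hp) => k; move/prodf_neq0/(_ (rshift _ k) isT): ho.
  by rewrite /= !lin_row row_dsubmx.
have := count_of_solutions uM d_gt0 deg lam_gt0 rho_gt0 gc Pn Pl.
by rewrite vsubmxK.
Qed.

End GenericCount.


Lemma gw_points_smooth (d : nat) (rho : seq nat) : 0 < d ->
  gw_points d (d.-1 * d.-2)./2 rho = (d * d.+1)./2 + size rho.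
Proof.
case: d => // e _; rewrite /gw_points; congr (_ + _); rewrite -[e.+1.-1]/e -[e.+1.-2]/e.-1.
have -> : e.+1 * e.+2 = e * e.-1 + (2 * e.+1).-1.*2 by case: e => // e; rewrite -!mul2n /=; lia.
by rewrite halfD odd_double andbF doubleK add0n addnC.
Qed.

Lemma size_forms_plane (d : nat) : 0 < d -> size (formms 3 d.-1) = (d * d.+1)./2.
Proof.
case: d => // e _ /=; rewrite size_formms addnC -[X in 'C(_, X)](addnK 2 e) [e + 2]addnC.
by rewrite bin_sub ?leq_addr // add2n bin2 mulnC.
Qed.

Theorem corollary4p4 (R : realType) (d : nat) (lam rho : seq nat) :
  let gmax := (d.-1 * d.-2)./2 in
  0 < d -> is_partition lam -> is_partition rho ->
  sumn lam + sumn rho = d ->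
  gw_points d gmax rho = (d * d.+1)./2 + size rho /\
  relative_GW (complex R) d gmax lam rho
    ((\prod_(r <- rho) r) *
     ((size rho)`! %/ \prod_(1 <= i < d.+1) (count_mem i rho)`!)).
Proof.
move=> gmax d0 /andP[_ lam_gt0] /andP[_ rho_gt0] deg; have en := gw_points_smooth rho d0.
split=> // l l0; have [p [p0 pl _]] := line_through l l.
have lp : dot l p = 0%R by rewrite dotC.
have [M [uM r2 _]] := frame_through p0 lp l0.
rewrite /gmax en -size_forms_plane // -r2.
exact (generic_count uM d0 deg lam_gt0 rho_gt0).
Qed.
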